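(* Let $\ell>3$ be prime. (1) For $1\le k\le\frac{\ell-3}{2}$ we have $C_{2k}\in P\mathcal{X}_{2k}$, whereas $C_{\ell-1}=2P\Phi_{\ell-2}+PG_C$ for some $G_C\in\mathcal{X}_{\ell-1}$. (2) For $2\le k\le\frac{\ell-3}{2}$ we have $\mathcal{R}_{2k}-P_k(\delta_q)\mathcal{R}_2\in P\mathcal{X}_{2k}$, whereas $$\mathcal{R}_{\ell-1}-P_{\frac{\ell-1}{2}}(\delta_q)\mathcal{R}_2=2P\Phi_{\ell-2}+PG_R$$ for some $G_R\in\mathcal{X}_{\ell-1}$.
   Context: $q=e^{2\pi iz}$, $\delta_q:=q\frac{d}{dq}$. $P:=\prod_{n\ge1}(1-q^n)^{-1}$; $\Phi_j:=\sum_{n\ge1}\sigma_j(n)q^n$, $\sigma_j(n)=\sum_{d\mid n}d^j$; $E_2:=1-24\Phi_1$. Rank: largest part minus number of parts; $N(m,n)$ = number of partitions of $n$ with rank $m$; $N_j(n):=\sum_mm^jN(m,n)$, $\mathcal{R}_j:=\sum_{n\ge1}N_j(n)q^n$. Crank: largest part if there are no ones, otherwise (number of parts larger than the number of ones) minus (number of ones); $M(m,n)$ = number of partitions of $n$ with crank $m$ for $n>1$, with $M(0,1):=-1$, $M(\pm1,1):=1$, $M(m,1):=0$ otherwise; $M_j(n):=\sum_mm^jM(m,n)$, $C_j:=\sum_{n\ge1}M_j(n)q^n$. $P_k(x)\in\mathbb{Q}[x]$: $P_0:=0$, $P_1:=1$, and for $k\ge2$, $P_k(x):=-\frac{1}{(2k-1)(k-1)}\sum_{i=1}^{k-1}\left(6x\binom{2k}{2i}(2^{2i-1}-1)+\binom{2k}{2i+2}(2^{2i+1}-1)-2^{2i}\binom{2k}{2i+1}+\binom{2k}{2i}\right)P_{k-i}(x)$.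 An $\ell$-integral quasimodular form of weight $w$ and level 1 is a sum of functions $E_2^aF_b$, $a,b\ge0$, $2a+b=w$, with $F_b\in M_b(SL_2(\mathbb{Z}))$ having rational, $\ell$-integral coefficients with bounded denominators; for even $k$, $\mathcal{X}_k$ is the set of sums of such forms of weight $\le k$, and $P\mathcal{X}_k:=\{GP:G\in\mathcal{X}_k\}$. *)

(* Defs.v *)
From Stdlib Require Import Reals.
From mathcomp Require Import all_boot all_order all_algebra.
Set Implicit Arguments. Unset Strict Implicit. Unset Printing Implicit Defensive.
Import Order.TTheory GRing.Theory Num.Theory.

Definition int2Z (z : int) : Z :=
  match z with Posz n => Z.of_nat n | Negz n => Z.opp (Z.of_nat n.+1) end.

Definition ratR (r : rat) : R := Rdiv (IZR (int2Z (numq r))) (IZR (int2Z (denq r))).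

Definition cmul (z w : R * R) : R * R :=
  (Rminus (Rmult z.1 w.1) (Rmult z.2 w.2), Rplus (Rmult z.1 w.2) (Rmult z.2 w.1)).
Definition cpow (z : R * R) (b : nat) : R * R := iter b (cmul z) (R1, R0).
Definition twopi : R := Rmult (INR 2) PI.
(* -1/z for z = x + i y *)
Definition cmoinv (z : R * R) : R * R :=
  let d := Rplus (Rmult z.1 z.1) (Rmult z.2 z.2) in
  (Rdiv (Ropp z.1) d, Rdiv z.2 d).

(* Formal q-series with rational coefficients: n |-> coefficient of q^n *)
Local Open Scope ring_scope.

Definition qser := nat -> rat.

Definition qadd (f g : qser) : qser := fun n => f n + g n.
Definition qsub (f g : qser) : qser := fun n => f n - g n.
Definition qscale (c : rat) (f : qser) : qser := fun n => c * f n.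
Definition qmul (f g : qser) : qser := fun n => \sum_(i < n.+1) f i * g (n - i)%N.
Definition qone : qser := fun n => (n == 0%N)%:R.
Definition qpow (f : qser) (a : nat) : qser := iter a (qmul f) qone.
Definition qzero : qser := fun _ => 0.

(* the theta-operator delta_q = q d/dq *)
Definition delta_q (f : qser) : qser := fun n => n%:R * f n.
Definition poly_delta (p : {poly rat}) (f : qser) : qser :=
  fun n => \sum_(i < size p) p`_i * (iter i delta_q f) n.

(* Sum_{m>=0} q^(m*j) = (1 - q^m)^{-1}, for m >= 1 *)
Definition geom (m : nat) : qser := fun n => (m %| n)%:R.
(* P = prod_{m>=1} (1-q^m)^{-1}; the coefficient of q^n only involves the
   factors with m <= n, so we take it from the finite product. *)
Definition Pq : qser := fun n => (\big[qmul/qone]_(1 <= m < n.+1) geom m) n.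

Definition sigma (j n : nat) : nat := \sum_(d <- divisors n) d ^ j.
Definition Phi (j : nat) : qser := fun n => if n == 0%N then 0 else (sigma j n)%:R.
Definition E2 : qser := qsub qone (qscale 24 (Phi 1)).

(* Partitions of n, encoded by multiplicities: f i = number of parts    *)
(* equal to i+1.                                                        *)
Definition part (n : nat) := {ffun 'I_n -> 'I_n.+1}.
Definition is_part (n : nat) (f : part n) : bool :=
  (\sum_(i < n) i.+1 * f i)%N == n.
Definition nparts n (f : part n) : nat := (\sum_(i < n) f i)%N.
Definition largest n (f : part n) : nat := (\max_(i < n | (f i : nat) != 0%N) i.+1)%N.
Definition nones n (f : part n) : nat := (\sum_(i < n | (i : nat) == 0%N) f i)%N.
Definition nlarger n (f : part n) : nat :=
  (\sum_(i < n | (nones f < i.+1)%N) f i)%N.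

Definition rank n (f : part n) : int := (largest f)%:Z - (nparts f)%:Z.
Definition crank n (f : part n) : int :=
  if nones f == 0%N then (largest f)%:Z else (nlarger f)%:Z - (nones f)%:Z.

Definition Nrank (m : int) (n : nat) : nat := #|[set f : part n | is_part f && (rank f == m)]|.
Definition Mcrank (m : int) (n : nat) : int :=
  if n == 1%N then
    (if m == 0 then -1 else if (m == 1) || (m == -1) then 1 else 0)
  else (#|[set f : part n | is_part f && (crank f == m)]|)%:Z.

(* N_j(n) = sum_m m^j N(m,n) = sum over partitions lambda of n of rank^j *)
Definition Nmom (j n : nat) : rat :=
  \sum_(f : part n | is_part f) ((rank f)%:~R) ^+ j.
(* M_j(n) = sum_m m^j M(m,n) *)
Definition Mmom (j n : nat) : rat :=
  if n == 1%N then
    (((-1) ^+ j) * 1 + (0 ^+ j) * (-1) + (1 ^+ j) * 1)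
  else \sum_(f : part n | is_part f) ((crank f)%:~R) ^+ j.

Definition Rser (j : nat) : qser := fun n => if n == 0%N then 0 else Nmom j n.
Definition Cser (j : nat) : qser := fun n => if n == 0%N then 0 else Mmom j n.

Definition Pnext (k : nat) (prev : seq {poly rat}) : {poly rat} :=
  if (k <= 1)%N then (k == 1%N)%:R else
  - ((((2 * k - 1) * (k - 1))%N%:R)^-1) *:
    \sum_(1 <= i < k)
      ((6%:R * ((('C(2 * k, 2 * i))%:R) * ((2 ^ (2 * i - 1))%:R - 1))) *: 'X
       + ((('C(2 * k, 2 * i + 2))%:R * ((2 ^ (2 * i + 1))%:R - 1)
          - (2 ^ (2 * i))%:R * ('C(2 * k, 2 * i + 1))%:R
          + ('C(2 * k, 2 * i))%:R)%:P)) * nth 0 prev (k - i).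

Fixpoint Plist (k : nat) : seq {poly rat} :=
  match k with
  | 0 => [:: Pnext 0 [::]]
  | k'.+1 => let s := Plist k' in rcons s (Pnext k'.+1 s)
  end.
Definition Ppoly (k : nat) : {poly rat} := nth 0 (Plist k) k.

(* real and imaginary part of a_n e^{2 pi i n z}, z = x + i y *)
Definition qterm_re (a : qser) (x y : R) (n : nat) : R :=
  Rmult (Rmult (ratR (a n)) (exp (Ropp (Rmult (Rmult twopi (INR n)) y))))
        (cos (Rmult (Rmult twopi (INR n)) x)).
Definition qterm_im (a : qser) (x y : R) (n : nat) : R :=
  Rmult (Rmult (ratR (a n)) (exp (Ropp (Rmult (Rmult twopi (INR n)) y))))
        (sin (Rmult (Rmult twopi (INR n)) x)).

Definition qsum_at (a : qser) (z w : R * R) : Prop :=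
  infinite_sum (qterm_re a z.1 z.2) w.1 /\ infinite_sum (qterm_im a z.1 z.2) w.2.

(* a is the q-expansion of an element of M_b(SL_2(Z)): the q-series converges
   on the whole upper half-plane (so defines a holomorphic function there,
   1-periodic and holomorphic at infinity), and f(-1/z) = z^b f(z). *)
Definition is_modular (b : nat) (a : qser) : Prop :=
  (forall z : R * R, Rlt R0 z.2 -> exists w, qsum_at a z w) /\
  (forall z w w' : R * R, Rlt R0 z.2 ->
     qsum_at a z w -> qsum_at a (cmoinv z) w' -> w' = cmul (cpow z b) w).

Definition l_integral (l : nat) (a : qser) : Prop :=
  (forall n, ~~ (l%:Z %| denq (a n))%Z) /\
  (exists D : nat, (0 < D)%N /\ forall n, (denq (a n) %| D%:Z)%Z).

Definition is_modular_l (l b : nat) (F : qser) : Prop := is_modular b F /\ l_integral l F.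

Definition quasimod_l (l w : nat) (G : qser) : Prop :=
  exists s : seq (nat * nat * qser),
    (forall t, List.In t s -> (2 * t.1.1 + t.1.2 = w)%N /\ is_modular_l l t.1.2 t.2) /\
    G = \big[qadd/qzero]_(t <- s) qmul (qpow E2 t.1.1) t.2.

Definition Xl (l k : nat) (G : qser) : Prop :=
  exists s : seq (nat * qser),
    (forall t, List.In t s -> (t.1 <= k)%N /\ quasimod_l l t.1 t.2) /\
    G = \big[qadd/qzero]_(t <- s) t.2.

Definition PXl (l k : nat) (H : qser) : Prop := exists G, Xl l k G /\ H = qmul Pq G.

(* Main.v *)
(* Rank and crank moments are read off two-variable generating functions, written in z and w = q/z.

   The logarithmic z-derivative of the crank product is a divisor-sum series V, so all crank moments
   are polynomials in the Phi_j (j odd) times P; the same holds for H = P^-2 C^3 with 3V in place of V.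
   The Atkin-Garvan rank-crank equation, multiplied by w^2 (1 + z^2), turns the rank moments into the
   moments of H up to exactly the recurrence that defines P_k.  That equation and the Weierstrass
   equation for z/(1-z)^2 + z dV/dz are obtained in the same way: the difference of both sides is
   symmetric under z <-> w and anti-invariant under a reflection of the exponent of z, and only 0 has
   these two properties.

   The Weierstrass equation expresses (a-4)(a+3) Phi_{a+1} by lower Phi's, so for a < l-3 the Phi_{a+1}
   are l-integral polynomials in E2, E4, E6, and l Phi_{l-2} still is one.  In the top weight the rank
   recurrence gives the coefficient 12/((l-2)(l-3)), which differs from 2 by -2l(l-5)/((l-2)(l-3)).

   For the modularity of E4 and E6, put f(v) = sum n^(k-1) x^n with x = exp(2 i pi v).  Iterating
   2^k f(2v) = f(v) + f(v + 1/2) and dominated convergence give the Lipschitz formula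
   f(w) = c sum_j (w+j)^-k; at w = 1/2 it also evaluates zeta(k).  Summing over w = mz identifies the
   Eisenstein series with the limit of lattice sums over squares, which transform exactly. *)
From HB Require Import structures.
From Stdlib Require Import Reals Lra Lia List.
From Coquelicot Require Coquelicot.
Require Import Defs.

(** The rows of the rank and crank functions are Laurent polynomials in z, whereas 1/(1-z) is a
    series in z; with w = q/z both become one-sided, so the identities live in power series in z and
    w. The reflection comes from expanding f/(1-z)^r at 0 and at infinity: for a row f invariant
    under z -> 1/z the two expansions differ by a polynomial in the exponent whose coefficients are
    moments of f. The rank-crank equation rests on a coincidence of such moments: those of H of
    order 0, 1, 2 are P, 0, 6 delta_q P, and the same 6 stands in front of delta_q R. A reflected
    index falls left of the diagonal, and exchanging z and w moves it to an earlier row; hence only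
    0 survives.

    The rank recurrence contains delta_q, so the l-integral polynomials in E2, E4, E6 must be stable
    under delta_q. The Weierstrass equation holds no q-derivative; Ramanujan's formulas come from a
    heat equation for the theta product, proved by the same symmetry argument. Their denominators
    12, 3, 2 are one place where l > 3 enters. *)

Module Analysis.
Import Coquelicot.Coquelicot ListNotations.
Open Scope C_scope.

(** * Complex limits and dominated convergence *)

Definition Cv (u : nat -> C) (l : C) : Prop :=
  forall e : R, (0 < e)%R -> exists N, forall n, (N <= n)%nat -> (Cmod (u n - l) < e)%R.
Fixpoint csum (n : nat) (f : nat -> C) : C :=
  match n with O => 0 | S m => csum m f + f m end.
Fixpoint rsum (n : nat) (f : nat -> R) : R :=
  match n with O => 0%R | S m => (rsum m f + f m)%R end.

Lemma csum_ext n f g : (forall i, (i < n)%nat -> f i = g i) -> csum n f = csum n g.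
Proof.
induction n as [|n IH]; intros H; simpl; auto.
rewrite IH, H; auto.
Qed.
Lemma csum_plus n f g : csum n (fun i => f i + g i) = csum n f + csum n g.
Proof. induction n as [|n IH]; simpl; [ring|rewrite IH; ring]. Qed.
Lemma csum_scal n c f : csum n (fun i => c * f i) = c * csum n f.
Proof. induction n as [|n IH]; simpl; [ring|rewrite IH; ring]. Qed.
Lemma csum_app n m f : csum (n + m) f = csum n f + csum m (fun i => f (n + i)%nat).
Proof.
induction m as [|m IH]; simpl; [rewrite Nat.add_0_r; ring|].
rewrite Nat.add_succ_r; simpl; rewrite IH; ring.
Qed.
Lemma csum_S n f : csum (S n) f = f O + csum n (fun i => f (S i)).
Proof. change (S n) with (1 + n)%nat; rewrite csum_app; simpl; ring. Qed.
Lemma csum_rev n f : csum n f = csum n (fun i => f (n - 1 - i)%nat).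
Proof.
induction n as [|n IH]; auto.
rewrite (csum_S n (fun i => f (S n - 1 - i)%nat)).
replace (S n - 1 - 0)%nat with n by lia.
change (csum (S n) f) with (csum n f + f n); rewrite IH, Cplus_comm; f_equal.
apply csum_ext; intros i Hi; f_equal; lia.
Qed.
Lemma rsum_le n f g : (forall i, (i < n)%nat -> (f i <= g i)%R) -> (rsum n f <= rsum n g)%R.
Proof.
induction n as [|n IH]; intros H; simpl; [lra|].
apply Rplus_le_compat; auto.
Qed.
Lemma rsum_scal n c f : (rsum n (fun i => c * f i) = c * rsum n f)%R.
Proof. induction n as [|n IH]; simpl; [ring|rewrite IH; ring]. Qed.
Lemma rsum_app n m f : (rsum (n + m) f = rsum n f + rsum m (fun i => f (n + i)%nat))%R.
Proof.
induction m as [|m IH]; simpl; [rewrite Nat.add_0_r; ring|].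
rewrite Nat.add_succ_r; simpl; rewrite IH; ring.
Qed.
Lemma rsum_pos n f : (forall i, (0 <= f i)%R) -> (0 <= rsum n f)%R.
Proof.
intros H; induction n as [|n IH]; simpl; [lra|]; specialize (H n); lra.
Qed.
Lemma rsum_mono n m f : (forall i, (0 <= f i)%R) -> (n <= m)%nat -> (rsum n f <= rsum m f)%R.
Proof.
intros H nm; replace m with (n + (m - n))%nat by lia; rewrite rsum_app.
pose proof (rsum_pos (m - n) (fun i => f (n + i)%nat) (fun i => H _)); lra.
Qed.
Lemma Cmod_csum n f : (Cmod (csum n f) <= rsum n (fun i => Cmod (f i)))%R.
Proof.
induction n as [|n IH]; simpl; [rewrite Cmod_0; lra|].
eapply Rle_trans; [apply Cmod_triangle|lra].
Qed.

Lemma Cmod_sub_sym x y : Cmod (x - y) = Cmod (y - x).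
Proof. rewrite <- Cmod_opp; f_equal; ring. Qed.
Lemma Cmod_tri3 x y z : (Cmod (x - z) <= Cmod (x - y) + Cmod (y - z))%R.
Proof. replace (x - z) with ((x - y) + (y - z)) by ring; apply Cmod_triangle. Qed.
Lemma Cmod_le_add x y : (Cmod x <= Cmod (x - y) + Cmod y)%R.
Proof. replace x with ((x - y) + y) at 1 by ring; apply Cmod_triangle. Qed.

Lemma Cv_ext u v l : (forall n, u n = v n) -> Cv u l -> Cv v l.
Proof. intros E H e e0; destruct (H e e0) as [N HN]; exists N; intros n nN; rewrite <- E; auto. Qed.
Lemma Cv_ev N u v l : (forall n, (N <= n)%nat -> u n = v n) -> Cv u l -> Cv v l.
Proof.
intros E H e e0; destruct (H e e0) as [N' HN]; exists (N + N')%nat; intros n nN.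
rewrite <- E by lia; apply HN; lia.
Qed.
Lemma Cv_const l : Cv (fun _ => l) l.
Proof. intros e e0; exists O; intros n _; replace (l - l) with (RtoC 0) by ring; rewrite Cmod_0; lra. Qed.
Lemma Cv_plus u v a b : Cv u a -> Cv v b -> Cv (fun n => u n + v n) (a + b).
Proof.
intros Hu Hv e e0; destruct (Hu (e/2)%R) as [N HN]; [lra|]; destruct (Hv (e/2)%R) as [N' HN']; [lra|].
exists (N + N')%nat; intros n nN; specialize (HN n ltac:(lia)); specialize (HN' n ltac:(lia)).
replace (u n + v n - (a + b)) with ((u n - a) + (v n - b)) by ring.
eapply Rle_lt_trans; [apply Cmod_triangle|lra].
Qed.
Lemma Cv_bd u l M : Cv u l -> (exists N, forall n, (N <= n)%nat -> (Cmod (u n) <= M)%R) -> (Cmod l <= M)%R.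
Proof.
intros H [N HN]; apply Rnot_lt_le; intros lt.
destruct (H (Cmod l - M)%R) as [N' HN']; [lra|].
specialize (HN (N + N')%nat ltac:(lia)); specialize (HN' (N + N')%nat ltac:(lia)).
rewrite Cmod_sub_sym in HN'; pose proof (Cmod_le_add l (u (N + N')%nat)); lra.
Qed.
Lemma Cv_unique u a b : Cv u a -> Cv u b -> a = b.
Proof.
intros Ha Hb; apply Ceq_minus, Cmod_eq_0, Rle_antisym; [|apply Cmod_ge_0].
apply Rnot_lt_le; intros lt.
destruct (Ha (Cmod (a - b) / 2)%R) as [N HN]; [lra|]; destruct (Hb (Cmod (a - b) / 2)%R) as [N' HN']; [lra|].
specialize (HN (N + N')%nat ltac:(lia)); specialize (HN' (N + N')%nat ltac:(lia)).
rewrite Cmod_sub_sym in HN; pose proof (Cmod_tri3 a (u (N + N')%nat) b); lra.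
Qed.
Lemma Cv_mult u v a b : Cv u a -> Cv v b -> Cv (fun n => u n * v n) (a * b).
Proof.
intros Hu Hv e e0.
pose proof (Cmod_ge_0 a) as A0; pose proof (Cmod_ge_0 b) as B0.
pose (d := (e / (Cmod a + Cmod b + 1 + e))%R).
assert (d0 : (0 < d)%R) by (apply Rdiv_lt_0_compat; lra).
assert (d1 : (d < 1)%R) by (apply (Rmult_lt_reg_r (Cmod a + Cmod b + 1 + e)); [lra|]; unfold d; field_simplify; lra).
assert (dE : (d * (Cmod a + Cmod b + 1 + e) = e)%R) by (unfold d; field; lra).
destruct (Hu d d0) as [N HN]; destruct (Hv d d0) as [N' HN'].
exists (N + N')%nat; intros n nN; specialize (HN n ltac:(lia)); specialize (HN' n ltac:(lia)).
replace (u n * v n - a * b) with ((u n - a) * (v n - b) + (a * (v n - b) + b * (u n - a))) by ring.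
eapply Rle_lt_trans; [apply Cmod_triangle|].
eapply Rle_lt_trans; [apply Rplus_le_compat_l, Cmod_triangle|]; rewrite !Cmod_mult.
pose proof (Cmod_ge_0 (u n - a)); pose proof (Cmod_ge_0 (v n - b)); nra.
Qed.
Lemma Cv_scal c u a : Cv u a -> Cv (fun n => c * u n) (c * a).
Proof. intros H; apply Cv_mult; [apply Cv_const|exact H]. Qed.
Lemma Cv_pow u a k : Cv u a -> Cv (fun n => u n ^ k) (a ^ k).
Proof.
intros H; induction k as [|k IH]; [apply (Cv_const 1)|].
rewrite Cpow_S; eapply Cv_ext; [|apply (Cv_mult _ _ _ _ H IH)]; intros n; simpl; auto.
Qed.
Lemma Cv_sub (phi : nat -> nat) u a : (forall J, exists m0, forall m, (m0 <= m)%nat -> (J <= phi m)%nat) ->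
  Cv u a -> Cv (fun n => u (phi n)) a.
Proof.
intros Hp H e e0; destruct (H e e0) as [N HN]; destruct (Hp N) as [m0 Hm]; exists m0; auto.
Qed.
Lemma Cv_csum n (u : nat -> nat -> C) v : (forall j, (j < n)%nat -> Cv (fun m => u m j) (v j)) ->
  Cv (fun m => csum n (u m)) (csum n v).
Proof.
induction n as [|n IH]; intros H; simpl; [apply Cv_const|].
apply Cv_plus; auto.
Qed.
Lemma Cv_0 u (a : nat -> R) : (forall n, (Cmod (u n) <= a n)%R) -> is_lim_seq a 0 -> Cv u 0.
Proof.
intros H L e e0; apply is_lim_seq_spec in L; destruct (L (mkposreal e e0)) as [N HN].
exists N; intros n nN; specialize (HN n nN); simpl in HN.
replace (u n - 0) with (u n) by ring; apply Rle_lt_trans with (a n); auto.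
rewrite Rminus_0_r in HN; apply Rle_lt_trans with (2 := HN); apply Rle_abs.
Qed.

Lemma Cmod_fst z : (Rabs (fst z) <= Cmod z)%R.
Proof. eapply Rle_trans; [apply Rmax_l|apply Rmax_Cmod]. Qed.
Lemma Cmod_snd z : (Rabs (snd z) <= Cmod z)%R.
Proof. eapply Rle_trans; [apply Rmax_r|apply Rmax_Cmod]. Qed.
Lemma Cmod_le_sum z : (Cmod z <= Rabs (fst z) + Rabs (snd z))%R.
Proof.
destruct z as [x y]; simpl.
replace (x, y) with (RtoC x + (0, y)%R) by (unfold RtoC, Cplus; simpl; f_equal; ring).
eapply Rle_trans; [apply Cmod_triangle|]; rewrite Cmod_R; apply Rplus_le_compat_l.
unfold Cmod; simpl; replace (0 * (0 * 1) + y * (y * 1))%R with (Rsqr y) by (unfold Rsqr; ring).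
rewrite sqrt_Rsqr_abs; lra.
Qed.

Lemma Cv_Un u l : Cv u l <-> Un_cv (fun n => fst (u n)) (fst l) /\ Un_cv (fun n => snd (u n)) (snd l).
Proof.
split.
- intros H; split; intros e e0; destruct (H e e0) as [N HN]; exists N; intros n nN; specialize (HN n nN);
    unfold Rdist; eapply Rle_lt_trans; [|apply HN| |apply HN].
  + apply (Cmod_fst (u n - l)).
  + apply (Cmod_snd (u n - l)).
- intros [H1 H2] e e0; destruct (H1 (e/2)%R) as [N HN]; [lra|]; destruct (H2 (e/2)%R) as [N' HN']; [lra|].
  exists (N + N')%nat; intros n nN; specialize (HN n ltac:(lia)); specialize (HN' n ltac:(lia)).
  eapply Rle_lt_trans; [apply Cmod_le_sum|]; unfold Rdist in *.
  change (fst (u n - l)) with (fst (u n) - fst l)%R; change (snd (u n - l)) with (snd (u n) - snd l)%R; lra.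
Qed.

Lemma C_complete u : (forall e : R, (0 < e)%R -> exists N, forall n m, (N <= n)%nat -> (N <= m)%nat ->
  (Cmod (u n - u m) < e)%R) -> exists l, Cv u l.
Proof.
intros H.
destruct (Rcomplete.R_complete (fun n => fst (u n))) as [x Hx].
  intros e e0; destruct (H e e0) as [N HN]; exists N; intros n m nN mN.
  eapply Rle_lt_trans; [apply (Cmod_fst (u n - u m))|apply HN; auto].
destruct (Rcomplete.R_complete (fun n => snd (u n))) as [y Hy].
  intros e e0; destruct (H e e0) as [N HN]; exists N; intros n m nN mN.
  eapply Rle_lt_trans; [apply (Cmod_snd (u n - u m))|apply HN; auto].
exists (x, y); apply Cv_Un; auto.
Qed.

Lemma bounded_tail B M : (forall j, (0 <= B j)%R) -> (forall n, (rsum n B <= M)%R) ->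
  forall e, (0 < e)%R -> exists J, forall n, (rsum n (fun i => B (J + i)%nat) < e)%R.
Proof.
intros B0 BM e e0.
assert (G : Un_growing (fun n => rsum n B)) by (intros n; simpl; specialize (B0 n); lra).
destruct (growing_cv _ G) as [l Hl].
  exists M; intros x [n ->]; auto.
destruct (Hl e e0) as [J HJ]; exists J; intros n.
pose proof (growing_ineq _ _ G Hl (J + n)%nat) as I; cbv beta in I; rewrite rsum_app in I.
specialize (HJ J ltac:(lia)); unfold Rdist in HJ; apply Rabs_def2 in HJ; lra.
Qed.

(** Dominated convergence for sums whose length [Nf m] grows too. The bound is asked only for
    [j < Nf m]; it passes to the limit terms because every [j] is eventually in range. Existence and
    equality of both limits come together. *)
Lemma tannery (u : nat -> nat -> C) (v : nat -> C) (B : nat -> R) (M : R) (Nf : nat -> nat) (m1 : nat) :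
  (forall n, (rsum n B <= M)%R) ->
  (forall m j, (m1 <= m)%nat -> (j < Nf m)%nat -> (Cmod (u m j) <= B j)%R) ->
  (forall j, Cv (fun m => u m j) (v j)) ->
  (forall J, exists m0, forall m, (m0 <= m)%nat -> (J <= Nf m)%nat) ->
  exists L, Cv (fun m => csum (Nf m) (u m)) L /\ Cv (fun n => csum n v) L.
Proof.
intros BM HB Hv HN.
assert (vB : forall j, (Cmod (v j) <= B j)%R).
  intros j; apply (Cv_bd _ _ _ (Hv j)); destruct (HN (S j)) as [m0 Hm].
  exists (m0 + m1)%nat; intros n Hn; apply HB; [lia|]; specialize (Hm n ltac:(lia)); lia.
assert (B0 : forall j, (0 <= B j)%R).
  intros j; apply Rle_trans with (Cmod (v j)); auto; apply Cmod_ge_0.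
assert (K : forall e, (0 < e)%R -> exists N, forall m n, (N <= m)%nat -> (N <= n)%nat ->
   (Cmod (csum (Nf m) (u m) - csum n v) < 3 * e)%R).
  intros e e0; destruct (bounded_tail B M B0 BM e e0) as [J HJ].
  destruct (Cv_csum J u v (fun j _ => Hv j) e e0) as [N1 HN1].
  destruct (HN J) as [N2 HN2]; exists (J + m1 + N1 + N2)%nat; intros m n mN nN.
  assert (T1 : (Cmod (csum (Nf m) (u m) - csum J (u m)) < e)%R).
    specialize (HN2 m ltac:(lia)); replace (Nf m) with (J + (Nf m - J))%nat by lia; rewrite csum_app.
    replace (csum J (u m) + csum (Nf m - J) (fun i => u m (J + i)%nat) - csum J (u m))
      with (csum (Nf m - J) (fun i => u m (J + i)%nat)) by ring.
    eapply Rle_lt_trans; [apply Cmod_csum|]; eapply Rle_lt_trans; [|apply (HJ (Nf m - J)%nat)].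
    apply rsum_le; intros i Hi; apply HB; lia.
  assert (T2 : (Cmod (csum n v - csum J v) < e)%R).
    replace n with (J + (n - J))%nat by lia; rewrite csum_app.
    replace (csum J v + csum (n - J) (fun i => v (J + i)%nat) - csum J v)
      with (csum (n - J) (fun i => v (J + i)%nat)) by ring.
    eapply Rle_lt_trans; [apply Cmod_csum|]; eapply Rle_lt_trans; [|apply (HJ (n - J)%nat)].
    apply rsum_le; intros i Hi; apply vB.
  specialize (HN1 m ltac:(lia)); rewrite Cmod_sub_sym in T2.
  pose proof (Cmod_tri3 (csum (Nf m) (u m)) (csum J (u m)) (csum n v)).
  pose proof (Cmod_tri3 (csum J (u m)) (csum J v) (csum n v)); lra.
destruct (C_complete (fun n => csum n v)) as [L HL].
  intros e e0; destruct (K (e / 6)%R) as [N HKN]; [lra|]; exists N; intros n m nN mN.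
  pose proof (HKN N n ltac:(lia) nN) as H1; pose proof (HKN N m ltac:(lia) mN) as H2.
  rewrite Cmod_sub_sym in H1; pose proof (Cmod_tri3 (csum n v) (csum (Nf N) (u N)) (csum m v)); lra.
exists L; split; auto; intros e e0.
destruct (K (e / 6)%R) as [N HKN]; [lra|]; destruct (HL (e / 2)%R) as [N' HN']; [lra|].
exists N; intros m mN; pose proof (HKN m (N + N')%nat mN ltac:(lia)) as H1.
specialize (HN' (N + N')%nat ltac:(lia)); pose proof (Cmod_tri3 (csum (Nf m) (u m)) (csum (N + N') v) L); lra.
Qed.

(** * The Lipschitz formula *)

(** The function exp(2 i pi v), in real and imaginary parts. *)
Definition ex (v : C) : C :=
  (exp (- (2 * PI * snd v)) * cos (2 * PI * fst v), exp (- (2 * PI * snd v)) * sin (2 * PI * fst v))%R.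

Lemma ex_plus a b : ex (a + b) = ex a * ex b.
Proof.
destruct a as [x y], b as [x' y']; unfold ex, Cmult, Cplus; simpl.
replace (- (2 * PI * (y + y')))%R with (- (2 * PI * y) + - (2 * PI * y'))%R by ring.
rewrite exp_plus, !Rmult_plus_distr_l, cos_plus, sin_plus; f_equal; ring.
Qed.
Lemma ex_half : ex (RtoC (/ 2)) = -1.
Proof.
unfold ex, RtoC; simpl; rewrite Rmult_0_r, Ropp_0, exp_0.
replace (2 * PI * / 2)%R with PI by field; rewrite cos_PI, sin_PI.
unfold Copp; simpl; f_equal; ring.
Qed.
Lemma ex_0 : ex 0 = 1.
Proof. unfold ex, RtoC; simpl; rewrite !Rmult_0_r, Ropp_0, exp_0, cos_0, sin_0; f_equal; ring. Qed.
Lemma ex_1 : ex 1 = 1.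
Proof.
replace (RtoC 1) with (RtoC (/ 2) + RtoC (/ 2)) at 1 by (rewrite <- RtoC_plus; f_equal; field).
rewrite ex_plus, ex_half; ring.
Qed.
Lemma ex_INR n : ex (RtoC (INR n)) = 1.
Proof.
induction n as [|n IH]; [apply ex_0|].
rewrite S_INR, RtoC_plus, ex_plus, IH, ex_1; ring.
Qed.
Lemma ex_period a n : ex (a + RtoC (INR n)) = ex a.
Proof. rewrite ex_plus, ex_INR; ring. Qed.
Lemma ex_mulnat n a : ex (RtoC (INR n) * a) = ex a ^ n.
Proof.
induction n as [|n IH]; [simpl; rewrite Cmult_0_l; apply ex_0|].
rewrite S_INR, RtoC_plus, Cmult_plus_distr_r, ex_plus, IH, Cmult_1_l, Cpow_S; ring.
Qed.
Lemma Cmod_ex v : Cmod (ex v) = exp (- (2 * PI * snd v)).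
Proof.
unfold Cmod, ex; cbn [fst snd].
set (r := exp _); set (t := (2 * PI * fst v)%R).
replace ((r * cos t) ^ 2 + (r * sin t) ^ 2)%R with (Rsqr r).
  apply sqrt_Rsqr; left; apply exp_pos.
pose proof (sin2_cos2 t) as H; unfold Rsqr in *.
replace ((r * cos t) ^ 2 + (r * sin t) ^ 2)%R with (r * r * (sin t * sin t + cos t * cos t))%R by ring.
rewrite H; ring.
Qed.

Lemma Cmod2 z : (Cmod z * Cmod z = fst z * fst z + snd z * snd z)%R.
Proof.
unfold Cmod; rewrite sqrt_sqrt; [ring|]; nra.
Qed.

(** The Taylor bound settles t <= 1, monotonicity the range up to pi/2, and beyond it the sine
    decreases to its value at 3 pi/4, which is bounded through sin(pi/4). *)
Lemma sin_lower t : (0 <= t <= 3 * PI / 4)%R -> (t / 8 <= sin t)%R.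
Proof.
intros [t0 t1].
pose proof PI_4 as P4; pose proof PI2_3_2 as P3.
assert (S1 : forall s, (0 <= s <= 1)%R -> (5 / 6 * s <= sin s)%R).
  intros s [s0 s1]; destruct (pre_sin_bound s 0 s0) as [H _]; [lra|].
  unfold sin_approx, sin_term in H; simpl in H.
  match type of H with (?a <= _)%R => replace a with (s - s * s * s / 6)%R in H by field end.
  assert (s * s * s <= s)%R by nra; lra.
destruct (Rle_lt_dec t 1) as [H|H]; [specialize (S1 t); lra|].
destruct (Rle_lt_dec t (PI / 2)) as [H1|H1].
  assert (sin 1 <= sin t)%R by (apply sin_incr_1; lra); specialize (S1 1%R); lra.
assert (E : (sin (3 * PI / 4) <= sin t)%R) by (apply sin_decr_1; lra).
assert (E2 : (1 / 2 <= sin (3 * PI / 4))%R).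
  replace (3 * PI / 4)%R with (PI - PI / 4)%R by field.
  rewrite sin_PI_x; assert (PI / 4 <= 1)%R by lra.
  specialize (S1 (PI / 4)%R); lra.
lra.
Qed.
Lemma sin2_lower t : (- (3 * PI / 4) <= t <= 3 * PI / 4)%R -> (t * t / 64 <= sin t * sin t)%R.
Proof.
intros H; destruct (Rle_lt_dec 0 t) as [t0|t0].
  pose proof (sin_lower t ltac:(lra)); nra.
pose proof (sin_lower (- t) ltac:(lra)) as S; rewrite sin_neg in S; nra.
Qed.

(* |1 - e(x+iy)|^2 = (1-r)^2 + 4 r sin(pi x)^2 with r = exp(-2 pi y). *)
Lemma ex_lower Y v : (Rabs (fst v) <= 3 / 4)%R -> (0 <= snd v <= Y)%R ->
  (exp (- (2 * PI * Y)) / 4 * Cmod v <= Cmod (1 - ex v))%R.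
Proof.
destruct v as [x y]; simpl fst; simpl snd; intros Hx [y0 yY].
pose proof PI2_3_2 as P3; pose proof PI_RGT_0 as Pp.
assert (Hx' : (- (3 / 4) <= x <= 3 / 4)%R).
  split; [pose proof (Rle_abs (- x)); rewrite Rabs_Ropp in *; lra|pose proof (Rle_abs x); lra].
set (r := exp (- (2 * PI * y))); set (r0 := exp (- (2 * PI * Y))).
assert (r0p : (0 < r0)%R) by apply exp_pos.
assert (r0r : (r0 <= r)%R).
  unfold r, r0; destruct (Req_dec y Y) as [->|ne]; [lra|].
  left; apply exp_increasing; nra.
assert (r1 : (y * r0 <= 1 - r)%R).
  assert (E : (r * exp (2 * PI * y) = 1)%R).
    unfold r; rewrite <- exp_plus, <- exp_0; f_equal; ring.
  pose proof (exp_ineq1_le (2 * PI * y)) as I.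
  assert (r * (1 + 2 * PI * y) <= 1)%R by (rewrite <- E; apply Rmult_le_compat_l; lra).
  assert (0 <= r * y)%R by nra; assert (r * y * 3 <= r * y * (2 * PI))%R by (apply Rmult_le_compat_l; lra).
  nra.
assert (rle1 : (r <= 1)%R) by nra.
assert (S : (x * x * 9 / 64 <= sin (PI * x) * sin (PI * x))%R).
  assert (I : (PI * x * (PI * x) / 64 <= sin (PI * x) * sin (PI * x))%R) by (apply sin2_lower; nra).
  assert (9 <= PI * PI)%R by nra; assert (0 <= x * x)%R by nra; nra.
assert (M : (Cmod (1 - ex (x, y)) * Cmod (1 - ex (x, y)) =
   (1 - r) * (1 - r) + 4 * r * (sin (PI * x) * sin (PI * x)))%R).
  rewrite Cmod2; unfold ex; cbn [fst snd]; fold r.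
  replace (2 * PI * x)%R with (2 * (PI * x))%R by ring.
  rewrite cos_2a_sin, sin_2a; simpl.
  pose proof (sin2_cos2 (PI * x)) as H; unfold Rsqr in H.
  set (s := sin (PI * x)) in *; set (c := cos (PI * x)) in *.
  assert (cc : (c ^ 2 = 1 - s ^ 2)%R) by (simpl; lra).
  ring_simplify; rewrite cc; ring.
pose proof (Cmod_ge_0 (x, y)); pose proof (Cmod_ge_0 (1 - ex (x, y))).
apply Rsqr_incr_0_var; [unfold Rsqr|lra]; rewrite M.
replace (r0 / 4 * Cmod (x, y) * (r0 / 4 * Cmod (x, y)))%R with (r0 * r0 / 16 * (Cmod (x, y) * Cmod (x, y)))%R by field.
rewrite Cmod2; simpl fst; simpl snd.
assert (A : (y * r0 * (y * r0) <= (1 - r) * (1 - r))%R) by (apply Rmult_le_compat; nra).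
assert (B : (4 * r0 * (x * x * 9 / 64) <= 4 * r * (sin (PI * x) * sin (PI * x)))%R).
  assert (0 <= x * x)%R by nra; apply Rmult_le_compat; lra.
assert (r0 <= 1)%R by lra; assert (0 <= x * x)%R by nra; assert (0 <= y * y)%R by nra.
assert (r0 * r0 * (x * x) <= r0 * (x * x))%R by (apply Rmult_le_compat_r; nra).
nra.
Qed.

Lemma Cinv_0 : / 0 = 0.
Proof. unfold Cinv, RtoC, Rdiv; cbn [fst snd]; f_equal; ring. Qed.
Lemma Ceq_dec (x y : C) : x = y \/ x <> y.
Proof.
destruct (Req_dec (Cmod (x - y)) 0) as [E|E].
  left; apply Ceq_minus, Cmod_eq_0, E.
right; intros ->; apply E; replace (y - y) with (RtoC 0) by ring; apply Cmod_0.
Qed.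
Lemma Cmult_integral (x y : C) : x * y = 0 -> x = 0 \/ y = 0.
Proof.
intros E; apply (f_equal Cmod) in E; rewrite Cmod_mult, Cmod_0 in E.
destruct (Rmult_integral _ _ E) as [H|H]; [left|right]; apply Cmod_eq_0, H.
Qed.
Lemma Cv_inv (u : nat -> C) (a : C) : a <> 0 -> Cv u a -> Cv (fun n => / u n) (/ a).
Proof.
intros a0 H e e0.
assert (A : (0 < Cmod a)%R) by (apply Cmod_gt_0; auto).
destruct (H (Cmod a / 2)%R) as [N HN]; [lra|].
destruct (H (e * (Cmod a * Cmod a) / 2)%R) as [N' HN'].
  apply Rmult_lt_0_compat; [|lra]; apply Rmult_lt_0_compat; auto; nra.
exists (N + N')%nat; intros n nN; specialize (HN n ltac:(lia)); specialize (HN' n ltac:(lia)).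
assert (B : (Cmod a / 2 < Cmod (u n))%R).
  rewrite Cmod_sub_sym in HN; pose proof (Cmod_le_add a (u n)); lra.
assert (u0 : u n <> 0) by (intros E; rewrite E, Cmod_0 in B; lra).
replace (/ u n - / a) with (- (u n - a) * (/ u n * / a)) by (field; auto).
rewrite !Cmod_mult, Cmod_opp, !Cmod_inv by auto.
rewrite <- Rinv_mult; apply (Rmult_lt_reg_r (Cmod (u n) * Cmod a)); [nra|].
rewrite Rmult_assoc, Rinv_l, Rmult_1_r by nra.
eapply Rlt_le_trans; [apply HN'|].
replace (e * (Cmod a * Cmod a) / 2)%R with (e * (Cmod a / 2 * Cmod a))%R by field.
apply Rmult_le_compat_l; [lra|]; apply Rmult_le_compat_r; lra.
Qed.

(** The value of sum n x^n. For even k, sum n^(k-1) x^n is a polynomial in it. *)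
Definition pf (x : C) : C := x / (1 - x) ^ 2.
(** Horner form of a_1 p + a_2 p^2 + ... without constant term; the weight k is twice the length of
    the list. *)
Fixpoint hev (l : list R) (p : C) : C :=
  match l with nil => 0 | a :: l' => p * (RtoC a + hev l' p) end.
(** The limit of v^k [hev l p] when v tends to 0 and v^2 p to s. The power of 0 is 1 only for the
    empty tail, so the last coefficient alone survives. *)
Fixpoint hlim (l : list R) (s : C) : C :=
  match l with nil => 0 | a :: l' => s * (RtoC a * 0 ^ (2 * length l') + hlim l' s) end.
Fixpoint hbd (l : list R) (K V : R) : R :=
  match l with nil => 0%R | a :: l' => (K * (Rabs a * V ^ (2 * length l') + hbd l' K V))%R end.

Lemma hbd_ge0 l K V : (0 <= K)%R -> (0 <= V)%R -> (0 <= hbd l K V)%R.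
Proof.
intros K0 V0; induction l as [|a l IH]; cbn [hbd]; [lra|].
apply Rmult_le_pos; auto; apply Rplus_le_le_0_compat; auto.
apply Rmult_le_pos; [apply Rabs_pos|apply pow_le; auto].
Qed.
Lemma hev_cons a l v p : v ^ (2 * length (a :: l)) * hev (a :: l) p =
  (v ^ 2 * p) * (RtoC a * v ^ (2 * length l) + v ^ (2 * length l) * hev l p).
Proof.
cbn [length hev]; replace (2 * S (length l))%nat with (2 + 2 * length l)%nat by lia.
rewrite Cpow_add_r; ring.
Qed.
Lemma hev_bd l K V v p : (0 <= K)%R -> (Cmod v <= V)%R -> (Cmod (v ^ 2 * p) <= K)%R ->
  (Cmod (v ^ (2 * length l) * hev l p) <= hbd l K V)%R.
Proof.
intros K0 vV vp; assert (V0 : (0 <= V)%R) by (pose proof (Cmod_ge_0 v); lra).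
induction l as [|a l IH]; [simpl; rewrite Cmult_0_r, Cmod_0; lra|].
rewrite hev_cons, Cmod_mult; cbn [hbd].
apply Rmult_le_compat; auto; try apply Cmod_ge_0.
eapply Rle_trans; [apply Cmod_triangle|]; apply Rplus_le_compat; auto.
rewrite Cmod_mult, Cmod_R; apply Rmult_le_compat_l; [apply Rabs_pos|].
rewrite Cmod_pow; apply pow_incr; split; auto; apply Cmod_ge_0.
Qed.
Lemma hev_lim l (V p : nat -> C) s : Cv V 0 -> Cv (fun m => V m ^ 2 * p m) s ->
  Cv (fun m => V m ^ (2 * length l) * hev l (p m)) (hlim l s).
Proof.
intros HV Hp; induction l as [|a l IH].
  cbn [hlim length hev]; apply (Cv_ext (fun _ => 0)); [intros; ring|apply Cv_const].
eapply Cv_ext; [intros n; symmetry; apply hev_cons|]; cbn [hlim].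
apply Cv_mult; auto; apply Cv_plus; auto; apply Cv_scal, Cv_pow; auto.
Qed.

Definition hh (m : nat) : R := (/ 2 ^ m)%R.
Lemma hh_pos m : (0 < hh m)%R. Proof. apply Rinv_0_lt_compat, pow_lt; lra. Qed.
Lemma hh_S m : hh (S m) = (hh m / 2)%R.
Proof. unfold hh; simpl; field; apply pow_nonzero; lra. Qed.
Lemma hh_lim (e : R) : (0 < e)%R -> exists N, forall n, (N <= n)%nat -> (hh n < e)%R.
Proof.
intros e0; destruct (pow_lt_1_zero (/ 2)) with (y := e) as [N HN]; auto.
  rewrite Rabs_right; lra.
exists N; intros n nN; specialize (HN n ltac:(lia)); unfold hh; rewrite <- pow_inv.
apply Rle_lt_trans with (2 := HN), Rle_abs.
Qed.
Lemma hh_der f l : derivable_pt_lim f 0 l -> forall e, (0 < e)%R ->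
  exists N, forall n, (N <= n)%nat -> (Rabs ((f (hh n) - f 0) / hh n - l) < e)%R.
Proof.
intros H e e0; destruct (H e e0) as [d Hd]; destruct (hh_lim d (cond_pos d)) as [N HN].
exists N; intros n nN; specialize (Hd (hh n)); rewrite Rplus_0_l in Hd; apply Hd.
  pose proof (hh_pos n); lra.
rewrite Rabs_right; auto; pose proof (hh_pos n); lra.
Qed.
(** The derivative of exp(2 i pi t u) at t = 0, taken along dyadic t and reduced to two real
    derivatives. *)
Lemma ex_der (u : C) : Cv (fun m => (1 - ex (u * RtoC (hh m))) / RtoC (hh m)) (- (2 * RtoC PI * Ci * u)).
Proof.
destruct u as [x y]; apply Cv_Un; cbn [fst snd].
assert (E : forall m, (1 - ex ((x, y) * RtoC (hh m))) / RtoC (hh m) =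
  (((fun t => - (exp (- (2 * PI * (y * t))) * cos (2 * PI * (x * t)))) (hh m) - - (exp (- (2 * PI * (y * 0))) * cos (2 * PI * (x * 0)))) / hh m,
   ((fun t => - (exp (- (2 * PI * (y * t))) * sin (2 * PI * (x * t)))) (hh m) - - (exp (- (2 * PI * (y * 0))) * sin (2 * PI * (x * 0)))) / hh m)%R).
  intros m; pose proof (hh_pos m); unfold Cdiv; rewrite <- RtoC_inv by lra.
  unfold ex, Cmult, Cminus, Cplus, Copp, RtoC; cbn [fst snd].
  replace (x * 0 + y * hh m)%R with (y * hh m)%R by ring.
  replace (x * hh m - y * 0)%R with (x * hh m)%R by ring.
  replace (exp (- (2 * PI * (y * 0)))) with 1%R by (rewrite !Rmult_0_r, Ropp_0, exp_0; reflexivity).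
  replace (2 * PI * (x * 0))%R with 0%R by ring; rewrite cos_0, sin_0.
  f_equal; field; lra.
split; intros e e0.
- assert (D : derivable_pt_lim (fun t => - (exp (- (2 * PI * (y * t))) * cos (2 * PI * (x * t))))%R 0
     (fst (- (2 * RtoC PI * Ci * (x, y))))).
    apply is_derive_Reals; auto_derive; auto.
    unfold Cmult, Copp, Ci, RtoC; simpl; rewrite !Rmult_0_r, Ropp_0, exp_0, cos_0, sin_0; ring.
  destruct (hh_der _ _ D e e0) as [N HN]; exists N; intros n nN; specialize (HN n ltac:(lia)).
  rewrite E; exact HN.
- assert (D : derivable_pt_lim (fun t => - (exp (- (2 * PI * (y * t))) * sin (2 * PI * (x * t))))%R 0
     (snd (- (2 * RtoC PI * Ci * (x, y))))).
    apply is_derive_Reals; auto_derive; auto.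
    unfold Cmult, Copp, Ci, RtoC; simpl; rewrite !Rmult_0_r, Ropp_0, exp_0, cos_0, sin_0; ring.
  destruct (hh_der _ _ D e e0) as [N HN]; exists N; intros n nN; specialize (HN n ltac:(lia)).
  rewrite E; exact HN.
Qed.

(** This is 1/(2 i pi)^2, the coefficient of the double pole of [pf (ex v)] at v = 0. *)
Definition s0 : C := RtoC (- / (4 * (PI * PI))).
Lemma RtoC_neq0 r : r <> 0%R -> RtoC r <> 0.
Proof. intros H E; apply H, RtoC_inj, E. Qed.
Lemma pf_lim (u : C) : u <> 0 -> Cv (fun m => (u * RtoC (hh m)) ^ 2 * pf (ex (u * RtoC (hh m)))) s0.
Proof.
intros u0.
assert (h0 : forall m, RtoC (hh m) <> 0) by (intros m; apply RtoC_neq0; pose proof (hh_pos m); lra).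
assert (Ci0 : Ci <> 0) by (intros E; apply (f_equal snd) in E; simpl in E; lra).
assert (pi0 : RtoC PI <> 0) by (apply RtoC_neq0, PI_neq0).
assert (H1 : Cv (fun m => ex (u * RtoC (hh m))) 1).
  apply (Cv_ext (fun m => 1 + (-(1)) * (RtoC (hh m) * ((1 - ex (u * RtoC (hh m))) / RtoC (hh m))))).
    intros m; field; auto.
  assert (K : Cv (fun m => 1 + (-(1)) * (RtoC (hh m) * ((1 - ex (u * RtoC (hh m))) / RtoC (hh m))))
      (1 + (-(1)) * (0 * (- (2 * RtoC PI * Ci * u))))).
    apply Cv_plus; [apply Cv_const|]; apply Cv_scal; apply Cv_mult; [|apply ex_der].
    intros e e0; destruct (hh_lim e e0) as [N HN]; exists N; intros n nN.
    replace (RtoC (hh n) - 0) with (RtoC (hh n)) by ring; rewrite Cmod_R, Rabs_right; auto.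
    pose proof (hh_pos n); lra.
  replace (1 + (-(1)) * (0 * (- (2 * RtoC PI * Ci * u)))) with (RtoC 1) in K by ring; exact K.
assert (n0 : (- (2 * RtoC PI * Ci * u)) ^ 2 <> 0).
  apply Cpow_nz; intros E0; assert (E : 2 * RtoC PI * Ci * u = 0) by (replace (2 * RtoC PI * Ci * u) with (- - (2 * RtoC PI * Ci * u)) by ring; rewrite E0; ring).
  apply Cmult_integral in E; destruct E as [E|E]; [|auto]; [].
  apply Cmult_integral in E; destruct E as [E|E]; [|auto]; [].
  apply Cmult_integral in E; destruct E as [E|E]; [|auto]; [].
  revert E; apply RtoC_neq0; lra.
replace s0 with (u ^ 2 * (1 * / (- (2 * RtoC PI * Ci * u)) ^ 2)).
  pose proof (ex_der u) as D; apply (fun H => Cv_pow _ _ 2 H) in D.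
  apply (Cv_inv _ _ n0) in D.
  eapply Cv_ext; [|apply (Cv_scal _ _ _ (Cv_mult _ _ _ _ H1 D))].
  intros m; unfold pf, Cdiv; cbv beta; rewrite !Cpow_mult_l, Cpow_inv by auto.
  (* The denominator may vanish at some dyadic points; as the inverse of 0 is 0, both sides are then
     0. *)
  destruct (Ceq_dec (1 - ex (u * RtoC (hh m))) 0) as [E|E].
    rewrite E; simpl; rewrite !Cmult_0_l, Cinv_0; ring.
  field; auto.
unfold s0; rewrite RtoC_opp, RtoC_inv, !RtoC_mult.
  assert (I : Ci * Ci = -1) by (unfold Ci, Cmult, Copp, RtoC; simpl; f_equal; ring).
  replace ((- (2 * RtoC PI * Ci * u)) ^ 2) with (4 * (RtoC PI * RtoC PI) * (Ci * Ci) * u ^ 2) by ring.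
  rewrite I; field; repeat split; auto; apply RtoC_neq0; lra.
pose proof PI_RGT_0; nra.
Qed.

Lemma rsum_inv2 : exists M, forall n, (rsum n (fun j => / (INR j + 1) ^ 2) <= M)%R.
Proof.
exists 2%R.
assert (H : forall n, (rsum (S n) (fun j => / (INR j + 1) ^ 2) <= 2 - / (INR n + 1))%R).
  induction n as [|n IH].
    cbn [rsum INR]; replace (0 + 1)%R with 1%R by ring; rewrite pow1, Rinv_1; lra.
  change (rsum (S (S n)) (fun j => / (INR j + 1) ^ 2))%R with
    (rsum (S n) (fun j => / (INR j + 1) ^ 2) + / (INR (S n) + 1) ^ 2)%R.
  eapply Rle_trans; [apply Rplus_le_compat_r, IH|].
  rewrite !S_INR; pose proof (pos_INR n) as P; set (a := INR n) in *.
  assert (E : (/ (a + 1 + 1) ^ 2 <= / (a + 1) - / (a + 1 + 1))%R).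
    replace (/ (a + 1) - / (a + 1 + 1))%R with (/ ((a + 1) * (a + 1 + 1)))%R by (field; lra).
    apply Rinv_le_contravar; nra.
  lra.
intros [|n]; [cbn [rsum]; lra|].
specialize (H n); assert (0 < / (INR n + 1))%R by (apply Rinv_0_lt_compat; pose proof (pos_INR n); lra); lra.
Qed.

Section Lipschitz.
Variable l : list R.
Let k := (2 * length l)%nat.
Let f (v : C) : C := hev l (pf (ex v)).
Hypothesis len : (1 <= length l)%nat.
(** For f(x) = sum n^(k-1) x^n the odd terms of f(x) + f(-x) cancel and the even ones give 2 *
    2^(k-1) f(x^2). *)
Hypothesis Hdup : forall x : C, x ^ 2 <> 1 -> 2 ^ k * hev l (pf (x ^ 2)) = hev l (pf x) + hev l (pf (- x)).

Lemma C2_neq0 : (2 : C) <> 0. Proof. apply RtoC_neq0; lra. Qed.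
Lemma f_dup v : ex v <> 1 -> f v = (/ 2) ^ k * (f (v * / 2) + f ((v + 1) * / 2)).
Proof.
intros H; pose proof C2_neq0 as C2.
assert (E : ex (v * / 2) ^ 2 = ex v).
  rewrite <- ex_mulnat; f_equal; simpl; rewrite RtoC_plus; field; auto.
assert (E' : ex ((v + 1) * / 2) = - ex (v * / 2)).
  replace ((v + 1) * / 2) with (v * / 2 + RtoC (/ 2)) by (rewrite RtoC_inv by lra; field; auto).
  rewrite ex_plus, ex_half; ring.
unfold f; rewrite E', <- Hdup by (rewrite E; auto); rewrite E.
rewrite Cpow_inv by auto; field; apply Cpow_nz; auto.
Qed.
Lemma f_period v n : f (v + RtoC (INR n)) = f v.
Proof. unfold f; rewrite ex_period; auto. Qed.

Lemma hhC m : RtoC (hh (S m)) = RtoC (hh m) * / 2.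
Proof. rewrite hh_S; unfold Rdiv; rewrite RtoC_mult, RtoC_inv by lra; auto. Qed.
Lemma hh_pow2 m : RtoC (INR (2 ^ m)) * RtoC (hh m) = 1.
Proof.
rewrite <- RtoC_mult; f_equal; unfold hh; rewrite pow_INR; replace (INR 2) with 2%R by (simpl; lra).
apply Rinv_r, pow_nonzero; lra.
Qed.
Lemma f_iter m w : ex w <> 1 ->
  f w = RtoC (hh m) ^ k * csum (2 ^ m) (fun j => f ((w + RtoC (INR j)) * RtoC (hh m))).
Proof.
intros H; induction m as [|m IH].
  unfold hh; cbn [Nat.pow csum pow INR]; rewrite Rinv_1, Cpow_1_l.
  replace ((w + 0) * 1) with w by ring; ring.
rewrite IH; replace (2 ^ S m)%nat with (2 ^ m + 2 ^ m)%nat by (simpl; lia).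
rewrite csum_app, <- csum_plus, hhC, Cpow_mult_l, <- Cmult_assoc; f_equal; rewrite <- csum_scal.
apply csum_ext; intros j _; rewrite f_dup.
  f_equal; f_equal; f_equal; [ring|].
  rewrite plus_INR, RtoC_plus; transitivity ((w + RtoC (INR j)) * (RtoC (hh m) * / 2) +
    (RtoC (INR (2 ^ m)) * RtoC (hh m)) * / 2); [rewrite hh_pow2|]; ring.
intros E; apply H.
assert (E' : ex (RtoC (INR (2 ^ m)) * ((w + RtoC (INR j)) * RtoC (hh m))) = 1).
  rewrite ex_mulnat, E; apply Cpow_1_l.
rewrite <- (ex_period w j), <- E'; f_equal.
transitivity ((RtoC (INR (2 ^ m)) * RtoC (hh m)) * (w + RtoC (INR j))); [rewrite hh_pow2|]; ring.
Qed.

(** The upper half of the dyadic points is moved by the period 1. For fixed j both arguments then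
    tend to 0, where the pole of f decides the limit; unshifted, the points with j near the end
    would approach the pole at 1. *)
Lemma f_iter2 m w : ex w <> 1 -> f w = csum (2 ^ m) (fun j => RtoC (hh (S m)) ^ k *
  (f ((w + RtoC (INR j)) * RtoC (hh (S m))) + f ((w - 1 - RtoC (INR j)) * RtoC (hh (S m))))).
Proof.
intros H; rewrite (f_iter (S m) w H), csum_scal; f_equal.
replace (2 ^ S m)%nat with (2 ^ m + 2 ^ m)%nat by (simpl; lia).
rewrite csum_app, csum_plus; f_equal; rewrite csum_rev; apply csum_ext; intros j Hj.
rewrite <- (f_period ((w - 1 - RtoC (INR j)) * RtoC (hh (S m))) 1); f_equal.
replace (INR (2 ^ m + (2 ^ m - 1 - j))) with (INR (2 ^ S m) - 1 - INR j)%R.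
  rewrite !RtoC_minus; change (RtoC (INR 1)) with (RtoC 1).
  transitivity ((w - 1 - RtoC (INR j)) * RtoC (hh (S m)) + RtoC (INR (2 ^ S m)) * RtoC (hh (S m))).
    ring.
  rewrite hh_pow2; auto.
replace (2 ^ S m)%nat with (2 ^ m + 2 ^ m)%nat by (simpl; lia).
rewrite !plus_INR, !minus_INR by lia; simpl; ring.
Qed.

(** Linear growth of the distances from w to the integers. Since k >= 2 it dominates the terms of
    the Lipschitz sum by a multiple of 1/(j+1)^2. *)
Definition sep (c : R) (w : C) : Prop := forall j : nat,
  (c * (INR j + 1) <= Cmod (w + RtoC (INR j)))%R /\ (c * (INR j + 1) <= Cmod (w - 1 - RtoC (INR j)))%R.

(** In the strip f has only the pole of order k at 0. The width 3/4 leaves room for the dyadic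
    points, whose real parts stay within 1/4 + 1/2. *)
Lemma f_bound (Y : R) : exists K : R, (0 <= K)%R /\ forall v : C, v <> 0 -> (Rabs (fst v) <= 3 / 4)%R -> (0 <= snd v <= Y)%R ->
  (Cmod (f v) <= K * / Cmod v ^ k)%R.
Proof.
set (r0 := exp (- (2 * PI * Y))); assert (r0p : (0 < r0)%R) by apply exp_pos.
pose (K0 := (16 / (r0 * r0))%R); assert (K00 : (0 <= K0)%R).
  unfold K0; apply Rlt_le, Rdiv_lt_0_compat; nra.
exists (hbd l K0 (1 + Rabs Y)); split; [apply hbd_ge0; auto; pose proof (Rabs_pos Y); lra|].
intros v v0 Hx Hy; pose proof (ex_lower Y v Hx Hy) as L; fold r0 in L.
assert (V : (0 < Cmod v)%R) by (apply Cmod_gt_0; auto).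
assert (vV : (Cmod v <= 1 + Rabs Y)%R).
  eapply Rle_trans; [apply Cmod_le_sum|]; pose proof (Rle_abs Y); rewrite (Rabs_right (snd v)) by lra; lra.
assert (B : (Cmod (v ^ 2 * pf (ex v)) <= K0)%R).
  assert (n0 : 1 - ex v <> 0) by (intros E; rewrite E, Cmod_0 in L; nra).
  unfold pf, Cdiv; rewrite !Cmod_mult, Cmod_inv by (apply Cpow_nz; auto).
  rewrite !Cmod_pow, Cmod_ex; set (d := Cmod (1 - ex v)) in *.
  assert (d0 : (0 < d)%R) by (unfold d; apply Cmod_gt_0; auto).
  assert (x1 : (exp (- (2 * PI * snd v)) <= 1)%R).
    rewrite <- exp_0; destruct (Req_dec (snd v) 0) as [E|E].
      rewrite E; replace (- (2 * PI * 0))%R with 0%R by ring; lra.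
    left; apply exp_increasing; pose proof PI_RGT_0; assert (0 < PI * snd v)%R by (apply Rmult_lt_0_compat; lra); lra.
  pose proof (exp_pos (- (2 * PI * snd v))) as x0; set (x := exp (- (2 * PI * snd v))) in *.
  apply (Rmult_le_reg_r (d ^ 2)); [apply pow_lt; auto|].
  replace (Cmod v ^ 2 * (x * / d ^ 2) * d ^ 2)%R with (Cmod v ^ 2 * x)%R by (field; lra).
  apply Rle_trans with (Cmod v ^ 2)%R.
    rewrite <- (Rmult_1_r (Cmod v ^ 2)) at 2; apply Rmult_le_compat_l; auto; apply pow_le; lra.
  replace (Cmod v ^ 2)%R with (K0 * (r0 / 4 * Cmod v) ^ 2)%R by (unfold K0; field; lra).
  apply Rmult_le_compat_l; auto; apply pow_incr; split; auto.
  apply Rmult_le_pos; lra.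
pose proof (hev_bd l K0 _ v _ K00 vV B) as H; rewrite Cmod_mult, Cmod_pow in H.
apply (Rmult_le_reg_l (Cmod v ^ k)); [apply pow_lt; auto|].
replace (Cmod v ^ k * (hbd l K0 (1 + Rabs Y) * / Cmod v ^ k))%R with (hbd l K0 (1 + Rabs Y)).
  exact H.
field; apply pow_nonzero; lra.
Qed.

Lemma f_scaled_lim (u : C) : u <> 0 -> Cv (fun m => RtoC (hh (S m)) ^ k * f (u * RtoC (hh (S m)))) (hlim l s0 * / u ^ k).
Proof.
intros u0.
assert (Z : Cv (fun m => u * RtoC (hh m)) 0).
  replace (RtoC 0) with (u * 0) by ring; apply Cv_scal.
  intros e e0; destruct (hh_lim e e0) as [N HN]; exists N; intros n nN.
  replace (RtoC (hh n) - 0) with (RtoC (hh n)) by ring; rewrite Cmod_R, Rabs_right; auto.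
  pose proof (hh_pos n); lra.
pose proof (hev_lim l _ _ _ Z (pf_lim u u0)) as H.
apply (Cv_sub S) in H; [|intros J; exists J; intros; lia].
rewrite Cmult_comm.
eapply Cv_ext; [|apply (Cv_scal _ _ _ H)].
intros n; cbv beta; fold k; rewrite Cpow_mult_l; unfold f; field; apply Cpow_nz; auto.
Qed.

Lemma pow_hh_le (c : R) (w : C) m j : (0 < c)%R -> (c * (INR j + 1) <= Cmod w)%R -> forall K, (0 <= K)%R ->
  (hh m ^ k * (K * / Cmod (w * RtoC (hh m)) ^ k) <= K * / c ^ k * / (INR j + 1) ^ 2)%R.
Proof.
intros c0 cw K K0; pose proof (hh_pos m) as h0; pose proof (pos_INR j) as j0.
assert (0 < c * (INR j + 1))%R by (apply Rmult_lt_0_compat; lra).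
rewrite Cmod_mult, Cmod_R, (Rabs_right (hh m)) by lra; rewrite Rpow_mult_distr.
assert (0 < Cmod w ^ k)%R by (apply pow_lt; lra).
assert (0 < hh m ^ k)%R by (apply pow_lt; lra).
replace (hh m ^ k * (K * / (Cmod w ^ k * hh m ^ k)))%R with (K * / Cmod w ^ k)%R by (field; lra).
rewrite Rmult_assoc; apply Rmult_le_compat_l; auto.
rewrite <- Rinv_mult; apply Rinv_le_contravar.
  apply Rmult_lt_0_compat; apply pow_lt; lra.
apply Rle_trans with ((c * (INR j + 1)) ^ k)%R; [|apply pow_incr; lra].
rewrite Rpow_mult_distr; apply Rmult_le_compat_l; [apply pow_le; lra|].
apply Rle_pow; [lra|unfold k; lia].
Qed.

Lemma lipschitz (w : C) (c : R) : (0 < c)%R -> sep c w -> ex w <> 1 -> (0 <= snd w)%R ->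
  Cv (fun n => csum n (fun j => hlim l s0 * (/ (w + RtoC (INR j)) ^ k + / (w - 1 - RtoC (INR j)) ^ k))) (f w).
Proof.
intros c0 Hs w1 Hy; destruct (f_bound (snd w)) as [K [K0 HK]].
destruct rsum_inv2 as [M HM].
assert (n1 : forall j, w + RtoC (INR j) <> 0).
  intros j E; destruct (Hs j) as [H _]; rewrite E, Cmod_0 in H; pose proof (pos_INR j); nra.
assert (n2 : forall j, w - 1 - RtoC (INR j) <> 0).
  intros j E; destruct (Hs j) as [_ H]; rewrite E, Cmod_0 in H; pose proof (pos_INR j); nra.
(* From [m1] on, the scaled real parts of w and of w shifted by one are at most 1/4, as [f_bound]
   requires. *)
destruct (INR_unbounded (4 * (Rabs (fst w) + 1))) as [m1 Hm1].
assert (big : forall m, (m1 <= m)%nat -> (4 * (Rabs (fst w) + 1) * hh (S m) <= 1)%R).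
  intros m mm; apply (Rmult_le_reg_r (INR (2 ^ S m))).
    apply lt_0_INR; pose proof (Nat.pow_nonzero 2 (S m)); lia.
  pose proof (hh_pow2 (S m)) as E; rewrite <- RtoC_mult in E; apply RtoC_inj in E.
  rewrite Rmult_assoc, (Rmult_comm (hh _)), E, Rmult_1_l, Rmult_1_r.
  apply Rle_trans with (INR m1); [lra|]; apply le_INR.
  assert (S m < 2 ^ S m)%nat by (apply Nat.pow_gt_lin_r; lia); lia.
destruct (tannery (fun m j => RtoC (hh (S m)) ^ k *
  (f ((w + RtoC (INR j)) * RtoC (hh (S m))) + f ((w - 1 - RtoC (INR j)) * RtoC (hh (S m)))))
  (fun j => hlim l s0 * (/ (w + RtoC (INR j)) ^ k + / (w - 1 - RtoC (INR j)) ^ k))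
  (fun j => 2 * (K * / c ^ k) * / (INR j + 1) ^ 2)%R (2 * (K * / c ^ k) * M)%R (fun m => 2 ^ m)%nat m1) as [L [H1 H2]].
- intros n; rewrite rsum_scal; apply Rmult_le_compat_l; auto.
  apply Rmult_le_pos; [lra|]; apply Rmult_le_pos; auto.
  left; apply Rinv_0_lt_compat, pow_lt; auto.
- intros m j mm jm; specialize (big m mm); pose proof (hh_pos (S m)) as h0; pose proof (Rabs_pos (fst w)) as ax.
  assert (jh : ((INR j + 1) * hh (S m) <= 1 / 2)%R).
    assert (I : (INR j + 1 <= INR (2 ^ m))%R) by (rewrite <- S_INR; apply le_INR; lia).
    pose proof (hh_pow2 (S m)) as E; rewrite <- RtoC_mult in E; apply RtoC_inj in E.
    replace (2 ^ S m)%nat with (2 * 2 ^ m)%nat in E by (simpl; lia).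
    rewrite mult_INR in E; simpl (INR 2) in E; nra.
  assert (h1 : (hh (S m) <= 1)%R) by nra.
  pose proof (pos_INR j) as j0; pose proof (Rle_abs (fst w)) as a1.
  pose proof (Rle_abs (- fst w)) as a2; rewrite Rabs_Ropp in a2.
  assert (xh : (- (1 / 4) <= fst w * hh (S m) <= 1 / 4)%R) by nra.
  assert (xh' : (- (1 / 4) <= fst w * hh (S m) + hh (S m) <= 1 / 4)%R) by nra.
  assert (jh0 : (0 <= INR j * hh (S m))%R) by (apply Rmult_le_pos; lra).
  rewrite Cmod_mult, Cmod_pow, Cmod_R, (Rabs_right (hh (S m))) by lra.
  apply Rle_trans with (hh (S m) ^ k * (K * / Cmod ((w + RtoC (INR j)) * RtoC (hh (S m))) ^ k) +
     hh (S m) ^ k * (K * / Cmod ((w - 1 - RtoC (INR j)) * RtoC (hh (S m))) ^ k))%R.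
    rewrite <- Rmult_plus_distr_l; apply Rmult_le_compat_l; [apply pow_le; lra|].
    eapply Rle_trans; [apply Cmod_triangle|]; apply Rplus_le_compat; apply HK.
    + intros E; destruct (Cmult_integral _ _ E) as [E1|E1]; [apply (n1 _ E1)|].
      revert E1; apply RtoC_neq0; lra.
    + simpl; apply Rabs_le; nra.
    + simpl; nra.
    + intros E; destruct (Cmult_integral _ _ E) as [E1|E1]; [apply (n2 _ E1)|].
      revert E1; apply RtoC_neq0; lra.
    + simpl; apply Rabs_le; nra.
    + simpl; nra.
  destruct (Hs j) as [S1 S2].
  pose proof (pow_hh_le c _ (S m) j c0 S1 K K0); pose proof (pow_hh_le c _ (S m) j c0 S2 K K0); lra.
- intros j; rewrite Cmult_plus_distr_l.
  eapply Cv_ext; [|apply (Cv_plus _ _ _ _ (f_scaled_lim _ (n1 j)) (f_scaled_lim _ (n2 j)))].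
  intros n; cbv beta; ring.
- intros J; exists J; intros m mJ; assert (m < 2 ^ m)%nat by (apply Nat.pow_gt_lin_r; lia); lia.
- replace (f w) with L; auto; apply (Cv_unique _ _ _ H1).
  apply (Cv_ext (fun _ => f w)); [intros m; apply f_iter2; auto|apply Cv_const].
Qed.
End Lipschitz.

Lemma csum_exchange n m (f : nat -> nat -> C) :
  csum n (fun i => csum m (fun j => f i j)) = csum m (fun j => csum n (fun i => f i j)).
Proof.
induction n as [|n IH]; cbn [csum].
  induction m as [|m IHm]; cbn [csum]; [auto|rewrite <- IHm; ring].
rewrite IH, <- csum_plus; auto.
Qed.

(** * Lambert series and lattice sums *)

(** The series g spread over the multiples of c, so that the inner series in q^c are all indexed by
    the power of q. *)
Definition mult (c : nat) (g : nat -> C) (m : nat) : C :=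
  if Nat.eqb (m mod c) 0 then g (m / c)%nat else 0.
Lemma csum_mult c g M : (0 < c)%nat ->
  exists N, csum M (mult c g) = csum N g /\ (M <= c * N)%nat /\ (c * N < M + c)%nat.
Proof.
intros c0; induction M as [|M [N [E [H1 H2]]]]; [exists O; cbn [csum]; repeat split; lia|].
cbn [csum]; rewrite E; unfold mult; pose proof (Nat.div_mod M c ltac:(lia)) as D.
destruct (Nat.eqb_spec (M mod c) 0) as [z|nz].
  rewrite z in D; assert (EN : N = (M / c)%nat) by nia.
  exists (S N); cbn [csum]; rewrite <- EN; repeat split; nia.
exists N; repeat split; [ring| |lia].
assert (M <> c * N)%nat; [|lia].
intros EM; apply nz; rewrite EM, Nat.mul_comm; apply Nat.Div0.mod_mul.
Qed.
Lemma csum_mult_cv c g L : (0 < c)%nat -> Cv (fun n => csum n g) L -> Cv (fun M => csum M (mult c g)) L.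
Proof.
intros c0 H e e0; destruct (H e e0) as [N HN]; exists (c * N)%nat; intros M MN.
destruct (csum_mult c g M c0) as [N' [-> [H1 H2]]]; apply HN; nia.
Qed.

(* sigma_j(m), with the sum taken over the complementary divisors. *)
Definition sg (j m : nat) : R :=
  rsum m (fun i => if Nat.eqb (m mod (S i)) 0 then (INR (m / S i) ^ j)%R else 0%R).

Lemma csum_RtoC n f : csum n (fun i => RtoC (f i)) = RtoC (rsum n f).
Proof. induction n as [|n IH]; cbn [csum rsum]; [auto|rewrite IH, RtoC_plus; auto]. Qed.
Lemma csum_scalr n (c : C) (f : nat -> C) : csum n (fun i => f i * c) = csum n f * c.
Proof. induction n as [|n IH]; cbn [csum]; [ring|rewrite IH; ring]. Qed.
Lemma csum_0 n (f : nat -> C) : (forall i, (i < n)%nat -> f i = 0) -> csum n f = 0.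
Proof. induction n as [|n IH]; intros H; cbn [csum]; [auto|rewrite IH, H; auto; ring]. Qed.

Definition lam (j : nat) (x : C) (n : nat) : C := RtoC (INR n ^ j) * x ^ n.

(** Cutting every inner series at the same power M of q reduces the interchange of summations to
    finite sums. *)
Lemma lambert_finite j (q : C) M : (0 < j)%nat ->
  csum M (fun i => csum M (mult (S i) (lam j (q ^ S i)))) = csum M (fun m => RtoC (sg j m) * q ^ m).
Proof.
intros j0; rewrite csum_exchange; apply csum_ext; intros m mM.
unfold sg; rewrite <- csum_RtoC, <- csum_scalr.
replace M with (m + (M - m))%nat by lia; rewrite csum_app, (csum_0 (M - m) (fun i => mult (S (m + i)) (lam j (q ^ S (m + i))) m)).
  rewrite Cplus_0_r; apply csum_ext; intros i im; unfold mult, lam.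
  destruct (Nat.eqb_spec (m mod S i) 0) as [z|nz]; [|ring].
  rewrite <- Cpow_mult_r; replace (S i * (m / S i))%nat with m; auto.
  pose proof (Nat.div_mod m (S i) ltac:(lia)); lia.
(* At m = 0 every modulus divides; these terms vanish because 0^j = 0 for j > 0. *)
intros i iM; unfold mult, lam; destruct m as [|m].
  rewrite Nat.Div0.mod_0_l, Nat.Div0.div_0_l; cbn [Nat.eqb INR]; rewrite pow_i by auto; ring.
rewrite Nat.mod_small by lia; destruct (Nat.eqb_spec (S m) 0); [lia|auto].
Qed.

Section Lambert.
Variables (j : nat) (q : C).
Hypothesis j0 : (0 < j)%nat.
Hypothesis q1 : (Cmod q < 1)%R.
Variable F : C -> C.
Hypothesis HF : forall x : C, (Cmod x < 1)%R -> Cv (fun n => csum n (lam j x)) (F x).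

(** At the real point |q| the series has nonnegative terms, so its convergence bounds the partial
    sums. *)
Lemma lam_sum_bd : exists K, forall n, (rsum n (fun i => INR i ^ j * Cmod q ^ i) <= K)%R.
Proof.
assert (c1 : (Cmod (RtoC (Cmod q)) < 1)%R) by (rewrite Cmod_R, Rabs_right; auto; pose proof (Cmod_ge_0 q); lra).
pose proof (HF _ c1) as H; apply Cv_Un in H; destruct H as [H _].
destruct (cauchy_bound _ (CV_Cauchy _ (exist _ _ H))) as [K HK]; exists K; intros n.
apply HK; exists n.
transitivity (fst (RtoC (rsum n (fun i => INR i ^ j * Cmod q ^ i)%R))); [auto|].
f_equal; rewrite <- csum_RtoC; apply csum_ext; intros i _; unfold lam.
rewrite <- RtoC_pow, RtoC_mult; auto.
Qed.

Lemma geom_bd r : (0 <= r < 1)%R -> forall n, (rsum n (fun i => r ^ i) <= / (1 - r))%R.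
Proof.
intros [r0 r1] n.
assert (E : (rsum n (fun i => r ^ i) * (1 - r) = 1 - r ^ n)%R).
  induction n as [|n IH]; cbn [rsum pow]; [ring|].
  rewrite Rmult_plus_distr_r, IH; ring.
apply (Rmult_le_reg_r (1 - r)); [lra|]; rewrite E, Rinv_l by lra.
pose proof (pow_le r n r0); lra.
Qed.

Lemma lambert : exists L, Cv (fun M => csum M (fun m => RtoC (sg j m) * q ^ m)) L /\
  Cv (fun n => csum n (fun i => F (q ^ S i))) L.
Proof.
destruct lam_sum_bd as [K HK]; pose proof (Cmod_ge_0 q) as q0.
assert (K0 : (0 <= K)%R) by exact (HK O).
assert (qi : forall i, (Cmod (q ^ S i) < 1)%R).
  intros i; rewrite Cmod_pow; apply Rle_lt_trans with (Cmod q); auto.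
  cbn [pow]; assert (Cmod q ^ i <= 1)%R by (rewrite <- (pow1 i); apply pow_incr; lra).
  assert (0 <= Cmod q ^ i)%R by (apply pow_le; auto); nra.
destruct (tannery (fun M i => csum M (mult (S i) (lam j (q ^ S i)))) (fun i => F (q ^ S i))
   (fun i => K * Cmod q ^ i)%R (K * / (1 - Cmod q))%R (fun M => M) O) as [L [H1 H2]].
- intros n; rewrite rsum_scal; apply Rmult_le_compat_l; auto; apply geom_bd; auto.
- intros M i _ _; destruct (csum_mult (S i) (lam j (q ^ S i)) M ltac:(lia)) as [N [-> _]].
  eapply Rle_trans; [apply Cmod_csum|].
  apply Rle_trans with (Cmod q ^ i * rsum N (fun n => INR n ^ j * Cmod q ^ n))%R.
    rewrite <- rsum_scal; apply rsum_le; intros n _; unfold lam.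
    rewrite Cmod_mult, Cmod_R, !Cmod_pow.
    assert (P : (0 <= INR n ^ j)%R) by (apply pow_le, pos_INR); rewrite Rabs_right by lra.
    destruct n as [|n]; [cbn [INR]; rewrite pow_i by auto; lra|].
    replace (Cmod q ^ i * (INR (S n) ^ j * Cmod q ^ S n))%R with (INR (S n) ^ j * Cmod q ^ (i + S n))%R
      by (rewrite pow_add; ring).
    apply Rmult_le_compat_l; auto; rewrite <- pow_mult.
    (* The exponent (i+1)(n+1) is at least i + (n+1), which splits off the geometric factor |q|^i of
       the dominating series. *)
    replace (S i * S n)%nat with ((i + S n) + i * n)%nat by lia; rewrite pow_add.
    assert (0 <= Cmod q ^ (i + S n))%R by (apply pow_le; auto).
    assert (Cmod q ^ (i * n) <= 1)%R by (rewrite <- (pow1 (i * n)); apply pow_incr; lra).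
    rewrite <- (Rmult_1_r (Cmod q ^ (i + S n))) at 2; apply Rmult_le_compat_l; auto.
  rewrite Rmult_comm; apply Rmult_le_compat_r; auto; apply pow_le; auto.
- intros i; apply csum_mult_cv; [lia|]; apply HF; auto.
- intros J; exists J; auto.
- exists L; split; auto; eapply Cv_ext; [|apply H1]; intros M; apply lambert_finite; auto.
Qed.
End Lambert.

Section Lattice.
Variable l : list R.
Let k := (2 * length l)%nat.
Hypothesis len : (2 <= length l)%nat.
Hypothesis Hdup : forall x : C, x ^ 2 <> 1 -> 2 ^ k * hev l (pf (x ^ 2)) = hev l (pf x) + hev l (pf (- x)).
Hypothesis Hser : forall x : C, (Cmod x < 1)%R -> Cv (fun n => csum n (lam (k - 1) x)) (hev l (pf x)).
Let Cs : C := hlim l s0.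
Hypothesis Cs0 : Cs <> 0.

Definition nz (n : nat) : C := RtoC (INR (S n)).
Lemma nz0 n : nz n <> 0. Proof. apply RtoC_neq0, not_0_INR; lia. Qed.

Lemma inv_pow_bd n : (Cmod (/ nz n ^ k) <= / (INR n + 1) ^ 2)%R.
Proof.
pose proof (pos_INR n); rewrite Cmod_inv by apply Cpow_nz, nz0.
rewrite Cmod_pow; unfold nz; rewrite Cmod_R, S_INR, Rabs_right by lra.
apply Rinv_le_contravar; [apply pow_lt; lra|apply Rle_pow; [lra|unfold k; lia]].
Qed.
Lemma zeta_ex : exists Z, Cv (fun n => csum n (fun i => / nz i ^ k)) Z.
Proof.
destruct rsum_inv2 as [M HM].
destruct (tannery (fun _ i => / nz i ^ k) (fun i => / nz i ^ k) _ M (fun m => m) O HM) as [L [H _]].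
- intros _ i _ _; apply inv_pow_bd.
- intros i; apply Cv_const.
- intros J; exists J; auto.
- exists L; exact H.
Qed.

(* The Lipschitz formula at w = 1/2. *)
Lemma zeta_val Z : Cv (fun n => csum n (fun i => / nz i ^ k)) Z ->
  Cs * Z * (2 * (2 ^ k - 1)) = hev l (- / 4).
Proof.
intros HZ; pose proof C2_neq0 as C2.
set (w := RtoC (/ 2)).
assert (ew : ex w = -1) by apply ex_half.
assert (o0 : forall j, 2 * RtoC (INR j) + 1 <> 0).
  intros j; rewrite <- RtoC_mult, <- RtoC_plus; apply RtoC_neq0; pose proof (pos_INR j); lra.
assert (P : pf (-1) = - / 4).
  unfold pf; replace ((1 - -1) ^ 2) with (RtoC 4) by ring; unfold Cdiv; ring.
assert (Sp : sep (/ 2) w).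
  intros j; pose proof (pos_INR j); unfold w; split; rewrite <- ?RtoC_minus, <- ?RtoC_plus, Cmod_R.
    rewrite Rabs_right; lra.
  rewrite Rabs_left; lra.
pose proof (lipschitz l ltac:(lia) Hdup w (/ 2) ltac:(lra) Sp) as H.
cbv zeta beta in H; rewrite ew, P in H.
assert (H' := H ltac:(intros E; apply RtoC_inj in E; lra) ltac:(unfold w; simpl; lra)); clear H.
fold k Cs in H'.
assert (H2 : Cv (fun n => csum n (fun j => Cs * (2 * 2 ^ k) * / (2 * RtoC (INR j) + 1) ^ k)) (hev l (- / 4))).
  eapply Cv_ext; [|apply H']; intros n; apply csum_ext; intros j _.
  assert (W : w + RtoC (INR j) = (2 * RtoC (INR j) + 1) * / 2).
    unfold w; rewrite RtoC_inv by lra; field; auto.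
  assert (W' : w - 1 - RtoC (INR j) = - (2 * RtoC (INR j) + 1) * / 2).
    unfold w; rewrite RtoC_inv by lra; field; auto.
  assert (N : forall x : C, (- x) ^ k = x ^ k).
    intros x; unfold k; rewrite !Cpow_mult_r; f_equal; ring.
  rewrite W, W', !Cpow_mult_l, N, Cpow_inv by auto; field; split; apply Cpow_nz; auto.
assert (H3 : Cv (fun n => csum (2 * n) (fun i => / nz i ^ k)) Z).
  apply (Cv_sub (fun n => 2 * n)%nat (fun n => csum n (fun i => / nz i ^ k))); auto.
  intros J; exists J; intros; lia.
assert (E2 : forall n, csum (2 * n) (fun i => / nz i ^ k) =
    csum n (fun j => / (2 * RtoC (INR j) + 1) ^ k) + / 2 ^ k * csum n (fun i => / nz i ^ k)).
  intros n; induction n as [|n IH]; [change (RtoC 0 = 0 + / 2 ^ k * 0); ring|].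
  replace (2 * S n)%nat with (S (S (2 * n))) by lia; cbn [csum]; rewrite IH.
  replace (nz (2 * n)%nat) with (2 * RtoC (INR n) + 1).
    replace (nz (S (2 * n)%nat)) with (2 * nz n).
      rewrite (Cpow_mult_l 2); field; repeat split; apply Cpow_nz; auto; apply nz0.
    unfold nz; rewrite <- RtoC_mult; f_equal; rewrite !S_INR, mult_INR; simpl; ring.
  unfold nz; rewrite <- RtoC_mult, <- RtoC_plus; f_equal; rewrite S_INR, mult_INR; simpl; ring.
assert (H4 : Cv (fun n => csum n (fun j => / (2 * RtoC (INR j) + 1) ^ k)) (Z + - / 2 ^ k * Z)).
  eapply Cv_ext; [|apply (Cv_plus _ _ _ _ H3 (Cv_scal (- / 2 ^ k) _ _ HZ))].
  intros n; cbv beta; rewrite E2; ring.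
apply (Cv_scal (Cs * (2 * 2 ^ k))) in H4.
assert (E : hev l (- / 4) = Cs * (2 * 2 ^ k) * (Z + - / 2 ^ k * Z)).
  apply (Cv_unique _ _ _ H2); eapply Cv_ext; [|apply H4].
  intros n; cbv beta; rewrite <- csum_scal; auto.
rewrite E; field; apply Cpow_nz; auto.
Qed.

Definition row (z : C) (N i : nat) : C := / (nz i * z) ^ k +
  csum N (fun j => / (nz i * z + nz j) ^ k + / (nz i * z - nz j) ^ k).
(* Half of the sum of (cz+d)^-k over the square |c|, |d| <= N without the origin (k is even). *)
Definition box (z : C) (N : nat) : C := csum N (fun i => / nz i ^ k) + csum N (row z N).

Lemma pow_k_neg (x : C) : (- x) ^ k = x ^ k.
Proof. unfold k; rewrite !Cpow_mult_r; f_equal; ring. Qed.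

(** The imaginary part of az + b controls a. If |b| is at most 2a|z| this controls b as well;
    otherwise the triangle inequality does. *)
Lemma sep_pos (z : C) (a b : R) : (0 < snd z)%R -> (0 <= a)%R ->
  (snd z / (2 * Cmod z + 1) * a <= Cmod (RtoC a * z + RtoC b))%R /\
  (snd z / (2 * Cmod z + 1) * Rabs b <= Cmod (RtoC a * z + RtoC b))%R.
Proof.
intros y0 a0; pose proof (Cmod_ge_0 z) as z0.
assert (yz : (snd z <= Cmod z)%R) by (eapply Rle_trans; [apply Rle_abs|apply Cmod_snd]).
set (y := snd z) in *; set (r := Cmod z) in *; set (ka := (y / (2 * r + 1))%R).
assert (k0 : (0 < ka)%R) by (apply Rdiv_lt_0_compat; lra).
assert (kE : (ka * (2 * r + 1) = y)%R) by (unfold ka; field; lra).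
assert (I : (a * y <= Cmod (RtoC a * z + RtoC b))%R).
  eapply Rle_trans; [|apply Cmod_snd]; eapply Rle_trans; [|apply Rle_abs]; unfold y; simpl; lra.
assert (ay : (a * y = ka * (2 * (a * r)) + ka * a)%R) by (rewrite <- kE; ring).
assert (ka0 : (0 <= ka * (a * r))%R) by (apply Rmult_le_pos; [lra|apply Rmult_le_pos; lra]).
assert (ka1 : (0 <= ka * a)%R) by (apply Rmult_le_pos; lra).
split; [lra|].
destruct (Rle_lt_dec (2 * (a * r)) (Rabs b)) as [H|H].
  2: assert (ka * Rabs b <= ka * (2 * (a * r)))%R by (apply Rmult_le_compat_l; lra); lra.
assert (T : (Rabs b <= Cmod (RtoC a * z + RtoC b) + a * r)%R).
  pose proof (Cmod_le_add (RtoC b) (- (RtoC a * z))) as T.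
  replace (RtoC b - - (RtoC a * z)) with (RtoC a * z + RtoC b) in T by ring.
  rewrite Cmod_opp, Cmod_mult, !Cmod_R, (Rabs_right a) in T by lra; exact T.
assert (k2 : (ka <= 1 / 2)%R) by nra.
pose proof (Rabs_pos b); nra.
Qed.

Section Point.
Variable z : C.
Hypothesis y0 : (0 < snd z)%R.
Let ka := (snd z / (2 * Cmod z + 1))%R.
Lemma ka_pos : (0 < ka)%R.
Proof. apply Rdiv_lt_0_compat; auto; pose proof (Cmod_ge_0 z); lra. Qed.

Lemma nzE i : nz i = RtoC (INR i + 1). Proof. unfold nz; rewrite S_INR; auto. Qed.
Lemma term_ge i (b : R) : (ka * (INR i + 1) <= Cmod (nz i * z + RtoC b))%R /\ (ka * Rabs b <= Cmod (nz i * z + RtoC b))%R.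
Proof. rewrite nzE; apply sep_pos; auto; pose proof (pos_INR i); lra. Qed.
Lemma term_nz i (b : R) : nz i * z + RtoC b <> 0.
Proof.
intros E; destruct (term_ge i b) as [H _]; rewrite E, Cmod_0 in H.
pose proof ka_pos; pose proof (pos_INR i); nra.
Qed.
(** Since k >= 4, the k-th power leaves a square in i and a square in j: the lattice sum converges
    absolutely. *)
Lemma row_term_bd i j (b : R) : (Rabs b = INR j + 1)%R ->
  (Cmod (/ (nz i * z + RtoC b) ^ k) <= / ka ^ k * / (INR i + 1) ^ 2 * / (INR j + 1) ^ 2)%R.
Proof.
intros bE; destruct (term_ge i b) as [H1 H2]; rewrite bE in H2; pose proof ka_pos as k0.
pose proof (pos_INR i); pose proof (pos_INR j).
rewrite Cmod_inv by (apply Cpow_nz, term_nz); rewrite Cmod_pow; set (t := Cmod (nz i * z + RtoC b)) in *.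
rewrite <- !Rinv_mult; apply Rinv_le_contravar.
  apply Rmult_lt_0_compat; [apply Rmult_lt_0_compat|]; apply pow_lt; lra.
assert (t0 : (0 < t)%R) by (apply Rlt_le_trans with (2 := H1); apply Rmult_lt_0_compat; lra).
assert (A : (INR i + 1 <= t / ka)%R).
  apply (Rmult_le_reg_l ka); auto; replace (ka * (t / ka))%R with t by (field; lra); auto.
assert (B : (INR j + 1 <= t / ka)%R).
  apply (Rmult_le_reg_l ka); auto; replace (ka * (t / ka))%R with t by (field; lra); auto.
replace (t ^ k)%R with (ka ^ k * (t / ka) ^ k)%R by (rewrite <- Rpow_mult_distr; f_equal; field; lra).
rewrite Rmult_assoc; apply Rmult_le_compat_l; [apply pow_le; lra|].
apply Rle_trans with ((t / ka) ^ 4)%R; [|apply Rle_pow; [lra|unfold k; lia]].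
replace ((t / ka) ^ 4)%R with ((t / ka) ^ 2 * (t / ka) ^ 2)%R by ring.
apply Rmult_le_compat; try (apply pow_le; lra); apply pow_incr; lra.
Qed.
Lemma axis_bd i : (Cmod (/ (nz i * z) ^ k) <= / ka ^ k * / (INR i + 1) ^ 2)%R.
Proof.
destruct (term_ge i 0) as [H1 _]; pose proof (term_nz i 0) as n0; pose proof ka_pos as k0; pose proof (pos_INR i).
rewrite Cplus_0_r in H1, n0.
rewrite Cmod_inv by (apply Cpow_nz; auto); rewrite Cmod_pow, <- Rinv_mult; apply Rinv_le_contravar.
  apply Rmult_lt_0_compat; apply pow_lt; lra.
apply Rle_trans with ((ka * (INR i + 1)) ^ k)%R; [|apply pow_incr; split; auto; apply Rmult_le_pos; lra].
rewrite Rpow_mult_distr; apply Rmult_le_compat_l; [apply pow_le; lra|].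
apply Rle_pow; [lra|unfold k; lia].
Qed.
Lemma nz_opp j : - nz j = RtoC (- (INR j + 1)). Proof. rewrite nzE, RtoC_opp; auto. Qed.

Lemma row_bd : exists K, (0 <= K)%R /\ forall N i, (Cmod (row z N i) <= K * / (INR i + 1) ^ 2)%R.
Proof.
destruct rsum_inv2 as [M HM]; pose proof ka_pos as k0; exists (/ ka ^ k * (1 + 2 * M))%R.
assert (M0 : (0 <= M)%R) by exact (HM O).
assert (K0 : (0 < / ka ^ k)%R) by (apply Rinv_0_lt_compat, pow_lt; auto).
split; [apply Rmult_le_pos; lra|]; intros N i; unfold row.
assert (I0 : (0 < / (INR i + 1) ^ 2)%R) by (apply Rinv_0_lt_compat, pow_lt; pose proof (pos_INR i); lra).
eapply Rle_trans; [apply Cmod_triangle|].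
replace (/ ka ^ k * (1 + 2 * M) * / (INR i + 1) ^ 2)%R with
  (/ ka ^ k * / (INR i + 1) ^ 2 + 2 * (/ ka ^ k * / (INR i + 1) ^ 2) * M)%R by ring.
apply Rplus_le_compat; [apply axis_bd|].
eapply Rle_trans; [apply Cmod_csum|].
apply Rle_trans with (rsum N (fun j => 2 * (/ ka ^ k * / (INR i + 1) ^ 2) * / (INR j + 1) ^ 2)%R).
  apply rsum_le; intros j _; eapply Rle_trans; [apply Cmod_triangle|].
  pose proof (pos_INR j).
  assert (A := row_term_bd i j (INR j + 1) ltac:(apply Rabs_right; lra)).
  assert (B := row_term_bd i j (- (INR j + 1)) ltac:(rewrite Rabs_Ropp; apply Rabs_right; lra)).
  rewrite <- nz_opp in B; rewrite <- nzE in A; unfold Cminus; lra.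
rewrite rsum_scal; apply Rmult_le_compat_l; auto; nra.
Qed.

Lemma row_lim i : Cv (fun N => row z N i) (/ Cs * hev l (pf (ex z ^ S i))).
Proof.
set (w := nz i * z); pose proof ka_pos as k0; pose proof (pos_INR i) as i0.
assert (ew : ex w = ex z ^ S i) by (unfold w, nz; apply ex_mulnat).
assert (yw : (0 < snd w)%R).
  unfold w; rewrite nzE; simpl; assert (0 < (INR i + 1) * snd z)%R by (apply Rmult_lt_0_compat; lra); lra.
assert (Sp : sep (ka / 2) w).
  intros j; pose proof (pos_INR j).
  destruct (term_ge i (INR j)) as [A1 A2]; rewrite Rabs_right in A2 by lra; fold w in A1, A2.
  destruct (term_ge i (- (INR j + 1))) as [_ B]; rewrite Rabs_Ropp, Rabs_right in B by lra; fold w in B.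
  split; [nra|].
  replace (w - 1 - RtoC (INR j)) with (w + RtoC (- (INR j + 1))) by (rewrite RtoC_opp, RtoC_plus; ring).
  nra.
assert (w1 : ex w <> 1).
  intros E; apply (f_equal Cmod) in E; rewrite Cmod_ex, Cmod_1, <- exp_0 in E; apply exp_inv in E.
  pose proof PI_RGT_0; assert (0 < PI * snd w)%R by (apply Rmult_lt_0_compat; auto); lra.
pose proof (lipschitz l ltac:(lia) Hdup w (ka / 2) ltac:(lra) Sp w1 ltac:(lra)) as H.
cbv zeta beta in H; rewrite ew in H; fold k Cs in H.
(* The Lipschitz sums pair w + j with w - 1 - j, the row pairs w + (j+1) with w - (j+1). Their
   partial sums differ by the boundary term at w + N. *)
assert (T : Cv (fun N => / (w + RtoC (INR N)) ^ k) 0).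
  apply (Cv_0 _ (fun N => / (ka / 2) ^ k * / INR (S N))%R).
  - intros N; destruct (Sp N) as [A _]; pose proof (pos_INR N).
    assert (n0 : w + RtoC (INR N) <> 0) by (intros E; rewrite E, Cmod_0 in A; nra).
    rewrite Cmod_inv by (apply Cpow_nz; auto); rewrite Cmod_pow, S_INR, <- Rinv_mult.
    apply Rinv_le_contravar; [apply Rmult_lt_0_compat; [apply pow_lt|]; lra|].
    apply Rle_trans with ((ka / 2 * (INR N + 1)) ^ k)%R; [|apply pow_incr; split; auto; apply Rmult_le_pos; lra].
    rewrite Rpow_mult_distr; apply Rmult_le_compat_l; [apply pow_le; lra|].
    rewrite <- (pow_1 (INR N + 1)) at 1; apply Rle_pow; [lra|unfold k; lia].
  - evar_last; [apply (is_lim_seq_scal_l (fun N => / INR (S N))%R (/ (ka / 2) ^ k) 0)|simpl; f_equal; ring].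
    apply (is_lim_seq_incr_1 (fun n => / INR n)%R), (is_lim_seq_inv INR p_infty); [apply is_lim_seq_INR|discriminate].
assert (H2 := Cv_plus _ _ _ _ (Cv_scal (/ Cs) _ _ H) T).
rewrite Cplus_0_r in H2; eapply Cv_ext; [|apply H2].
intros N; cbv beta; unfold row; fold w; rewrite <- csum_scal.
assert (E : forall m, csum m (fun i0 => / Cs * (Cs * (/ (w + RtoC (INR i0)) ^ k + / (w - 1 - RtoC (INR i0)) ^ k))) +
   / (w + RtoC (INR m)) ^ k = / w ^ k + csum m (fun j => / (w + nz j) ^ k + / (w - nz j) ^ k)).
  assert (n1 : forall j, w + RtoC (INR j) <> 0).
    intros j E; destruct (Sp j) as [A _]; rewrite E, Cmod_0 in A; pose proof (pos_INR j); nra.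
  assert (n2 : forall j, w - 1 - RtoC (INR j) <> 0).
    intros j E; destruct (Sp j) as [_ A]; rewrite E, Cmod_0 in A; pose proof (pos_INR j); nra.
  intros m; induction m as [|m IH].
    cbn [csum INR]; rewrite Cplus_0_r; ring.
  cbn [csum]; rewrite Cplus_assoc, <- IH.
  replace (w - nz m) with (w - 1 - RtoC (INR m)) by (rewrite nzE, RtoC_plus; ring).
  change (RtoC (INR (S m))) with (nz m).
  assert (m1 : w + nz m <> 0) by apply n1.
  field; repeat split; auto; apply Cpow_nz; auto.
apply E.
Qed.

Lemma box_lim Z : Cv (fun n => csum n (fun i => / nz i ^ k)) Z -> exists L,
  Cv (fun M => csum M (fun m => RtoC (sg (k - 1) m) * ex z ^ m)) L /\ Cv (box z) (Z + / Cs * L).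
Proof.
intros HZ.
assert (q1 : (Cmod (ex z) < 1)%R).
  rewrite Cmod_ex, <- exp_0; apply exp_increasing; pose proof PI_RGT_0.
  assert (0 < PI * snd z)%R by (apply Rmult_lt_0_compat; auto); lra.
destruct (lambert (k - 1) (ex z) ltac:(unfold k; lia) q1 (fun x => hev l (pf x)) Hser) as [L [H1 H2]].
exists L; split; auto; apply Cv_plus; auto.
destruct row_bd as [K [K0 HK]]; destruct rsum_inv2 as [M HM].
destruct (tannery (fun N i => row z N i) (fun i => / Cs * hev l (pf (ex z ^ S i)))
  (fun i => K * / (INR i + 1) ^ 2)%R (K * M)%R (fun N => N) O) as [L' [A B]].
- intros n; rewrite rsum_scal; apply Rmult_le_compat_l; auto.
- intros m j _ _; apply HK.
- apply row_lim.
- intros J; exists J; auto.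
- assert (E : L' = / Cs * L).
    apply (Cv_unique _ _ _ B); eapply Cv_ext; [|apply (Cv_scal (/ Cs) _ _ H2)].
    intros n; cbv beta; rewrite csum_scal; auto.
  rewrite <- E; exact A.
Qed.
End Point.

(** As c(-1/z) + d = (dz - c)/z, the substitution permutes the square |c|, |d| <= N by (c, d) -> (d,
    -c) up to sign, and k is even. Summing over squares makes the transformation exact for each N,
    before any limit. *)
Lemma box_inv (z z' : C) N : z <> 0 -> (forall i (b : R), nz i * z + RtoC b <> 0) -> z' = - / z ->
  box z' N = z ^ k * box z N.
Proof.
intros z0 Hz ->; unfold box.
assert (R : forall w, csum N (row w N) = csum N (fun i => / (nz i * w) ^ k) +
   csum N (fun i => csum N (fun j => / (nz i * w + nz j) ^ k + / (nz i * w - nz j) ^ k))).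
  intros w; rewrite <- csum_plus; auto.
rewrite !R, !Cmult_plus_distr_l, <- !csum_scal.
replace (csum N (fun i => / (nz i * - / z) ^ k)) with (csum N (fun i => z ^ k * / nz i ^ k)).
  replace (csum N (fun i => z ^ k * / (nz i * z) ^ k)) with (csum N (fun i => / nz i ^ k)).
    rewrite !Cplus_assoc; f_equal; [ring|].
    rewrite csum_exchange; apply csum_ext; intros i _; rewrite <- csum_scal; apply csum_ext; intros j _.
    assert (n1 : nz i * z + nz j <> 0) by (rewrite (nzE j); apply Hz).
    assert (n2 : nz i * z - nz j <> 0) by (unfold Cminus; rewrite nz_opp; apply Hz).
    replace (nz j * - / z + nz i) with ((nz i * z - nz j) * / z) by (field; auto).
    replace (nz j * - / z - nz i) with (- (nz i * z + nz j) * / z) by (field; auto).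
    rewrite !Cpow_mult_l, pow_k_neg, Cpow_inv by auto; field; repeat split; apply Cpow_nz; auto.
  apply csum_ext; intros i _; rewrite Cpow_mult_l; field; split; apply Cpow_nz; auto; apply nz0.
apply csum_ext; intros i _; replace (nz i * - / z) with (- (nz i * / z)) by ring.
rewrite pow_k_neg, Cpow_mult_l, Cpow_inv by auto; field; split; apply Cpow_nz; auto; apply nz0.
Qed.

(** By [zeta_val], e is [Cs] times the zeta value: the constant term of the Eisenstein series
    normalized to have divisor sums as its other coefficients. *)
Lemma eisenstein (e z z' : C) : (0 < snd z)%R -> (0 < snd z')%R -> z' = - / z ->
  e * (2 * (2 ^ k - 1)) = hev l (- / 4) -> exists L L',
  Cv (fun M => csum M (fun m => RtoC (sg (k - 1) m) * ex z ^ m)) L /\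
  Cv (fun M => csum M (fun m => RtoC (sg (k - 1) m) * ex z' ^ m)) L' /\
  e + L' = z ^ k * (e + L).
Proof.
intros y0 y0' Ez He; destruct zeta_ex as [Z HZ]; pose proof (zeta_val Z HZ) as Ze.
destruct (box_lim z y0 Z HZ) as [L [A B]]; destruct (box_lim z' y0' Z HZ) as [L' [A' B']].
exists L, L'; repeat split; auto.
assert (z0 : z <> 0) by (intros E; rewrite E in y0; simpl in y0; lra).
assert (E : Z + / Cs * L' = z ^ k * (Z + / Cs * L)).
  apply (Cv_unique _ _ _ B'); eapply Cv_ext; [|apply (Cv_scal (z ^ k) _ _ B)].
  intros N; symmetry; apply box_inv; auto; intros i b; apply term_nz; auto.
assert (eE : e = Cs * Z).
  assert (p2 : 2 * (2 ^ k - 1) <> 0).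
    rewrite <- RtoC_pow, <- RtoC_minus, <- RtoC_mult; apply RtoC_neq0.
    assert (1 < 2 ^ k)%R by (apply Rlt_pow_R1; [lra|unfold k; lia]); lra.
  transitivity (e * (2 * (2 ^ k - 1)) * / (2 * (2 ^ k - 1))); [field|rewrite He, <- Ze; field]; auto;
    intros E'; apply p2; rewrite E'; ring.
transitivity (Cs * (Z + / Cs * L')); [rewrite eE; field; auto|].
rewrite E, eE; field; auto.
Qed.
End Lattice.

(** With r = t^2, a factor n t^n is at most 1 + t + t^2 + ... = 1/(1-t), and i drops by one. *)
Lemma pow_geom_lim i : forall r, (0 <= r < 1)%R -> is_lim_seq (fun n => INR n ^ i * r ^ n)%R 0.
Proof.
induction i as [|i IH]; intros r [r0 r1].
  apply (is_lim_seq_ext (fun n => r ^ n)%R); [intros n; simpl; ring|].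
  apply is_lim_seq_geom; rewrite Rabs_right; lra.
set (t := sqrt r).
assert (t0 : (0 <= t)%R) by apply sqrt_pos.
assert (tt : (t * t = r)%R) by (apply sqrt_sqrt; auto).
assert (t1 : (t < 1)%R) by nra.
assert (B : forall n, (INR n * t ^ n <= / (1 - t))%R).
  intros n; apply Rle_trans with (2 := geom_bd t (conj t0 t1) n).
  assert (G : forall m, (m <= n)%nat -> (INR m * t ^ n <= rsum m (fun i => t ^ i))%R).
    induction m as [|m IHm]; intros mn; [cbn [rsum INR]; lra|].
    cbn [rsum]; rewrite S_INR; specialize (IHm ltac:(lia)).
    assert (t ^ n <= t ^ m)%R; [|lra].
    replace n with (m + (n - m))%nat by lia; rewrite pow_add.
    assert (0 <= t ^ m)%R by (apply pow_le; auto).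
    assert (t ^ (n - m) <= 1)%R by (rewrite <- (pow1 (n - m)); apply pow_incr; lra).
    nra.
  apply G; auto.
apply (is_lim_seq_le_le (fun _ => 0%R) _ (fun n => / (1 - t) * (INR n ^ i * t ^ n))%R).
- intros n; pose proof (pos_INR n); split.
    apply Rmult_le_pos; apply pow_le; auto.
  replace (INR n ^ S i * r ^ n)%R with ((INR n * t ^ n) * (INR n ^ i * t ^ n))%R.
    apply Rmult_le_compat_r; auto; apply Rmult_le_pos; apply pow_le; auto.
  rewrite <- tt, Rpow_mult_distr; simpl; ring.
- apply is_lim_seq_const.
- evar_last; [apply (is_lim_seq_scal_l _ (/ (1 - t)) 0), IH; lra|simpl; f_equal; ring].
Qed.
Lemma pow_geom_Cv i (x : C) : (Cmod x < 1)%R -> Cv (fun n => RtoC (INR n) ^ i * x ^ n) 0.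
Proof.
intros x1; apply (Cv_0 _ (fun n => INR n ^ i * Cmod x ^ n)%R).
  intros n; rewrite Cmod_mult, !Cmod_pow, Cmod_R, Rabs_right; [lra|apply Rle_ge, pos_INR].
apply pow_geom_lim; pose proof (Cmod_ge_0 x); auto.
Qed.

Lemma one_sub_neq0 (x : C) : (Cmod x < 1)%R -> 1 - x <> 0.
Proof. intros H E; apply Ceq_minus in E; rewrite <- E, Cmod_1 in H; lra. Qed.

(** With p = x/(1-x)^2, sum n^3 x^n = p + 6 p^2 and sum n^5 x^n = p + 30 p^2 + 120 p^3. *)
Definition l4 : list R := [1; 6]%R.
Definition l6 : list R := [1; 30; 120]%R.

(** The remainder is explicit: expanding (n+m)^3 and summing over m gives x^n times a binomial
    combination of powers of n, with the full sums [A1], [A2], [A3] of m^i x^m as coefficients. *)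
Lemma ser4 (x : C) : (Cmod x < 1)%R -> Cv (fun n => csum n (lam 3 x)) (hev l4 (pf x)).
Proof.
intros x1; pose proof (one_sub_neq0 x x1) as n0; pose proof (fun i => pow_geom_Cv i x x1) as P.
pose (A1 := x / (1 - x) ^ 2); pose (A2 := x * (1 + x) / (1 - x) ^ 3).
pose (A3 := x * (1 + 4 * x + x ^ 2) / (1 - x) ^ 4).
assert (E : forall n, csum n (lam 3 x) = A3 + (- / (1 - x) * (RtoC (INR n) ^ 3 * x ^ n) +
   (- (3 * A1) * (RtoC (INR n) ^ 2 * x ^ n) + (- (3 * A2) * (RtoC (INR n) ^ 1 * x ^ n) +
    - A3 * (RtoC (INR n) ^ 0 * x ^ n))))).
  intros n; unfold A1, A2, A3; induction n as [|n IH]; [change (RtoC (INR 0)) with (RtoC 0); cbn [csum Cpow]; field; auto|].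
  cbn [csum]; rewrite IH, S_INR, RtoC_plus, (Cpow_S x n); unfold lam; rewrite RtoC_pow.
  generalize (x ^ n) (RtoC (INR n)); intros X N; field; auto.
eapply Cv_ext; [intros n; symmetry; apply E|].
replace (hev l4 (pf x)) with (A3 + (- / (1 - x) * 0 + (- (3 * A1) * 0 + (- (3 * A2) * 0 + - A3 * 0)))).
  apply Cv_plus; [apply Cv_const|]; repeat apply Cv_plus; apply Cv_scal; auto.
unfold hev, l4, pf, A1, A2, A3; field; auto.
Qed.
Lemma ser6 (x : C) : (Cmod x < 1)%R -> Cv (fun n => csum n (lam 5 x)) (hev l6 (pf x)).
Proof.
intros x1; pose proof (one_sub_neq0 x x1) as n0; pose proof (fun i => pow_geom_Cv i x x1) as P.
pose (A1 := x / (1 - x) ^ 2); pose (A2 := x * (1 + x) / (1 - x) ^ 3).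
pose (A3 := x * (1 + 4 * x + x ^ 2) / (1 - x) ^ 4).
pose (A4 := x * (1 + 11 * x + 11 * x ^ 2 + x ^ 3) / (1 - x) ^ 5).
pose (A5 := x * (1 + 26 * x + 66 * x ^ 2 + 26 * x ^ 3 + x ^ 4) / (1 - x) ^ 6).
assert (E : forall n, csum n (lam 5 x) = A5 + (- / (1 - x) * (RtoC (INR n) ^ 5 * x ^ n) +
   (- (5 * A1) * (RtoC (INR n) ^ 4 * x ^ n) + (- (10 * A2) * (RtoC (INR n) ^ 3 * x ^ n) +
   (- (10 * A3) * (RtoC (INR n) ^ 2 * x ^ n) + (- (5 * A4) * (RtoC (INR n) ^ 1 * x ^ n) +
    - A5 * (RtoC (INR n) ^ 0 * x ^ n))))))).
  intros n; unfold A1, A2, A3, A4, A5; induction n as [|n IH]; [change (RtoC (INR 0)) with (RtoC 0); cbn [csum Cpow]; field; auto|].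
  cbn [csum]; rewrite IH, S_INR, RtoC_plus, (Cpow_S x n); unfold lam; rewrite RtoC_pow.
  generalize (x ^ n) (RtoC (INR n)); intros X N; field; auto.
eapply Cv_ext; [intros n; symmetry; apply E|].
replace (hev l6 (pf x)) with (A5 + (- / (1 - x) * 0 + (- (5 * A1) * 0 + (- (10 * A2) * 0 +
   (- (10 * A3) * 0 + (- (5 * A4) * 0 + - A5 * 0)))))).
  apply Cv_plus; [apply Cv_const|]; repeat apply Cv_plus; apply Cv_scal; auto.
unfold hev, l6, pf, A1, A2, A3, A4, A5; field; auto.
Qed.

Lemma sq_neq1 (x : C) : x ^ 2 <> 1 -> 1 - x <> 0 /\ 1 + x <> 0 /\ 1 - x ^ 2 <> 0.
Proof.
intros H; repeat split; intros E; apply H.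
- apply Ceq_minus in E; rewrite <- E; ring.
- replace x with (- (1 - (1 + x))) by ring; rewrite E; ring.
- apply Ceq_minus in E; auto.
Qed.
Lemma dup4 (x : C) : x ^ 2 <> 1 ->
  2 ^ (2 * length l4) * hev l4 (pf (x ^ 2)) = hev l4 (pf x) + hev l4 (pf (- x)).
Proof.
intros H; destruct (sq_neq1 x H) as [H1 [H2 H3]].
change (2 * length l4)%nat with 4%nat; unfold hev, l4, pf; field; repeat split; auto.
replace (1 - - x) with (1 + x) by ring; auto.
Qed.
Lemma dup6 (x : C) : x ^ 2 <> 1 ->
  2 ^ (2 * length l6) * hev l6 (pf (x ^ 2)) = hev l6 (pf x) + hev l6 (pf (- x)).
Proof.
intros H; destruct (sq_neq1 x H) as [H1 [H2 H3]].
change (2 * length l6)%nat with 6%nat; unfold hev, l6, pf; field; repeat split; auto.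
replace (1 - - x) with (1 + x) by ring; auto.
Qed.
Lemma s0_neq0 : s0 <> 0.
Proof.
apply RtoC_neq0; pose proof PI_RGT_0; assert (0 < PI * PI)%R by nra.
assert (0 < / (4 * (PI * PI)))%R by (apply Rinv_0_lt_compat; lra); lra.
Qed.
Lemma hlim4 : hlim l4 s0 <> 0.
Proof.
replace (hlim l4 s0) with (6 * s0 ^ 2) by (unfold l4; cbn [hlim length Nat.mul Nat.add Cpow]; ring).
intros E; destruct (Cmult_integral _ _ E) as [E'|E']; revert E'; [apply RtoC_neq0; lra|apply Cpow_nz, s0_neq0].
Qed.
Lemma hlim6 : hlim l6 s0 <> 0.
Proof.
replace (hlim l6 s0) with (120 * s0 ^ 3) by (unfold l6; cbn [hlim length Nat.mul Nat.add Cpow]; ring).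
intros E; destruct (Cmult_integral _ _ E) as [E'|E']; revert E'; [apply RtoC_neq0; lra|apply Cpow_nz, s0_neq0].
Qed.

Definition eis_id (k : nat) (kap : R) := forall z z' : C, (0 < snd z)%R -> (0 < snd z')%R -> z' = - / z ->
  exists L L', Cv (fun M => csum M (fun m => RtoC (sg (k - 1) m) * ex z ^ m)) L /\
  Cv (fun M => csum M (fun m => RtoC (sg (k - 1) m) * ex z' ^ m)) L' /\
  1 + RtoC kap * L' = z ^ k * (1 + RtoC kap * L).
Lemma eis_norm k (e : C) (kap : R) z L L' : RtoC kap * e = 1 -> e + L' = z ^ k * (e + L) ->
  1 + RtoC kap * L' = z ^ k * (1 + RtoC kap * L).
Proof.
intros H E; rewrite <- H; transitivity (RtoC kap * (e + L')); [ring|rewrite E; ring].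
Qed.
(** At p = -1/4 the polynomial p + 6 p^2 equals 1/8; divided by 2 (2^4 - 1) = 30 this is 1/240. For
    weight 6 the value -1/4 divided by 126 gives -1/504. *)
Lemma eis4 : eis_id 4 240.
Proof.
intros z z' y0 y0' E.
destruct (eisenstein l4 (le_n 2) dup4 ser4 hlim4 (/ 240) z z' y0 y0' E) as [L [L' [A [B D]]]].
  change (2 * length l4)%nat with 4%nat; unfold hev, l4; field; repeat split; apply RtoC_neq0; lra.
exists L, L'; repeat split; auto; apply (eis_norm _ (/ 240)); auto.
apply Cinv_r, RtoC_neq0; lra.
Qed.
Lemma eis6 : eis_id 6 (-504).
Proof.
intros z z' y0 y0' E.
destruct (eisenstein l6 ltac:(simpl; lia) dup6 ser6 hlim6 (- / 504) z z' y0 y0' E) as [L [L' [A [B D]]]].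
  change (2 * length l6)%nat with 6%nat; unfold hev, l6; field; repeat split; apply RtoC_neq0; lra.
exists L, L'; repeat split; auto; apply (eis_norm _ (- / 504)); auto.
field; apply RtoC_neq0; lra.
Qed.

(** * Modularity of power series in exp(2 i pi z) *)

Definition qs (a : nat -> R) (z w : C) : Prop :=
  infinite_sum (fun n => Rmult (Rmult (a n) (exp (Ropp (Rmult (Rmult (INR 2 * PI) (INR n)) (snd z)))))
    (cos (Rmult (Rmult (INR 2 * PI) (INR n)) (fst z)))) (fst w) /\
  infinite_sum (fun n => Rmult (Rmult (a n) (exp (Ropp (Rmult (Rmult (INR 2 * PI) (INR n)) (snd z)))))
    (sin (Rmult (Rmult (INR 2 * PI) (INR n)) (fst z)))) (snd w).

Definition qpart (a : nat -> R) (z : C) (n : nat) : C := csum n (fun m => RtoC (a m) * ex z ^ m).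

Lemma qs_Cv a z w : qs a z w <-> Cv (qpart a z) w.
Proof.
assert (T : forall m, RtoC (a m) * ex z ^ m =
  (Rmult (Rmult (a m) (exp (Ropp (Rmult (Rmult (INR 2 * PI) (INR m)) (snd z)))))
    (cos (Rmult (Rmult (INR 2 * PI) (INR m)) (fst z))),
   Rmult (Rmult (a m) (exp (Ropp (Rmult (Rmult (INR 2 * PI) (INR m)) (snd z)))))
    (sin (Rmult (Rmult (INR 2 * PI) (INR m)) (fst z))))).
  intros m; rewrite <- ex_mulnat; destruct z as [x y]; unfold ex, Cmult, RtoC; cbn [fst snd].
  replace (2 * PI * (INR m * y + 0 * x))%R with (INR 2 * PI * INR m * y)%R by (simpl; ring).
  replace (2 * PI * (INR m * x - 0 * y))%R with (INR 2 * PI * INR m * x)%R by (simpl; ring).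
  f_equal; ring.
assert (F : forall n, fst (qpart a z (S n)) = sum_f_R0 (fun n => Rmult (Rmult (a n) (exp (Ropp (Rmult (Rmult (INR 2 * PI) (INR n)) (snd z)))))
    (cos (Rmult (Rmult (INR 2 * PI) (INR n)) (fst z)))) n /\
  snd (qpart a z (S n)) = sum_f_R0 (fun n => Rmult (Rmult (a n) (exp (Ropp (Rmult (Rmult (INR 2 * PI) (INR n)) (snd z)))))
    (sin (Rmult (Rmult (INR 2 * PI) (INR n)) (fst z)))) n).
  induction n as [|n [IH1 IH2]].
    unfold qpart; cbn [csum]; rewrite T; cbn [sum_f_R0 Cplus fst snd RtoC]; split; apply Rplus_0_l.
  unfold qpart in *; set (X := csum (S n) _) in *; cbn [csum]; fold X.
  change (csum n (fun m => RtoC (a m) * ex z ^ m) + RtoC (a n) * ex z ^ n) with X.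
  rewrite T; cbn [sum_f_R0]; rewrite <- IH1, <- IH2; split; reflexivity.
assert (S1 : Cv (qpart a z) w <-> Cv (fun n => qpart a z (S n)) w).
  split; intros H.
    apply (Cv_sub S (qpart a z)); auto; intros J; exists J; intros; lia.
  intros e e0; destruct (H e e0) as [N HN]; exists (S N); intros [|n] nN; [lia|]; apply HN; lia.
rewrite S1, Cv_Un; split; intros [H1 H2]; split; intros e e0;
  [destruct (H1 e e0) as [N HN]|destruct (H2 e e0) as [N HN]|destruct (H1 e e0) as [N HN]|destruct (H2 e e0) as [N HN]];
  exists N; intros n nN; specialize (HN n nN); destruct (F n) as [F1 F2];
  [rewrite F1|rewrite F2|rewrite <- F1|rewrite <- F2]; exact HN.
Qed.

Definition modular (b : nat) (a : nat -> R) : Prop :=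
  (forall z : C, (0 < snd z)%R -> exists w, Cv (qpart a z) w) /\
  (forall z w w' : C, (0 < snd z)%R -> Cv (qpart a z) w -> Cv (qpart a (- / z)) w' -> w' = z ^ b * w).

Lemma im_moinv (z : C) : (0 < snd z)%R -> (0 < snd (- / z)%C)%R.
Proof.
destruct z as [x y]; intros y0; unfold Copp, Cinv; cbn [fst snd] in *.
replace (- (- y / (x ^ 2 + y ^ 2)))%R with (y / (x ^ 2 + y ^ 2))%R by (field; nra).
apply Rdiv_lt_0_compat; nra.
Qed.

Lemma Cmod_ex_lt1 (z : C) : (0 < snd z)%R -> (Cmod (ex z) < 1)%R.
Proof.
intros y0; rewrite Cmod_ex, <- exp_0; apply exp_increasing; pose proof PI_RGT_0.
assert (0 < PI * snd z)%R by (apply Rmult_lt_0_compat; auto); lra.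
Qed.

(** Convergence at half the imaginary part bounds the terms there. The modulus of exp(2 i pi z) is
    the square of the one at that point, so at z the terms decay geometrically. *)
Lemma abs_conv (a : nat -> R) : (forall z : C, (0 < snd z)%R -> exists w, Cv (qpart a z) w) ->
  forall z : C, (0 < snd z)%R -> exists K, forall n, (rsum n (fun m => Cmod (RtoC (a m) * ex z ^ m)) <= K)%R.
Proof.
intros H z y0; set (z2 := (0, snd z / 2)%R : C).
assert (y2 : (0 < snd z2)%R) by (simpl; lra).
destruct (H z2 y2) as [w Hw]; destruct (Hw 1%R ltac:(lra)) as [N HN].
set (r := Cmod (ex z2)).
assert (r0 : (0 <= r)%R) by apply Cmod_ge_0; assert (r1 : (r < 1)%R) by (apply Cmod_ex_lt1; auto).
assert (rr : (Cmod (ex z) = r * r)%R).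
  unfold r; rewrite !Cmod_ex, <- exp_plus; f_equal; simpl; field.
assert (tb : forall m, (N <= m)%nat -> (Cmod (RtoC (a m)) * r ^ m <= 2)%R).
  intros m mN; unfold r; rewrite <- Cmod_pow, <- Cmod_mult.
  replace (RtoC (a m) * ex z2 ^ m) with ((qpart a z2 (S m) - w) - (qpart a z2 m - w)) by (unfold qpart; cbn [csum]; ring).
  eapply Rle_trans; [apply Cmod_triangle|]; rewrite Cmod_opp.
  pose proof (HN m mN); pose proof (HN (S m) ltac:(lia)); lra.
exists (rsum N (fun m => Cmod (RtoC (a m) * ex z ^ m)) + 2 * / (1 - r))%R; intros n.
apply Rle_trans with (rsum (N + n) (fun m => Cmod (RtoC (a m) * ex z ^ m))).
  apply rsum_mono; [intros; apply Cmod_ge_0|lia].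
rewrite rsum_app; apply Rplus_le_compat_l.
apply Rle_trans with (rsum n (fun i => 2 * r ^ i)%R); [|rewrite rsum_scal; apply Rmult_le_compat_l; [lra|apply geom_bd; auto]].
apply rsum_le; intros i _; rewrite Cmod_mult, Cmod_pow, rr, Rpow_mult_distr.
rewrite <- Rmult_assoc; apply Rmult_le_compat; [|apply pow_le; auto|apply tb; lia|].
  apply Rmult_le_pos; [apply Cmod_ge_0|apply pow_le; auto].
rewrite pow_add; rewrite <- (Rmult_1_l (r ^ i)) at 2; apply Rmult_le_compat_r; [apply pow_le; auto|].
rewrite <- (pow1 N); apply pow_incr; lra.
Qed.

Definition conv (a a' : nat -> R) (n : nat) : R := rsum (S n) (fun i => a i * a' (n - i)%nat)%R.

(** The partial sum of a Cauchy product is a triangle of terms; it is written by rows so that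
    [tannery] applies. *)
Lemma conv_finite (a a' : nat -> R) (z : C) M :
  qpart (conv a a') z M = csum M (fun i => RtoC (a i) * ex z ^ i * qpart a' z (M - i)).
Proof.
induction M as [|M IH]; auto; unfold qpart in *; cbn [csum]; rewrite IH.
assert (E : forall i, (i < M)%nat -> RtoC (a i) * ex z ^ i * csum (S M - i) (fun m => RtoC (a' m) * ex z ^ m) =
   RtoC (a i) * ex z ^ i * csum (M - i) (fun m => RtoC (a' m) * ex z ^ m) +
   RtoC (a i * a' (M - i)%nat) * ex z ^ M).
  intros i iM; replace (S M - i)%nat with (S (M - i)) by lia; cbn [csum].
  replace (ex z ^ M) with (ex z ^ i * ex z ^ (M - i)) by (rewrite <- Cpow_add_r; f_equal; lia).
  rewrite RtoC_mult; ring.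
rewrite (csum_ext _ _ _ E), csum_plus, csum_scalr, csum_RtoC.
unfold conv; cbn [rsum]; rewrite RtoC_plus, RtoC_mult, Nat.sub_diag.
replace (S M - M)%nat with 1%nat by lia.
cbn [csum]; ring.
Qed.

Lemma conv_Cv (a a' : nat -> R) (z w w' : C) : (exists K, forall n, (rsum n (fun m => Cmod (RtoC (a m) * ex z ^ m)) <= K)%R) ->
  (exists K, forall n, (rsum n (fun m => Cmod (RtoC (a' m) * ex z ^ m)) <= K)%R) ->
  Cv (qpart a z) w -> Cv (qpart a' z) w' -> Cv (qpart (conv a a') z) (w * w').
Proof.
intros [K HK] [K' HK'] Hw Hw'.
assert (K'0 : (0 <= K')%R) by exact (HK' O).
destruct (tannery (fun M i => RtoC (a i) * ex z ^ i * qpart a' z (M - i)) (fun i => RtoC (a i) * ex z ^ i * w')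
  (fun i => K' * Cmod (RtoC (a i) * ex z ^ i))%R (K' * K)%R (fun M => M) O) as [L [A B]].
- intros n; rewrite rsum_scal; apply Rmult_le_compat_l; auto.
- intros M i _ _; rewrite Cmod_mult, Rmult_comm; apply Rmult_le_compat_r; [apply Cmod_ge_0|].
  eapply Rle_trans; [apply Cmod_csum|apply HK'].
- intros i; apply Cv_scal, (Cv_sub (fun M => M - i)%nat); auto; intros J; exists (J + i)%nat; intros; lia.
- intros J; exists J; auto.
- assert (E : L = w * w').
    apply (Cv_unique _ _ _ B); eapply Cv_ext; [|apply (Cv_mult _ _ _ _ Hw (Cv_const w'))].
    intros n; cbv beta; unfold qpart; rewrite csum_scalr; auto.
  rewrite <- E; eapply Cv_ext; [|apply A]; intros M; rewrite conv_finite; auto.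
Qed.

Lemma modular_mul b b' a a' : modular b a -> modular b' a' -> modular (b + b') (conv a a').
Proof.
intros [H1 H2] [H1' H2'].
assert (P : forall z w w' : C, (0 < snd z)%R -> Cv (qpart a z) w -> Cv (qpart a' z) w' ->
   Cv (qpart (conv a a') z) (w * w')).
  intros z w w' y0; apply conv_Cv; apply abs_conv; auto.
split.
  intros z y0; destruct (H1 z y0) as [w Hw]; destruct (H1' z y0) as [w' Hw']; exists (w * w'); auto.
intros z w w' y0 A B; pose proof (im_moinv z y0) as y0'.
destruct (H1 z y0) as [u Hu]; destruct (H1' z y0) as [u' Hu'].
destruct (H1 _ y0') as [v Hv]; destruct (H1' _ y0') as [v' Hv'].
rewrite (Cv_unique _ _ _ A (P _ _ _ y0 Hu Hu')), (Cv_unique _ _ _ B (P _ _ _ y0' Hv Hv')).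
rewrite (H2 z u v y0 Hu Hv), (H2' z u' v' y0 Hu' Hv'), Cpow_add_r; ring.
Qed.

Lemma modular_const (c : R) (a : nat -> R) : a O = c -> (forall n, a (S n) = 0%R) -> modular 0 a.
Proof.
intros a0 aS.
assert (H : forall z, Cv (qpart a z) (RtoC c)).
  intros z; apply (Cv_ev 1 (fun _ => RtoC c)); [|apply Cv_const].
  intros [|n] n1; [lia|]; clear n1; unfold qpart; rewrite csum_S, a0, (csum_0 n).
    simpl; ring.
  intros i _; rewrite aS; ring.
split; [intros z _; exists (RtoC c); auto|].
intros z w w' _ A B; rewrite (Cv_unique _ _ _ A (H z)), (Cv_unique _ _ _ B (H _)); simpl; ring.
Qed.

Lemma modular_eis k kap (a : nat -> R) : eis_id k kap -> a O = 1%R ->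
  (forall n, a (S n) = (kap * sg (k - 1) (S n))%R) -> modular k a.
Proof.
intros E a0 aS.
assert (Q : forall z L, Cv (fun M => csum M (fun m => RtoC (sg (k - 1) m) * ex z ^ m)) L ->
   Cv (qpart a z) (1 + RtoC kap * L)).
  intros z L H; apply (Cv_ev 1 (fun n => 1 + RtoC kap * csum n (fun m => RtoC (sg (k - 1) m) * ex z ^ m))).
    intros [|n] n1; [lia|]; clear n1; unfold qpart; rewrite !csum_S, a0.
    replace (sg (k - 1) 0) with 0%R by reflexivity.
    rewrite !Cmult_plus_distr_l, <- (csum_scal n (RtoC kap)).
    replace (csum n (fun i => RtoC (a (S i)) * ex z ^ S i)) with
      (csum n (fun i => RtoC kap * (RtoC (sg (k - 1) (S i)) * ex z ^ S i))).
      simpl; ring.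
    apply csum_ext; intros i _; rewrite aS, RtoC_mult; ring.
  apply Cv_plus; [apply Cv_const|apply Cv_scal; auto].
split.
  intros z y0; destruct (E z _ y0 (im_moinv z y0) eq_refl) as [L [_ [A _]]]; eexists; apply Q, A.
intros z w w' y0 A B; destruct (E z _ y0 (im_moinv z y0) eq_refl) as [L [L' [HL [HL' EL]]]].
rewrite (Cv_unique _ _ _ A (Q _ _ HL)), (Cv_unique _ _ _ B (Q _ _ HL')); auto.
Qed.

Lemma moinvE (x y : R) : (0 < y)%R ->
  (Rdiv (Ropp x) (Rplus (Rmult x x) (Rmult y y)), Rdiv y (Rplus (Rmult x x) (Rmult y y))) = - / ((x, y) : C).
Proof.
intros y0; unfold Copp, Cinv; cbn [fst snd]; f_equal; field; nra.
Qed.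

Lemma Rdiv_cross (a b c d : R) : b <> 0%R -> d <> 0%R -> (a * d = c * b)%R -> (a / b = c / d)%R.
Proof.
intros b0 d0 E; apply (Rmult_eq_reg_r (b * d)); [|apply Rmult_integral_contrapositive; auto].
replace (a / b * (b * d))%R with (a * d)%R by (field; auto).
replace (c / d * (b * d))%R with (c * b)%R by (field; auto); auto.
Qed.
Lemma Rdiv_add (a b c d : R) : b <> 0%R -> d <> 0%R -> ((a * d + c * b) / (b * d) = a / b + c / d)%R.
Proof. intros; field; auto. Qed.
Lemma Rdiv_mul (a b c d : R) : b <> 0%R -> d <> 0%R -> (a * c / (b * d) = a / b * (c / d))%R.
Proof. intros; field; auto. Qed.
Lemma Rdiv_one a : (a / 1 = a)%R. Proof. field. Qed.

End Analysis.

From mathcomp Require Import all_boot all_order all_algebra boolp.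
From mathcomp Require Import zify ring lra.
Set Implicit Arguments. Unset Strict Implicit. Unset Printing Implicit Defensive.
Import Order.TTheory GRing.Theory Num.Theory.
Local Open Scope ring_scope.

(** * Formal power series *)

(** A wrapper that makes the Cauchy product the ring multiplication. This product is written as
    [qmul] is, so series identities convert to those of the statement by computation. *)
Record ser (A : Type) := Ser { coef :> nat -> A }.

HB.instance Definition _ A := gen_eqMixin (ser A).
HB.instance Definition _ A := gen_choiceMixin (ser A).

Lemma serP A (f g : ser A) : (forall n, f n = g n) -> f = g.
Proof. by case: f g => f [g] /= /funext ->. Qed.

Section SerRing.
Variable A : comNzRingType.
Implicit Types f g h : ser A.

Definition sadd f g := Ser (fun n => f n + g n).
Definition sopp f := Ser (fun n => - f n).
Definition szero : ser A := Ser (fun _ => 0).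
Definition sone : ser A := Ser (fun n => (n == 0%N)%:R).
Definition smul f g := Ser (fun n => \sum_(i < n.+1) f i * g (n - i)%N).

Lemma saddA : associative sadd. Proof. by move=> f g h; apply: serP => n /=; rewrite addrA. Qed.
Lemma saddC : commutative sadd. Proof. by move=> f g; apply: serP => n /=; rewrite addrC. Qed.
Lemma sadd0 : left_id szero sadd. Proof. by move=> f; apply: serP => n /=; rewrite add0r. Qed.
Lemma saddN : left_inverse szero sopp sadd.
Proof. by move=> f; apply: serP => n /=; rewrite addNr. Qed.
HB.instance Definition _ := GRing.isZmodule.Build (ser A) saddA saddC sadd0 saddN.

Lemma coef_mulmx f g N n : (n <= N)%N ->
  smul f g n = (\poly_(i < N.+1) f i * \poly_(i < N.+1) g i)`_n.
Proof.
move=> nN; rewrite coefM /=; apply: eq_bigr => i _.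
by rewrite !coef_poly !ltnS (leq_trans _ nN) ?(leq_trans (leq_subr _ _) nN) // -ltnS.
Qed.

Lemma coef_poly3 (p q : {poly A}) f N n : (n <= N)%N ->
  (forall i, (i <= N)%N -> p`_i = f i) -> (p * q)`_n = (\poly_(i < N.+1) f i * q)`_n.
Proof.
move=> nN pf; rewrite !coefM; apply: eq_bigr => i _.
have iN : (i <= N)%N by apply: leq_trans nN; rewrite -ltnS.
by rewrite coef_poly ltnS iN pf.
Qed.

Lemma smulC : commutative smul.
Proof. by move=> f g; apply: serP => n; rewrite !(@coef_mulmx _ _ n) // mulrC. Qed.

Lemma smulA : associative smul.
Proof.
move=> f g h; apply: serP => n; rewrite [in LHS]smulC !(@coef_mulmx _ _ n) //.
have E f' g' i : (i <= n)%N ->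
    (\poly_(j < n.+1) f' j * \poly_(j < n.+1) g' j)`_i = smul f' g' i.
  by move=> i_n; rewrite -coef_mulmx.
rewrite -(@coef_poly3 _ _ (smul g h) _ _ (leqnn n) (E g h)).
by rewrite -(@coef_poly3 _ _ (smul f g) _ _ (leqnn n) (E f g)) [in LHS]mulrC mulrA.
Qed.

Lemma smul1 : left_id sone smul.
Proof.
move=> f; apply: serP => n /=.
by rewrite big_ord_recl /= mul1r subn0 big1 ?addr0 // => i _; rewrite mul0r.
Qed.

Lemma smulD : left_distributive smul sadd.
Proof.
move=> f g h; apply: serP => n /=; rewrite -big_split /=.
by apply: eq_bigr => i _; rewrite mulrDl.
Qed.

Lemma sone_neq0 : sone != 0.
Proof. by apply/eqP => /(congr1 (fun f : ser A => f 0%N)) /= /eqP; rewrite oner_eq0. Qed.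

HB.instance Definition _ := GRing.Zmodule_isComNzRing.Build (ser A)
  smulA smulC smul1 smulD sone_neq0.

Lemma serD f g n : (f + g) n = f n + g n. Proof. by []. Qed.
Lemma serN f n : (- f) n = - f n. Proof. by []. Qed.
Lemma serB f g n : (f - g) n = f n - g n. Proof. by []. Qed.
Lemma ser0 n : (0 : ser A) n = 0. Proof. by []. Qed.
Lemma ser1 n : (1 : ser A) n = (n == 0%N)%:R. Proof. by []. Qed.
Lemma serM f g n : (f * g) n = \sum_(i < n.+1) f i * g (n - i)%N. Proof. by []. Qed.
Lemma ser_sum I (r : seq I) (P : pred I) (F : I -> ser A) n :
  (\sum_(i <- r | P i) F i) n = \sum_(i <- r | P i) F i n.
Proof. by apply: (big_morph (fun f : ser A => f n)). Qed.
Lemma serMn f k n : (f *+ k) n = f n *+ k.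
Proof. by elim: k => [|k IH]; rewrite ?mulr0n // !mulrS serD IH. Qed.

Definition mono (c : A) (d : nat) : ser A := Ser (fun n => if n == d then c else 0).

Lemma mono_mul c d f n : (mono c d * f) n = if (d <= n)%N then c * f (n - d)%N else 0.
Proof.
rewrite serM; case: leqP => dn.
  rewrite (bigD1 (inord d)) //= inordK ?ltnS // eqxx big1 ?addr0 // => i ne.
  case: eqP => [E|]; last by rewrite mul0r.
  by case/eqP: ne; apply: val_inj; rewrite /= inordK ?ltnS.
rewrite big1 // => i _ /=; case: eqP => [E|]; last by rewrite mul0r.
by have := ltn_ord i; rewrite E ltnS leqNgt dn.
Qed.

Lemma monoM c d c' d' : mono c d * mono c' d' = mono (c * c') (d + d').
Proof.
apply: serP => n; rewrite mono_mul /=; case: leqP => dn.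
  by rewrite -{2}(subnKC dn) eqn_add2l; case: eqP => // _; rewrite mulr0.
by case: eqP => // E; move: dn; rewrite E ltnNge leq_addr.
Qed.
Lemma mono1 : mono 1 0 = 1. Proof. by apply: serP => n /=; case: eqP. Qed.
Lemma mono0 d : mono 0 d = 0. Proof. by apply: serP => n /=; case: eqP. Qed.
Lemma monoX c d k : mono c d ^+ k = mono (c ^+ k) (k * d).
Proof. by elim: k => [|k IH]; rewrite ?expr0 ?mono1 // !exprS IH monoM mulSn. Qed.
Lemma monoE c d n : mono c d n = if n == d then c else 0. Proof. by []. Qed.

Definition eqm (N : nat) f g := forall n, (n < N)%N -> f n = g n.

Lemma eqm_sym N f g : eqm N f g -> eqm N g f. Proof. by move=> H n /H. Qed.
Lemma eqm_trans N f g h : eqm N f g -> eqm N g h -> eqm N f h.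
Proof. by move=> H H' n nN; rewrite H ?H'. Qed.
Lemma eqmD N f f' g g' : eqm N f f' -> eqm N g g' -> eqm N (f + g) (f' + g').
Proof. by move=> H H' n nN; rewrite !serD H ?H'. Qed.
Lemma eqmN N f f' : eqm N f f' -> eqm N (- f) (- f').
Proof. by move=> H n nN; rewrite !serN H. Qed.
Lemma eqmB N f f' g g' : eqm N f f' -> eqm N g g' -> eqm N (f - g) (f' - g').
Proof. by move=> H H'; apply: eqmD => //; apply: eqmN. Qed.
Lemma eqmM N f f' g g' : eqm N f f' -> eqm N g g' -> eqm N (f * g) (f' * g').
Proof.
move=> H H' n nN; rewrite !serM; apply: eq_bigr => i _.
have iN : (i < N)%N by apply: leq_ltn_trans nN; rewrite -ltnS.
by rewrite H // H' // (leq_ltn_trans (leq_subr _ _) nN).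
Qed.
Lemma eqmMl N f g g' : eqm N g g' -> eqm N (f * g) (f * g').
Proof. by apply: eqmM. Qed.
Lemma eqmMr N f g g' : eqm N g g' -> eqm N (g * f) (g' * f).
Proof. by move=> H; apply: eqmM. Qed.
Lemma eqm_le N M f g : (N <= M)%N -> eqm M f g -> eqm N f g.
Proof. by move=> NM H n nN; apply: H; apply: leq_trans NM. Qed.
Lemma eqm_prod N I (r : seq I) (P : pred I) (F G : I -> ser A) :
  (forall i, P i -> eqm N (F i) (G i)) ->
  eqm N (\prod_(i <- r | P i) F i) (\prod_(i <- r | P i) G i).
Proof. by move=> H; elim/big_rec2: _ => // i x y Pi; apply: eqmM; apply: H. Qed.
Lemma eqmP f g : (forall N, eqm N f g) -> f = g.
Proof. by move=> H; apply: serP => n; apply: (H n.+1). Qed.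
Lemma eqm_mul0 N M f g : eqm N f 0 -> eqm M g 0 -> eqm (N + M) (f * g) 0.
Proof.
move=> H H' n nN; rewrite serM big1 // => i _.
case: (ltnP i N) => iN; first by rewrite H // ser0 mul0r.
by rewrite H' ?ser0 ?mulr0 //; have := ltn_ord i; lia.
Qed.
Lemma eqm_exp0 f k : eqm 1 f 0 -> eqm k (f ^+ k) 0.
Proof. by move=> H; elim: k => // k IH; rewrite exprS -add1n; apply: eqm_mul0. Qed.
Lemma eqm_mono c d N : (N <= d)%N -> eqm N (mono c d) 0.
Proof. by move=> Nd n nN; rewrite monoE ltn_eqF // (leq_trans nN). Qed.

Lemma eqm_prod1 N M (u : nat -> ser A) : (N <= M)%N ->
  (forall m, (N <= m)%N -> eqm N (u m) 1) ->
  eqm N (\prod_(m < M) u m) (\prod_(m < N) u m).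
Proof.
move=> NM H; rewrite -(subnKC NM) big_split_ord /= -[X in eqm _ _ X]mulr1.
apply: eqmM => //; elim/big_rec: _ => // i x _ IH.
by rewrite -[1]mulr1; apply: eqmM => //; apply: H; rewrite leq_addr.
Qed.
Lemma eqm_sum0 N M (u : nat -> ser A) : (N <= M)%N ->
  (forall m, (N <= m)%N -> eqm N (u m) 0) ->
  eqm N (\sum_(m < M) u m) (\sum_(m < N) u m).
Proof.
move=> NM H; rewrite -(subnKC NM) big_split_ord /= -[X in eqm _ _ X]addr0.
apply: eqmD => //; elim/big_rec: _ => // i x _ IH.
by rewrite -[0]addr0; apply: eqmD => //; apply: H; rewrite leq_addr.
Qed.

(** Each coefficient is read from finitely many factors. This is the infinite product as soon as
    factor m equals 1 up to degree m, see [iprod_eqm]. *)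
Definition iprod (u : nat -> ser A) : ser A := Ser (fun n => (\prod_(m < n.+1) u m) n).
Definition isum (u : nat -> ser A) : ser A := Ser (fun n => (\sum_(m < n.+1) u m) n).

Lemma iprod_eqm u N : (forall m, eqm m.+1 (u m) 1) -> eqm N (iprod u) (\prod_(m < N) u m).
Proof.
move=> H n nN /=; rewrite (@eqm_prod1 n.+1 N u) // => m nm.
by apply: eqm_le (H m); apply: leqW.
Qed.
Lemma isum_eqm u N : (forall m, eqm m (u m) 0) -> eqm N (isum u) (\sum_(m < N) u m).
Proof.
move=> H n nN /=; rewrite (@eqm_sum0 n.+1 N u) // => m nm.
by apply: eqm_le (H m).
Qed.

Lemma ser_lreg f g : (forall x, f 0%N * x = 0 -> x = 0) -> f * g = 0 -> g = 0.
Proof.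
move=> f0 fg; apply: serP => n; elim/ltn_ind: n => n IH; apply: f0.
have : (f * g) n = 0 by rewrite fg.
rewrite serM big_ord_recl subn0.
rewrite [X in _ + X]big1 ?addr0 // => i _ /=.
by rewrite IH ?ser0 ?mulr0 // /bump /=; have := ltn_ord i; lia.
Qed.
Lemma ser_lreg1 f g : f 0%N = 1 -> f * g = 0 -> g = 0.
Proof. by move=> f0; apply: ser_lreg => x; rewrite f0 mul1r. Qed.
Lemma ser_cancel f g h : f 0%N = 1 -> f * g = f * h -> g = h.
Proof.
move=> f0 /eqP; rewrite -subr_eq0 -mulrBr => /eqP /(ser_lreg1 f0) /eqP.
by rewrite subr_eq0 => /eqP.
Qed.

Lemma ser_inv f : f 0%N = 1 -> exists g, f * g = 1.
Proof.
move=> f0; pose t := 1 - f.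
have t0 : eqm 1 t 0 by move=> [|//] _; rewrite serB f0 ser1 subrr.
have tk m : eqm m (t ^+ m) 0 by apply: eqm_exp0.
exists (isum (fun k => t ^+ k)); apply: eqmP => N.
apply: (eqm_trans (eqmMl f (@isum_eqm (fun k => t ^+ k) N tk))).
have -> : f = 1 - t by rewrite /t opprB addrC subrK.
rewrite -opprB mulNr -subrX1 opprB -[X in eqm _ _ X]subr0.
by apply: eqmB => //; apply: tk.
Qed.

(** The series c t^d/(1 - c t^d) in the series variable t, without constant term: the shape of the
    logarithmic derivative of 1 - c t^d. *)
Definition geo (c : A) (d : nat) : ser A :=
  Ser (fun n => if (d %| n)%N && (0 < n)%N then c ^+ (n %/ d)%N else 0).

Lemma geoE c d : (0 < d)%N -> (1 - mono c d) * geo c d = mono c d.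
Proof.
move=> d0; apply: serP => n; rewrite mulrBl mul1r serB mono_mul monoE /=.
have [dn|nd] := leqP d n; last first.
  rewrite ltn_eqF //; case: ifP => [/andP[/dvdnP[k nE] n0]|]; last by rewrite subr0.
  by move: nd n0; rewrite nE; case: k {nE} => // k; rewrite mulSn ltnNge leq_addr.
rewrite (leq_trans d0 dn) andbT subn_gt0 dvdn_subl //.
have [->|nd] := eqVneq n d.
  by rewrite dvdnn ltnn mulr0 subr0 divnn d0 expr1.
rewrite ltn_neqAle eq_sym nd dn andbT; case: ifP => dvd; last by rewrite mulr0 subrr.
by rewrite -{1}(subnK dn) divnDr // divnn d0 addn1 exprS subrr.
Qed.

End SerRing.

Section MapSer.
Variables (A A' : comNzRingType) (phi : {rmorphism A -> A'}).
Definition mapser (f : ser A) : ser A' := Ser (fun n => phi (f n)).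
Lemma mapser_is_zmod : zmod_morphism mapser.
Proof. by move=> f g; apply: serP => n /=; rewrite rmorphB. Qed.
Lemma mapser_is_monoid : monoid_morphism mapser.
Proof.
split; first by apply: serP => n /=; rewrite rmorph_nat.
move=> f g; apply: serP => n; rewrite /= rmorph_sum.
by apply: eq_bigr => i _; rewrite rmorphM.
Qed.
HB.instance Definition _ := GRing.isZmodMorphism.Build _ _ mapser mapser_is_zmod.
HB.instance Definition _ := GRing.isMonoidMorphism.Build _ _ mapser mapser_is_monoid.
End MapSer.

(** * Derivations and logarithmic derivatives *)

Section Derivations.
Variable R : comNzRingType.

Definition derivation (D : R -> R) :=
  (forall x y, D (x + y) = D x + D y) /\ (forall x y, D (x * y) = D x * y + x * D y).

Variable D : R -> R.
Hypothesis DD : derivation D.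
Lemma derD x y : D (x + y) = D x + D y. Proof. exact: DD.1. Qed.
Lemma derM x y : D (x * y) = D x * y + x * D y. Proof. exact: DD.2. Qed.
Lemma der0 : D 0 = 0. Proof. by apply: (addrI (D 0)); rewrite -derD !addr0. Qed.
Lemma derN x : D (- x) = - D x.
Proof. by apply/eqP; rewrite -subr_eq0 opprK -derD addNr der0. Qed.
Lemma derB x y : D (x - y) = D x - D y. Proof. by rewrite derD derN. Qed.
Lemma der1 : D 1 = 0.
Proof. by apply: (addrI (D 1)); rewrite addr0 -{3}[1]mul1r derM mulr1 mul1r. Qed.
Lemma derMn x n : D (x *+ n) = D x *+ n.
Proof. by elim: n => [|n IH]; rewrite ?mulr0n ?der0 // !mulrS derD IH. Qed.
Lemma der_sum I (r : seq I) (P : pred I) (F : I -> R) :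
  D (\sum_(i <- r | P i) F i) = \sum_(i <- r | P i) D (F i).
Proof. by apply: (big_morph D derD der0). Qed.
Lemma der_log_prod N (u e : nat -> R) : (forall m, D (u m) = u m * e m) ->
  D (\prod_(m < N) u m) = \prod_(m < N) u m * \sum_(m < N) e m.
Proof.
move=> H; elim: N => [|N IH]; first by rewrite !big_ord0 der1 mulr0.
by rewrite !big_ord_recr /= derM IH H; ring.
Qed.
Lemma iterDD n x y : iter n D (x + y) = iter n D x + iter n D y.
Proof. by elim: n => //= n ->; rewrite derD. Qed.
Lemma iterDMn n x k : iter n D (x *+ k) = iter n D x *+ k.
Proof. by elim: n => //= n ->; rewrite derMn. Qed.
Lemma iterDM n x y :
  iter n D (x * y) = \sum_(i < n.+1) (iter i D x * iter (n - i) D y) *+ 'C(n, i).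
Proof.
elim: n => [|n IH]; first by rewrite big_ord1 /= mulr1n.
rewrite iterS IH der_sum.
transitivity (\sum_(i < n.+1) ((iter i.+1 D x * iter (n - i) D y) *+ 'C(n, i) +
   (iter i D x * iter (n.+1 - i) D y) *+ 'C(n, i))).
  by apply: eq_bigr => i _; rewrite derMn derM mulrnDl subSn // -ltnS.
rewrite big_split /= [RHS]big_ord_recl /= ?subn0 bin0 mulr1n.
transitivity (x * D (iter n D y) + \sum_(i < n.+1)
   ((iter i.+1 D x * iter (n - i) D y) *+ 'C(n, i.+1) +
    (iter i.+1 D x * iter (n - i) D y) *+ 'C(n, i))); last first.
  by congr (_ + _); apply: eq_bigr => i _; rewrite /bump /= add1n subSS binS mulrnDr.
rewrite big_split /= addrA addrC; congr (_ + _).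
rewrite big_ord_recl /= ?subn0 bin0 mulr1n [X in _ = _ + X]big_ord_recr /=.
rewrite bin_small // mulr0n addr0; congr (_ + _).
Qed.
End Derivations.

Section DerSer.
Variable A : comNzRingType.
Definition dq (f : ser A) : ser A := Ser (fun n => f n *+ n).
Lemma dqE f n : dq f n = f n *+ n. Proof. by []. Qed.
Lemma dq_der : derivation dq.
Proof.
split=> f g; apply: serP => n; first by rewrite !dqE mulrnDl.
rewrite serD dqE !serM -sumrMnl -big_split; apply: eq_bigr => i _.
by rewrite /= mulrnAl mulrnAr -mulrnDr subnKC // -ltnS.
Qed.
Definition lift (D : A -> A) (f : ser A) : ser A := Ser (fun n => D (f n)).
Lemma liftE D f n : lift D f n = D (f n). Proof. by []. Qed.
Lemma lift_der D : derivation D -> derivation (lift D).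
Proof.
move=> DD; split=> f g; apply: serP => n; first by rewrite !liftE (derD DD).
rewrite serD liftE !serM (der_sum DD) -big_split; apply: eq_bigr => i _.
by rewrite (derM DD).
Qed.
Lemma sub_der (D D' : A -> A) : derivation D -> derivation D' -> derivation (fun x => D x - D' x).
Proof.
move=> DD DD'; split=> x y; first by rewrite (derD DD) (derD DD'); ring.
by rewrite (derM DD) (derM DD'); ring.
Qed.
Lemma dq_eqm N (f g : ser A) : eqm N f g -> eqm N (dq f) (dq g).
Proof. by move=> H n nN /=; rewrite H. Qed.
Lemma lift_eqm D N (f g : ser A) : eqm N f g -> eqm N (lift D f) (lift D g).
Proof. by move=> H n nN /=; rewrite H. Qed.
End DerSer.

Lemma derX_der : derivation (fun p : {poly rat} => 'X * p^`()).
Proof. by split=> p r; rewrite ?derivD ?derivM; ring. Qed.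

(* Two-variable series in w = q/z: the coefficient of w^b is a polynomial in z, so that w^b z^a
   stands for q^b z^(a-b). *)
Definition SP := ser {poly rat}.
Definition S1 := ser rat.
Definition SB := ser (ser rat).

(** The operator z d/dz at fixed q: it multiplies w^b z^a by a - b, while [dq], which is q d/dq at
    fixed z, multiplies it by b. *)
Definition dz (f : SP) : SP := lift (fun p => 'X * p^`()) f - dq f.
Definition dzB (f : SB) : SB := lift (@dq _) f - dq f.
Lemma dz_der : derivation dz. Proof. exact: sub_der (lift_der derX_der) (dq_der _). Qed.
Lemma dzB_der : derivation dzB. Proof. exact: sub_der (lift_der (dq_der _)) (dq_der _). Qed.
Lemma dz_eqm N f g : eqm N f g -> eqm N (dz f) (dz g).
Proof. by move=> H; apply: eqmB; [apply: lift_eqm|apply: dq_eqm]. Qed.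

Lemma dz_mono a b : dz (mono 'X^a b) = (mono 'X^a b) *+ a - (mono 'X^a b) *+ b.
Proof.
apply: serP => n; rewrite /dz !serB !serMn /=; case: eqP => [->|_].
  by rewrite derivXn mulrnAr; case: a => [|a]; rewrite ?mulr0n // -exprS.
by rewrite derivC mulr0 !mul0rn.
Qed.
Lemma dq_mono (A : comNzRingType) (c : A) b : dq (mono c b) = (mono c b) *+ b.
Proof. by apply: serP => n; rewrite serMn /=; case: eqP => [->|_] //; rewrite !mul0rn. Qed.

Definition p2s (p : {poly rat}) : ser rat := Ser (fun n => p`_n).
Lemma p2s_zmod : zmod_morphism p2s.
Proof. by move=> p r; apply: serP => n /=; rewrite coefB. Qed.
Lemma p2s_monoid : monoid_morphism p2s.
Proof.
split; first by apply: serP => n /=; rewrite coef1.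
by move=> p r; apply: serP => n; rewrite serM /= coefM.
Qed.
HB.instance Definition _ := GRing.isZmodMorphism.Build _ _ p2s p2s_zmod.
HB.instance Definition _ := GRing.isMonoidMorphism.Build _ _ p2s p2s_monoid.
Lemma p2sX a : p2s 'X^a = mono 1 a.
Proof. by apply: serP => n /=; rewrite coefXn; case: eqP. Qed.

Notation iot := (mapser p2s).
Notation ev1 := (mapser (horner_eval (1 : rat))).

Lemma iot_mono a b : iot (mono 'X^a b) = mono (mono 1 a) b.
Proof. by apply: serP => n /=; case: eqP => _; rewrite ?p2sX ?raddf0. Qed.
Lemma iot_inj : injective iot.
Proof.
move=> f g H; apply: serP => b; apply/polyP => a.
exact: (congr1 (fun h : SB => h b a) H).
Qed.
Lemma iot_dz f : iot (dz f) = dzB (iot f).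
Proof.
apply: serP => b; apply: serP => a; rewrite /= !coefB coefMn coefXM coef_deriv.
by case: a => [|a] /=; rewrite ?mulr0n ?serB ?serMn.
Qed.
Lemma iot_dq f : iot (dq f) = dq (iot f).
Proof. by apply: serP => b; apply: serP => a; rewrite /= serMn coefMn. Qed.
Lemma dzBE f b a : dzB f b a = (a%:R - b%:R) * f b a.
Proof. by rewrite mulrBl !mulr_natl /dzB !serB liftE !dqE serMn. Qed.

(** The exchange of z and w, that is z -> q/z at fixed q. *)
Definition swap (f : SB) : SB := Ser (fun b => Ser (fun a => f a b)).
Lemma swap_zmod : zmod_morphism swap.
Proof. by []. Qed.
Lemma serMM (f g : SB) b a :
  (f * g) b a = \sum_(i < b.+1) \sum_(j < a.+1) f i j * g (b - i)%N (a - j)%N.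
Proof. by rewrite serM ser_sum; apply: eq_bigr => i _; rewrite serM. Qed.
Lemma swap_monoid : monoid_morphism swap.
Proof.
split; first by apply: serP => -[|b]; apply: serP => -[|a].
move=> f g; apply: serP => b; apply: serP => a.
by rewrite serMM [LHS]serMM exchange_big.
Qed.
HB.instance Definition _ := GRing.isZmodMorphism.Build _ _ swap swap_zmod.
HB.instance Definition _ := GRing.isMonoidMorphism.Build _ _ swap swap_monoid.
Lemma swap_mono a b : swap (mono (mono 1 a) b) = mono (mono 1 b) a.
Proof.
apply: serP => n; apply: serP => m.
have [->|/negbTE Em] := eqVneq m b; have [->|/negbTE En] := eqVneq n a;
  by rewrite /= ?eqxx ?Em ?En //= ?eqxx ?Em ?En.
Qed.
Lemma swapP f : swap f = f <-> forall b a, f b a = f a b.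
Proof.
split=> [H b a|H]; first by rewrite -[in LHS]H.
by apply: serP => b; apply: serP => a /=.
Qed.

(** * Reversal of the z-grading *)

Definition revp m (p : {poly rat}) : {poly rat} := \poly_(j < m.+1) p`_(m - j).

Lemma coef_mul_rect (p s : {poly rat}) m n a : (size p <= m.+1)%N -> (size s <= n.+1)%N ->
  (p * s)`_a = \sum_(j < m.+1) \sum_(k < n.+1) p`_j * s`_k * (a == j + k)%N%:R.
Proof.
move=> sp ss; have polyE (r : {poly rat}) d : (size r <= d.+1)%N -> r = \sum_(j < d.+1) r`_j *: 'X^j.
  move=> sr; rewrite -(poly_def d.+1 (fun j => r`_j)); apply/polyP => i.
  rewrite coef_poly; case: ltnP => // di.
  by rewrite nth_default // (leq_trans sr di).
rewrite {1}(polyE _ _ sp) {1}(polyE _ _ ss) mulr_suml coef_sum.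
apply: eq_bigr => j _; rewrite mulr_sumr coef_sum; apply: eq_bigr => k _.
by rewrite -scalerAl -scalerAr scalerA -exprD coefZ coefXn.
Qed.

Lemma size_revp m p : (size (revp m p) <= m.+1)%N.
Proof. exact: size_poly. Qed.
Lemma coef_revp m p j : (j <= m)%N -> (revp m p)`_j = p`_(m - j).
Proof. by move=> jm; rewrite coef_poly ltnS jm. Qed.

Lemma revpM m n (p s : {poly rat}) : (size p <= m.+1)%N -> (size s <= n.+1)%N ->
  revp (m + n) (p * s) = revp m p * revp n s.
Proof.
move=> sp ss; apply/polyP => a.
rewrite (coef_mul_rect _ (size_revp m p) (size_revp n s)) coef_poly.
have ordle d (j : 'I_d.+1) : (j <= d)%N by rewrite -ltnS.
case: ltnP => amn.
  rewrite (coef_mul_rect _ sp ss) (reindex_inj rev_ord_inj) /=.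
  apply: eq_bigr => j _; rewrite (reindex_inj rev_ord_inj) /=.
  apply: eq_bigr => k _; rewrite !subSS !coef_revp //; congr (_ * _%:R).
  by have := ordle _ j; have := ordle _ k; lia.
rewrite big1 // => j _; rewrite big1 // => k _.
have -> : (a == j + k)%N = false by have := ordle _ j; have := ordle _ k; lia.
by rewrite mulr0.
Qed.

(** The substitution z -> 1/z at fixed q, as z has exponent a - b. The size bound says that in q^b
    the exponents of z lie between -b and b; it makes reversal multiplicative. *)
Definition rv (f g : SP) := forall b, (size (f b) <= b.*2.+1)%N /\ g b = revp b.*2 (f b).
Definition pal f := rv f f.

Lemma rvM f f' g g' : rv f f' -> rv g g' -> rv (f * g) (f' * g').
Proof.
move=> H H' b; split.
  rewrite serM; apply: (leq_trans (size_sum _ _ _)); apply/bigmax_leqP => i _.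
  apply: (leq_trans (size_polyMleq _ _)).
  have := (H i).1; have := (H' (b - i)%N).1; have iN := ltn_ord i; set x := size _; set y := size _; set k := (b - i)%N.
  have kE : (k + i = b)%N by rewrite subnK.
  rewrite -!addnn => hx hy; lia.
rewrite !serM; apply/polyP => a; rewrite coef_sum coef_poly.
transitivity (\sum_(i < b.+1) (revp b.*2 (f i * g (b - i)%N))`_a).
  apply: eq_bigr => i _; rewrite (H i).2 (H' (b - i)%N).2.
  rewrite -revpM ?(H i).1 ?(H' (b - i)%N).1 //.
  by rewrite -doubleD subnKC // -ltnS.
case: ltnP => ab; last first.
  by rewrite big1 // => i _; rewrite nth_default // (leq_trans (size_revp _ _) ab).
by rewrite coef_sum; apply: eq_bigr => i _; rewrite coef_revp.
Qed.
Lemma rv_mono a b : (a <= b.*2)%N -> rv (mono 'X^a b) (mono 'X^(b.*2 - a) b).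
Proof.
move=> ab n; rewrite !monoE; case: eqP => [->|_].
  split; first by rewrite size_polyXn.
  apply/polyP => i; rewrite coef_poly !coefXn; case: ltnP => ib.
    by congr (_%:R); apply/eqP/eqP; lia.
  by case: eqP => //; lia.
split; first by rewrite size_poly0.
by apply/polyP => i; rewrite coef_poly !coef0 if_same.
Qed.
Lemma rvB f f' g g' : rv f f' -> rv g g' -> rv (f - g) (f' - g').
Proof.
move=> H H' b; split.
  by rewrite serB; apply: (leq_trans (size_polyD _ _)); rewrite geq_max size_polyN (H b).1 (H' b).1.
by rewrite !serB (H b).2 (H' b).2; apply/polyP => i; rewrite !(coefB, coef_poly); case: ltnP; rewrite ?subr0 // coefB.
Qed.
Lemma rvD f f' g g' : rv f f' -> rv g g' -> rv (f + g) (f' + g').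
Proof.
move=> H H' b; split.
  by rewrite serD; apply: (leq_trans (size_polyD _ _)); rewrite geq_max (H b).1 (H' b).1.
by rewrite !serD (H b).2 (H' b).2; apply/polyP => i; rewrite !(coefD, coef_poly); case: ltnP; rewrite ?addr0 // coefD.
Qed.
Lemma rv1 : rv 1 1.
Proof. by rewrite -mono1; apply: (@rv_mono 0 0). Qed.
Lemma rv0 : rv 0 0. Proof. by have := rvB rv1 rv1; rewrite subrr. Qed.
Lemma rv_prod N (u v : nat -> SP) : (forall m, rv (u m) (v m)) ->
  rv (\prod_(m < N) u m) (\prod_(m < N) v m).
Proof. by move=> H; elim/big_rec2: _ => [|i x y _]; [exact: rv1|apply: rvM]. Qed.
Lemma rv_sum N (u v : nat -> SP) : (forall m, rv (u m) (v m)) ->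
  rv (\sum_(m < N) u m) (\sum_(m < N) v m).
Proof. by move=> H; elim/big_rec2: _ => [|i x y _]; [exact: rv0|apply: rvD]. Qed.
Lemma rv_iprod u v : (forall m, rv (u m) (v m)) -> rv (iprod u) (iprod v).
Proof. by move=> H b; exact: (rv_prod b.+1 H b). Qed.
Lemma rv_isum u v : (forall m, rv (u m) (v m)) -> rv (isum u) (isum v).
Proof. by move=> H b; exact: (rv_sum b.+1 H b). Qed.
Lemma rvC f g : rv f g -> rv g f.
Proof.
move=> H b; have [sf ->] := H b; split; first exact: size_revp.
apply/polyP => j; rewrite coef_poly; case: ltnP => jb.
  by rewrite coef_revp ?leq_subr // subKn.
by rewrite nth_default // (leq_trans sf).
Qed.

(** * Moments *)

(** Applying dz^j and setting z = 1 replaces z^n by n^j; on a rank or crank generating function this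
    gives the series of j-th moments. *)
Definition mom j f : S1 := ev1 (iter j dz f).

Lemma coef_iter_dz j (f : SP) b a : (iter j dz f b)`_a = (a%:R - b%:R) ^+ j * (f b)`_a.
Proof.
have E := iot_dz; have {}E : iot (iter j dz f) = iter j dzB (iot f).
  by elim: j => //= j <-; rewrite E.
transitivity (iot (iter j dz f) b a); first by [].
rewrite E {E}; elim: j => [|j IH]; first by rewrite expr0 mul1r.
by rewrite iterS dzBE IH exprS mulrA.
Qed.

Lemma momE j (f : SP) b N : (size (f b) <= N)%N ->
  mom j f b = \sum_(a < N) (a%:R - b%:R) ^+ j * (f b)`_a.
Proof.
move=> sN; rewrite /mom /= /horner_eval.
have sN' : (size (iter j dz f b) <= N)%N.
  by apply/leq_sizeP => i Ni; rewrite coef_iter_dz nth_default ?mulr0 // (leq_trans sN).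
rewrite (horner_coef_wide _ sN'); apply: eq_bigr => i _.
by rewrite expr1n mulr1 coef_iter_dz.
Qed.
Lemma mom_pal j f : pal f -> odd j -> mom j f = 0.
Proof.
move=> H oj; apply: serP => b; rewrite ser0; have [s E] := H b.
have E2 : mom j f b = - mom j f b.
  rewrite {1}(momE j s) (momE j s) -sumrN (reindex_inj rev_ord_inj) /=.
  apply: eq_bigr => i _; have ib : (i <= b.*2)%N by rewrite -ltnS.
  rewrite subSS {1}E coef_revp ?leq_subr // subKn // -mulNr; congr (_ * _).
  have -> : (b.*2 - i)%:R - b%:R = - (i%:R - b%:R) :> rat by rewrite natrB // -[X in X%:R - _]addnn natrD; ring.
  by rewrite exprNn -signr_odd oj expr1 mulN1r.
lra.
Qed.
Lemma mom_D j f g : mom j (f + g) = mom j f + mom j g.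
Proof. by rewrite /mom (iterDD dz_der) rmorphD. Qed.
Lemma mom_Mn j f k : mom j (f *+ k) = mom j f *+ k.
Proof. by rewrite /mom (iterDMn dz_der) rmorphMn. Qed.
Lemma mom_M j f g : mom j (f * g) = \sum_(i < j.+1) (mom i f * mom (j - i) g) *+ 'C(j, i).
Proof.
rewrite /mom (iterDM dz_der) rmorph_sum; apply: eq_bigr => i _.
by rewrite rmorphMn rmorphM.
Qed.
Lemma mom_dz j f : mom j (dz f) = mom j.+1 f.
Proof. by rewrite /mom iterSr. Qed.
Lemma dq_dz f : dq (dz f) = dz (dq f).
Proof.
apply: serP => b; apply/polyP => a.
rewrite -!/(iter 1 dz _) coef_iter_dz /= !coefMn.
have := coef_iter_dz 1 f b a; rewrite /= => ->; rewrite expr1; ring.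
Qed.
Lemma mom_dq j f : mom j (dq f) = dq (mom j f).
Proof.
rewrite /mom; have -> : iter j dz (dq f) = dq (iter j dz f).
  by elim: j => //= j ->; rewrite dq_dz.
by apply: serP => b; rewrite /= rmorphMn.
Qed.

(** * Products and divisor sums *)

Section DivisorSums.
Variable V : zmodType.
Definition sdiv (F : nat -> nat -> V) b := \sum_(1 <= d < b.+1 | (d %| b)%N) F d (b %/ d)%N.
Lemma sdivE F b : (0 < b)%N -> sdiv F b = \sum_(d <- divisors b) F d (b %/ d)%N.
Proof.
case: b => // b _.
rewrite /sdiv -big_filter; apply: perm_big; apply: uniq_perm.
- by rewrite filter_uniq // iota_uniq.
- exact: divisors_uniq.
move=> d; rewrite mem_filter -dvdn_divisors // mem_index_iota.
case dv: (d %| b.+1)%N => //=.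
by rewrite (dvdn_gt0 _ dv) // ltnS (dvdn_leq _ dv).
Qed.
Lemma sdivC F b : sdiv F b = sdiv (fun d e => F e d) b.
Proof.
case: b => [|b]; first by rewrite /sdiv !big_geq.
rewrite !sdivE // [RHS](perm_big [seq (b.+1 %/ d)%N | d <- divisors b.+1]).
  rewrite big_map; rewrite big_seq [RHS]big_seq; apply: eq_bigr => d.
  rewrite -dvdn_divisors // => /dvdnP[k E]; rewrite E.
  have k0 : (0 < k)%N by case: k E.
  have d0 : (0 < d)%N by case: (d) E; rewrite ?muln0.
  by rewrite mulnK // mulKn.
have inj : {in divisors b.+1 &, injective (fun d => b.+1 %/ d)%N}.
  move=> d d'; rewrite -!dvdn_divisors // => dv dv' E.
  apply/eqP; rewrite -(eqn_pmul2l (m := b.+1 %/ d)) ?divn_gt0 ?(dvdn_gt0 _ dv) ?(dvdn_leq _ dv) //.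
  by rewrite {2}E !divnK.
apply: uniq_perm; rewrite ?divisors_uniq ?map_inj_in_uniq ?divisors_uniq //.
move=> d; apply/idP/mapP => [dv|[d' dv' ->]].
  move: dv; rewrite -dvdn_divisors // => dv; exists (b.+1 %/ d)%N.
    by rewrite -dvdn_divisors // dvdn_div.
  by rewrite divnA // mulKn.
by move: dv'; rewrite -!dvdn_divisors // => dv'; apply: dvdn_div.
Qed.
Lemma sum_pos_sdiv F b :
  \sum_(m < b.+1) (if (m.+1 %| b)%N && (0 < b)%N then F m.+1 (b %/ m.+1)%N else 0) = sdiv F b.
Proof.
case: b => [|b]; first by rewrite big_ord1 /= /sdiv big_geq.
rewrite big_ord_recr /= gtnNdvd // addr0 /sdiv big_add1 big_mkord.
by rewrite [RHS]big_mkcond; apply: eq_bigr => i _; rewrite andbT.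
Qed.
Lemma sdiv_eq F G b : (0 < b)%N ->
  (forall d k, (0 < d)%N -> b = (d * k)%N -> F d k = G d k) -> sdiv F b = sdiv G b.
Proof.
move=> b0 FG; rewrite !sdivE // big_seq [RHS]big_seq; apply: eq_bigr => d.
rewrite -dvdn_divisors // => dv; apply: FG; first exact: dvdn_gt0 dv.
by rewrite mulnC divnK.
Qed.
Lemma sdivD F G b : sdiv F b + sdiv G b = sdiv (fun d k => F d k + G d k) b.
Proof. by rewrite /sdiv big_split. Qed.
Lemma sdivN F b : - sdiv F b = sdiv (fun d k => - F d k) b.
Proof. by rewrite /sdiv sumrN. Qed.
Lemma sdiv0 F : sdiv F 0 = 0.
Proof. by rewrite /sdiv big_geq. Qed.
End DivisorSums.

Definition Afac m : SP := 1 - mono 'X^(m.+2) m.+1.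
Definition Bfac m : SP := 1 - mono 'X^m m.+1.
Definition Qfac m : SP := 1 - mono 'X^(m.+1) m.+1.
Definition PA := iprod Afac.
Definition PB := iprod Bfac.
Definition PQ := iprod Qfac.
Definition zfac : SP := 1 - mono 'X^1 0.

Lemma fac_eqm (A : comNzRingType) (c : A) N d : (N <= d)%N -> eqm N (1 - mono c d) 1.
Proof. by move=> Nd; rewrite -[X in eqm _ _ X]subr0; apply: eqmB => //; apply: eqm_mono. Qed.
Lemma geo_eqm (A : comNzRingType) (c : A) d : eqm d (geo c d) 0.
Proof.
move=> n nd; rewrite ser0 /=; case: n nd => [|n] nd; first by rewrite andbF.
by rewrite gtnNdvd.
Qed.

Lemma der_log_iprod (A : comNzRingType) (D : ser A -> ser A) (u e : nat -> ser A) :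
  derivation D -> (forall N f g, eqm N f g -> eqm N (D f) (D g)) ->
  (forall m, eqm m.+1 (u m) 1) -> (forall m, eqm m (e m) 0) ->
  (forall m, D (u m) = u m * e m) -> D (iprod u) = iprod u * isum e.
Proof.
move=> DD De u1 e0 H; apply: eqmP => N.
apply: (eqm_trans (De _ _ _ (iprod_eqm (N := N) u1))).
rewrite (der_log_prod DD _ H); apply: eqm_sym.
by apply: eqmM; [apply: iprod_eqm|apply: isum_eqm].
Qed.

Lemma dz_Afac m : dz (Afac m) = Afac m * - geo 'X^(m.+2) m.+1.
Proof.
rewrite /Afac mulrN geoE // (derB dz_der) (der1 dz_der) dz_mono sub0r; congr (- _).
by rewrite mulrS addrK.
Qed.
Lemma dz_Bfac m : dz (Bfac m) = Bfac m * geo 'X^m m.+1.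
Proof.
rewrite /Bfac geoE // (derB dz_der) (der1 dz_der) dz_mono sub0r.
by rewrite mulrS opprB addrK.
Qed.
Lemma dz_Qfac m : dz (Qfac m) = 0.
Proof. by rewrite /Qfac (derB dz_der) (der1 dz_der) dz_mono subrr subr0. Qed.
Lemma dq_fac (A : comNzRingType) (c : A) m :
  dq (1 - mono c m.+1) = (1 - mono c m.+1) * - (geo c m.+1 *+ m.+1).
Proof.
rewrite mulrN mulrnAr geoE // (derB (@dq_der _)) (der1 (@dq_der _)) dq_mono sub0r //.
Qed.

(** The sum over k, n of q^(kn) (z^k - z^-k); [User] sums n q^(kn) (z^k + z^-k + 1). Up to sign
    these are the logarithmic derivatives in z and q of the products [PA * PB] and
    [PA * PB * PQ]. *)
Definition Vser : SP := Ser (fun b => sdiv (fun k _ => 'X^(b + k) - 'X^(b - k)) b).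
Definition User : SP :=
  Ser (fun b => sdiv (fun k n => ('X^(b + k) + 'X^(b - k) + 'X^b) *+ n) b).

Lemma isumN (A : comNzRingType) (u : nat -> ser A) : isum (fun m => - u m) = - isum u.
Proof.
apply: serP => n; rewrite serN -[isum _ n]/((\sum_(m < n.+1) - u m) n).
by rewrite sumrN.
Qed.
Lemma isum_geo (A : comNzRingType) (c : nat -> A) (l : nat -> nat) b :
  isum (fun m => geo (c m) m.+1 *+ l m) b = sdiv (fun k n => c n.-1 ^+ k *+ l n.-1) b.
Proof.
rewrite [RHS]sdivC -sum_pos_sdiv [LHS]ser_sum; apply: eq_bigr => m _.
by rewrite serMn /=; case: ifP; rewrite ?mul0rn.
Qed.

Lemma dz_PAB : dz (PA * PB) = - (PA * PB * Vser).
Proof.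
rewrite (derM dz_der).
rewrite (der_log_iprod dz_der dz_eqm (fun m => fac_eqm _ (leqnn m.+1)) _ dz_Afac); last first.
  by move=> m; rewrite -oppr0; apply: eqmN; apply: (eqm_le (leqnSn m)); apply: geo_eqm.
rewrite (der_log_iprod dz_der dz_eqm (fun m => fac_eqm _ (leqnn m.+1)) _ dz_Bfac); last first.
  by move=> m; apply: (eqm_le (leqnSn m)); apply: geo_eqm.
rewrite -/PA -/PB isumN.
have -> : Vser = isum (fun m => geo 'X^(m.+2) m.+1 *+ 1) - isum (fun m => geo 'X^m m.+1 *+ 1).
  apply: serP => b; rewrite serB (isum_geo (fun m => 'X^(m.+2)) (fun=> 1%N)).
  rewrite (isum_geo (fun m => 'X^m) (fun=> 1%N)) sdivN sdivD.
  case: b => [|b]; first by rewrite /Vser /= !sdiv0.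
  apply: sdiv_eq => // k [|n] k0 E; first by rewrite muln0 in E.
  rewrite -!exprM /= E !mulr1n; congr ('X^_ - 'X^_); lia.
by rewrite /=; ring.
Qed.

Lemma dq_PABQ : dq (PA * PB * PQ) = - (PA * PB * PQ * User).
Proof.
have E (c : nat -> {poly rat}) : dq (iprod (fun m => 1 - mono (c m) m.+1)) =
   iprod (fun m => 1 - mono (c m) m.+1) * isum (fun m => - (geo (c m) m.+1 *+ m.+1)).
  apply: der_log_iprod => //.
  - exact: dq_der.
  - exact: dq_eqm.
  - by move=> m; apply: fac_eqm.
  - move=> m; rewrite -oppr0; apply: eqmN; apply: (eqm_le (leqnSn m)) => n nm.
    by rewrite serMn geo_eqm // ser0 mul0rn.
  - by move=> m; rewrite dq_fac.
rewrite !(derM (@dq_der _)) (E (fun m => 'X^(m.+2))) (E (fun m => 'X^m)) (E (fun m => 'X^(m.+1))).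
rewrite -!/(Afac _) -!/(Bfac _) -!/(Qfac _) -/PA -/PB -/PQ !isumN.
have -> : User = isum (fun m => geo 'X^(m.+2) m.+1 *+ m.+1) +
    isum (fun m => geo 'X^m m.+1 *+ m.+1) + isum (fun m => geo 'X^(m.+1) m.+1 *+ m.+1).
  apply: serP => b; rewrite !serD (isum_geo (fun m => 'X^(m.+2)) succn).
  rewrite (isum_geo (fun m => 'X^m) succn) (isum_geo (fun m => 'X^(m.+1)) succn) !sdivD.
  case: b => [|b]; first by rewrite /User /= !sdiv0.
  apply: sdiv_eq => // k [|n] k0 E'; first by rewrite muln0 in E'.
  rewrite -!exprM /= E' -!mulrnDl; congr (('X^_ + 'X^_ + 'X^_) *+ _); lia.
by ring.
Qed.

(** * The q-binomial theorem and a Heine recursion *)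

Section QSeries.
Variable A : comNzRingType.
Implicit Types a x q : ser A.

Lemma eqmM_ord M N (f g g' : ser A) : eqm M f 0 -> eqm N g g' -> eqm (M + N) (f * g) (f * g').
Proof.
move=> f0 gg n nN; apply/eqP; rewrite -subr_eq0 -serB -mulrBr; apply/eqP.
by apply: (eqm_mul0 f0) nN => m mN; rewrite serB gg // subrr.
Qed.

Lemma isum_telescope (S al : nat -> ser A) : (forall k, S k = 1 + al k * S k.+1) ->
  (forall k, eqm 1 (al k) 0) -> S 0%N = isum (fun n => \prod_(k < n) al k).
Proof.
move=> HS Hal.
have ord n : eqm n (\prod_(k < n) al k) 0.
  elim: n => [|n IH] //; rewrite big_ord_recr /= -addn1; exact: eqm_mul0.
apply: eqmP => N; apply: eqm_sym; apply: (eqm_trans (isum_eqm ord)).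
have -> : S 0%N = \sum_(n < N) \prod_(k < n) al k + (\prod_(k < N) al k) * S N.
  elim: N => [|N IH]; first by rewrite !big_ord0 add0r mul1r.
  by rewrite IH big_ord_recr [in RHS]big_ord_recr /= {1}HS; ring.
rewrite -[X in eqm _ X _]addr0; apply: eqmD => //; rewrite -(mul0r (S N)).
by apply: eqmM => //; apply: eqm_sym; apply: ord.
Qed.

Definition poch a q j := \prod_(i < j) (1 - a * q ^+ i).

(** Here d j is 1/(q;q)_j. The sum F(x) satisfies (1 - x) F(x) = (1 - ax) F(xq); iterating this
    leaves F(x q^N), which tends to 1. *)
Lemma q_binomial a x q (d : nat -> ser A) : eqm 1 x 0 -> eqm 1 q 0 -> d 0%N = 1 ->
  (forall j, d j.+1 * (1 - q ^+ j.+1) = d j) ->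
  isum (fun j => poch a q j * d j * x ^+ j) * iprod (fun k => 1 - x * q ^+ k) =
  iprod (fun k => 1 - a * x * q ^+ k).
Proof.
move=> x0 q0 d0 dS.
have xq k : eqm k.+1 (x * q ^+ k) 0 by rewrite -add1n; apply: eqm_mul0 => //; apply: eqm_exp0.
pose c j := poch a q j * d j.
pose G k := isum (fun j => c j * (x * q ^+ k) ^+ j).
have ordG k j : eqm j (c j * (x * q ^+ k) ^+ j) 0.
  rewrite -(mulr0 (c j)); apply: eqmMl; apply: eqm_exp0.
  by apply: eqm_le (xq k).
have rec k : (1 - x * q ^+ k) * G k = (1 - a * x * q ^+ k) * G k.+1.
  apply: eqmP => N.
  apply: (eqm_trans (eqmMl _ (isum_eqm (ordG k)))); apply: eqm_sym.
  apply: (eqm_trans (eqmMl _ (isum_eqm (ordG k.+1)))).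
  set X := x * q ^+ k; pose t j := c j * X ^+ j * (1 - q ^+ j).
  have E : (1 - X) * (\sum_(m < N) c m * X ^+ m) =
      (1 - a * x * q ^+ k) * (\sum_(m < N) c m * (x * q ^+ k.+1) ^+ m) - t N.
    elim: N => [|N IH].
      by rewrite !big_ord0 !mulr0 /t expr0 subrr mulr0 subr0.
    rewrite !big_ord_recr /= !mulrDr IH /t.
    have cS : c N.+1 * (1 - q ^+ N.+1) = c N * (1 - a * q ^+ N).
      by rewrite /c -mulrA dS /poch big_ord_recr /=; ring.
    have -> : x * q ^+ k.+1 = X * q by rewrite /X exprS; ring.
    have -> : a * x * q ^+ k = a * X by rewrite /X mulrA.
    have -> : c N.+1 * X ^+ N.+1 * (1 - q ^+ N.+1) = c N * (1 - a * q ^+ N) * X ^+ N.+1.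
      by rewrite -cS; ring.
    by rewrite (exprMn N X q) exprS; ring.
  rewrite E -[X in eqm _ X _]subr0; apply: eqmB => //; apply: eqm_sym.
  rewrite /t -(mul0r (1 - q ^+ N)); apply: eqmMr; exact: ordG.
have prodG N : G 0%N * \prod_(k < N) (1 - x * q ^+ k) = \prod_(k < N) (1 - a * x * q ^+ k) * G N.
  elim: N => [|N IH]; first by rewrite !big_ord0 mulr1 mul1r.
  by rewrite !big_ord_recr /= mulrA IH -[LHS]mulrA -[RHS]mulrA -rec [(1 - _) * G N]mulrC.
have fac y k : eqm k.+1 y 0 -> eqm k.+1 (1 - y) 1.
  by move=> H; rewrite -[X in eqm _ _ X]subr0; apply: eqmB.
have -> : isum (fun j => poch a q j * d j * x ^+ j) = G 0%N.
  by rewrite /G expr0 mulr1.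
apply: eqmP => N.
apply: (@eqm_trans _ _ _ (G 0%N * \prod_(k < N) (1 - x * q ^+ k))).
  by apply: eqmMl; apply: iprod_eqm => k; apply: fac.
rewrite prodG; apply: eqm_sym.
rewrite -[iprod _]mulr1; apply: eqmM.
  apply: iprod_eqm => k; apply: fac; rewrite -mulrA -(mulr0 a); exact: eqmMl.
case: N => // N; apply: eqm_sym; apply: (eqm_trans (isum_eqm (ordG _))).
rewrite big_ord_recl /= expr0 mulr1 /c /poch big_ord0 mul1r d0 -[X in eqm _ _ X]addr0.
apply: eqmD => //; elim/big_rec: _ => // i y _ IH; rewrite -[0]addr0; apply: eqmD => //.
rewrite -(mulr0 (c (bump 0 i))) /bump /= add1n; apply: eqmMl; rewrite exprS.
by rewrite -(mul0r ((x * q ^+ N.+1) ^+ i)); apply: eqmMr; apply: eqm_le (xq _).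
Qed.

(** [heine 0] is [sum_n (xy)^n q^(n^2) / ((xq)_n (yq)_n)] in one-sided form,
    with [kap = xyq], [xi = xq], [eta = yq]. *)
Section Heine.
Variables (kap xi eta q : ser A) (g h : nat -> ser A).
Hypothesis gE : forall i, (1 - xi * q ^+ i) * g i = 1.
Hypothesis hE : forall i, (1 - eta * q ^+ i) * h i = 1.
Hypothesis kE : xi * eta = kap * q.
Hypothesis eta0 : eqm 1 eta 0.
Hypothesis kap0 : eqm 1 kap 0.

Definition heine k := 1 + kap * q ^+ (2 * k) *
  isum (fun L => (eta * q ^+ k) ^+ L * \prod_(i < L.+1) g (k + i)%N).

(** With X = xi q^k and Y = eta q^k, summation by parts in L extracts 1/(1 - Y) and turns the sum
    into the one belonging to k + 1. *)
Lemma heine_rec k : heine k = 1 + kap * q ^+ (2 * k) * g k * h k * heine k.+1.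
Proof.
pose e L := \prod_(i < L) g (k.+1 + i)%N.
have eS L : e L.+1 * (1 - xi * q ^+ k * q ^+ L.+1) = e L.
  by rewrite /e big_ord_recr /= -mulrA [g _ * _]mulrC -mulrA -exprD addnS -addSn gE mulr1.
have e1 L : \prod_(i < L.+1) g (k + i)%N = g k * e L.
  rewrite big_ord_recl /= addn0; congr (_ * _); apply: eq_bigr => i _.
  by rewrite /bump /= add1n addnS addSn.
have [Y YE] : exists Y, Y = eta * q ^+ k by exists (eta * q ^+ k).
have [X XE] : exists X, X = xi * q ^+ k by exists (xi * q ^+ k).
have Y0 : eqm 1 Y 0 by rewrite YE -(mul0r (q ^+ k)); apply: eqmMr.
have key : (1 - Y) * isum (fun L => Y ^+ L * e L) =
   1 + X * Y * q * isum (fun L => (Y * q) ^+ L * e L.+1).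
  apply: eqmP => N; case: N => // N.
  have o1 L : eqm L (Y ^+ L * e L) 0 by rewrite -(mul0r (e L)); apply: eqmMr; apply: eqm_exp0.
  have o2 L : eqm L ((Y * q) ^+ L * e L.+1) 0.
    by rewrite exprMn -mulrA -(mul0r (q ^+ L * e L.+1)); apply: eqmMr; apply: eqm_exp0.
  apply: (eqm_trans (eqmMl _ (isum_eqm o1))); apply: eqm_sym.
  apply: (@eqm_trans _ _ _ (1 + X * Y * q * \sum_(L < N) (Y * q) ^+ L * e L.+1)).
    apply: eqmD => //; rewrite -!mulrA; apply: eqmMl; rewrite -[N.+1]add1n.
    apply: eqmM_ord => //; apply: eqmMl; exact: isum_eqm.
  have -> : (1 - Y) * (\sum_(L < N.+1) Y ^+ L * e L) =
     1 + X * Y * q * (\sum_(L < N) (Y * q) ^+ L * e L.+1) - Y ^+ N.+1 * e N.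
    elim: N => [|N IH].
      by rewrite big_ord_recr !big_ord0 /= /e big_ord0; ring.
    rewrite big_ord_recr /= mulrDr IH [in RHS]big_ord_recr /= -[e N]eS exprMn.
    by rewrite -XE !exprS; ring.
  rewrite -[X in eqm _ X _]subr0; apply: eqmB => //; apply: eqm_sym.
  by rewrite -(mul0r (e N)); apply: eqmMr; apply: eqm_exp0.
have gk : (1 - X) * g k = 1 by rewrite XE; apply: gE.
have hk : (1 - Y) * h k = 1 by rewrite YE; apply: hE.
rewrite /heine.
have -> : isum (fun L => (eta * q ^+ k) ^+ L * \prod_(i < L.+1) g (k + i)%N) =
   g k * isum (fun L => Y ^+ L * e L).
  apply: serP => n.
  transitivity ((g k * \sum_(m < n.+1) Y ^+ m * e m) n).
    rewrite [LHS]/=; congr (coef _ n); rewrite mulr_sumr.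
    by apply: eq_bigr => m _; rewrite e1 -YE; ring.
  apply: (@eqmMl _ n.+1) => // m mn; apply/esym; apply: isum_eqm => // L.
  by rewrite -(mul0r (e L)); apply: eqmMr; apply: eqm_exp0.
have -> : isum (fun L => Y ^+ L * e L) = h k * (1 + X * Y * q * isum (fun L => (Y * q) ^+ L * e L.+1)).
  by rewrite -key mulrA [h k * _]mulrC hk mul1r.
have -> : isum (fun L => (eta * q ^+ k.+1) ^+ L * \prod_(i < L.+1) g (k.+1 + i)%N) =
   isum (fun L => (Y * q) ^+ L * e L.+1).
  by rewrite YE -mulrA -exprSr.
have -> : X * Y * q = kap * q ^+ (2 * k.+1).
  have -> : X * Y * q = (xi * eta) * q ^+ (2 * k).+1 by rewrite XE YE mul2n -addnn exprS exprD; ring.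
  by rewrite kE mulnS !exprS; ring.
ring.
Qed.

(** The one-sided form is what partitions sorted by their largest part produce; the two-sided form
    on the right displays the symmetries. *)
Lemma heineE : heine 0 =
  isum (fun n => \prod_(k < n) (kap * q ^+ (2 * k) * g k * h k)).
Proof.
apply: (isum_telescope (S := heine) (al := fun k => kap * q ^+ (2 * k) * g k * h k)) => [k|k]; first exact: heine_rec.
by rewrite -!mulrA -(mul0r (q ^+ (2 * k) * (g k * h k))); apply: eqmMr.
Qed.
End Heine.
End QSeries.

Lemma iprodM (A : comNzRingType) (u v : nat -> ser A) :
  (forall m, eqm m.+1 (u m) 1) -> (forall m, eqm m.+1 (v m) 1) ->
  iprod u * iprod v = iprod (fun m => u m * v m).
Proof.
move=> Hu Hv; apply: eqmP => N.
apply: (eqm_trans (eqmM (iprod_eqm (N := N) Hu) (iprod_eqm (N := N) Hv))).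
rewrite -big_split; apply: eqm_sym; apply: iprod_eqm => m.
by rewrite -[1]mulr1; apply: eqmM.
Qed.
Lemma iprod1 (A : comNzRingType) : iprod (fun _ => 1 : ser A) = 1.
Proof. by apply: serP => n; rewrite -[LHS]/((\prod_(m < n.+1) 1 : ser A) n) big1. Qed.
Lemma eq_iprod (A : comNzRingType) (u v : nat -> ser A) : u =1 v -> iprod u = iprod v.
Proof. by move=> /funext ->. Qed.
Lemma isum_recl (A : comNzRingType) (u : nat -> ser A) : (forall m, eqm m (u m) 0) ->
  isum u = u 0%N + isum (fun m => u m.+1).
Proof.
move=> Hu; apply: serP => n; rewrite serD.
have -> : isum u n = (\sum_(m < n.+2) u m) n by apply: (isum_eqm Hu).
by rewrite big_ord_recl serD.
Qed.

Definition gA k : SP := 1 + geo 'X^(k.+2) k.+1.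
Definition gB k : SP := 1 + geo 'X^k k.+1.
Definition gQ k : SP := 1 + geo 'X^(k.+1) k.+1.
Lemma geo_inv (A : comNzRingType) (c : A) d : (0 < d)%N -> (1 - mono c d) * (1 + geo c d) = 1.
Proof. by move=> d0; rewrite mulrDr geoE // mulr1 subrK. Qed.
Lemma gAE k : Afac k * gA k = 1. Proof. exact: geo_inv. Qed.
Lemma gBE k : Bfac k * gB k = 1. Proof. exact: geo_inv. Qed.
Lemma gQE k : Qfac k * gQ k = 1. Proof. exact: geo_inv. Qed.
Lemma ginv_eqm (A : comNzRingType) (c : A) d : eqm d (1 + geo c d) 1.
Proof. by rewrite -[X in eqm _ _ X]addr0; apply: eqmD => //; apply: geo_eqm. Qed.

Definition qS : SP := mono 'X^1 1.
Definition wS : SP := mono 'X^0 1.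
Definition zS : SP := mono 'X^1 0.
Definition zqS : SP := mono 'X^2 1.
Lemma qSX k : qS ^+ k = mono 'X^k k.
Proof. by rewrite /qS monoX -exprM mul1n muln1. Qed.
Lemma wq k : wS * qS ^+ k = mono 'X^k k.+1.
Proof. by rewrite qSX monoM -exprD. Qed.
Lemma zqq k : zqS * qS ^+ k = mono 'X^(k.+2) k.+1.
Proof. by rewrite qSX monoM -exprD. Qed.
Lemma zwS : zS * wS = qS. Proof. by rewrite monoM -exprD. Qed.
Lemma zqSE : zS * qS = zqS. Proof. by rewrite monoM -exprD. Qed.

Lemma rv_geo k : rv (geo 'X^(k.+2) k.+1) (geo 'X^k k.+1).
Proof.
move=> b; rewrite /=; case: ifP => [/andP[/dvdnP[m ->] _]|_].
  have := @rv_mono (k.+2 * m) (m * k.+1) _ (m * k.+1)%N; rewrite !monoE eqxx.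
  rewrite mulnK // -!exprM.
  have -> : ((m * k.+1).*2 - k.+2 * m = k * m)%N by lia.
  by apply; lia.
by have := rv0 b; rewrite !ser0.
Qed.
Lemma rv_gA k : rv (gA k) (gB k). Proof. exact: rvD rv1 (rv_geo k). Qed.
Lemma pal_q k : pal (qS ^+ k).
Proof. by rewrite qSX; have := @rv_mono k k; rewrite -addnn addnK; apply; lia. Qed.

(** * The rank and crank generating functions *)

(** The rank function sum q^(n^2)/((zq)_n (q/z)_n), entered through its sum over the largest
    part. *)
Definition Rgf : SP := heine qS zqS qS gB 0.

Lemma zq_ord : eqm 1 zqS 0. Proof. exact: eqm_mono. Qed.
Lemma q_ord : eqm 1 qS 0. Proof. exact: eqm_mono. Qed.

Lemma pal_Rgf : pal Rgf.
Proof.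
rewrite /Rgf (@heineE _ qS wS zqS qS gB gA).
- rewrite /pal; apply: rv_isum => n; apply: (@rv_prod n (fun k => qS * qS ^+ (2 * k) * gB k * gA k) (fun k => qS * qS ^+ (2 * k) * gB k * gA k)) => k.
  rewrite -exprS -!mulrA; apply: rvM; first exact: pal_q.
  by rewrite {2}[gB k * gA k]mulrC; apply: rvM; [apply: rvC|]; apply: rv_gA.
- by move=> i; rewrite wq; apply: gBE.
- by move=> i; rewrite zqq; apply: gAE.
- by rewrite /wS /zqS /qS !monoM -!exprD.
- exact: zq_ord.
- exact: q_ord.
Qed.

(** The series sum q^(n^2+n)/((zq)_n (q^2/z)_n). Its two families of factors are exchanged by z <->
    w, whereas those of [Rgf] are exchanged by z -> 1/z. *)
Definition S2 : SP := heine (qS ^+ 2) zqS qS (fun i => gB i.+1) 0.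

Lemma S2E : S2 = isum (fun n => \prod_(k < n) (qS ^+ 2 * qS ^+ (2 * k) * gB k.+1 * gA k)).
Proof.
rewrite /S2 (@heineE _ (qS ^+ 2) (wS * qS) zqS qS (fun i => gB i.+1) gA) //.
- by move=> i; rewrite -mulrA -exprS wq; apply: gBE.
- by move=> i; rewrite zqq; apply: gAE.
- by rewrite -zqSE -zwS; ring.
- exact: zq_ord.
- by rewrite expr2 -(mulr0 qS); apply: eqmMl; apply: q_ord.
Qed.

Lemma Rgf_S2 : zS * S2 * gB 0 = Rgf - zfac.
Proof.
have ord (e : nat -> SP) L : eqm L (zqS ^+ L * e L) 0.
  by rewrite -(mul0r (e L)); apply: eqmMr; apply: eqm_exp0; apply: zq_ord.
pose e1 L := \prod_(i < L) gB i.+1.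
have -> : Rgf = 1 + qS * (gB 0 * (1 + zqS * isum (fun L => zqS ^+ L * e1 L.+1))).
  rewrite /Rgf /heine !mulr1; congr (1 + qS * _).
  transitivity (gB 0 * isum (fun L => zqS ^+ L * e1 L)).
    apply: eqmP => N.
    apply: (eqm_trans (@isum_eqm _ (fun L => zqS ^+ L * \prod_(i < L.+1) gB (0 + i)) N (ord _))).
    apply: eqm_sym; apply: (eqm_trans (eqmMl _ (isum_eqm (ord e1)))).
    rewrite mulr_sumr => n nN; congr (coef _ n); apply: eq_bigr => L _.
    by rewrite big_ord_recl /= mulrCA; congr (_ * (_ * _)); apply: eq_bigr.
  congr (_ * _); rewrite (isum_recl (ord e1)) expr0 mul1r /e1 big_ord0; congr (_ + _).
  apply: eqmP => N; apply: (eqm_trans (@isum_eqm _ _ N _)).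
    by move=> m; rewrite -/(e1 _) exprSr -mulrA; apply: (ord (fun m => zqS * e1 m.+1)).
  apply: eqm_sym; apply: (eqm_trans (eqmMl _ (isum_eqm (ord (fun L => e1 L.+1))))).
  by rewrite mulr_sumr => n nN; congr (coef _ n); apply: eq_bigr => L _; rewrite mulrA -exprS.
have -> : S2 = 1 + qS ^+ 2 * isum (fun L => zqS ^+ L * e1 L.+1).
  by rewrite /S2 /heine !mulr1.
have -> : zfac = 1 - zS by [].
apply/eqP; rewrite -subr_eq0; apply/eqP.
have g0 : (1 - wS) * gB 0 = 1 by apply: gBE.
rewrite -zqSE -zwS; set I := isum _.
have -> : zS * (1 + (zS * wS) ^+ 2 * I) * gB 0 - (1 + zS * wS * (gB 0 * (1 + zS * (zS * wS) * I)) - (1 - zS)) = zS * ((1 - wS) * gB 0 - 1) by ring.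
by rewrite g0 subrr mulr0.
Qed.

Definition IA := iprod gA.
Definition IB := iprod gB.
Definition Cgf : SP := PQ * IA * IB.
Lemma PA_IA : PA * IA = 1.
Proof.
rewrite iprodM; first by rewrite (eq_iprod gAE) iprod1.
- by move=> m; apply: fac_eqm.
- by move=> m; apply: ginv_eqm.
Qed.
Lemma PB_IB : PB * IB = 1.
Proof.
rewrite iprodM; first by rewrite (eq_iprod gBE) iprod1.
- by move=> m; apply: fac_eqm.
- by move=> m; apply: ginv_eqm.
Qed.
Lemma CgfE : Cgf * (PA * PB) = PQ.
Proof.
rewrite /Cgf; have -> : PQ * IA * IB * (PA * PB) = PQ * (PA * IA) * (PB * IB) by ring.
by rewrite PA_IA PB_IB !mulr1.
Qed.
Lemma pal_PQ : pal PQ.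
Proof. by apply: rv_iprod => m; apply: rvB rv1 _; rewrite -qSX; apply: pal_q. Qed.
Lemma pal_Cgf : pal Cgf.
Proof.
rewrite /pal {2}/Cgf -mulrA [IA * IB]mulrC mulrA; apply: rvM; first apply: rvM.
- exact: pal_PQ.
- by apply: rv_iprod => m; apply: rv_gA.
- by apply: rv_iprod => m; apply: rvC; apply: rv_gA.
Qed.

Lemma iprod_coef0 (A : comNzRingType) (u : nat -> ser A) : iprod u 0%N = u 0%N 0%N.
Proof. by rewrite /= big_ord1. Qed.
Lemma PAB_0 : (PA * PB) 0%N = 1.
Proof.
rewrite serM big_ord1 !iprod_coef0 /Afac /Bfac !serB !ser1 !monoE /=.
by rewrite !subr0 mulr1.
Qed.
Lemma PQ_0 : PQ 0%N = 1.
Proof. by rewrite iprod_coef0 /Qfac serB ser1 monoE subr0. Qed.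

Lemma dz_PQ : dz PQ = 0.
Proof.
rewrite (@der_log_iprod _ dz _ (fun=> 0) dz_der dz_eqm).
- have -> : isum (fun=> 0 : SP) = 0 by apply: serP => n; rewrite -[LHS]/((\sum_(m < n.+1) 0 : SP) n) big1.
  by rewrite mulr0.
- by move=> m; apply: fac_eqm.
- by [].
- by move=> m; rewrite mulr0 dz_Qfac.
Qed.

Lemma dz_Cgf : dz Cgf = Cgf * Vser.
Proof.
have E : dz (Cgf * (PA * PB)) = 0 by rewrite CgfE dz_PQ.
apply: (ser_cancel PAB_0); apply/eqP; rewrite -subr_eq0; apply/eqP.
by rewrite -E (derM dz_der Cgf) dz_PAB; ring.
Qed.

(** * Embedding of q-series *)

(** Since q = zw, the power q^b sits at w^b z^b. *)
Definition emb (f : S1) : SP := Ser (fun b => f b *: 'X^b).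
Lemma emb_zmod : zmod_morphism emb.
Proof. by move=> f g; apply: serP => n; rewrite serB /= scalerBl. Qed.
Lemma emb_monoid : monoid_morphism emb.
Proof.
split; first by apply: serP => -[|n]; rewrite ser1 /= ?scale1r ?scale0r ?expr0.
move=> f g; apply: serP => n; rewrite serM -[LHS]/((f * g) n *: 'X^n) serM scaler_suml.
apply: eq_bigr => i _ /=.
by rewrite -scalerAl -scalerAr scalerA -exprD subnKC // -ltnS.
Qed.
HB.instance Definition _ := GRing.isZmodMorphism.Build _ _ emb emb_zmod.
HB.instance Definition _ := GRing.isMonoidMorphism.Build _ _ emb emb_monoid.
Lemma emb_mono c d : emb (mono c d) = mono (c *: 'X^d) d.
Proof. by apply: serP => n /=; case: eqP => [->|_]; rewrite ?scale0r. Qed.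
Lemma dz_emb f : dz (emb f) = 0.
Proof.
apply: serP => b; apply/polyP => a; have := coef_iter_dz 1 (emb f) b a; rewrite [iter 1 _ _]/= => ->.
rewrite ser0 coef0 /= coefZ coefXn expr1; case: eqP => [->|_]; first by rewrite subrr mul0r.
by rewrite !mulr0.
Qed.
Lemma swap_emb f : swap (iot (emb f)) = iot (emb f).
Proof.
apply/swapP => b a; rewrite /= !coefZ !coefXn; case: (eqVneq a b) => [->|ab] //.
by rewrite /= !mulr0.
Qed.
Lemma mom_emb j f g : mom j (emb f * g) = f * mom j g.
Proof.
rewrite /mom; have -> : iter j dz (emb f * g) = emb f * iter j dz g.
  by elim: j => //= j ->; rewrite (derM dz_der) dz_emb mul0r add0r.
rewrite rmorphM; congr (_ * _); apply: serP => b.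
by rewrite /= /horner_eval hornerZ hornerXn expr1n mulr1.
Qed.

Definition P1 : S1 := Ser Pq.
Definition Q1 : S1 := iprod (fun m => 1 - mono 1 m.+1).
Lemma emb_Q1 : emb Q1 = PQ.
Proof.
have H N : emb (\prod_(m < N) (1 - mono 1 m.+1)) = \prod_(m < N) Qfac m.
  rewrite rmorph_prod; apply: eq_bigr => m _.
  have -> : Qfac m = emb 1 - emb (mono 1 m.+1) by rewrite emb_mono scale1r rmorph1.
  exact: rmorphB.
by apply: serP => n; rewrite -[RHS]/((\prod_(m < n.+1) Qfac m) n) -H.
Qed.

Lemma coef_prod_qmul I (r : seq I) (F : I -> S1) :
  coef (\prod_(i <- r) F i) = \big[qmul/qone]_(i <- r) coef (F i).
Proof. by elim/big_rec2: _ => // i x y _ <-. Qed.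

Lemma P1E : P1 = iprod (fun m => 1 + geo (1 : rat) m.+1).
Proof.
apply: serP => n; rewrite -[RHS]/(coef (\prod_(m < n.+1) (1 + geo (1 : rat) m.+1)) n).
rewrite -[LHS]/((\big[qmul/qone]_(1 <= m < n.+1) geom m) n) big_add1.
have -> : \big[qmul/qone]_(0 <= i < n.+1.-1) geom i.+1 =
   coef (\prod_(0 <= m < n) (1 + geo (1 : rat) m.+1)).
  rewrite coef_prod_qmul; apply: eq_bigr => m _; apply: funext => b.
  rewrite serD ser1 /= /geom expr1n; case: b => [|b]; first by rewrite dvdn0 andbF addr0.
  by rewrite andbT add0r; case: (_ %| _)%N.
pose p := \prod_(m < n) (1 + geo (1 : rat) m.+1).
(* At degree n, [iprod] uses one factor more than [Pq]; that factor is 1 up to degree n. *)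
have H : eqm n.+1 (p * 1) (p * (1 + geo (1 : rat) n.+1)).
  by apply: eqmMl; apply: eqm_sym; exact: ginv_eqm.
by rewrite big_mkord big_ord_recr -[RHS]/((p * (1 + geo (1 : rat) n.+1)) n) -H // mulr1.
Qed.

Lemma Q1_P1 : Q1 * P1 = 1.
Proof.
rewrite P1E iprodM.
- by rewrite (eq_iprod (fun m => geo_inv (1 : rat) (ltn0Sn m))) iprod1.
- by move=> m; apply: fac_eqm.
- by move=> m; apply: ginv_eqm.
Qed.

Lemma mapser_iprod (A A' : comNzRingType) (phi : {rmorphism A -> A'}) (u : nat -> ser A) :
  mapser phi (iprod u) = iprod (fun m => mapser phi (u m)).
Proof.
apply: serP => n; rewrite -[LHS]/(mapser phi (\prod_(m < n.+1) u m) n).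
by rewrite rmorph_prod.
Qed.
Lemma mapser_mono (A A' : comNzRingType) (phi : {rmorphism A -> A'}) c d :
  mapser phi (mono c d) = mono (phi c) d.
Proof. by apply: serP => n /=; case: eqP; rewrite ?rmorph0. Qed.
Lemma ev1_fac a m : ev1 (1 - mono 'X^a m) = 1 - mono 1 m.
Proof.
have -> : ev1 (1 - mono 'X^a m) = ev1 1 - ev1 (mono 'X^a m) by exact: rmorphB.
by rewrite mapser_mono rmorph1 /= /horner_eval hornerXn expr1n.
Qed.
Lemma ev1_PA : ev1 PA = Q1.
Proof. by rewrite mapser_iprod; apply: eq_iprod => m; apply: ev1_fac. Qed.
Lemma ev1_PB : ev1 PB = Q1.
Proof. by rewrite mapser_iprod; apply: eq_iprod => m; apply: ev1_fac. Qed.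
Lemma ev1_PQ : ev1 PQ = Q1.
Proof. by rewrite mapser_iprod; apply: eq_iprod => m; apply: ev1_fac. Qed.

Lemma mom0_Cgf : mom 0 Cgf = P1.
Proof.
have E : ev1 Cgf * (Q1 * Q1) = Q1.
  transitivity (ev1 (Cgf * (PA * PB))); last by rewrite CgfE ev1_PQ.
  have M (x y : SP) : ev1 (x * y) = ev1 x * ev1 y by exact: rmorphM.
  by rewrite (M Cgf) (M PA) ev1_PA ev1_PB.
have -> : mom 0 Cgf = ev1 Cgf * (Q1 * Q1) * (P1 * P1).
  by rewrite -mulrA [Q1 * Q1 * _]mulrACA Q1_P1 !mulr1.
by rewrite E mulrA Q1_P1 mul1r.
Qed.

Definition phiS j : S1 := Ser (Phi j).

Lemma dq_Q1 : dq Q1 = - (Q1 * phiS 1).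
Proof.
rewrite (@der_log_iprod _ (@dq _) _ (fun m => - (geo 1 m.+1 *+ m.+1)) (@dq_der _) (@dq_eqm _)).
- rewrite isumN mulrN; congr (- (_ * _)); apply: serP => b.
  rewrite (isum_geo (fun=> 1) succn) sdivC.
  case: b => [|b]; first by rewrite sdiv0.
  rewrite sdivE //= /Phi /= /sigma natr_sum big_seq [RHS]big_seq; apply: eq_bigr => d.
  by rewrite -dvdn_divisors // => dv; rewrite expr1n expn1 prednK // (dvdn_gt0 _ dv).
- by move=> m; apply: fac_eqm.
- move=> m; rewrite -oppr0; apply: eqmN => n nm; rewrite serMn geo_eqm ?ser0 ?mul0rn //.
  exact: leqW.
- by move=> m; rewrite dq_fac.
Qed.
Lemma dq_P1 : dq P1 = P1 * phiS 1.
Proof.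
have := der1 (@dq_der rat); rewrite -Q1_P1 (derM (@dq_der _)) dq_Q1 => E.
have -> : dq P1 = P1 * (- (Q1 * phiS 1) * P1 + Q1 * dq P1) + P1 * phiS 1 * (Q1 * P1)
   + (1 - Q1 * P1) * dq P1 by ring.
by rewrite E Q1_P1; ring.
Qed.

(** * Moments of divisor sums *)

(** The action of [dz] on the row b alone, so that moments of divisor sums can be taken term by
    term. *)
Definition opz b (p : {poly rat}) := 'X * p^`() - p *+ b.
Definition rowmom j b p := (iter j (opz b) p).[1].
Lemma rowmomE j f b : mom j f b = rowmom j b (f b).
Proof.
rewrite /mom /rowmom /= /horner_eval; congr (_.[1]).
by elim: j => //= j ->.
Qed.
Lemma rowmomD j b p r : rowmom j b (p + r) = rowmom j b p + rowmom j b r.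
Proof.
rewrite /rowmom -hornerD; congr (_.[1]); elim: j => //= j ->.
by rewrite /opz derivD mulrnDl; ring.
Qed.
Lemma rowmom0 j b : rowmom j b 0 = 0.
Proof. by apply: (addrI (rowmom j b 0)); rewrite -rowmomD !addr0. Qed.
Lemma rowmomN j b p : rowmom j b (- p) = - rowmom j b p.
Proof. by apply/eqP; rewrite -subr_eq0 opprK -rowmomD addNr rowmom0. Qed.
Lemma rowmomMn j b p k : rowmom j b (p *+ k) = rowmom j b p *+ k.
Proof. by elim: k => [|k IH]; rewrite ?rowmom0 // !mulrS rowmomD IH. Qed.
Lemma rowmomX j b a : rowmom j b 'X^a = (a%:R - b%:R) ^+ j.
Proof.
rewrite /rowmom; have -> : iter j (opz b) 'X^a = (a%:R - b%:R) ^+ j *: 'X^a.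
  elim: j => [|j IH]; first by rewrite expr0 scale1r.
  rewrite iterS IH /opz derivZ derivXn -scalerAr mulrnAr.
  have -> : 'X * 'X^(a.-1) *+ a = 'X^a *+ a :> {poly rat}.
    by case: a {IH} => [|a]; rewrite ?mulr0n // -exprS.
  by rewrite -!scaler_nat !scalerA -scalerBl; congr (_ *: _); rewrite exprS; ring.
by rewrite hornerZ hornerXn expr1n mulr1.
Qed.
Lemma rowmom_sdiv j b F : rowmom j b (sdiv F b) = sdiv (fun d k => rowmom j b (F d k)) b.
Proof. by rewrite /sdiv; apply: (big_morph _ (rowmomD j b) (rowmom0 j b)). Qed.
Lemma rowmom_pm j b k : (k <= b)%N ->
  rowmom j b 'X^(b + k) = k%:R ^+ j /\ rowmom j b 'X^(b - k) = (-1) ^+ j * k%:R ^+ j.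
Proof.
move=> kb; rewrite !rowmomX natrD natrB //.
by split; [|rewrite -exprMn]; congr (_ ^+ _); ring.
Qed.
Lemma sdiv_le d k b : (0 < b)%N -> b = (d * k)%N -> (d <= b)%N.
Proof. by move=> b0 E; apply: dvdn_leq => //; rewrite E dvdn_mulr. Qed.

Lemma mom_V j : mom j Vser = if odd j then phiS j *+ 2 else 0.
Proof.
apply: serP => b; rewrite rowmomE rowmom_sdiv.
case: b => [|b].
  by rewrite sdiv0; case: ifP; rewrite ?serMn /= /Phi ?mul0rn.
have -> : (if odd j then phiS j *+ 2 else 0) b.+1 = sdiv (fun k _ => (1 - (-1) ^+ j) * k%:R ^+ j) b.+1.
  rewrite -(signr_odd _ j) sdivE // -mulr_sumr.
  case: (odd j); last by rewrite expr0 subrr mul0r.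
  rewrite serMn /= /Phi /= /sigma natr_sum mulr2n expr1.
  have -> : \sum_(i <- divisors b.+1) (i ^ j)%:R = \sum_(i <- divisors b.+1) i%:R ^+ j :> rat.
    by apply: eq_bigr => i _; rewrite natrX.
  by ring.
apply: sdiv_eq => // k n k0 /(sdiv_le (ltn0Sn b)) kb.
by rewrite rowmomD rowmomN; have [-> ->] := rowmom_pm j kb; ring.
Qed.

Lemma mom_U j : mom j.*2.+2 User = dq (phiS j.*2.+1) *+ 2.
Proof.
apply: serP => b; rewrite rowmomE rowmom_sdiv serMn dqE.
case: b => [|b]; first by rewrite sdiv0 mul0rn.
rewrite /= /Phi /= /sigma natr_sum -!sumrMnl -(@sdivE _ (fun k _ => (k ^ j.*2.+1)%:R *+ b.+1 *+ 2)) //.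
apply: sdiv_eq => // k n k0 E; have kb := sdiv_le (ltn0Sn b) E.
rewrite rowmomMn !rowmomD; have [-> ->] := rowmom_pm j.*2.+2 kb.
rewrite rowmomX subrr expr0n addr0.
have -> : (-1) ^+ j.*2.+2 = 1 :> rat by rewrite -signr_odd /= odd_double.
rewrite mul1r E natrX exprSr mulr_natr -mulr2n -!mulrnA; congr (_ *+ _).
by rewrite mulnAC mulnA.
Qed.

(** * The auxiliary series [P^-2 C^3] *)

Definition Hgf : SP := emb (Q1 ^+ 2) * Cgf ^+ 3.

Lemma pal_PQ2 : pal (emb (Q1 ^+ 2)).
Proof. by rewrite expr2 rmorphM /= emb_Q1; apply: rvM; exact: pal_PQ. Qed.
Lemma pal_Hgf : pal Hgf.
Proof.
apply: rvM; first exact: pal_PQ2.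
by rewrite /pal !exprS expr0 mulr1; do 2 (apply: rvM; first exact: pal_Cgf); exact: pal_Cgf.
Qed.
Lemma dz_Hgf : dz Hgf = Hgf * (Vser *+ 3).
Proof.
have D3 (x v : SP) : dz x = x * v -> dz (x ^+ 3) = x ^+ 3 * (v *+ 3).
  by move=> E; rewrite !exprS expr0 mulr1 !(derM dz_der) E; ring.
by rewrite /Hgf (derM dz_der (emb _)) dz_emb mul0r add0r (D3 _ _ dz_Cgf) mulrA.
Qed.
Lemma mom0_Hgf : mom 0 Hgf = P1.
Proof.
rewrite mom_emb.
have X (x : SP) : mom 0 (x ^+ 3) = mom 0 x ^+ 3 by exact: rmorphXn.
rewrite (X Cgf) mom0_Cgf !exprS expr0 !mulr1.
have -> : Q1 * Q1 * (P1 * (P1 * P1)) = (Q1 * P1) * (Q1 * P1) * P1 by ring.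
by rewrite Q1_P1 !mul1r.
Qed.
(** This explains the exponents in H: the cube gives 3V and hence 6 P Phi_1 = 6 delta_q P, which
    [full_F] requires, and P^-2 brings the moment of order 0 back to P. *)
Lemma mom2_Hgf : mom 2 Hgf = dq P1 *+ 6.
Proof.
rewrite -(mom_dz 1) dz_Hgf mom_M !big_ord_recl big_ord0 /= !mom_Mn !mom_V /=.
by rewrite mom0_Hgf dq_P1 mul0rn mulr0 mul0rn addr0 mulr1n !mulrnAr -mulrnA.
Qed.

(** * Symmetry under exchange of z and w *)

Lemma iot_cancel (f : SP) (g h : SB) : (f 0%N)`_0 = 1 -> iot f * g = iot f * h -> g = h.
Proof.
move=> f0 /eqP; rewrite -subr_eq0 -mulrBr => /eqP E; apply/eqP; rewrite -subr_eq0; apply/eqP.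
apply: (ser_lreg _ E) => x; apply: ser_lreg1; exact: f0.
Qed.

(** Truncation in w alone is not stable under the exchange, so the coefficient at (b, a) is compared
    at a stage beyond both indices. *)
Lemma swap_lim (f : SP) (u : nat -> SP) :
  (forall N, eqm N f (u N)) -> (forall N, swap (iot (u N)) = iot (u N)) ->
  swap (iot f) = iot f.
Proof.
move=> fu su; apply/swapP => b a.
have E N b' a' : (b' < N)%N -> iot f b' a' = iot (u N) b' a' by move=> bN; rewrite /= (fu N).
rewrite !(E (maxn b a).+1) ?ltnS ?leq_maxl ?leq_maxr //.
exact: ((swapP _).1 (su _)).
Qed.

Lemma iot_fac a m : iot (1 - mono 'X^a m) = 1 - mono (mono 1 a) m.
Proof.
transitivity (iot 1 - iot (mono 'X^a m)); first exact: rmorphB.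
by rewrite iot_mono rmorph1.
Qed.
Lemma swap_fac a m : swap (1 - mono (mono (1 : rat) a) m) = 1 - mono (mono 1 m) a.
Proof.
transitivity (swap 1 - swap (mono (mono 1 a) m)); first exact: rmorphB.
by rewrite swap_mono rmorph1.
Qed.

Lemma swap_theta : swap (iot (zfac * PA * PB)) = iot (zfac * PA * PB).
Proof.
(* The factor 1 - z joins the first product as its term k = 0; the two products are then exchanged
   factor by factor. *)
pose tA N := \prod_(k < N) (1 - mono 'X^(k.+1) k) : SP.
pose tB N := \prod_(k < N) Bfac k : SP.
apply: (@swap_lim _ (fun N => tA N.+1 * tB N.+1)) => N.
  rewrite -mulrA /tA big_ord_recl -/zfac -mulrA; apply: eqmMl; apply: eqmM.
    rewrite (_ : \prod_(i < N) _ = \prod_(m < N) Afac m) //.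
    by apply: iprod_eqm => m; apply: fac_eqm.
  apply: eqm_le (leqnSn N) _; apply: iprod_eqm => m; exact: fac_eqm.
have -> : iot (tA N.+1 * tB N.+1) =
  \prod_(k < N.+1) (1 - mono (mono (1 : rat) k.+1) k) * \prod_(k < N.+1) (1 - mono (mono (1 : rat) k) k.+1).
  rewrite rmorphM !rmorph_prod; congr (_ * _); apply: eq_bigr => k _; exact: iot_fac.
rewrite rmorphM !rmorph_prod mulrC; congr (_ * _); apply: eq_bigr => k _; exact: swap_fac.
Qed.

(** The series 1/(1-z). It is infinite in z, which is the reason for [SB]: the rows of [SP] are
    polynomials. *)
Definition uB : SB := mono (Ser (fun=> 1)) 0.
Lemma zfac_uB : iot zfac * uB = 1.
Proof.
have -> : iot zfac = mono (1 - mono 1 1) 0.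
  rewrite iot_fac -[in LHS]mono1; apply: serP => b; rewrite serB !monoE.
  by case: eqP; rewrite ?subrr.
have E : (1 - mono (1 : rat) 1) * Ser (fun=> 1) = 1.
  apply: serP => a; rewrite mulrBl mul1r serB mono_mul ser1.
  by case: a => [|a]; rewrite /= ?mul1r ?subrr ?subr0.
by rewrite /uB monoM E mono1.
Qed.
(** Multiplication by the symmetric product of [swap_theta] leaves [PQ], a series in q = zw alone;
    that product starts with 1 and cancels. *)
Lemma swap_CuB : swap (iot Cgf * uB) = iot Cgf * uB.
Proof.
have E : iot (zfac * PA * PB) * (iot Cgf * uB) = iot PQ.
  have M (x y : SP) : iot (x * y) = iot x * iot y by exact: rmorphM.
  rewrite -CgfE (M (zfac * PA) PB) (M zfac PA) (M Cgf) (M PA PB).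
  have -> : iot zfac * iot PA * iot PB * (iot Cgf * uB) =
    iot zfac * uB * (iot Cgf * (iot PA * iot PB)) by ring.
  by rewrite zfac_uB mul1r.
have c0 : ((zfac * PA * PB) 0%N)`_0 = 1.
  have -> : (zfac * PA * PB) 0%N = zfac 0%N by rewrite -mulrA serM big_ord1 subnn PAB_0 mulr1.
  by rewrite /zfac serB ser1 monoE /= coefB coef1 coefX subr0.
apply: (iot_cancel c0); rewrite E -{1}swap_theta -rmorphM /= E -emb_Q1.
exact: swap_emb.
Qed.

Lemma swap_HuB : swap (iot Hgf * uB ^+ 3) = iot Hgf * uB ^+ 3.
Proof.
have -> : iot Hgf * uB ^+ 3 = iot (emb (Q1 ^+ 2)) * (iot Cgf * uB) ^+ 3.
  have X3 : iot (Cgf ^+ 3) = iot Cgf ^+ 3 by exact: rmorphXn.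
  have M : iot Hgf = iot (emb (Q1 ^+ 2)) * iot (Cgf ^+ 3) by exact: rmorphM.
  by rewrite M X3 (exprMn 3 (iot Cgf) uB) [RHS]mulrA.
have M (x y : SB) : swap (x * y) = swap x * swap y by exact: rmorphM.
have X (x : SB) k : swap (x ^+ k) = swap x ^+ k by exact: rmorphXn.
by rewrite M X swap_CuB swap_emb.
Qed.

Lemma swap_inv f g f' g' : f * g = 1 -> f' * g' = 1 -> swap f = f' -> swap g = g'.
Proof.
move=> fg fg' E; have H : f' * swap g = 1.
  rewrite -E; transitivity (swap (f * g)); first by rewrite rmorphM.
  by rewrite fg; exact: rmorph1.
by rewrite -[LHS]mul1r -fg' [f' * g']mulrC -mulrA H mulr1.
Qed.

Lemma iot_inv f g : f * g = 1 -> iot f * iot g = 1.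
Proof. by move=> E; transitivity (iot (f * g)); [rewrite rmorphM|rewrite E; exact: rmorph1]. Qed.

Lemma swap_S2 : swap (iot S2) = iot S2.
Proof.
pose al k := qS ^+ 2 * qS ^+ (2 * k) * gB k.+1 * gA k.
have ord n : eqm n (\prod_(k < n) al k) 0.
  elim: n => [|n IH] //; rewrite big_ord_recr /= -addn1; apply: eqm_mul0 => //.
  rewrite -[0](mul0r (qS * qS ^+ (2 * n) * gB n.+1 * gA n)) /al expr2 -!mulrA.
  by apply: eqmMr; exact: q_ord.
apply: (@swap_lim _ (fun N => \sum_(n < N) \prod_(k < n) al k)) => N.
  by rewrite S2E; apply: isum_eqm.
rewrite !rmorph_sum; apply: eq_bigr => n _.
change (swap (iot (\prod_(k < n) al k)) = iot (\prod_(k < n) al k)).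
have -> : iot (\prod_(k < n) al k) = \prod_(k < n) iot (al k) by exact: rmorph_prod.
have -> : swap (\prod_(k < n) iot (al k)) = \prod_(k < n) swap (iot (al k)) by exact: rmorph_prod.
apply: eq_bigr => k _.
have -> : iot (al k) = iot (qS ^+ (2 + 2 * k)) * (iot (gB k.+1) * iot (gA k)).
  by rewrite /al -exprD -mulrA -!rmorphM.
have M (x y : SB) : swap (x * y) = swap x * swap y by exact: rmorphM.
rewrite !M qSX iot_mono swap_mono; congr (_ * _); rewrite mulrC.
have a1 := iot_inv (gAE k); have b1 := iot_inv (gBE k.+1).
rewrite !iot_fac in a1 b1.
by rewrite (swap_inv a1 b1 (swap_fac _ _)) (swap_inv b1 a1 (swap_fac _ _)).
Qed.

(* Kser = (R/(1-z) - 1)/z for the rank generating function R; uB is 1/(1-z). *)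
Definition Kser : SB := iot (S2 * gB 0) * uB.
Lemma swap_K : swap Kser = Kser.
Proof.
have -> : Kser = iot S2 * (iot (gB 0) * uB) by rewrite /Kser mulrA -rmorphM.
have -> : swap (iot S2 * (iot (gB 0) * uB)) = swap (iot S2) * (swap (iot (gB 0)) * swap uB).
  by rewrite !rmorphM.
have b1 := iot_inv (gBE 0); rewrite iot_fac in b1.
have z1 := zfac_uB; rewrite iot_fac in z1.
rewrite swap_S2 (swap_inv b1 z1 (swap_fac _ _)) (swap_inv z1 b1 (swap_fac _ _)).
by congr (_ * _); rewrite mulrC.
Qed.
Definition zB : SB := mono (mono 1 1) 0.
Lemma zK : zB * Kser = iot Rgf * uB - 1.
Proof.
have -> : zB = iot zS by rewrite iot_mono.
have B (x y : SP) : iot (x - y) = iot x - iot y by exact: rmorphB.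
rewrite /Kser mulrA -rmorphM /= mulrA Rgf_S2 B mulrBl zfac_uB //.
Qed.

(** * Reflection of expansions in 1/(1-z) *)

Section Reflection.
Variables (h : nat -> rat) (phi : int -> rat) (e : rat) (r b : nat).
Hypothesis h_sym : forall j, (j <= b.*2)%N -> h j = h (b.*2 - j)%N.
Hypothesis h_big : forall j, (b.*2 < j)%N -> h j = 0.
Hypothesis r0 : (0 < r)%N.
Hypothesis phi_sym : forall x : int, phi (- r%:Z - x) = e * phi x.
Hypothesis phi0 : forall i, (0 < i < r)%N -> phi (- i%:Z) = 0.

Let k a := \sum_(0 <= j < a.+1) phi (a%:Z - j%:Z) * h j.
Let full a := \sum_(0 <= j < b.*2.+1) phi (a%:Z - j%:Z) * h j.

Lemma gap a m : (m <= a + r)%N -> \sum_(a.+1 <= j < m) phi (a%:Z - j%:Z) * h j = 0.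
Proof.
move=> mr; rewrite big_nat big1 // => j /andP[aj jm].
by rewrite (_ : a%:Z - j%:Z = - (j - a)%N%:Z) ?phi0 ?mul0r //; lia.
Qed.

(** [k a] is a coefficient of the expansion at 0, [full a] the same sum over the entire row. The
    next r - 1 terms after [k a] vanish by [phi0]; the rest of the row is, by the symmetries of h
    and phi, e times the partial sum at a'. *)
Lemma reflectE a a' : (a + a' + r = b.*2)%N -> full a = k a + e * k a'.
Proof.
move=> E; rewrite /full (@big_cat_nat _ _ _ a.+1) //=; last by lia.
congr (_ + _); rewrite (@big_cat_nat _ _ _ (a + r)%N) //=; [|lia|lia].
rewrite gap // add0r -{1}[(a + r)%N]add0n big_addn.
have -> : (b.*2.+1 - (a + r) = a'.+1)%N by lia.
rewrite big_nat_rev /= mulr_sumr !big_nat; apply: eq_bigr => i /andP[_ ia].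
rewrite mulrA -phi_sym [in RHS]h_sym; last by lia.
by congr (phi _ * h _); lia.
Qed.

Lemma reflect_big a : (b.*2 < a + r)%N -> full a = k a.
Proof.
move=> E; have [ab|ab] := leqP b.*2 a.
  rewrite /k (@big_cat_nat _ _ _ b.*2.+1) //= [X in _ = _ + X]big_nat [X in _ = _ + X]big1 ?addr0 // => j /andP[bj _].
  by rewrite h_big ?mulr0.
rewrite /full (@big_cat_nat _ _ _ a.+1) //=; last by lia.
by rewrite gap ?addr0 //; lia.
Qed.
End Reflection.

(** Induction on the row b. Entries left of the diagonal belong, by symmetry, to earlier rows;
    entries right of it are reflected to its left or onto it. The last hypothesis treats the
    diagonal: it vanishes, or the centre of reflection lies strictly left of it. *)
Lemma sym_refl_eq0 (x : SB) c s (e : rat) : swap x = x -> (s <= 1)%N ->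
  (forall b a a', (a + a' + c = b.*2 + s)%N -> x b a = e * x b a') ->
  (forall b a, (b.*2 + s < a + c)%N -> x b a = 0) ->
  (forall b, x b b = 0) \/ (0 < c)%N /\ s = 0%N -> x = 0.
Proof.
move=> /swapP sx s1 rx bx dx.
suff H b : forall a, x b a = 0 by apply: serP => b; apply: serP => a.
elim/ltn_ind: b => b IH.
have lt a : (a < b)%N -> x b a = 0 by move=> ab; rewrite sx IH.
move=> a; have [/lt //|ba] := ltnP a b.
have [E|E] := ltnP (b.*2 + s) (a + c); first exact: bx.
case: dx => [dx|[c0 s0]].
  have [->//|ab] := eqVneq a b.
  rewrite (@rx _ _ (b.*2 + s - (a + c))%N); last by lia.
  have [->|nb] := eqVneq (b.*2 + s - (a + c))%N b; first by rewrite dx mulr0.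
  by rewrite lt ?mulr0 //; lia.
by rewrite (@rx _ _ (b.*2 + s - (a + c))%N) ?lt ?mulr0 //; lia.
Qed.

Lemma pal_coef f b : pal f -> (forall j, (j <= b.*2)%N -> (f b)`_j = (f b)`_(b.*2 - j)) /\
  (forall j, (b.*2 < j)%N -> (f b)`_j = 0).
Proof.
move=> pf; have [s E] := pf b; split=> j jb; last by rewrite nth_default // (leq_trans s).
by rewrite {1}E coef_revp.
Qed.

Definition Us : S1 := Ser (fun=> 1).
Lemma Us1 n : (Us ^+ 1) n = 1. Proof. by rewrite expr1. Qed.
Lemma UsS r n : (Us ^+ r.+1) n = \sum_(j < n.+1) (Us ^+ r) j.
Proof. by rewrite exprSr serM; apply: eq_bigr => i _; rewrite mulr1. Qed.
Lemma Us2 n : (Us ^+ 2) n = n.+1%:R.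
Proof. by rewrite UsS; under eq_bigr => i _ do rewrite Us1; rewrite sumr_const card_ord. Qed.
Lemma Us3 n : (Us ^+ 3) n = n.+1%:R * n.+2%:R / 2%:R.
Proof.
rewrite UsS; under eq_bigr => i _ do rewrite Us2.
elim: n => [|n IH]; first by rewrite big_ord1.
by rewrite big_ord_recr /= IH -!natr1; field.
Qed.
Lemma uBX r : uB ^+ r = mono (Us ^+ r) 0.
Proof. by rewrite monoX muln0. Qed.
Lemma coef_uB (f : SP) r b a :
  (iot f * uB ^+ r) b a = \sum_(0 <= j < a.+1) (Us ^+ r) (a - j)%N * (f b)`_j.
Proof.
rewrite mulrC uBX mono_mul subn0 leq0n [Us ^+ r * _]mulrC serM big_mkord.
by apply: eq_bigr => j _; rewrite mulrC.
Qed.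

(** * The rank-crank differential equation *)

Lemma coef_z_mul (f : SB) b a : (zB * f) b a.+1 = f b a.
Proof. by rewrite mono_mul subn0 mono_mul subSS subn0 mul1r. Qed.
Lemma coef_z_mul0 (f : SB) b : (zB * f) b 0%N = 0.
Proof. by rewrite mono_mul subn0 mono_mul. Qed.

Lemma mom_sum (f : SP) b j : pal f -> mom j f b = \sum_(0 <= a < b.*2.+1) (a%:R - b%:R) ^+ j * (f b)`_a.
Proof. by move=> pf; rewrite (momE j (pf b).1) big_mkord. Qed.

Lemma mom0_Rgf_sum b : \sum_(0 <= a < b.*2.+1) (Rgf b)`_a = mom 0 Rgf b.
Proof. by rewrite (mom_sum _ _ pal_Rgf); apply: eq_bigr => a _; rewrite expr0 mul1r. Qed.

Lemma coef_K b a : Kser b a = (iot Rgf * uB) b a.+1.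
Proof.
rewrite -coef_z_mul zK !serB ser1.
by have -> : ((b == 0%N)%:R : S1) a.+1 = 0; [case: b|rewrite subr0].
Qed.

Definition one_int (x : int) : rat := 1.
Lemma one_int_refl (x : int) : one_int (- 1%:Z - x) = 1 * one_int x.
Proof. by rewrite mul1r. Qed.
Lemma one_int0 i : (0 < i < 1)%N -> one_int (- i%:Z) = 0.
Proof. by case: i => [|[|i]]. Qed.
Lemma coef_Ru b a : (iot Rgf * uB) b a =
  \sum_(0 <= j < a.+1) one_int (a%:Z - j%:Z) * (Rgf b)`_j.
Proof. by rewrite -(expr1 uB) coef_uB; apply: eq_bigr => j _; rewrite Us1. Qed.
Lemma mom0_Rgf_one a b : mom 0 Rgf b = \sum_(0 <= j < b.*2.+1) one_int (a%:Z - j%:Z) * (Rgf b)`_j.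
Proof. by rewrite -mom0_Rgf_sum; apply: eq_bigr => j _; rewrite mul1r. Qed.

(** R/(1-z) reflects with r = 1; the division by z in K shifts both indices by one, which yields the
    centre of reflection of 1/(1-z)^3. *)
Lemma K_refl b a a' : (a + a' + 3 = b.*2)%N -> Kser b a + Kser b a' = mom 0 Rgf b.
Proof.
move=> E; have [hs _] := pal_coef b pal_Rgf.
rewrite !coef_K !coef_Ru (mom0_Rgf_one a.+1).
rewrite (@reflectE _ _ 1 1 b hs isT one_int_refl one_int0 a.+1 a'.+1) ?mul1r //.
by lia.
Qed.

Lemma K_big b a : (b.*2 < a + 3)%N -> Kser b a = mom 0 Rgf b.
Proof.
move=> E; rewrite coef_K coef_Ru (mom0_Rgf_one a.+1).
have [hs hb] := pal_coef b pal_Rgf.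
have [E'|E'] := ltnP b.*2 (a + 2)%N.
  by rewrite (@reflect_big _ _ 1 b hb isT one_int0) //; lia.
have Eb : (b.*2 = a + 2)%N by lia.
(* The index a = 2b - 2 still has a reflected partner, the coefficient of q^b z^-b. It is 0 because
   R - (1 - z) is divisible by z. *)
have R0 : (Rgf b)`_0 = 0.
  have : (Rgf - zfac) b = zS 0%N * (S2 * gB 0) b.
    by rewrite -Rgf_S2 -mulrA mono_mul subn0.
  rewrite serB monoE eqxx expr1 /zfac serB ser1 monoE.
  case: b Eb {E E' hs hb} => [|b] Eb; first by lia.
  by rewrite /= !subr0 => ->; rewrite coefXM.
rewrite (@reflectE _ _ 1 1 b hs isT one_int_refl one_int0 a.+1 0%N); last by lia.
by rewrite big_nat1 R0 !mulr0 addr0.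
Qed.

Lemma serD2 (x y : SB) b a : (x + y) b a = x b a + y b a. Proof. by []. Qed.
Lemma serMn2 (x : SB) k b a : (x *+ k) b a = x b a *+ k.
Proof. by rewrite !serMn. Qed.
Lemma serB2 (x y : SB) b a : (x - y) b a = x b a - y b a. Proof. by []. Qed.

(** The rank-crank operator carried over from R to K. Its multiplier is [wt b a] = (a - b)^2 + 3 (a
    + b) + 2, visibly symmetric in a and b. *)
Definition KD : SB := dq Kser *+ 6 + dzB (dzB Kser) + dzB Kser *+ 3 + Kser *+ 2.
Definition wt (b a : nat) : rat :=
  6%:R * b%:R + (a%:R - b%:R) ^+ 2 + 3%:R * (a%:R - b%:R) + 2%:R.
Lemma coef_KD b a : KD b a = wt b a * Kser b a.
Proof.
have E1 := dzBE Kser b a; have E2 := dzBE (dzB Kser) b a; rewrite {}E1 in E2.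
have E1 := dzBE Kser b a; have E3 : dq Kser b a = b%:R * Kser b a by rewrite dqE serMn mulr_natl.
rewrite /KD; move: (dzB (dzB Kser)) (dzB Kser) (dq Kser) E1 E2 E3 => d2 d1 d0 E1 E2 E3.
by rewrite 3!serD2 !serMn2 E1 E2 E3 /wt; ring.
Qed.
Lemma swap_KD : swap KD = KD.
Proof.
apply/swapP => b a; rewrite !coef_KD ((swapP _).1 swap_K b a); congr (_ * _).
by rewrite /wt; ring.
Qed.

(** Twice the coefficient of z^x in 1/(1-z)^3, extended to all integers; it vanishes at -1 and
    -2. *)
Definition phi3 (x : int) : rat := (x%:~R + 1) * (x%:~R + 2%:R).
Lemma phi3_refl (x : int) : phi3 (- 3%:Z - x) = 1 * phi3 x.
Proof. by rewrite /phi3 rmorphB rmorphN /= mul1r; ring. Qed.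
Lemma phi30 i : (0 < i < 3)%N -> phi3 (- i%:Z) = 0.
Proof. by case: i => [|[|[|i]]]. Qed.
Lemma phi3_nat a j : (j <= a)%N -> phi3 (a%:Z - j%:Z) = (Us ^+ 3) (a - j)%N *+ 2.
Proof.
move=> ja; rewrite subzn // Us3 /phi3 -!pmulrn.
by rewrite -addn2 -addn1 !natrD; field.
Qed.
Lemma coef_F b a : (iot Hgf * uB ^+ 3 *+ 2) b a =
  \sum_(0 <= j < a.+1) phi3 (a%:Z - j%:Z) * (Hgf b)`_j.
Proof.
rewrite serMn2 coef_uB -sumrMnl big_nat [RHS]big_nat; apply: eq_bigr => j /andP[_ ja].
by rewrite phi3_nat // mulrnAl.
Qed.
(** Expanded about j = b, the sum involves the moments of H of order 0, 1 and 2. The value 6 delta_q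
    P of the last one supplies the summand 6b of the weight. *)
Lemma full_F b a : \sum_(0 <= j < b.*2.+1) phi3 (a%:Z - j%:Z) * (Hgf b)`_j = wt b a * P1 b.
Proof.
have [G GE] : exists G : nat -> nat -> rat, forall d j, G d j = (j%:R - b%:R) ^+ d * (Hgf b)`_j.
  by exists (fun d j => (j%:R - b%:R) ^+ d * (Hgf b)`_j).
have E j : phi3 (a%:Z - j%:Z) * (Hgf b)`_j =
  ((a%:R - b%:R) ^+ 2 + 3%:R * (a%:R - b%:R) + 2%:R) * G 0%N j
  - (2%:R * (a%:R - b%:R) + 3%:R) * G 1%N j + G 2%N j.
  by rewrite !GE /phi3 rmorphB /= -!pmulrn; ring.
have S d : \sum_(0 <= j < b.*2.+1) G d j = mom d Hgf b.
  by rewrite (mom_sum _ _ pal_Hgf); apply: eq_bigr => j _; rewrite GE.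
rewrite (eq_bigr _ (fun j _ => E j)) big_split /= sumrB -!mulr_sumr !S.
rewrite mom0_Hgf mom2_Hgf (mom_pal pal_Hgf) // ser0 serMn dqE /wt.
by rewrite mulr0 subr0 -(mulr_natr (P1 b) b); rewrite -[Pq b]/(P1 b); ring.
Qed.

Lemma F_refl b a a' : (a + a' + 3 = b.*2)%N ->
  (iot Hgf * uB ^+ 3 *+ 2) b a + (iot Hgf * uB ^+ 3 *+ 2) b a' = wt b a * P1 b.
Proof.
move=> E; rewrite !coef_F -full_F; have [hs hb] := pal_coef b pal_Hgf.
by rewrite (@reflectE _ _ 1 3 b hs isT phi3_refl phi30 a a') ?mul1r.
Qed.
Lemma F_big b a : (b.*2 < a + 3)%N -> (iot Hgf * uB ^+ 3 *+ 2) b a = wt b a * P1 b.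
Proof.
move=> E; rewrite !coef_F -full_F; have [hs hb] := pal_coef b pal_Hgf.
by rewrite (@reflect_big _ _ 3 b hb isT phi30).
Qed.
Lemma wt_refl b a a' : (a + a' + 3 = b.*2)%N -> wt b a' = wt b a.
Proof.
move=> E; have E' : (a + a' + 3)%:R = (b + b)%:R :> rat by rewrite E addnn.
rewrite !natrD in E'; rewrite /wt.
have -> : a'%:R = b%:R + b%:R - a%:R - 3%:R :> rat by rewrite -E'; ring.
by ring.
Qed.

Lemma lin (x x' w k k' : rat) : x + x' = w * (k + k') -> x - w * k = -1 * (x' - w * k').
Proof. by move=> E; rewrite -[x](addrK x') E; ring. Qed.

Lemma rank_crank_coef : mom 0 Rgf = P1 -> iot Hgf * uB ^+ 3 *+ 2 = KD.
Proof.
move=> R0; apply/eqP; rewrite -subr_eq0; apply/eqP.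
apply: (@sym_refl_eq0 _ 3 0 (-1)) => //.
- have B (x y : SB) : swap (x - y) = swap x - swap y by exact: rmorphB.
  have D (x : SB) : swap (x *+ 2) = swap x *+ 2 by exact: rmorphMn.
  by rewrite B D swap_HuB swap_KD.
- move=> b a a'; rewrite addn0 => E; rewrite !serB2 !coef_KD.
  have := F_refl E; have := K_refl E; rewrite R0 (wt_refl E) => <- F.
  exact: lin F.
- by move=> b a; rewrite addn0 => E; rewrite serB2 coef_KD F_big // K_big // R0 subrr.
- by right.
Qed.

Lemma dz_uB : dzB uB = zB * uB ^+ 2.
Proof.
have E : dzB (iot zfac * uB) = 0 by rewrite zfac_uB (der1 dzB_der).
have zf : iot zfac = 1 - zB by rewrite iot_fac.
have dzf : dzB zB = zB.
  by rewrite -[zB]iot_mono -iot_dz dz_mono mulr0n subr0.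
move: E; rewrite (derM dzB_der) {1}zf (derB dzB_der) (der1 dzB_der) dzf sub0r => E.
have u1 := zfac_uB.
have -> : dzB uB = uB * (- zB * uB + iot zfac * dzB uB) + zB * uB ^+ 2
  + (1 - iot zfac * uB) * dzB uB by ring.
by rewrite E u1; ring.
Qed.

Section PDE.
Variables (R : comNzRingType) (z u r r1 r2 rq H k kq k1 k2 f : R).
(** Here f, u, r, k stand for 1 - z, 1/(1-z), R and K, with the suffixes 1, 2, q for derivatives.
    Multiplying by z f^3 and using f u = 1 eliminates u and k. *)
Lemma pde_algebra : f * u = 1 -> f = 1 - z -> z * k = r * u - 1 ->
  z * kq = rq * u -> z * k1 = (r1 * u + r * (z * u ^+ 2)) - (r * u - 1) ->
  z * k2 + z * k1 = (r2 * u + r1 * (z * u ^+ 2) *+ 2 +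
     r * (z * u ^+ 2 + z * u * (z * u ^+ 2) *+ 2)) - (r1 * u + r * (z * u ^+ 2)) ->
  H * u ^+ 3 *+ 2 = kq *+ 6 + k2 + k1 *+ 3 + k *+ 2 ->
  z * H *+ 2 = f ^+ 2 * rq *+ 6 + f ^+ 2 * r2 + (1 - z ^+ 2) * r1 + z * r *+ 2.
Proof.
move=> fu fz zk zkq zk1 zk2 E.
have -> : z * H *+ 2 = f ^+ 3 * (z * (H * u ^+ 3 *+ 2)) + z * H *+ 2 * (1 - (f * u) ^+ 3) by ring.
rewrite fu E.
have -> : z * (kq *+ 6 + k2 + k1 *+ 3 + k *+ 2) =
  z * kq *+ 6 + (z * k2 + z * k1) + z * k1 *+ 2 + z * k *+ 2 by ring.
rewrite zk2 zk1 zk zkq.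
have -> : f ^+ 3 * (rq * u *+ 6 + (r2 * u + r1 * (z * u ^+ 2) *+ 2 +
  r * (z * u ^+ 2 + z * u * (z * u ^+ 2) *+ 2) - (r1 * u + r * (z * u ^+ 2))) +
  (r1 * u + r * (z * u ^+ 2) - (r * u - 1)) *+ 2 + (r * u - 1) *+ 2) =
  f ^+ 2 * rq *+ 6 * (f * u) + f ^+ 2 * (f * u) * (r2 + r1) + f * (f * u) ^+ 2 * (z * r1 *+ 2 + r * z *+ 2) +
  (f * u) ^+ 3 * r * z ^+ 2 *+ 2 by ring.
by rewrite fu fz; ring.
Qed.
End PDE.

Lemma rank_crank_pde : mom 0 Rgf = P1 ->
  zS * Hgf *+ 2 = zfac ^+ 2 * dq Rgf *+ 6 + zfac ^+ 2 * dz (dz Rgf) +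
     (1 - zS ^+ 2) * dz Rgf + zS * Rgf *+ 2.
Proof.
move=> /rank_crank_coef E.
have dzf : dzB zB = zB by rewrite -[zB]iot_mono -iot_dz dz_mono mulr0n subr0.
have dqz : dq zB = 0 by rewrite dq_mono.
have dqu : dq uB = 0 by rewrite dq_mono.
have zf : iot zfac = 1 - zB by rewrite iot_fac.
have DK : zB * dzB Kser = dzB (iot Rgf) * uB + iot Rgf * (zB * uB ^+ 2) - (iot Rgf * uB - 1).
  have := congr1 dzB zK; rewrite (derM dzB_der zB) dzf (derB dzB_der) (der1 dzB_der) subr0.
  by rewrite (derM dzB_der (iot Rgf)) dz_uB -zK => <-; rewrite addrC addKr.
have := @pde_algebra _ zB uB (iot Rgf) (iot (dz Rgf)) (iot (dz (dz Rgf))) (iot (dq Rgf)) (iot Hgf)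
   Kser (dq Kser) (dzB Kser) (dzB (dzB Kser)) (iot zfac) zfac_uB zf zK.
move=> /(_ _ _ _ E) H.
apply: iot_inj.
have M (x y : SP) : iot (x * y) = iot x * iot y by exact: rmorphM.
have D (x y : SP) : iot (x + y) = iot x + iot y by exact: rmorphD.
have B (x y : SP) : iot (x - y) = iot x - iot y by exact: rmorphB.
have N (x : SP) k : iot (x *+ k) = iot x *+ k by exact: rmorphMn.
have X (x : SP) k : iot (x ^+ k) = iot x ^+ k by exact: rmorphXn.
have zBE : iot zS = zB by exact: iot_mono.
rewrite N (M zS Hgf) zBE H.
- have E1 : iot (zfac ^+ 2 * dq Rgf *+ 6) = iot zfac ^+ 2 * iot (dq Rgf) *+ 6.
    by rewrite N (M (zfac ^+ 2) (dq Rgf)) (X zfac 2%N).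
  have E2 : iot (zfac ^+ 2 * dz (dz Rgf)) = iot zfac ^+ 2 * iot (dz (dz Rgf)).
    by rewrite (M (zfac ^+ 2) (dz (dz Rgf))) (X zfac 2%N).
  have E3 : iot ((1 - zS ^+ 2) * dz Rgf) = (1 - zB ^+ 2) * iot (dz Rgf).
    by rewrite (M (1 - zS ^+ 2) (dz Rgf)) (B 1 (zS ^+ 2)) (X zS 2%N) zBE (rmorph1 iot).
  have E4 : iot (zS * Rgf *+ 2) = zB * iot Rgf *+ 2 by rewrite N (M zS Rgf) zBE.
  by rewrite -E1 -E2 -E3 -E4 -!D.
- have := congr1 (@dq _) zK; rewrite (derM (@dq_der _) zB) dqz mul0r add0r (derB (@dq_der _)).
  by rewrite (der1 (@dq_der _)) subr0 (derM (@dq_der _) (iot Rgf)) dqu mulr0 addr0 iot_dq.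
- by rewrite iot_dz.
- have EL : dzB (zB * dzB Kser) = zB * dzB (dzB Kser) + zB * dzB Kser.
    by rewrite (derM dzB_der zB) dzf addrC.
  rewrite -EL DK (derB dzB_der) (derD dzB_der) (derB dzB_der) (der1 dzB_der).
  rewrite (derM dzB_der (dzB (iot Rgf))) (derM dzB_der (iot Rgf) (zB * _)).
  rewrite (derM dzB_der (iot Rgf) uB) (derM dzB_der zB) dzf expr2 (derM dzB_der uB) dz_uB !iot_dz.
  by ring.
Qed.

Definition V1 : SP := Ser (fun b => sdiv (fun k _ => ('X^(b + k) + 'X^(b - k)) *+ k) b).

Lemma opzD b p r : opz b (p + r) = opz b p + opz b r.
Proof. by rewrite /opz derivD mulrnDl; ring. Qed.
Lemma opz0 b : opz b 0 = 0. Proof. by rewrite /opz deriv0 mulr0 mul0rn subrr. Qed.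
Lemma opzN b p : opz b (- p) = - opz b p.
Proof. by apply/eqP; rewrite -subr_eq0 opprK -opzD addNr opz0. Qed.
Lemma opzX b a : opz b 'X^a = 'X^a *+ a - 'X^a *+ b.
Proof.
rewrite /opz derivXn mulrnAr; congr (_ - _).
by case: a => [|a]; rewrite ?mulr0n // -exprS.
Qed.

Lemma dz_V : dz Vser = V1.
Proof.
apply: serP => b; rewrite -[LHS]/(opz b (sdiv _ b)) /sdiv.
rewrite (big_morph _ (opzD b) (opz0 b)) /= big_nat_cond [RHS]big_nat_cond.
apply: eq_bigr => k /andP[/andP[_ kb] _].
rewrite opzD opzN !opzX mulrnDl (mulrnDr _ b k) [X in X - _ = _]addrAC subrr add0r; congr (_ + _).
have E : (b = (b - k) + k)%N by rewrite subnK // -ltnS.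
by rewrite {4}E mulrnDr opprB addrC addKr.
Qed.

Definition palrow b (p : {poly rat}) := (size p <= b.*2.+1)%N /\ p = revp b.*2 p.
Lemma palrowD b p r : palrow b p -> palrow b r -> palrow b (p + r).
Proof.
move=> [sp ep] [sr er]; split.
  by apply: (leq_trans (size_polyD _ _)); rewrite geq_max sp sr.
rewrite {1}ep {1}er; apply/polyP => i; rewrite coefD !coef_poly.
by case: ltnP; rewrite ?addr0 // coefD.
Qed.
Lemma palrow0 b : palrow b 0.
Proof. by have := rv0 b; rewrite !ser0. Qed.
Lemma palrowMn b p k : palrow b p -> palrow b (p *+ k).
Proof. by move=> H; elim: k => [|k IH]; rewrite ?mulrS; [exact: palrow0|apply: palrowD]. Qed.
Lemma palrow_pm b k : (k <= b)%N -> palrow b ('X^(b + k) + 'X^(b - k)).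
Proof.
move=> kb; have H1 := @rv_mono (b + k) b _ b; have H2 := @rv_mono (b - k) b _ b.
rewrite !monoE eqxx in H1 H2.
have {}[|s1 e1] := H1; first by lia.
have {}[|s2 e2] := H2; first by lia.
split; first by apply: (leq_trans (size_polyD _ _)); rewrite geq_max s1 s2.
have E1 : (b.*2 - (b + k) = b - k)%N by lia.
have E2 : (b.*2 - (b - k) = b + k)%N by lia.
rewrite E1 in e1; rewrite E2 in e2; rewrite {1}e1 {1}e2 addrC.
apply/polyP => i; rewrite coefD !coef_poly.
by case: ltnP; rewrite ?addr0 // coefD.
Qed.
Lemma pal_V1 : pal V1.
Proof.
move=> b; rewrite -/(palrow b (V1 b)) /= /sdiv big_nat_cond.
elim/big_rec: _ => [|k p /andP[/andP[_ kb] _] H]; first exact: palrow0.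
by apply: palrowD => //; apply: palrowMn; apply: palrow_pm; rewrite -ltnS.
Qed.

Lemma mom_V1 j : mom j V1 = mom j.+1 Vser.
Proof. by rewrite -dz_V mom_dz. Qed.

Lemma pal_reflect f b a a' : pal f -> (a + a' = b.*2)%N -> iot f b a = iot f b a'.
Proof.
move=> /(pal_coef b)[H _] E; rewrite -[LHS]/((f b)`_a) H; last by lia.
by congr (_`_ _); lia.
Qed.
Lemma pal_big f b a : pal f -> (b.*2 < a)%N -> iot f b a = 0.
Proof. by move=> /(pal_coef b)[_ H] E; rewrite -[LHS]/((f b)`_a) H. Qed.

(** * The Weierstrass equation *)

(** The Weierstrass function in the multiplicative variable z, up to scaling and an additive
    multiple of E2. *)
Definition wp : SB := zB * uB ^+ 2 + iot V1.

Definition dist (a b : nat) := ((a - b) + (b - a))%N.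
(** The pole part z/(1-z)^2 is the row b = 0 of the same rule, since every a divides 0. Symmetry
    follows because |a - b| divides b exactly when it divides a. *)
Lemma coef_wp b a : wp b a = if (dist a b %| b)%N then (dist a b)%:R else 0.
Proof.
rewrite /wp serD2 /zB uBX monoM add0n.
case: b => [|b].
  rewrite {2}/dist dvdn0 /dist subn0 sub0n addn0 monoE eqxx mono_mul.
  have V10 : V1 0%N = 0 by exact: sdiv0.
  rewrite -[iot V1 0%N a]/((V1 0%N)`_a) V10 coef0 addr0.
  by case: a => [|a] //; rewrite mul1r Us2 subn1.
have -> : mono (mono 1 1 * Us ^+ 2) 0 b.+1 a = 0 :> rat by [].
rewrite add0r -[LHS]/((sdiv (fun k _ => ('X^(b.+1 + k) + 'X^(b.+1 - k)) *+ k) b.+1 : {poly rat})`_a) /sdiv coef_sum.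
have [t tE] : exists t, t = dist a b.+1 by exists (dist a b.+1).
rewrite -tE; have tE' : t = ((a - b.+1) + (b.+1 - a))%N by [].
have E k : (0 < k <= b.+1)%N ->
   ((('X^(b.+1 + k) + 'X^(b.+1 - k)) *+ k : {poly rat}))`_a = if k == t then t%:R else 0.
  move=> kb; rewrite coefMn coefD !coefXn.
  have [kE|kE] := eqVneq k t.
    have [aE|aE] : (a = b.+1 + k \/ a = b.+1 - k)%N by lia.
      have h1 : (a == b.+1 + k)%N by rewrite aE.
      have h2 : (a == b.+1 - k)%N = false by lia.
      by rewrite h1 h2 addr0 -kE.
    have h1 : (a == b.+1 - k)%N by rewrite aE.
    have h2 : (a == b.+1 + k)%N = false by lia.
    by rewrite h1 h2 add0r -kE.
  have h1 : (a == b.+1 - k)%N = false by lia.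
  have h2 : (a == b.+1 + k)%N = false by lia.
  by rewrite h1 h2 addr0 mul0rn.
rewrite big_nat_cond (eq_bigr (fun k => if k == t then t%:R else 0)); last first.
  by move=> k /andP[/andP[k0 kb] _]; rewrite E // k0.
case: ifP => tb; last first.
  by rewrite big1 // => k /andP[_ kb]; case: eqP => // kt; rewrite -kt kb in tb.
have [t0|t0] := posnP t.
  by rewrite big1 t0 // => k /andP[/andP[k0 _] _]; case: eqP => // k1; rewrite k1 in k0.
have tbl : (t <= b.+1)%N by apply: dvdn_leq.
rewrite -big_nat_cond -big_filter.
have tin : t \in [seq k <- index_iota 1 b.+2 | (k %| b.+1)%N].
  by rewrite mem_filter tb mem_index_iota t0 ltnS.
rewrite (bigD1_seq t tin) ?filter_uniq ?iota_uniq //=.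
rewrite eqxx big1 ?addr0 //.
by move=> k /negbTE ->.
Qed.
Lemma swap_wp : swap wp = wp.
Proof.
apply/swapP => b a; rewrite !coef_wp.
have -> : dist b a = dist a b by rewrite /dist addnC.
congr (if _ then _ else _).
have [ab|ba] := leqP b a.
  have H d : a = (b + d)%N -> (d %| b)%N = (d %| a)%N by move=> ->; rewrite dvdn_addl.
  by apply: H; rewrite /dist; lia.
have H d : b = (a + d)%N -> (d %| b)%N = (d %| a)%N by move=> ->; rewrite dvdn_addl.
by apply: H; rewrite /dist; lia.
Qed.

Definition phi2 (x : int) : rat := x%:~R + 1.
Lemma phi2_refl (x : int) : phi2 (- 2%:Z - x) = -1 * phi2 x.
Proof. by rewrite /phi2 rmorphB rmorphN /=; ring. Qed.
Lemma phi20 i : (0 < i < 2)%N -> phi2 (- i%:Z) = 0.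
Proof. by case: i => [|[|i]]. Qed.

(** Subtracting 2 Phi_1 makes V1 vanish at z = 1. By the symmetry z -> 1/z the first moment vanishes
    as well, so each row of V0 is divisible by (1-z)^2. *)
Definition V0 : SP := V1 - emb (phiS 1 *+ 2).
Lemma pal_emb f : pal (emb f).
Proof.
move=> b; have [s e] := @rv_mono b b (leq_trans (leq_addr b b) (eq_leq (addnn b))) b.
rewrite !monoE eqxx -addnn addnK addnn in s e; split; first exact: leq_trans (size_scale_leq _ _) s.
apply/polyP => i; rewrite -[emb f b]/(f b *: 'X^b) {1}e coefZ !coef_poly.
by case: ltnP; rewrite ?mulr0 // coefZ.
Qed.
Lemma pal_V0 : pal V0. Proof. by apply: rvB; [exact: pal_V1|exact: pal_emb]. Qed.
Lemma mom0_emb f : mom 0 (emb f) = f.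
Proof. by rewrite -[emb f]mulr1 mom_emb -[mom 0 1]/(ev1 1) rmorph1 mulr1. Qed.
Lemma momB0 x y : mom 0 (x - y) = mom 0 x - mom 0 y. Proof. exact: rmorphB. Qed.
Lemma mom0_V0 : mom 0 V0 = 0.
Proof. by rewrite /V0 momB0 mom_V1 mom_V mom0_emb subrr. Qed.

Lemma coef_V0u b a : (iot V0 * uB ^+ 2) b a =
  \sum_(0 <= j < a.+1) phi2 (a%:Z - j%:Z) * (V0 b)`_j.
Proof.
rewrite coef_uB big_nat [RHS]big_nat; apply: eq_bigr => j /andP[_ ja].
by rewrite Us2 subzn // /phi2 -pmulrn natr1.
Qed.
Lemma full_V0 b a : \sum_(0 <= j < b.*2.+1) phi2 (a%:Z - j%:Z) * (V0 b)`_j = 0.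
Proof.
have [G GE] : exists G : nat -> nat -> rat, forall d j, G d j = (j%:R - b%:R) ^+ d * (V0 b)`_j.
  by exists (fun d j => (j%:R - b%:R) ^+ d * (V0 b)`_j).
have E j : phi2 (a%:Z - j%:Z) * (V0 b)`_j = (a%:R - b%:R + 1) * G 0%N j - G 1%N j.
  by rewrite !GE /phi2 rmorphB /= -!pmulrn; ring.
have S d : \sum_(0 <= j < b.*2.+1) G d j = mom d V0 b.
  by rewrite (mom_sum _ _ pal_V0); apply: eq_bigr => j _; rewrite GE.
rewrite (eq_bigr _ (fun j _ => E j)) sumrB -!mulr_sumr !S.
by rewrite mom0_V0 (mom_pal pal_V0) // ser0 mulr0 subrr.
Qed.

Lemma V0u_refl b a a' : (a + a' = b.*2)%N -> (zB * (iot V0 * uB ^+ 2)) b a = (zB * (iot V0 * uB ^+ 2)) b a'.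
Proof.
have [hs hb] := pal_coef b pal_V0.
wlog aa' : a a' / (a <= a')%N.
  move=> W E; have [?|/ltnW ?] := leqP a a'; first exact: W.
  by apply/esym/W; rewrite // addnC.
case: a aa' => [|a] aa' E; last first.
  case: a' aa' E => // a' _ E; rewrite !coef_z_mul !coef_V0u.
  have := @reflectE _ _ (-1) 2 b hs isT phi2_refl phi20 a a'.
  rewrite full_V0 => H; apply/eqP; rewrite -subr_eq0; apply/eqP.
  by rewrite -mulN1r -H //; lia.
rewrite coef_z_mul0; case: a' aa' E => [|a'] _ E; first by rewrite coef_z_mul0.
by rewrite coef_z_mul coef_V0u -(@reflect_big _ _ 2 b hb isT phi20) ?full_V0 //; lia.
Qed.
Lemma V0u_big b a : (b.*2 < a)%N -> (zB * (iot V0 * uB ^+ 2)) b a = 0.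
Proof.
have [hs hb] := pal_coef b pal_V0; case: a => // a E.
by rewrite coef_z_mul coef_V0u -(@reflect_big _ _ 2 b hb isT phi20) ?full_V0 //; lia.
Qed.

(** In [wp_ode_regular] the summand 1 cancels the linear term of the pole part, and 24 Phi_1 turns
    12 V1 into 12 V0, which removes the double pole. *)
Definition E2S : S1 := 1 - phiS 1 *+ 24.

(* The pole part satisfies p'' = 6 p^2 + p identically. *)
Lemma wp_ode_regular :
  wp ^+ 2 *+ 6 - dzB (dzB wp) + iot (emb E2S) * wp =
  zB * (iot V0 * uB ^+ 2) *+ 12 + iot (V1 ^+ 2 *+ 6 - dz (dz V1) + emb E2S * V1).
Proof.
have dzf : dzB zB = zB by rewrite -[zB]iot_mono -iot_dz dz_mono mulr0n subr0.
have zf : iot zfac = 1 - zB by rewrite iot_fac.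
have M (x y : SP) : iot (x * y) = iot x * iot y by exact: rmorphM.
have D (x y : SP) : iot (x + y) = iot x + iot y by exact: rmorphD.
have B (x y : SP) : iot (x - y) = iot x - iot y by exact: rmorphB.
have N (x : SP) k : iot (x *+ k) = iot x *+ k by exact: rmorphMn.
have X (x : SP) k : iot (x ^+ k) = iot x ^+ k by exact: rmorphXn.
have Ee : iot (emb E2S) = 1 - iot (emb (phiS 1)) *+ 24.
  have -> : emb E2S = 1 - emb (phiS 1) *+ 24.
    by rewrite /E2S -(rmorph1 emb) -rmorphMn; exact: rmorphB.
  by rewrite B N (rmorph1 iot).
have -> : iot (V1 ^+ 2 *+ 6 - dz (dz V1) + emb E2S * V1) =
   iot V1 ^+ 2 *+ 6 - dzB (dzB (iot V1)) + iot (emb E2S) * iot V1.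
  by rewrite (D (V1 ^+ 2 *+ 6 - dz (dz V1))) (B (V1 ^+ 2 *+ 6)) N (X V1) (M (emb E2S)) !iot_dz.
have -> : iot V0 = iot V1 - iot (emb (phiS 1)) *+ 2.
  have -> : V0 = V1 - emb (phiS 1) *+ 2 by rewrite /V0 -rmorphMn.
  by rewrite (B V1) N.
have d1 : dzB (zB * uB ^+ 2) = zB * uB ^+ 2 + zB ^+ 2 * uB ^+ 3 *+ 2.
  by rewrite (derM dzB_der zB) dzf expr2 (derM dzB_der uB) dz_uB; ring.
have d2 : dzB (dzB (zB * uB ^+ 2)) = zB * uB ^+ 2 + zB ^+ 2 * uB ^+ 3 *+ 6 + zB ^+ 3 * uB ^+ 4 *+ 6.
  rewrite d1 (derD dzB_der) d1 (derMn dzB_der) (derM dzB_der (zB ^+ 2)) expr2 (derM dzB_der zB) dzf.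
  by rewrite !exprS !expr0 !mulr1 !(derM dzB_der uB) !dz_uB; ring.
rewrite /wp (derD dzB_der (zB * uB ^+ 2)) (derD dzB_der (dzB (zB * uB ^+ 2))) d2 Ee.
move: (dzB (dzB (iot V1))) (iot V1) (iot (emb (phiS 1))) => v2 v f1.
have u1 : uB = 1 + zB * uB by have := zfac_uB; rewrite zf mulrBl mul1r => /eqP; rewrite subr_eq => /eqP.
have key : (zB * uB ^+ 2) ^+ 2 *+ 6 = zB ^+ 2 * uB ^+ 3 *+ 6 + zB ^+ 3 * uB ^+ 4 *+ 6.
  have -> : (zB * uB ^+ 2) ^+ 2 *+ 6 = zB ^+ 2 * uB ^+ 3 * uB *+ 6 by ring.
  by rewrite {2}u1; ring.
have -> : (zB * uB ^+ 2 + v) ^+ 2 *+ 6 = (zB * uB ^+ 2) ^+ 2 *+ 6 + zB * uB ^+ 2 * v *+ 12 + v ^+ 2 *+ 6 by ring.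
by rewrite key; ring.
Qed.

Lemma serBD2 (x y z : SB) b a : (x - y + z) b a = x b a - y b a + z b a. Proof. by []. Qed.
Lemma serMD2 (x y : SB) k b a : (x *+ k + y) b a = x b a *+ k + y b a.
Proof. by rewrite serD2 serMn2. Qed.
Lemma wp_ode : exists kap, zS * V0 *+ 12 + zfac ^+ 2 * (V1 ^+ 2 *+ 6 - dz (dz V1) + emb E2S * V1) =
   zfac ^+ 2 * emb kap.
Proof.
have [X X0] : exists X : SB, X = wp ^+ 2 *+ 6 - dzB (dzB wp) + iot (emb E2S) * wp.
  by exists (wp ^+ 2 *+ 6 - dzB (dzB wp) + iot (emb E2S) * wp).
(* The unknown constant is read off the diagonal, the place of the powers of q = zw, so that the
   difference vanishes there. *)
pose kap := Ser (fun b => X b b) : S1; exists kap.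
have palR : pal (V1 ^+ 2 *+ 6 - dz (dz V1) + emb E2S * V1).
  apply: rvD; last by apply: rvM; [exact: pal_emb|exact: pal_V1].
  apply: rvB.
    have := rvM (pal_emb 6%:R) (rvM pal_V1 pal_V1).
    by rewrite rmorph_nat mulr_natl expr2.
  move=> b; have [s e] := pal_V1 b.
  have H i : (dz (dz V1) b)`_i = (i%:R - b%:R) ^+ 2 * (V1 b)`_i := coef_iter_dz 2 V1 b i.
  split; first by apply/leq_sizeP => i si; rewrite H nth_default ?mulr0 // (leq_trans s).
  apply/polyP => i; rewrite coef_poly; case: ltnP => ib.
    rewrite !H {1}e coef_revp //; congr (_ * _).
    by rewrite natrB // -[X in X%:R - _ - _]addnn natrD; ring.
  by rewrite H nth_default ?mulr0 // (leq_trans s).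
have XE : X = iot (emb kap).
  apply/eqP; rewrite -subr_eq0; apply/eqP.
  apply: (@sym_refl_eq0 _ 0 0 1) => //.
  - apply/swapP => b a; rewrite 2!serB2 ((swapP _).1 (swap_emb kap) b a); congr (_ - _).
    rewrite X0 2!serBD2; congr (_ - _ + _).
    + apply: ((swapP _).1 _ b a).
      have N (x : SB) : swap (x *+ 6) = swap x *+ 6 by exact: rmorphMn.
      have M (x y : SB) : swap (x * y) = swap x * swap y by exact: rmorphM.
      by rewrite N expr2 M swap_wp.
    + by rewrite !dzBE ((swapP _).1 swap_wp b a); ring.
    + apply: ((swapP _).1 _ b a).
      have M (x y : SB) : swap (x * y) = swap x * swap y by exact: rmorphM.
      by rewrite M swap_wp swap_emb.
  - move=> b a a'; rewrite !addn0 mul1r => E; rewrite 2!serB2 (pal_reflect (pal_emb kap) E).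
    rewrite X0 wp_ode_regular 2!serMD2 (pal_reflect palR E).
    by rewrite (V0u_refl E).
  - move=> b a; rewrite !addn0 => E; rewrite serB2 (pal_big (pal_emb kap) E).
    rewrite X0 wp_ode_regular serMD2 (pal_big palR E) V0u_big //.
  - left=> b; rewrite serB2 -[iot (emb kap) b b]/((X b b *: 'X^b)`_b).
    by rewrite coefZ coefXn eqxx mulr1 subrr.
move: XE; rewrite X0 wp_ode_regular => XE; apply: iot_inj.
have M (x y : SP) : iot (x * y) = iot x * iot y by exact: rmorphM.
have D (x y : SP) : iot (x + y) = iot x + iot y by exact: rmorphD.
have N (x : SP) k : iot (x *+ k) = iot x *+ k by exact: rmorphMn.
have Xn (x : SP) k : iot (x ^+ k) = iot x ^+ k by exact: rmorphXn.
have zBE : iot zS = zB by exact: iot_mono.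
rewrite (D (zS * V0 *+ 12)) N (M zS) zBE !(M (zfac ^+ 2)) !(Xn zfac) -XE.
have u1 := zfac_uB.
rewrite mulrDr; congr (_ + _).
have -> : iot zfac ^+ 2 * (zB * (iot V0 * uB ^+ 2) *+ 12) = zB * iot V0 * (iot zfac * uB) ^+ 2 *+ 12 by ring.
by rewrite u1; ring.
Qed.

(** * The heat equation of the theta product *)

Definition YY : SP := PA * PB * PQ.
Definition theta : SP := zfac * YY.

Lemma swap_thetaQ : swap (iot theta) = iot theta.
Proof.
have M (x y : SP) : iot (x * y) = iot x * iot y by exact: rmorphM.
have Ms (x y : SB) : swap (x * y) = swap x * swap y by exact: rmorphM.
have -> : theta = zfac * PA * PB * PQ by rewrite /theta /YY; ring.
by rewrite (M (zfac * PA * PB)) Ms swap_theta -emb_Q1 swap_emb.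
Qed.
Lemma pal_YY : pal YY.
Proof.
apply: rvM; last exact: pal_PQ.
rewrite [X in rv _ X]mulrC; apply: rvM.
  by apply: rv_iprod => m; apply: rvB rv1 _; have := @rv_mono m.+2 m.+1; rewrite (_ : (m.+1.*2 - m.+2 = m)%N); [apply; lia|lia].
by apply: rv_iprod => m; apply: rvB rv1 _; have := @rv_mono m m.+1; rewrite (_ : (m.+1.*2 - m = m.+2)%N); [apply; lia|lia].
Qed.
Lemma coef_theta0 b : iot theta b 0%N = (YY b)`_0.
Proof.
have -> : theta = YY - zS * YY by rewrite /theta mulrBl mul1r.
by rewrite -[LHS]/(((YY - zS * YY) b)`_0) serB mono_mul subn0 coefB coefXM subr0.
Qed.
Lemma coef_thetaS b a : iot theta b a.+1 = (YY b)`_a.+1 - (YY b)`_a.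
Proof.
have -> : theta = YY - zS * YY by rewrite /theta mulrBl mul1r.
by rewrite -[LHS]/(((YY - zS * YY) b)`_a.+1) serB mono_mul subn0 coefB coefXM.
Qed.
(** The factor 1 - z moves the centre of reflection from b to b + 1/2 and brings in the sign. *)
Lemma theta_refl b a a' : (a + a' = b.*2 + 1)%N -> iot theta b a = - iot theta b a'.
Proof.
have [H B] := pal_coef b pal_YY.
have zero a0 : (a0 = b.*2 + 1)%N -> iot theta b a0 = - iot theta b 0%N.
  move=> ->; rewrite addn1 coef_thetaS coef_theta0 B ?sub0r; last by lia.
  by rewrite (H b.*2) // subnn.
case: a => [|a] E; first by rewrite (zero a') ?opprK.
case: a' E => [|a'] E; first by apply: zero; lia.
rewrite !coef_thetaS opprB.
rewrite (H a.+1); last by lia.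
rewrite (H a); last by lia.
by congr (_`_ _ - _`_ _); lia.
Qed.
Lemma theta_big b a : (b.*2 + 1 < a)%N -> iot theta b a = 0.
Proof.
have [_ B] := pal_coef b pal_YY; case: a => // a E.
by rewrite coef_thetaS !B ?subrr //; lia.
Qed.

(** Its multiplier a + b - (a - b)^2 is symmetric in a and b, and for fixed b invariant under a - b
    -> 1 - (a - b), the reflection of theta. *)
Definition heat_op (f : SP) : SP := dq f *+ 2 - dz (dz f) + dz f.
Lemma coef_heat f b a : iot (heat_op f) b a =
  (2%:R * b%:R - (a%:R - b%:R) ^+ 2 + (a%:R - b%:R)) * iot f b a.
Proof.
have E1 : (dz f b)`_a = (a%:R - b%:R) * (f b)`_a by have := coef_iter_dz 1 f b a; rewrite expr1.
have E2 : (dz (dz f) b)`_a = (a%:R - b%:R) ^+ 2 * (f b)`_a := coef_iter_dz 2 f b a.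
have E0 : (dq f b)`_a = b%:R * (f b)`_a by rewrite dqE coefMn mulr_natl.
rewrite /heat_op -[LHS]/((_ : {poly rat})`_a) -[iot f b a]/((f b)`_a).
move: (dz (dz f)) (dz f) (dq f) E1 E2 E0 => d2 d1 d0 E1 E2 E0.
by rewrite serD serB serMn coefD coefB coefMn E1 E2 E0; ring.
Qed.

Lemma coef_emb_mul (k : S1) (f : SP) b :
  iot (emb k * f) b b = (k * Ser (fun n => iot f n n : rat)) b.
Proof.
have -> : iot (emb k * f) b b = ((emb k * f) b)`_b by [].
rewrite !serM coef_sum; apply: eq_bigr => i _ /=.
rewrite -scalerAl coefZ coefXnM ltnNge -ltnS ltn_ord /=.
by congr (_ * _`_ _).
Qed.

Lemma heat_theta : exists kap : S1, heat_op theta = emb kap * theta *+ 2.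
Proof.
pose t0 : S1 := Ser (fun n => iot theta n n : rat).
have t00 : t0 0%N = 1.
  rewrite /= -[LHS]/(iot theta 0%N 0%N) coef_theta0 /YY serM big_ord1 PAB_0 PQ_0 mulr1.
  by rewrite coef1.
have [g tg] := ser_inv t00.
(* On the diagonal the operator is 2 delta_q; [kap] is the logarithmic derivative of the diagonal
   part [t0], which makes the difference vanish there. *)
pose kap := dq t0 * g; exists kap.
have kt : kap * t0 = dq t0 by rewrite /kap -mulrA [g * t0]mulrC tg mulr1.
apply: iot_inj; apply/eqP; rewrite -subr_eq0; apply/eqP.
have M (x y : SP) : iot (x * y) = iot x * iot y by exact: rmorphM.
have N (x : SP) k : iot (x *+ k) = iot x *+ k by exact: rmorphMn.
have ser_embM (f : SP) b a : iot (emb kap * f) b a =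
    \sum_(i < b.+1) (if (i <= a)%N then kap i * iot f (b - i)%N (a - i)%N else 0).
  rewrite -[LHS]/(((emb kap * f) b)`_a) serM coef_sum; apply: eq_bigr => i _ /=.
  by rewrite -scalerAl coefZ coefXnM ltnNge; case: (i <= a)%N; rewrite ?mulr0.
apply: (@sym_refl_eq0 _ 0 1 (-1)) => //.
- have Ms (x y : SB) : swap (x * y) = swap x * swap y by exact: rmorphM.
  apply/swapP => b a; rewrite 2!serB2 !coef_heat ((swapP _).1 swap_thetaQ b a); congr (_ - _).
    by ring.
  apply: ((swapP _).1 _ b a); rewrite N M.
  have Ns (x : SB) : swap (x *+ 2) = swap x *+ 2 by exact: rmorphMn.
  by rewrite Ns Ms swap_thetaQ swap_emb.
- move=> b a a'; rewrite addn0 => E; rewrite 2!serB2 !coef_heat N !serMn2 !ser_embM (theta_refl E).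
  have -> : \sum_(i < b.+1) (if (i <= a)%N then kap i * iot theta (b - i)%N (a - i)%N else 0) =
     - \sum_(i < b.+1) (if (i <= a')%N then kap i * iot theta (b - i)%N (a' - i)%N else 0).
    rewrite -sumrN; apply: eq_bigr => i _; have ib := ltn_ord i.
    have [ia|ia] := leqP i a; have [ia'|ia'] := leqP i a'; last by rewrite oppr0.
    - by rewrite -mulrN; congr (_ * _); apply: theta_refl; lia.
    - by rewrite theta_big ?mulr0 ?oppr0 //; lia.
    - by rewrite theta_big ?mulr0 ?oppr0 //; lia.
  have -> : a%:R - b%:R = 1 - (a'%:R - b%:R) :> rat.
    have := congr1 (fun n => n%:R : rat) E; rewrite /= -addnn !natrD => E'.
    by rewrite -[a%:R](addrK a'%:R) E'; ring.
  by ring.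
- move=> b a; rewrite addn0 => E; rewrite serB2 coef_heat N serMn2 ser_embM theta_big // mulr0.
  rewrite big1 ?mul0rn ?subrr // => i _; have ib := ltn_ord i.
  by case: leqP => // ia; rewrite theta_big ?mulr0 //; lia.
- left=> b; rewrite serB2 coef_heat N serMn2 coef_emb_mul -/t0 kt dqE subrr.
  by rewrite -[t0 b]/(iot theta b b); ring.
Qed.

Lemma YY0 : YY 0%N = 1.
Proof. by rewrite /YY serM big_ord1 PAB_0 PQ_0 mulr1. Qed.

(** The heat equation divided by [YY], whose logarithmic derivatives in z and q are -V and -U. *)
Lemma heat_log : exists kap : S1,
  zfac * (Vser ^+ 2 - V1 + User *+ 2 + emb kap *+ 2) + (1 + zS) * Vser = 0.
Proof.
have [kap H] := heat_theta; exists kap.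
have dY : dz YY = - (YY * Vser).
  by rewrite /YY (derM dz_der (PA * PB)) dz_PQ dz_PAB; ring.
have dqY : dq YY = - (YY * User) by exact: dq_PABQ.
have dzz : dz zS = zS by rewrite dz_mono mulr0n subr0.
have dzf : dz zfac = - zS by rewrite (derB dz_der 1 zS) (der1 dz_der) dzz sub0r.
have dqf : dq zfac = 0 by rewrite (derB (@dq_der _) 1 zS) (der1 (@dq_der _)) dq_mono mulr0n subr0.
have dth : dz theta = - (zS * YY) - zfac * YY * Vser.
  by rewrite /theta (derM dz_der zfac) dzf dY; ring.
have ddth : dz (dz theta) = - (zS * YY) + zS * YY * Vser *+ 2 - zfac * YY * V1 + zfac * YY * Vser ^+ 2.
  rewrite dth (derB dz_der) (derN dz_der) (derM dz_der zS) dzz dY.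
  by rewrite (derM dz_der (zfac * YY)) (derM dz_der zfac) dzf dY dz_V; ring.
have dqth : dq theta = - (zfac * YY * User).
  by rewrite /theta (derM (@dq_der _) zfac) dqf dqY; ring.
move: H; rewrite /heat_op dqth ddth dth /theta => H.
have zf : zfac = 1 - zS by [].
apply: (ser_lreg1 YY0).
have -> : YY * (zfac * (Vser ^+ 2 - V1 + User *+ 2 + emb kap *+ 2) + (1 + zS) * Vser) =
  emb kap * (zfac * YY) *+ 2 - (- (zfac * YY * User) *+ 2 -
     (- (zS * YY) + zS * YY * Vser *+ 2 - zfac * YY * V1 + zfac * YY * Vser ^+ 2) +
     (- (zS * YY) - zfac * YY * Vser)) + (1 - zS - zfac) * YY * Vser by ring.
by rewrite H subrr zf; ring.
Qed.

(** * Partitions by rank and crank *)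

Section PartitionGF.
Variables (A : comNzRingType) (n : nat) (al : nat -> nat -> bool) (c : nat -> A).

(** [al s k] says whether the part s may occur k times and [c s] is its weight. Distributing the
    product chooses all multiplicities, which is the encoding of [part]; largest parts, ones and
    unrestricted partitions are all instances. *)
Lemma part_gf :
  \sum_(f : part n | is_part f && [forall i : 'I_n, al i.+1 (f i)]) \prod_(i < n) c i.+1 ^+ f i =
  (\prod_(i < n) \sum_(k < n.+1 | al i.+1 k) mono (c i.+1) i.+1 ^+ k) n.
Proof.
have -> : \prod_(i < n) \sum_(k < n.+1 | al i.+1 k) mono (c i.+1) i.+1 ^+ k =
  \prod_(i < n) \sum_(k < n.+1) (if al i.+1 k then mono (c i.+1) i.+1 ^+ k else 0).
  by apply: eq_bigr => i _; rewrite big_mkcond.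
rewrite bigA_distr_bigA ser_sum [LHS]big_mkcond; apply: eq_bigr => f _.
have [/forallP alf|/forallPn[i ni]] := boolP [forall i : 'I_n, al i.+1 (f i)]; last first.
  have -> : \prod_(i < n) (if al i.+1 (f i) then mono (c i.+1) i.+1 ^+ f i else 0) = 0.
    by rewrite (bigD1 i) //= (negbTE ni) mul0r.
  by rewrite andbF.
rewrite andbT (eq_bigr (fun i : 'I_n => mono (c i.+1) i.+1 ^+ f i)); last by move=> i _; rewrite alf.
have -> : \prod_(i < n) mono (c i.+1) i.+1 ^+ f i =
    mono (\prod_(i < n) c i.+1 ^+ f i) (\sum_(i < n) i.+1 * f i)%N.
  elim/big_rec3: _ => [|i x y z _ ->]; first by rewrite mono1.
  by rewrite monoX monoM mulnC.
by rewrite monoE /is_part eq_sym.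
Qed.

Lemma part_gf_eqm (G : nat -> ser A) :
  (forall i, (i < n)%N -> eqm n.+1 (\sum_(k < n.+1 | al i.+1 k) mono (c i.+1) i.+1 ^+ k) (G i)) ->
  \sum_(f : part n | is_part f && [forall i : 'I_n, al i.+1 (f i)]) \prod_(i < n) c i.+1 ^+ f i =
  (\prod_(i < n) G i) n.
Proof. by move=> H; rewrite part_gf; apply: (@eqm_prod _ n.+1) => // i _; apply: H. Qed.
End PartitionGF.

Section TruncatedGeometric.
Variables (A : comNzRingType) (n : nat) (c : A) (d : nat).
Hypothesis d0 : (0 < d)%N.
Let t := mono c d.
Lemma trunc_all : eqm n.+1 (\sum_(k < n.+1) t ^+ k) (1 + geo c d).
Proof.
have -> : \sum_(k < n.+1) t ^+ k = (1 + geo c d) * ((1 - t) * \sum_(k < n.+1) t ^+ k).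
  by rewrite mulrA [_ * (1 - t)]mulrC geo_inv // mul1r.
rewrite -opprB mulNr -subrX1 opprB -[X in eqm _ _ X]mulr1; apply: eqmMl.
rewrite -[X in eqm _ _ X]subr0; apply: eqmB => //; rewrite /t monoX; apply: eqm_mono.
by apply: leq_pmulr.
Qed.
Lemma trunc_pos : eqm n.+1 (\sum_(k < n.+1 | (k : nat) != 0%N) t ^+ k) (geo c d).
Proof.
have := trunc_all; rewrite (bigD1 ord0) //= expr0 => H m mn.
by have := H m mn; rewrite !serD => /addrI <-.
Qed.
Lemma trunc_zero : \sum_(k < n.+1 | (k : nat) == 0%N) t ^+ k = 1.
Proof. by rewrite (big_pred1 ord0) // => k. Qed.
Lemma trunc_one j : (j <= n)%N -> \sum_(k < n.+1 | (k : nat) == j) t ^+ k = t ^+ j.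
Proof.
move=> jn; rewrite (big_pred1 (Ordinal (jn : (j < n.+1)%N))) // .
Qed.
End TruncatedGeometric.

Section Statistics.
Variables (n : nat) (f : part n).
Hypothesis fp : is_part f.
Lemma nparts_le : (nparts f <= n)%N.
Proof.
rewrite -[X in (_ <= X)%N](eqP fp); apply: leq_sum => i _.
by rewrite leq_pmull.
Qed.
Lemma largest_le : (largest f <= n)%N.
Proof. by apply/bigmax_leqP => i _. Qed.
Lemma nones_le : (nones f <= n)%N.
Proof.
apply: leq_trans nparts_le; rewrite /nones /nparts [X in (_ <= X)%N](bigID (fun i : 'I_n => (i : nat) == 0%N)) /=.
exact: leq_addr.
Qed.
(** A condition on each multiplicity separately, the form that [part_gf] accepts. *)
Lemma largestP L : (0 < L)%N -> (largest f == L) =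
  [forall i : 'I_n, if (i.+1 < L)%N then true else if i.+1 == L then (f i : nat) != 0%N else (f i : nat) == 0%N] && (L <= n)%N.
Proof.
move=> L0; apply/eqP/andP => [E|[/forallP H Ln]].
  split; last by rewrite -E largest_le.
  apply/forallP => i; case: ltngtP => // iL.
    apply/negP => /negP fi; suff : (i.+1 <= largest f)%N by rewrite E leqNgt iL.
    exact: (@leq_bigmax_cond _ (fun i : 'I_n => (f i : nat) != 0%N) (fun i => i.+1) i).
  apply/negP => fi; have : (largest f <= L.-1)%N.
    apply/bigmax_leqP => j fj; have jn : (j.+1 <= L)%N.
      rewrite -E; exact: (@leq_bigmax_cond _ (fun i : 'I_n => (f i : nat) != 0%N) (fun i => i.+1) j).
    have ne : j.+1 != L.
      apply/eqP => jL; have ij : j = i by apply: val_inj => /=; apply: succn_inj; rewrite jL iL.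
      by rewrite ij fi in fj.
    by rewrite -ltnS prednK // ltn_neqAle ne jn.
  by rewrite E -ltnS prednK // ltnn.
apply/eqP; rewrite eqn_leq; apply/andP; split.
  apply/bigmax_leqP => i fi; have Hi := H i; rewrite leqNgt; apply/negP => Li.
  have e1 : (i.+1 < L)%N = false by lia.
  have e2 : (i.+1 == L) = false by lia.
  by rewrite e1 e2 in Hi; rewrite Hi in fi.
case: L L0 H Ln => // L _ H Ln.
have := H (Ordinal Ln); rewrite ltnn eqxx => fL.
exact: (@leq_bigmax_cond _ (fun i : 'I_n => (f i : nat) != 0%N) (fun i => i.+1) (Ordinal Ln)).
Qed.
Lemma largest_gt0 : (0 < n)%N -> (0 < largest f)%N.
Proof.
move=> n0; rewrite lt0n; apply/eqP => L0.
have f0 i : (f i : nat) = 0%N.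
  apply/eqP/negPn/negP => fi.
  have := (@leq_bigmax_cond _ (fun i : 'I_n => (f i : nat) != 0%N) (fun i => i.+1) i fi).
  by rewrite -/(largest f) L0.
by have := eqP fp; rewrite big1 => [E|i _]; [rewrite -E in n0|rewrite f0 muln0].
Qed.
End Statistics.

Lemma big_fibre (V : zmodType) (T : finType) (P : pred T) (s : T -> nat) (F : T -> V) N :
  (forall f, P f -> (s f < N)%N) ->
  \sum_(f | P f) F f = \sum_(L < N) \sum_(f | P f && (s f == L)) F f.
Proof.
move=> H; transitivity (\sum_(L < N) \sum_(f | P f) (if s f == L then F f else 0)).
  rewrite exchange_big /=; apply: eq_bigr => f Pf.
  rewrite (bigD1 (Ordinal (H f Pf))) //= eqxx big1 ?addr0 // => i ne.
  by case: eqP => // E; case/eqP: ne; apply: val_inj.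
by apply: eq_bigr => L _; rewrite -big_mkcondr.
Qed.

Lemma prod_if (A : comNzRingType) (a : nat -> A) (b : A) L n : (L < n)%N ->
  \prod_(i < n) (if (i < L)%N then a i else if (i : nat) == L then b else 1) = \prod_(i < L) a i * b.
Proof.
move=> Ln; rewrite -(big_mkord xpredT (fun i => if (i < L)%N then a i else if i == L then b else 1)).
rewrite (@big_cat_nat _ _ _ L) //=; last exact: ltnW.
congr (_ * _).
  rewrite -(big_mkord xpredT a) !big_nat; apply: eq_bigr => i /andP[_ iL]; by rewrite iL.
rewrite big_ltn // ltnn eqxx big_nat big1 ?mulr1 // => i /andP[Li _].
by rewrite ltnNge (ltnW Li) /= gtn_eqF.
Qed.

Lemma geo_mul (A : comNzRingType) (c : A) d : (0 < d)%N -> geo c d = mono c d * (1 + geo c d).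
Proof.
move=> d0; have /eqP := geoE c d0; rewrite mulrBl mul1r subr_eq => /eqP E.
by rewrite mulrDr mulr1 {1}E.
Qed.

Lemma coef_zmul a (f : SP) n : (mono 'X^a 0 * f) n = 'X^a * f n.
Proof. by rewrite mono_mul subn0. Qed.

Lemma sum_part0 (F : part 0 -> {poly rat}) : \sum_(f : part 0 | is_part f) F f = F [ffun=> ord0].
Proof.
rewrite (big_pred1 [ffun=> ord0]) // => f; rewrite /is_part big_ord0 eqxx.
by apply/esym/eqP/ffunP => -[].
Qed.

Lemma sum_weighted n (f : part n) : is_part f -> (\sum_(i < n) i * f i = n - nparts f)%N.
Proof.
move=> fp; rewrite -[X in (X - _)%N](eqP fp).
have -> : (\sum_(i < n) i.+1 * f i = \sum_(i < n) i * f i + nparts f)%N.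
  by rewrite /nparts -big_split; apply: eq_bigr => i _; rewrite mulSn addnC.
by rewrite addnK.
Qed.

Lemma Rgf_row n : Rgf n = \sum_(f : part n | is_part f) 'X^(n + largest f - nparts f).
Proof.
have ord L : eqm L (zqS ^+ L * \prod_(i < L.+1) gB i) 0.
  by rewrite -(mul0r (\prod_(i < L.+1) gB i)); apply: eqmMr; apply: eqm_exp0; apply: zq_ord.
have RE : Rgf = 1 + qS * isum (fun L => zqS ^+ L * \prod_(i < L.+1) gB i).
  by rewrite /Rgf /heine !mulr1.
case: n => [|n].
  rewrite sum_part0 RE serD mono_mul addr0 ser1 eqxx.
  by rewrite /nparts /largest !big_ord0 expr0.
have -> : Rgf n.+1 = \sum_(L < n.+1) (qS * (zqS ^+ L * \prod_(i < L.+1) gB i)) n.+1.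
  rewrite RE serD ser1 add0r -ser_sum -mulr_sumr.
  by rewrite (@eqmM_ord _ 1 n.+1 _ _ _ q_ord (isum_eqm ord)).
rewrite (@big_fibre _ _ _ (fun f => (largest f).-1) _ n.+1); last first.
  by move=> f fp; have := largest_gt0 fp isT; have := largest_le f; lia.
apply: eq_bigr => L _; have Ln := ltn_ord L.
pose al s k := if (s < L.+1)%N then true else if s == L.+1 then k != 0%N else k == 0%N.
(* Each part s contributes w^s z^(s-1) = q^s/z, which counts the parts; the factor z^(L+1) of the
   largest part stands outside. *)
pose c s : {poly rat} := 'X^(s.-1).
transitivity ('X^(L.+1) * \sum_(f : part n.+1 | is_part f && [forall i : 'I_n.+1, al i.+1 (f i)])
   \prod_(i < n.+1) c i.+1 ^+ f i); last first.
  rewrite mulr_sumr; apply: eq_big => [f|f].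
    apply: andb_id2l => fp; have L0 := largest_gt0 fp isT.
    rewrite -eqSS (prednK L0) (largestP fp (ltn0Sn L)) Ln andbT.
    by [].
  move=> /andP[fp /forallP fal].
  have Lf : largest f = L.+1.
    apply/eqP; rewrite (largestP fp (ltn0Sn L)) Ln andbT; exact/forallP.
  have -> : \prod_(i < n.+1) c i.+1 ^+ f i = 'X^(n.+1 - nparts f).
    rewrite -(sum_weighted fp) -prodrXr; apply: eq_bigr => i _.
    by rewrite /c exprM.
  by rewrite -exprD Lf; congr ('X^_); have := nparts_le fp; lia.
rewrite (@part_gf_eqm _ _ _ _ (fun i => if (i < L)%N then gB i else if i == L then geo 'X^L L.+1 else 1)).
  rewrite (prod_if gB (geo 'X^L L.+1) Ln).
  have -> : qS * (zqS ^+ L * \prod_(i < L.+1) gB i) =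
      mono 'X^(L.+1) 0 * (\prod_(i < L) gB i * geo 'X^L L.+1).
    have -> : geo 'X^L L.+1 = mono 'X^L L.+1 * gB L by exact: geo_mul.
    have -> : \prod_(i < L.+1) gB i = \prod_(i < L) gB i * gB L by exact: big_ord_recr.
    rewrite [LHS]mulrA; have -> : qS * zqS ^+ L = mono 'X^(L.+1) 0 * mono 'X^L L.+1.
      by rewrite /qS /zqS monoX !monoM -!exprM -!exprD; congr (mono 'X^_ _); lia.
    move: (\prod_(i < L) gB i) (gB L) (mono _ 0) (mono _ L.+1) => p g m1 m2; ring.
  by rewrite coef_zmul.
move=> i _; rewrite /al /c /= ltnS eqSS; case: ltngtP => iL.
- exact: trunc_all.
- by rewrite trunc_zero.
- by rewrite iL; apply: trunc_pos.
Qed.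

Lemma iprod_eqmS (A : comNzRingType) (u : nat -> ser A) N :
  (forall m, eqm m.+1 (u m) 1) -> eqm N.+1 (iprod u) (\prod_(m < N) u m).
Proof.
move=> H; apply: (eqm_trans (iprod_eqm (N := N.+1) H)).
rewrite big_ord_recr -[X in eqm _ _ X]mulr1; apply: eqmMl; exact: H.
Qed.

Lemma mom0_Rgf : mom 0 Rgf = P1.
Proof.
apply: serP => n; rewrite rowmomE Rgf_row.
rewrite (big_morph _ (rowmomD 0 n) (rowmom0 0 n)) P1E.
rewrite (@iprod_eqmS _ _ n) //; last by move=> m; exact: ginv_eqm.
have H := @part_gf_eqm rat n (fun _ _ => true) (fun=> 1) _ (fun i _ => @trunc_all rat n 1 i.+1 (ltn0Sn i)).
rewrite -H; apply: eq_big => [f|f _].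
  by rewrite (_ : [forall i : 'I_n, true]) ?andbT //; apply/forallP.
by rewrite rowmomX expr0 big1 // => i _; rewrite expr1n.
Qed.

Lemma Nmom_mom j n : Nmom j n = mom j Rgf n.
Proof.
rewrite rowmomE Rgf_row (big_morph _ (rowmomD j n) (rowmom0 j n)).
apply: eq_bigr => f fp; rewrite rowmomX; congr (_ ^+ _).
rewrite /rank natrB; last by have := nparts_le fp; lia.
by rewrite natrD rmorphB /= -!pmulrn; ring.
Qed.

(** This is 1/(q;q)_j; [dd'] omits the factor 1/(1-q), that is, the parts equal to one. *)
Definition dd j := \prod_(i < j) gQ i.
Definition dd' j := \prod_(1 <= i < j) gQ i.
Lemma dd'E j : (0 < j)%N -> (1 - qS) * dd j = dd' j.
Proof.
move=> j0; rewrite /dd -(big_mkord xpredT gQ) big_ltn // mulrA.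
have -> : (1 - qS) * gQ 0 = 1 by exact: gQE.
by rewrite mul1r.
Qed.
Lemma dd0 : dd 0 = 1. Proof. by rewrite /dd big_ord0. Qed.
Lemma ddS j : dd j.+1 * (1 - qS ^+ j.+1) = dd j.
Proof.
rewrite /dd big_ord_recr /= -mulrA [gQ j * _]mulrC qSX.
have -> : (1 - mono 'X^(j.+1) j.+1) * gQ j = 1 by exact: gQE.
by rewrite mulr1.
Qed.
Lemma iprod_recl (A : comNzRingType) (u : nat -> ser A) : (forall m, eqm m.+1 (u m) 1) ->
  iprod u = u 0%N * iprod (fun m => u m.+1).
Proof.
move=> H; apply: eqmP => N.
apply: (eqm_trans (@eqm_le _ N N.+1 _ _ (leqnSn N) (iprod_eqm (N := N.+1) H))).
rewrite big_ord_recl; apply: eqmMl; apply: eqm_sym; apply: (iprod_eqm (u := fun m => u m.+1)) => m.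
by apply: eqm_le (H m.+1).
Qed.

Lemma euler_PA : isum (fun L => dd L * zqS ^+ L) = IA.
Proof.
have := @q_binomial _ 0 zqS qS dd zq_ord q_ord dd0 ddS.
have -> : iprod (fun k => 1 - zqS * qS ^+ k) = PA by apply: eq_iprod => k; rewrite zqq.
have -> : iprod (fun k => 1 - 0 * zqS * qS ^+ k) = 1.
  by rewrite -[RHS]iprod1; apply: eq_iprod => k; rewrite !mul0r subr0.
have -> : isum (fun j => poch 0 qS j * dd j * zqS ^+ j) = isum (fun L => dd L * zqS ^+ L).
  congr isum; apply: funext => j; rewrite /poch big1 ?mul1r // => i _.
  by rewrite mul0r subr0.
by move=> E; rewrite -[LHS]mulr1 -PA_IA mulrA E mul1r.
Qed.

Definition F2ser := isum (fun j => poch zqS qS j * dd j * wS ^+ j).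
(** The q-binomial theorem with a = zq and x = w. Its summation index j will be the number of
    ones. *)
Lemma Cgf_F2 : Cgf = (1 - qS) * F2ser * IA.
Proof.
have w0 : eqm 1 wS 0 by exact: eqm_mono.
have := @q_binomial _ zqS wS qS dd w0 q_ord dd0 ddS.
have -> : iprod (fun k => 1 - wS * qS ^+ k) = PB by apply: eq_iprod => k; rewrite wq.
have -> : iprod (fun k => 1 - zqS * wS * qS ^+ k) = iprod (fun k => Qfac k.+1).
  by apply: eq_iprod => k; rewrite /zqS /wS monoM qSX monoM -!exprD.
rewrite -/F2ser => E.
have PQE : PQ = (1 - qS) * iprod (fun k => Qfac k.+1).
  by rewrite /PQ iprod_recl // => m; apply: fac_eqm.
have -> : F2ser = F2ser * PB * IB by rewrite -mulrA PB_IB mulr1.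
by rewrite E /Cgf PQE; move: (iprod _) IA IB => x y z; ring.
Qed.

Lemma poch_IA n j : (j <= n)%N -> eqm n.+1 (poch zqS qS j * IA) (\prod_(j <= i < n) gA i).
Proof.
move=> jn; apply: (@eqm_trans _ _ _ (poch zqS qS j * \prod_(i < n) gA i)).
  by apply: eqmMl; apply: iprod_eqmS => m; apply: ginv_eqm.
have -> : poch zqS qS j * \prod_(i < n) gA i = \prod_(j <= i < n) gA i; last by [].
rewrite -(big_mkord xpredT gA) (@big_cat_nat _ _ _ j) //= mulrA.
have -> : poch zqS qS j * \prod_(0 <= i < j) gA i = 1.
  rewrite /poch -(big_mkord xpredT (fun i => 1 - zqS * qS ^+ i)) -big_split big1_seq // => i _.
  by rewrite zqq; exact: gAE.
by rewrite mul1r.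
Qed.

Lemma nonesE n (f : part n.+1) : nones f = f ord0.
Proof. by rewrite /nones (big_pred1 ord0) // => i; rewrite -val_eqE. Qed.

Lemma crank_noones n L : (0 < L <= n)%N ->
  \sum_(f : part n.+1 | is_part f && (nones f == 0%N) && (largest f == L.+1)) 'X^(n.+1 + L.+1) =
  (zqS ^+ L.+1 * dd' L.+1) n.+1.
Proof.
move=> /andP[L0 Ln].
pose al s k := if s == 1%N then k == 0%N else if (s < L.+1)%N then true else if s == L.+1 then k != 0%N else k == 0%N.
pose c s : {poly rat} := 'X^s.
transitivity ('X^(L.+1) * \sum_(f : part n.+1 | is_part f && [forall i : 'I_n.+1, al i.+1 (f i)])
   \prod_(i < n.+1) c i.+1 ^+ f i).
  rewrite mulr_sumr; apply: eq_big => [f|f].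
    rewrite -andbA; apply: andb_id2l => fp; rewrite (largestP fp (ltn0Sn L)) ltnS Ln andbT nonesE.
    apply/andP/forallP => [[f0 /forallP H] i|H].
      rewrite /al eqSS; case: eqP => [i0|_]; last exact: H.
      by rewrite (_ : i = ord0) //; apply: val_inj.
    split; first by have := H ord0; rewrite /al.
    apply/forallP => i; have := H i; rewrite /al eqSS; case: eqP => [i0|//].
    by rewrite i0 ltnS L0.
  move=> /andP[/andP[fp _] _].
  have -> : \prod_(i < n.+1) c i.+1 ^+ f i = 'X^(n.+1).
    rewrite -[X in 'X^X](eqP fp) -prodrXr; apply: eq_bigr => i _.
    by rewrite /c exprM.
  by rewrite -exprD addnC.
pose a i := if i == 0%N then 1 else gQ i.
rewrite (@part_gf_eqm _ _ _ _ (fun i => if (i < L)%N then a i else if i == L then geo 'X^(L.+1) L.+1 else 1)).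
  rewrite (prod_if a (geo 'X^(L.+1) L.+1) (Ln : (L < n.+1)%N)).
  have -> : zqS ^+ L.+1 * dd' L.+1 = mono 'X^(L.+1) 0 * (\prod_(i < L) a i * geo 'X^(L.+1) L.+1).
    have -> : geo 'X^(L.+1) L.+1 = mono 'X^(L.+1) L.+1 * gQ L by exact: geo_mul.
    have -> : dd' L.+1 = \prod_(i < L) a i * gQ L.
      rewrite /dd' big_nat_recr //= -(big_mkord xpredT a) [in RHS]big_ltn // {1}/a eqxx mul1r.
      congr (_ * _); rewrite !big_nat; apply: eq_bigr => i /andP[i0 _].
      by rewrite /a gtn_eqF.
    have -> : zqS ^+ L.+1 = mono 'X^(L.+1) 0 * mono 'X^(L.+1) L.+1.
      by rewrite /zqS monoX !monoM -!exprM -!exprD; congr (mono 'X^_ _); lia.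
    move: (\prod_(i < L) a i) (gQ L) (mono _ 0) (mono _ L.+1) => p g m1 m2; ring.
  by rewrite coef_zmul.
move=> i _; rewrite /al /c /a eqSS; case: eqP => [->|/eqP i0].
  by rewrite L0 trunc_zero.
rewrite ltnS eqSS; case: ltngtP => iL.
- exact: trunc_all.
- by rewrite trunc_zero.
- by rewrite iL; apply: trunc_pos.
Qed.

Lemma crank_ones n j : (0 < j <= n.+1)%N ->
  \sum_(f : part n.+1 | is_part f && (nones f == j)) 'X^(n.+1 + nlarger f - j) =
  (wS ^+ j * dd' j * (poch zqS qS j * IA)) n.+1.
Proof.
move=> /andP[j0 jn].
pose al s k := if s == 1%N then k == j else true.
(* A one contributes w = q/z, a part up to j only q^s, and a larger part q^s z: the exponent of z is
   the crank. *)
pose c s : {poly rat} := if s == 1%N then 1 else if (s <= j)%N then 'X^s else 'X^(s.+1).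
transitivity (\sum_(f : part n.+1 | is_part f && [forall i : 'I_n.+1, al i.+1 (f i)])
   \prod_(i < n.+1) c i.+1 ^+ f i).
  apply: eq_big => [f|f /andP[fp /eqP f0]].
    apply: andb_id2l => fp; rewrite nonesE; apply/idP/forallP => [f0 i|H].
      rewrite /al eqSS; case: eqP => [i0|//].
      by rewrite (_ : i = ord0) //; apply: val_inj.
    by have := H ord0; rewrite /al.
  transitivity (\prod_(i < n.+1) ('X^((if (i : nat) == 0%N then 0 else i.+1 * f i) + (if (j < i.+1)%N then f i : nat else 0)) : {poly rat})); last first.
    apply: eq_bigr => i _; rewrite /c eqSS.
    have [i0|i0] := eqVneq (i : nat) 0%N; first by rewrite i0 ltnS leqNgt j0 expr1n.
    have [ij|ij] := leqP i.+1 j; first by rewrite addn0 exprM.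
    by rewrite -exprM; congr ('X^_); rewrite [RHS]mulSn addnC.
  rewrite prodrXr big_split /=; congr ('X^_).
  have E1 : (\sum_(i < n.+1) (if (i : nat) == 0 then 0 else i.+1 * f i) + j = n.+1)%N.
    rewrite -[RHS](eqP fp) (bigD1 ord0) //= add0n [RHS](bigD1 ord0) //= mul1n -f0 nonesE addnC.
    congr (_ + _)%N; apply: eq_bigr => i i0.
    by rewrite -val_eqE in i0; rewrite (negbTE i0).
  have E2 : (\sum_(i < n.+1) (if (j < i.+1)%N then f i : nat else 0) = nlarger f)%N.
    by rewrite /nlarger f0 [RHS]big_mkcond.
  by rewrite E2 -[RHS](addnK j) [in RHS]addnAC E1.
rewrite (@part_gf_eqm _ _ _ _ (fun i => if i == 0%N then wS ^+ j else if (i < j)%N then gQ i else gA i)).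
  apply: (@eqm_trans _ n.+2 _ (wS ^+ j * dd' j * \prod_(j <= i < n.+1) gA i)) => //; last first.
    by apply: eqm_sym; apply: eqmMl; apply: poch_IA.
  pose F i := if i == 0%N then wS ^+ j else if (i < j)%N then gQ i else gA i.
  rewrite -(big_mkord xpredT F) big_ltn // (@big_cat_nat _ _ _ j) //=.
  have -> : \prod_(1 <= i < j) F i = dd' j.
    rewrite /dd' !big_nat; apply: eq_bigr => i /andP[i0 ij].
    by rewrite /F ij gtn_eqF.
  have -> : \prod_(j <= i < n.+1) F i = \prod_(j <= i < n.+1) gA i.
    rewrite !big_nat; apply: eq_bigr => i /andP[ji _].
    by rewrite /F ltnNge ji /= gtn_eqF // (leq_trans j0).
  by rewrite mulrA.
move=> i _; rewrite /al /c eqSS; case: eqP => [->|/eqP i0].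
  by rewrite trunc_one // /wS expr0.
by case: ltnP => ij; apply: trunc_all.
Qed.

(** The first sum collects partitions without ones, the second those with j + 1 ones. The
    exceptional terms -q + zq, with q/z from the second sum, give the prescribed values M(0,1) = -1
    and M(1,1) = M(-1,1) = 1. *)
Lemma Cgf_expand n : Cgf n.+1 = (1 - qS + zqS) n.+1
  + \sum_(L < n) (zqS ^+ L.+2 * dd' L.+2) n.+1
  + \sum_(j < n.+1) (wS ^+ j.+1 * dd' j.+1 * (poch zqS qS j.+1 * IA)) n.+1.
Proof.
have w0 : eqm 1 wS 0 by exact: eqm_mono.
have ordF j : eqm j (poch zqS qS j * dd j * wS ^+ j) 0.
  by rewrite -(mulr0 (poch zqS qS j * dd j)); apply: eqmMl; apply: eqm_exp0.
have ordE L : eqm L (dd L * zqS ^+ L) 0.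
  by rewrite -(mulr0 (dd L)); apply: eqmMl; apply: eqm_exp0; apply: zq_ord.
have EA : eqm n.+2 ((1 - qS) * IA) ((1 - qS + zqS) + \sum_(L < n) zqS ^+ L.+2 * dd' L.+2).
  rewrite -euler_PA; apply: (eqm_trans (eqmMl _ (isum_eqm (N := n.+2) ordE))).
  rewrite big_ord_recl big_ord_recl dd0 expr0 mulr1 expr1.
  have -> : (1 - qS) * (1 + (dd (bump 0 0) * zqS ^+ bump 0 0 + \sum_(i < n) dd (bump 0 (bump 0 i)) * zqS ^+ bump 0 (bump 0 i)))
     = (1 - qS) + (1 - qS) * dd 1 * zqS + \sum_(i < n) zqS ^+ i.+2 * dd' i.+2; last first.
    by rewrite dd'E // /dd' big_geq // mul1r.
  rewrite !mulrDr mulr1 addrA; congr (_ + _ + _); first by rewrite mulrA expr1.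
  by rewrite mulr_sumr; apply: eq_bigr => i _; rewrite -dd'E // /bump /=; ring.
have E : eqm n.+2 Cgf ((1 - qS + zqS) + \sum_(L < n) zqS ^+ L.+2 * dd' L.+2 +
     \sum_(j < n.+1) wS ^+ j.+1 * dd' j.+1 * (poch zqS qS j.+1 * IA)).
  have -> : Cgf = (1 - qS) * IA * F2ser by rewrite Cgf_F2 mulrAC.
  apply: (eqm_trans (eqmMl _ (isum_eqm (N := n.+2) ordF))).
  have P0 : poch zqS qS 0 = 1 by rewrite /poch big_ord0.
  rewrite big_ord_recl P0 dd0 expr0 !mulr1 mulrDr mulr1.
  apply: eqmD => //; rewrite mulr_sumr => m mn; congr (coef _ m).
  apply: eq_bigr => j _; rewrite /bump /= -dd'E //.
  by move: (poch _ _ _) (dd _) (wS ^+ _) IA => a b c d; ring.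
by rewrite E // !serD !ser_sum.
Qed.

(** A partition of n + 2 without ones has largest part at least 2, whence the shift of L. *)
Lemma crank_sum n (F : part n.+2 -> rat) :
  \sum_(f : part n.+2 | is_part f) F f =
  \sum_(L < n.+1) \sum_(f : part n.+2 | is_part f && (nones f == 0%N) && (largest f == L.+2)) F f +
  \sum_(j < n.+2) \sum_(f : part n.+2 | is_part f && (nones f == j.+1)) F f.
Proof.
rewrite (bigID (fun f => nones f == 0%N)) /=; congr (_ + _).
  rewrite (@big_fibre _ _ _ (fun f => (largest f).-2) _ n.+1).
    apply: eq_bigr => L _; apply: eq_bigl => f.
    apply: andb_id2l => /andP[fp f0].
    have L1 : largest f != 1%N.
      apply/negP; rewrite (largestP fp (ltn0Sn 0)) => /andP[/forallP/(_ ord0)] /=.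
      by rewrite -nonesE f0.
    by have := largest_gt0 fp isT; move: L1; case: (largest f) => [|[|l]].
  by move=> f /andP[fp _]; have := largest_le f; case: (largest f) => [|[|l]] //=; rewrite ltnS.
rewrite (@big_fibre _ _ _ (fun f => (nones f).-1) _ n.+2).
  apply: eq_bigr => j _; apply: eq_bigl => f; rewrite -andbA; apply: andb_id2l => fp.
  by case: (nones f).
move=> f /andP[fp f0]; have := nones_le fp; rewrite -lt0n in f0.
by rewrite -{1}(prednK f0).
Qed.

Lemma Mmom_mom j n : (0 < n)%N -> Mmom j n = mom j Cgf n.
Proof.
case: n => // -[|n] _; rewrite rowmomE Cgf_expand.
  rewrite big_ord0 addr0 big_ord_recl big_ord0 addr0 -[Mmom j 1]/((-1) ^+ j * 1 + 0 ^+ j * (-1) + 1 ^+ j * 1).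
  have -> : (1 - qS + zqS) 1%N = - 'X^1 + 'X^2.
    by rewrite serD serB ser1 sub0r /qS /zqS !monoE.
  have -> : (wS ^+ 1 * dd' 1 * (poch zqS qS 1 * IA)) 1%N = 'X^0.
    rewrite /dd' big_geq // mulr1 expr1 mono_mul leqnn subnn serM big_ord1.
    rewrite /poch big_ord1 expr0 mulr1 serB ser1 /zqS monoE subr0 iprod_coef0.
    by rewrite /gA serD ser1 /= addr0 !mulr1.
  rewrite !rowmomD rowmomN !rowmomX expr1n.
  have -> : (1%:R - 1%:R : rat) = 0 by rewrite subrr.
  by rewrite sub0r; ring.
have -> : (1 - qS + zqS) n.+2 = 0 by rewrite serD serB ser1 /qS /zqS !monoE !subr0 addr0.
rewrite add0r [Mmom j n.+2]/Mmom -[n.+2 == 1%N]/false crank_sum rowmomD !(big_morph _ (rowmomD j n.+2) (rowmom0 j n.+2)).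
congr (_ + _); apply: eq_bigr => i _.
  rewrite -crank_noones ?ltn_ord // (big_morph _ (rowmomD j n.+2) (rowmom0 j n.+2)).
  apply: eq_bigr => f /andP[/andP[fp f0] /eqP fL].
  rewrite rowmomX /crank f0 fL -pmulrn natrD; congr (_ ^+ _); ring.
rewrite -crank_ones ?ltn_ord // (big_morph _ (rowmomD j n.+2) (rowmom0 j n.+2)).
apply: eq_bigr => f /andP[fp /eqP f0]; rewrite rowmomX /crank f0 /=; congr (_ ^+ _).
have ji := ltn_ord i.
by rewrite rmorphB /= -!pmulrn natrB ?natrD; [ring|lia].
Qed.

(** * Moments of the Weierstrass and heat equations *)

Lemma momD j f g : mom j (f + g) = mom j f + mom j g. Proof. exact: mom_D. Qed.
Lemma momN j f : mom j (- f) = - mom j f.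
Proof.
have m0 : mom j 0 = 0 by apply: (addrI (mom j 0)); rewrite -momD !addr0.
by apply/eqP; rewrite -subr_eq0 opprK -momD addNr m0.
Qed.
Lemma momB j f g : mom j (f - g) = mom j f - mom j g. Proof. by rewrite momD momN. Qed.
Lemma mom_mono j a b : mom j (mono 'X^a b) = mono ((a%:R - b%:R) ^+ j) b.
Proof.
apply: serP => n; rewrite rowmomE !monoE; case: eqP => [->|_]; last exact: rowmom0.
by rewrite rowmomX.
Qed.
Lemma mom_embE j f : mom j (emb f) = if j == 0%N then f else 0.
Proof.
rewrite -[emb f]mulr1 mom_emb -mono1 -(expr0 'X) mom_mono subrr expr0n.
by case: j => [|j]; rewrite ?mono1 ?mulr1 //= mono0 mulr0.
Qed.
Lemma torsion (f g : S1) n : (0 < n)%N -> f *+ n = g *+ n -> f = g.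
Proof.
move=> n0 E; apply: serP => i; have := congr1 (fun h : S1 => h i) E; rewrite !serMn.
by move/eqP; rewrite -subr_eq0 -mulrnBl mulrn_eq0 gtn_eqF //= subr_eq0 => /eqP.
Qed.
Lemma mono1_cancel (f : S1) : mono 1 1 * f = 0 -> f = 0.
Proof.
move=> E; apply: serP => i; have := congr1 (fun h : S1 => h i.+1) E.
by rewrite mono_mul subn1 mul1r.
Qed.

Definition vv i : S1 := mom i V1.
Lemma vvE i : vv i = if odd i then 0 else phiS i.+1 *+ 2.
Proof. by rewrite /vv mom_V1 mom_V /=; case: (odd i). Qed.

(** The m-th moment of 6 V1^2 - V1'' + E2 V1 - [kap], the primes being z-derivatives. *)
Definition TT (kap : S1) m : S1 :=
  (\sum_(i < m.+1) (vv i * vv (m - i)) *+ 'C(m, i)) *+ 6 - vv m.+2 + E2S * vv m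
  - (if m == 0%N then kap else 0).


Lemma weierstrass_moments : exists kap, forall k, (0 < k)%N ->
  vv k.*2 *+ 6 + \sum_(1 <= i < k.+1) TT kap (k.*2 - i.*2) *+ 'C(k.*2, i.*2) = 0.
Proof.
have [kap H] := wp_ode; exists kap => k k0.
pose T := V1 ^+ 2 *+ 6 - dz (dz V1) + emb E2S * V1 - emb kap.
(* With the factor w, (1-z)^2 becomes q (z - 2 + 1/z), whose moments are 2q in positive even order
   and 0 otherwise. *)
pose y := wS * zfac ^+ 2.
have HT m : mom m T = TT kap m.
  rewrite /T /TT momB momD momB mom_Mn expr2 mom_M !mom_dz mom_emb mom_embE.
  by rewrite -/(vv _) -/(vv _).
have E : qS * V0 *+ 12 + y * T = 0.
  have -> : qS * V0 *+ 12 + y * T = wS * ((zS * V0 *+ 12 + zfac ^+ 2 * (V1 ^+ 2 *+ 6 - dz (dz V1) + emb E2S * V1)) - zfac ^+ 2 * emb kap).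
    rewrite -zwS /y /T; move: V0 V1 (dz _) (emb E2S) (emb kap) zfac wS zS => a b c d e f g h; ring.
  by rewrite H subrr mulr0.
have qE : qS = emb (mono 1 1) by rewrite emb_mono scale1r.
have momy i : mom i y = mono 1 1 * (if (0 < i)%N && ~~ odd i then 1 *+ 2 else 0).
  have -> : y = wS - qS *+ 2 + zqS.
    have -> : y = wS - (zS * wS) *+ 2 + zS * (zS * wS) by rewrite /y /zfac -/zS; ring.
    by rewrite zwS zqSE.
  rewrite momD momB mom_Mn /wS /qS /zqS !mom_mono.
  have -> : (2%:R - 1%:R : rat) = 1 by [].
  rewrite subrr sub0r expr1n expr0n -signr_odd.
  case: i => [|i]; rewrite /=.
    by rewrite mulr0 expr0 mulr2n; ring.
  rewrite mono0 mul0rn subr0; case: (odd i); rewrite /= ?expr0 ?mulr2n.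
    by rewrite mulrDr mulr1.
  rewrite mulr0 expr1; apply: serP => n; rewrite serD !monoE ser0; case: eqP => _; last by rewrite addr0.
  by rewrite addNr.
have := congr1 (mom k.*2) E; rewrite momD mom_Mn qE mom_emb mom_M.
have -> : mom k.*2 0 = 0 by have := momB k.*2 0 0; rewrite !subrr.
have -> : mom k.*2 V0 = vv k.*2.
  by rewrite /V0 momB mom_embE double_eq0 gtn_eqF // subr0.
have -> : \sum_(i < (k.*2).+1) (mom i y * mom (k.*2 - i) T) *+ 'C(k.*2, i) =
  mono 1 1 * ((\sum_(1 <= i < k.+1) TT kap (k.*2 - i.*2) *+ 'C(k.*2, i.*2)) *+ 2).
  pose F i := (if (0 < i)%N && ~~ odd i then TT kap (k.*2 - i) *+ 2 *+ 'C(k.*2, i) else 0).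
  transitivity (mono 1 1 * \sum_(0 <= i < (k.*2).+1) F i).
    rewrite big_mkord mulr_sumr; apply: eq_bigr => i _; rewrite momy HT /F.
    case: ifP => _; last by rewrite mulr0 mul0r mul0rn.
    by rewrite -mulrA mulrnAr; congr (_ * _ *+ _); rewrite mulrnAl mul1r.
  congr (_ * _).
  have FE n : \sum_(0 <= i < (n.*2).+1) F i = \sum_(1 <= i < n.+1) F i.*2.
    elim: n => [|n IH]; first by rewrite big_nat1 big_geq.
    rewrite doubleS !(big_nat_recr n.*2.+2) //= (big_nat_recr n.*2.+1) //= IH [RHS]big_nat_recr //= doubleS.
    by rewrite {2}/F /= odd_double /= addr0.
  rewrite FE -sumrMnl !big_nat; apply: eq_bigr => i /andP[i0 _].
  by rewrite /F double_gt0 i0 odd_double /= -!mulrnA mulnC.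
move=> E'; apply: (@torsion _ _ 2) => //; rewrite mul0rn; apply: mono1_cancel.
rewrite mulrnDl mulrDr -[RHS]E'; congr (_ + _).
by rewrite -mulrnA mulrnAr.
Qed.

Lemma mom_U_odd j : odd j -> mom j User = 0.
Proof.
move=> oj; apply: serP => b; rewrite rowmomE rowmom_sdiv ser0.
case: b => [|b]; first by rewrite sdiv0.
transitivity (sdiv (fun _ _ => 0 : rat) b.+1); last by rewrite /sdiv big1.
apply: sdiv_eq => // k n k0 /(sdiv_le (ltn0Sn b)) kb.
have [E1 E2] := rowmom_pm j kb.
rewrite rowmomMn !rowmomD E1 E2 rowmomX subrr expr0n -(signr_odd _ j) oj expr1 mulN1r subrr add0r.
by rewrite (_ : (j == 0)%N = false) ?mul0rn //; case: (j) oj.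
Qed.

Definition GG (kap : S1) m : S1 :=
  (\sum_(i < m.+1) (mom i Vser * mom (m - i) Vser) *+ 'C(m, i)) - mom m.+1 Vser + mom m User *+ 2
  + (if m == 0%N then kap else 0) *+ 2.

Lemma heat_moments : exists kap, forall a, (0 < a)%N ->
  \sum_(i < a) GG kap i *+ 'C(a, i) = mom a Vser *+ 2 + \sum_(i < a) mom i Vser *+ 'C(a, i).
Proof.
have [kap H] := heat_log; exists kap => a a0.
pose G := Vser ^+ 2 - V1 + User *+ 2 + emb kap *+ 2.
have HG m : mom m G = GG kap m.
  by rewrite /G /GG momD (momD _ (Vser ^+ 2 - V1)) momB !mom_Mn expr2 mom_M mom_V1 mom_embE.
have mz i : mom i zfac = (if i == 0%N then 1 else 0) - 1.
  rewrite /zfac momB mom_mono subr0 expr1n mono1; congr (_ - _).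
  by rewrite -(rmorph1 emb) mom_embE.
have mz' i : mom i (1 + zS) = (if i == 0%N then 1 else 0) + 1.
  rewrite momD /zS mom_mono subr0 expr1n mono1; congr (_ + _).
  by rewrite -(rmorph1 emb) mom_embE.
have E0 i : (i < a)%N -> (a - i == 0)%N = false by move=> ia; lia.
have E1 : mom a (zfac * G) = - \sum_(i < a) GG kap i *+ 'C(a, i).
  rewrite mulrC mom_M big_ord_recr /= subnn mz eqxx subrr mulr0 mul0rn addr0 -sumrN.
  by apply: eq_bigr => i _; rewrite HG mz E0 // sub0r mulrN1 mulNrn.
have E2 : mom a ((1 + zS) * Vser) = mom a Vser *+ 2 + \sum_(i < a) mom i Vser *+ 'C(a, i).
  rewrite mulrC mom_M big_ord_recr /= subnn binn mz' eqxx [in RHS]addrC; congr (_ + _).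
    by apply: eq_bigr => i _; rewrite mz' E0 // add0r mulr1.
  by rewrite mulrDr mulr1 mulr1n.
have m0 : mom a 0 = 0 by have := momB a 0 0; rewrite !subrr.
have := congr1 (mom a) H; rewrite -/G momD E1 E2 m0 addrC => /eqP.
by rewrite subr_eq0 => /eqP ->.
Qed.

Ltac eval_nat :=
  repeat match goal with
  | |- context [binomial ?m ?n] => let v := eval vm_compute in (binomial m n) in
      change (binomial m n) with v
  | |- context [subn ?m ?n] => let v := eval vm_compute in (subn m n) in
      progress change (subn m n) with v
  | |- context [double ?m] => let v := eval vm_compute in (double m) in
      progress change (double m) with v
  end.


Lemma eq_of_sub (x y a b : S1) : a = 0 -> b = 0 -> x - y = a - b -> x = y.
Proof. by move=> -> -> /eqP; rewrite subrr subr_eq0 => /eqP. Qed.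

(** * Ramanujan's differential equations *)

Section Relations.
Let p1 := phiS 1. Let p3 := phiS 3. Let p5 := phiS 5. Let p7 := phiS 7. Let p9 := phiS 9.

Lemma TT0 kap : TT kap 0 = vv 0 ^+ 2 *+ 6 - vv 2 + E2S * vv 0 - kap.
Proof. by rewrite /TT big_ord1 /= binn mulr1n. Qed.
Lemma TT2 kap : TT kap 2 = vv 0 * vv 2 *+ 12 - vv 4 + E2S * vv 2.
Proof.
rewrite /TT !big_ord_recr big_ord0 /=; eval_nat; rewrite (vvE 1) /=.
by move: (vv 0) (vv 2) (vv 4) E2S => a b c e; ring.
Qed.
Lemma TT4 kap : TT kap 4 = vv 0 * vv 4 *+ 12 + vv 2 ^+ 2 *+ 36 - vv 6 + E2S * vv 4.
Proof.
rewrite /TT !big_ord_recr big_ord0 /=; eval_nat; rewrite (vvE 1) (vvE 3) /=.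
by move: (vv 0) (vv 2) (vv 4) (vv 6) E2S => a b c d e; ring.
Qed.

(** The coefficients of E8 = E4^2. Orders 2 and 6 of the Weierstrass moments suffice: the first
    eliminates [kap], and the terms in Phi_1 and Phi_5 cancel. *)
Lemma phi7E : p7 = p3 + p3 ^+ 2 *+ 120.
Proof.
have [kap H] := weierstrass_moments.
have H1 := H 1%N isT; have H3 := H 3%N isT.
rewrite (big_ltn (isT : (1 < 2)%N)) (big_geq (isT : (2 <= 2)%N)) in H1.
rewrite (big_ltn (isT : (1 < 4)%N)) (big_ltn (isT : (2 < 4)%N)) (big_ltn (isT : (3 < 4)%N)) in H3.
rewrite (big_geq (isT : (4 <= 4)%N)) in H3; move: H1 H3; eval_nat.
rewrite (TT0 kap) TT2 TT4 !vvE /= -/p1 -/p3 -/p5 -/p7 /E2S -/p1.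
move: kap p1 p3 p5 p7 {H} => kap a b c d H1 H3.
apply: (@torsion _ _ 18 isT); apply: (eq_of_sub H1 H3); ring.
Qed.


Lemma GG_odd kap m : odd m -> GG kap m = 0.
Proof.
move=> om; rewrite /GG big1 => [|i _]; last first.
  have im : (i <= m)%N by rewrite -ltnS.
  rewrite !mom_V oddB // om; case: (odd i); rewrite /= ?mul0r ?mulr0 mul0rn //.
rewrite mom_V /= om mom_U_odd // mul0rn; case: m om => // m _ /=.
Qed.
Lemma GG2 kap : GG kap 2 = p1 ^+ 2 *+ 8 - p3 *+ 2 + dq p1 *+ 4.
Proof.
rewrite /GG !big_ord_recr big_ord0 /=; eval_nat; rewrite (mom_U 0) !mom_V /= -/p1 -/p3.
by move: (dq p1) p1 p3 => d a b; ring.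
Qed.
Lemma GG4 kap : GG kap 4 = p1 * p3 *+ 32 - p5 *+ 2 + dq p3 *+ 4.
Proof.
rewrite /GG !big_ord_recr big_ord0 /=; eval_nat; rewrite (mom_U 1) !mom_V /= -/p1 -/p3 -/p5.
by move: (dq p3) p1 p3 p5 => d a b c; ring.
Qed.
Lemma GG6 kap : GG kap 6 = p1 * p5 *+ 48 + p3 ^+ 2 *+ 80 - p7 *+ 2 + dq p5 *+ 4.
Proof.
rewrite /GG !big_ord_recr big_ord0 /=; eval_nat; rewrite (mom_U 2) !mom_V /= -/p1 -/p3 -/p5 -/p7.
by move: (dq p5) p1 p3 p5 p7 => d a b c f; ring.
Qed.

(** In odd order only even moments of the bracket in [heat_log] remain. Its zeroth moment g contains
    the unknown constant, and the first equation determines it. *)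
Lemma heat135 : exists g : S1, [/\ g = p1 *+ 4,
  (GG 0 2 *+ 3 + g = p3 *+ 4 + p1 *+ 6)%R,
  (GG 0 4 *+ 5 + GG 0 2 *+ 10 + g = p5 *+ 4 + p3 *+ 20 + p1 *+ 10)%R &
  (GG 0 6 *+ 7 + GG 0 4 *+ 35 + GG 0 2 *+ 21 + g = p7 *+ 4 + p5 *+ 42 + p3 *+ 70 + p1 *+ 14)%R].
Proof.
have [kap H] := heat_moments; exists (GG kap 0).
have K m : GG kap m.+1 = GG 0 m.+1 by rewrite /GG.
have H1 := H 1%N isT; have H3 := H 3%N isT; have H5 := H 5%N isT; have H7 := H 7%N isT.
rewrite !big_ord_recr !big_ord0 /= in H1.
rewrite !big_ord_recr !big_ord0 /= in H3.
rewrite !big_ord_recr !big_ord0 /= in H5.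
rewrite !big_ord_recr !big_ord0 /= in H7.
move: H1 H3 H5 H7; eval_nat.
rewrite !(GG_odd kap (isT : odd 1)) !(GG_odd kap (isT : odd 3)) !(GG_odd kap (isT : odd 5)) !K.
rewrite !mom_V /= -/p1 -/p3 -/p5 -/p7.
move: (GG kap 0) (GG 0 2) (GG 0 4) (GG 0 6) p1 p3 p5 p7 => g g2 g4 g6 a b c d H1 H3 H5 H7.
split.
- by rewrite -[LHS]add0r -[X in _ = X *+ 4]/a; move: H1; rewrite mulr1n => ->; ring.
- apply/eqP; rewrite -subr_eq0; apply/eqP; move/eqP: H3; rewrite -subr_eq0 => /eqP <-; ring.
- apply/eqP; rewrite -subr_eq0; apply/eqP; move/eqP: H5; rewrite -subr_eq0 => /eqP <-; ring.
- apply/eqP; rewrite -subr_eq0; apply/eqP; move/eqP: H7; rewrite -subr_eq0 => /eqP <-; ring.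
Qed.

Lemma eq_lin (x y a b : S1) : a = b -> x - y = a - b -> x = y.
Proof. by move=> ->; rewrite subrr => /eqP; rewrite subr_eq0 => /eqP. Qed.

Lemma dq_phi1 : dq p1 *+ 6 = p3 *+ 5 + p1 - p1 ^+ 2 *+ 12.
Proof.
have [g [-> H _ _]] := heat135; rewrite GG2 in H.
apply: (@torsion _ _ 2 isT); apply: (eq_lin H).
by move: (dq p1) p1 p3 => d a b; ring.
Qed.
Lemma dq_phi3 : dq p3 *+ 30 = p5 *+ 21 + p3 *+ 10 - p1 - p1 * p3 *+ 240.
Proof.
have [g [-> H3 H5 _]] := heat135; rewrite GG4 GG2 in H5; rewrite GG2 in H3.
have E := congr2 (fun x y : S1 => x *+ 3 - y *+ 10) H5 H3; rewrite /= in E.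
apply: (@torsion _ _ 2 isT); apply: (eq_lin E).
by move: (dq p1) (dq p3) p1 p3 p5 => d e a b c; ring.
Qed.
Lemma dq_phi5 : dq p5 *+ 42 = p5 *+ 21 + p3 *+ 20 + p1 - p1 * p5 *+ 504 + p3 ^+ 2 *+ 2400.
Proof.
have [g [-> H3 H5 H7]] := heat135; rewrite GG4 GG2 in H5; rewrite GG2 in H3; rewrite GG6 GG4 GG2 in H7.
have E := congr2 (fun x y : S1 => x - y) (congr2 (fun x y : S1 => x *+ 3 - y *+ 21) H7 H5)
   (congr1 (fun x : S1 => - (x *+ 49)) H3); rewrite /= phi7E in E.
apply: (@torsion _ _ 2 isT); apply: (eq_lin E).
by move: (dq p1) (dq p3) (dq p5) p1 p3 p5 => d e f a b c; ring.
Qed.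

Definition E4S : S1 := 1 + phiS 3 *+ 240.
Definition E6S : S1 := 1 - phiS 5 *+ 504.
Lemma dq_E2 : dq E2S *+ 12 = E2S ^+ 2 - E4S.
Proof.
rewrite /E2S (derB (@dq_der _)) (der1 (@dq_der _)) (derMn (@dq_der _)) /E4S.
have E := congr1 (fun x : S1 => - (x *+ 48)) dq_phi1; rewrite /= -/p1 -/p3 in E *.
apply: (eq_lin E); move: (dq p1) p1 p3 => d a b; ring.
Qed.
Lemma dq_E4 : dq E4S *+ 3 = E2S * E4S - E6S.
Proof.
rewrite /E4S (derD (@dq_der _)) (der1 (@dq_der _)) (derMn (@dq_der _)) /E2S /E6S.
have E := congr1 (fun x : S1 => x *+ 24) dq_phi3; rewrite /= -/p1 -/p3 -/p5 in E *.
apply: (eq_lin E); move: (dq p3) p1 p3 p5 => d a b c; ring.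
Qed.
Lemma dq_E6 : dq E6S *+ 2 = E2S * E6S - E4S ^+ 2.
Proof.
rewrite /E6S (derB (@dq_der _)) (der1 (@dq_der _)) (derMn (@dq_der _)) /E2S /E4S.
have E := congr1 (fun x : S1 => - (x *+ 24)) dq_phi5; rewrite /= -/p1 -/p3 -/p5 in E *.
apply: (eq_lin E); move: (dq p5) p1 p3 p5 => d a b c; ring.
Qed.
End Relations.

(** * The recurrence for rank moments *)

Definition cst (c : rat) : S1 := mono c 0.
Lemma cstM c f n : (cst c * f) n = c * f n.
Proof. by rewrite mono_mul subn0. Qed.
Lemma cst_mul c d : cst (c * d) = cst c * cst d. Proof. by rewrite /cst monoM. Qed.
Lemma cstD c d : cst (c + d) = cst c + cst d.
Proof. by apply: serP => n; rewrite serD !monoE; case: eqP; rewrite ?addr0. Qed.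
Lemma cstN c : cst (- c) = - cst c.
Proof. by apply: serP => n; rewrite serN !monoE; case: eqP; rewrite ?oppr0. Qed.
Lemma cst1 : cst 1 = 1. Proof. exact: mono1. Qed.
Lemma cst0 : cst 0 = 0. Proof. exact: mono0. Qed.
Lemma cst_nat n : cst n%:R = n%:R.
Proof. by elim: n => [|n IH]; rewrite ?cst0 // -natr1 cstD IH cst1 natr1. Qed.
Lemma cst_natM n f : cst n%:R * f = f *+ n. Proof. by rewrite cst_nat mulr_natl. Qed.

Lemma sum_even_odd (V : zmodType) (F : nat -> V) k :
  \sum_(i < k.*2.+1) F i = \sum_(s < k.+1) F s.*2 + \sum_(s < k) F s.*2.+1.
Proof.
elim: k => [|k IH]; first by rewrite !big_ord1 big_ord0 addr0.
rewrite doubleS big_ord_recr big_ord_recr IH [in RHS]big_ord_recr [X in _ = _ + X]big_ord_recr /= doubleS.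
by rewrite -[LHS]addrA [X in _ + X]addrC addrACA.
Qed.

Definition RR j : S1 := mom j Rgf.
Definition HH j : S1 := mom j Hgf.

Lemma mom_q_mul j f g (c : nat -> rat) : (forall i, mom i f = mono (c i) 2) ->
  mom j (f * g) = mono 1 2 * \sum_(i < j.+1) cst (c i) * mom (j - i) g *+ 'C(j, i).
Proof.
move=> H; rewrite mom_M mulr_sumr; apply: eq_bigr => i _.
by rewrite H mulrnAr mulrA /cst monoM addn0 mul1r.
Qed.
Lemma mono2_cancel (f g : S1) : mono 1 2 * f = mono 1 2 * g -> f = g.
Proof.
move=> E; apply: serP => i; have := congr1 (fun h : S1 => h i.+2) E.
by rewrite !mono_mul !subn2 !mul1r.
Qed.

(** The coefficients of the rank-crank equation times w^2 (1 + z^2). As Laurent polynomials times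
    q^2, [y2] and [c2] are even and [m2] is odd under z -> 1/z, so half of their moments vanish; the
    terms z^2 and z^-2 produce the powers of 2 in the recurrence of P_k. *)
Definition y2 : SP := wS ^+ 2 * (1 + zS ^+ 2) * zfac ^+ 2.
Definition m2 : SP := wS ^+ 2 * (1 - zS ^+ 4).
Definition c2 : SP := wS ^+ 2 * zS * (1 + zS ^+ 2).

Lemma wz_mono e : wS ^+ 2 * zS ^+ e = mono 'X^e 2.
Proof. by rewrite /wS /zS !monoX monoM expr0 expr1n mul1r muln0 addn0 muln1 -exprM mul1n. Qed.
Lemma mom_wz i e : mom i (wS ^+ 2 * zS ^+ e) = mono ((e%:R - 2%:R) ^+ i) 2.
Proof. by rewrite wz_mono mom_mono. Qed.
Lemma monoD (c d : rat) b : mono c b + mono d b = mono (c + d) b.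
Proof. by apply: serP => n; rewrite serD !monoE; case: eqP; rewrite ?addr0. Qed.
Lemma monoN (c : rat) b : - mono c b = mono (- c) b.
Proof. by apply: serP => n; rewrite serN !monoE; case: eqP; rewrite ?oppr0. Qed.

Definition yc i : rat := (-2%:R) ^+ i - (-1) ^+ i *+ 2 + 0 ^+ i *+ 2 - 1 *+ 2 + 2%:R ^+ i.
Definition mc i : rat := (-2%:R) ^+ i - 2%:R ^+ i.
Definition cc i : rat := (-1) ^+ i + 1.

Lemma mom_y2 i : mom i y2 = mono (yc i) 2.
Proof.
have -> : y2 = wS ^+ 2 * zS ^+ 0 - wS ^+ 2 * zS ^+ 1 *+ 2 + wS ^+ 2 * zS ^+ 2 *+ 2
   - wS ^+ 2 * zS ^+ 3 *+ 2 + wS ^+ 2 * zS ^+ 4.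
  by rewrite /y2 /zfac -/zS; move: wS zS => w z; ring.
rewrite momD momB momD momB !mom_Mn !mom_wz !mulr2n !(monoN, monoD) /yc.
congr (mono _ _); rewrite sub0r subrr.
have -> : (1%:R - 2%:R : rat) = -1 by [].
have -> : (3%:R - 2%:R : rat) = 1 by [].
have -> : (4%:R - 2%:R : rat) = 2%:R by [].
by rewrite !expr1n !mulr2n.
Qed.
Lemma mom_m2 i : mom i m2 = mono (mc i) 2.
Proof.
have -> : m2 = wS ^+ 2 * zS ^+ 0 - wS ^+ 2 * zS ^+ 4 by rewrite /m2 expr0 mulrBr !mulr1.
rewrite momB !mom_wz monoN monoD /mc sub0r.
by have -> : (4%:R - 2%:R : rat) = 2%:R by [].
Qed.
Lemma mom_c2 i : mom i c2 = mono (cc i) 2.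
Proof.
have -> : c2 = wS ^+ 2 * zS ^+ 1 + wS ^+ 2 * zS ^+ 3 by rewrite /c2; move: wS zS => w z; ring.
rewrite momD !mom_wz monoD /cc.
have -> : (1%:R - 2%:R : rat) = -1 by [].
have -> : (3%:R - 2%:R : rat) = 1 by [].
by rewrite expr1n.
Qed.

Lemma pow2_even s : (-2%:R : rat) ^+ s.*2 = 2%:R ^+ s.*2.
Proof. by rewrite -mul2n !exprM sqrrN. Qed.
Lemma powN1_even s : (-1 : rat) ^+ s.*2 = 1.
Proof. by rewrite -mul2n exprM sqrrN !expr1n. Qed.
Lemma yc_odd s : yc s.*2.+1 = 0.
Proof. by rewrite /yc !exprS pow2_even powN1_even mul0r; ring. Qed.
Lemma yc_even s : (0 < s)%N -> yc s.*2 = 4%:R * (2%:R ^+ (s.*2.-1) - 1).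
Proof.
case: s => // s _; rewrite /yc pow2_even powN1_even expr0n doubleS /= exprS; ring.
Qed.
Lemma yc0 : yc 0 = 0. Proof. by rewrite /yc !expr0; ring. Qed.
Lemma mc_even s : mc s.*2 = 0. Proof. by rewrite /mc pow2_even subrr. Qed.
Lemma mc_odd s : mc s.*2.+1 = - (4%:R * 2%:R ^+ s.*2).
Proof. by rewrite /mc !exprS pow2_even; ring. Qed.
Lemma cc_even s : cc s.*2 = 2%:R. Proof. by rewrite /cc powN1_even. Qed.
Lemma cc_odd s : cc s.*2.+1 = 0. Proof. by rewrite /cc exprS powN1_even; ring. Qed.

Lemma rank_conv k :
  (\sum_(i < k.*2.+1) cst (cc i) * HH (k.*2 - i) *+ 'C(k.*2, i)) *+ 2 =
  (\sum_(i < k.*2.+1) cst (yc i) * dq (RR (k.*2 - i)) *+ 'C(k.*2, i)) *+ 6 +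
  (\sum_(i < k.*2.+1) cst (yc i) * RR (k.*2 - i).+2 *+ 'C(k.*2, i)) +
  (\sum_(i < k.*2.+1) cst (mc i) * RR (k.*2 - i).+1 *+ 'C(k.*2, i)) +
  (\sum_(i < k.*2.+1) cst (cc i) * RR (k.*2 - i) *+ 'C(k.*2, i)) *+ 2.
Proof.
have E : c2 * Hgf *+ 2 = y2 * dq Rgf *+ 6 + y2 * dz (dz Rgf) + m2 * dz Rgf + c2 * Rgf *+ 2.
  have := congr1 (fun x : SP => wS ^+ 2 * (1 + zS ^+ 2) * x) (rank_crank_pde mom0_Rgf).
  rewrite /= /c2 /y2 /m2 => E.
  have -> : wS ^+ 2 * zS * (1 + zS ^+ 2) * Hgf *+ 2 = wS ^+ 2 * (1 + zS ^+ 2) * (zS * Hgf *+ 2).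
    by move: Hgf wS zS => h w z; ring.
  rewrite E; move: (dq Rgf) (dz (dz Rgf)) (dz Rgf) Rgf zfac wS zS => a b c d f w z; ring.
apply: mono2_cancel; have := congr1 (mom k.*2) E.
rewrite (momD _ (y2 * dq Rgf *+ 6 + y2 * dz (dz Rgf) + m2 * dz Rgf)) (momD _ (y2 * dq Rgf *+ 6 + y2 * dz (dz Rgf))) (momD _ (y2 * dq Rgf *+ 6)) !mom_Mn.
rewrite (mom_q_mul _ Hgf mom_c2) (mom_q_mul _ (dq Rgf) mom_y2) (mom_q_mul _ (dz (dz Rgf)) mom_y2).
rewrite (mom_q_mul _ (dz Rgf) mom_m2) (mom_q_mul _ Rgf mom_c2) => EE.
have F (a b c d e a' b' c' d' e' m : S1) : a = a' -> b = b' -> c = c' -> d = d' -> e = e' ->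
    m * a *+ 2 = m * b *+ 6 + m * c + m * d + m * e *+ 2 ->
    m * (a' *+ 2) = m * (b' *+ 6 + c' + d' + e' *+ 2).
  by move=> <- <- <- <- <- H; rewrite mulrnAr H; ring.
apply: F EE; rewrite // ; apply: eq_bigr => i _.
- by rewrite mom_dq.
- by rewrite !mom_dz.
- by rewrite mom_dz.
Qed.

(** [ra k i] and [rb k i] are the linear and the constant coefficient of the factor of P_(k-i) in
    [Pnext]. *)
Definition ra k s : rat := 6%:R * (('C(2 * k, 2 * s))%:R * ((2 ^ (2 * s - 1))%:R - 1)).
Definition rb k s : rat := ('C(2 * k, 2 * s + 2))%:R * ((2 ^ (2 * s + 1))%:R - 1)
          - (2 ^ (2 * s))%:R * ('C(2 * k, 2 * s + 1))%:R + ('C(2 * k, 2 * s))%:R.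

Lemma cst_bin c f n : cst c * f *+ n = cst (c * n%:R) * f.
Proof. by rewrite cst_mul cst_nat -mulr_natr mulrAC. Qed.

Lemma rank_rec k :
  \sum_(s < k.+1) cst 'C(2 * k, 2 * s)%:R * HH (k.*2 - s.*2) =
  \sum_(s < k.+1) (cst (ra k s) * dq (RR (k.*2 - s.*2)) + cst (rb k s) * RR (k.*2 - s.*2)).
Proof.
have E := rank_conv k; set X := LHS.
(* The sums of [rank_conv] carry a common factor 4. *)
have c4 (f : S1) : cst 4%:R * f = 0 -> f = 0.
  move=> H; apply: serP => n; have := congr1 (fun g : S1 => g n) H.
  by rewrite cstM ser0 => /eqP; rewrite mulf_eq0 => /orP[//|/eqP].
apply/eqP; rewrite -subr_eq0; apply/eqP/c4; rewrite mulrBr; apply/eqP; rewrite subr_eq0; apply/eqP.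
have -> : cst 4%:R * X = (\sum_(i < k.*2.+1) cst (cc i) * HH (k.*2 - i) *+ 'C(k.*2, i)) *+ 2.
  rewrite (sum_even_odd (fun i => cst (cc i) * HH (k.*2 - i) *+ 'C(k.*2, i))).
  rewrite [X in (_ + X) *+ 2]big1 ?addr0; last by move=> i _; rewrite cc_odd cst0 mul0r mul0rn.
  rewrite /X mulr_sumr -sumrMnl; apply: eq_bigr => s _.
  rewrite cc_even !cst_bin mulrA -cst_mul !mul2n; congr (cst _ * _); rewrite -!natrM; congr (_%:R); lia.
rewrite E.
have odd0 (f g : nat -> rat) (G : nat -> S1) : (forall s, f s.*2.+1 = 0) ->
    \sum_(i < k.*2.+1) cst (f i) * G (k.*2 - i)%N *+ 'C(k.*2, i) =
    \sum_(s < k.+1) cst (f s.*2 * ('C(2 * k, 2 * s))%:R) * G (k.*2 - s.*2)%N.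
  move=> H; rewrite (sum_even_odd (fun i => cst (f i) * G (k.*2 - i)%N *+ 'C(k.*2, i))).
  rewrite [X in _ + X]big1 ?addr0; last by move=> i _; rewrite H cst0 mul0r mul0rn.
  by apply: eq_bigr => s _; rewrite cst_bin !mul2n.
rewrite (odd0 yc yc (fun j => dq (RR j)) yc_odd) (odd0 yc yc (fun j => RR j.+2) yc_odd).
rewrite (odd0 cc cc RR cc_odd).
rewrite (sum_even_odd (fun i => cst (mc i) * RR (k.*2 - i).+1 *+ 'C(k.*2, i))).
rewrite [X in _ + (X + _) + _]big1 ?add0r; last by move=> i _; rewrite mc_even cst0 mul0r mul0rn.
have -> : \sum_(s < k) cst (mc s.*2.+1) * RR (k.*2 - s.*2.+1).+1 *+ 'C(k.*2, s.*2.+1) =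
   \sum_(s < k.+1) cst (- (4%:R * (2 ^ (2 * s) * 'C(2 * k, 2 * s + 1))%:R)) * RR (k.*2 - s.*2).
  rewrite big_ord_recr /= [X in _ = _ + X](_ : _ = 0) ?addr0; last first.
    by rewrite (@bin_small (2 * k)) ?muln0 ?mulr0 ?oppr0 ?cst0 ?mul0r //; lia.
  apply: eq_bigr => s _; rewrite cst_bin mc_odd !mul2n addn1; congr (cst _ * RR _).
    by rewrite natrM natrX; ring.
  by have := ltn_ord s; lia.
(* The second z-derivative raises the moment by two, so s is replaced by s + 1. The initial term
   vanishes with [yc 0], and the new final one has a binomial coefficient out of range. *)
have -> : \sum_(s < k.+1) cst (yc s.*2 * ('C(2 * k, 2 * s))%:R) * RR (k.*2 - s.*2).+2 =
   \sum_(s < k.+1) cst (4%:R * (('C(2 * k, 2 * s + 2))%:R * ((2 ^ (2 * s + 1))%:R - 1))) * RR (k.*2 - s.*2).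
  rewrite big_ord_recl yc0 mul0r cst0 mul0r add0r [in RHS]big_ord_recr /=.
  rewrite [X in _ = _ + X](_ : _ = 0) ?addr0; last first.
    by rewrite (@bin_small (2 * k)) ?mul0r ?mulr0 ?cst0 ?mul0r //; lia.
  apply: eq_bigr => s _; rewrite -[bump 0 s]/(s.+1) yc_even // -[s.+1.*2.-1]/(s.*2.+1) -!mul2n addn1 addn2 mulnS.
  rewrite (_ : (2 * k - (2 + 2 * s)).+2 = 2 * k - 2 * s)%N; last by have := ltn_ord s; lia.
  by congr (cst _ * _); rewrite natrX; ring.
rewrite -!sumrMnl -!big_split /= mulr_sumr; apply: eq_bigr => s _.
have F (x a a' z m c b f g : S1) : x * a = a' *+ 6 -> x * b = z + m + c *+ 2 ->
    a' * f *+ 6 + z * g + m * g + c * g *+ 2 = x * (a * f + b * g).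
  by move=> H1 H2; rewrite mulrDr !mulrA H1 H2; ring.
apply: F; rewrite -cst_mul.
  rewrite -cst_natM -cst_mul; congr cst; rewrite /ra; case: (nat_of_ord s) => [|n].
    by rewrite yc0 muln0 expn0; ring.
  rewrite yc_even // -[n.+1.*2.-1]/(n.*2.+1) -natrX (_ : 2 * n.+1 - 1 = n.*2.+1)%N; last lia.
  by ring.
rewrite -cst_natM -cst_mul -!cstD; congr cst; rewrite /rb cc_even natrM; ring.
Qed.

(** * The l-integral ring generated by E2, E4, E6 *)

Lemma bin2_even k : 'C(k.*2, 2) = (k * k.*2.-1)%N.
Proof.
by have := mul_bin_diag k.*2 1; rewrite bin1 -!muln2; nia.
Qed.

Section LocalRing.
Variable l : nat.
Hypothesis hl : prime l.
Hypothesis hl3 : (3 < l)%N.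

Definition lint (c : rat) := exists (n : int) (d : nat), ~~ (l %| d)%N /\ c = n%:~R / d%:R.

Lemma nz d : ~~ (l %| d)%N -> (d%:R : rat) != 0.
Proof. by case: d => [|d] H; [rewrite dvdn0 in H|rewrite pnatr_eq0]. Qed.
Lemma lint_div (n : int) d : ~~ (l %| d)%N -> lint (n%:~R / d%:R).
Proof. by move=> H; exists n, d. Qed.
Lemma l1 : ~~ (l %| 1)%N. Proof. by rewrite dvdn1 neq_ltn (ltn_trans _ hl3) ?orbT. Qed.
Lemma lint_int (n : int) : lint n%:~R.
Proof. by rewrite -[n%:~R]divr1; apply: lint_div l1. Qed.
Lemma lint_nat n : lint n%:R. Proof. exact: (lint_int n). Qed.
Lemma lint0 : lint 0. Proof. exact: (lint_int 0). Qed.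
Lemma lint1 : lint 1. Proof. exact: (lint_int 1). Qed.
Lemma lint_inv d : ~~ (l %| d)%N -> lint d%:R^-1.
Proof. by move=> H; rewrite -[_^-1]mul1r; apply: (lint_div 1 H). Qed.
Lemma lintM c c' : lint c -> lint c' -> lint (c * c').
Proof.
move=> [n [d [H ->]]] [n' [d' [H' ->]]]; exists (n * n'), (d * d')%N; split.
  by rewrite Euclid_dvdM // negb_or H.
by rewrite rmorphM natrM invfM /=; ring.
Qed.
Lemma lintD c c' : lint c -> lint c' -> lint (c + c').
Proof.
move=> [n [d [H ->]]] [n' [d' [H' ->]]]; exists (n * d' + n' * d), (d * d')%N; split.
  by rewrite Euclid_dvdM // negb_or H.
rewrite addf_div ?nz // natrM rmorphD !rmorphM /=; congr (_ / _); ring.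
Qed.
Lemma lintN c : lint c -> lint (- c).
Proof. by rewrite -mulN1r; apply: lintM; exact: (lint_int (-1)). Qed.
Lemma lintB c c' : lint c -> lint c' -> lint (c - c').
Proof. by move=> H H'; apply: lintD => //; apply: lintN. Qed.

Lemma l_small d : (0 < d)%N -> (d < l)%N -> ~~ (l %| d)%N.
Proof. by move=> d0 dl; apply/negP => /(dvdn_leq d0); rewrite leqNgt dl. Qed.
Lemma lM d d' : ~~ (l %| d)%N -> ~~ (l %| d')%N -> ~~ (l %| d * d')%N.
Proof. by move=> H H'; rewrite Euclid_dvdM // negb_or H. Qed.
Lemma l2 : ~~ (l %| 2)%N. Proof. by apply: l_small => //; lia. Qed.
Lemma l3 : ~~ (l %| 3)%N. Proof. by apply: l_small => //; lia. Qed.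

(** The l-integral polynomials in E2, E4, E6 of weight at most k, as a filtered ring. Induction on
    this form gives stability under delta_q without writing out monomials. *)
Inductive Y : nat -> S1 -> Prop :=
| Yc k c : lint c -> Y k (cst c)
| YE2 k : (2 <= k)%N -> Y k E2S
| YE4 k : (4 <= k)%N -> Y k E4S
| YE6 k : (6 <= k)%N -> Y k E6S
| YD k f g : Y k f -> Y k g -> Y k (f + g)
| YM a b k f g : (a + b <= k)%N -> Y a f -> Y b g -> Y k (f * g).

Lemma Yw k k' f : Y k f -> (k <= k')%N -> Y k' f.
Proof.
move=> H; elim: H k' => {k f} [k c H|k H|k H|k H|k f g _ IH _ IH'|a b k f g H Hf _ Hg _] k' kk.
- exact: Yc.
- by apply: YE2; exact: leq_trans kk.
- by apply: YE4; exact: leq_trans kk.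
- by apply: YE6; exact: leq_trans kk.
- by apply: YD; [exact: IH|exact: IH'].
- by apply: (YM _ Hf Hg); exact: leq_trans kk.
Qed.
Lemma YZ k c f : lint c -> Y k f -> Y k (cst c * f).
Proof. by move=> H; apply: (@YM 0 k) => //; apply: Yc. Qed.
Lemma Yn k f n : Y k f -> Y k (f *+ n).
Proof. by rewrite -cst_natM; apply: YZ; exact: lint_nat. Qed.
Lemma YN k f : Y k f -> Y k (- f).
Proof. by rewrite -mulN1r -cst1 -cstN; apply: YZ; exact: (lint_int (-1)). Qed.
Lemma YB k f g : Y k f -> Y k g -> Y k (f - g).
Proof. by move=> H H'; apply: YD => //; apply: YN. Qed.
Lemma Y0 k : Y k 0. Proof. by rewrite -cst0; apply: Yc lint0. Qed.
Lemma Y1 k : Y k 1. Proof. by rewrite -cst1; apply: Yc lint1. Qed.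
Lemma Ysum k I (r : seq I) (P : pred I) (F : I -> S1) :
  (forall i, P i -> Y k (F i)) -> Y k (\sum_(i <- r | P i) F i).
Proof. by move=> H; elim/big_rec: _ => [|i x Pi]; [exact: Y0|apply: YD; exact: H]. Qed.
Lemma Ydiv k f n : ~~ (l %| n)%N -> Y k (f *+ n) -> Y k f.
Proof.
move=> H Hf; have -> : f = cst n%:R^-1 * (f *+ n).
  by rewrite -cst_natM mulrA -cst_mul mulVf ?nz // cst1 mul1r.
by apply: YZ => //; exact: lint_inv.
Qed.

(** Ramanujan's formulas raise the weight by 2, and their denominators 12, 3, 2 are prime to l. *)
Lemma Ydq k f : Y k f -> Y k.+2 (dq f).
Proof.
elim=> {k f} [k c H|k H|k H|k H|k f g _ IH _ IH'|a b k f g H Hf IH Hg IH'].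
- by rewrite dq_mono mulr0n; exact: Y0.
- apply: (@Ydiv _ _ (4 * 3)); first by rewrite lM ?l3 // (lM l2 l2).
  rewrite dq_E2; apply: YB; last exact: YE4.
  by rewrite expr2; apply: (@YM 2 2) => //; apply: YE2.
- apply: Ydiv l3 _; rewrite dq_E4; apply: YB; last by apply: YE6.
  by apply: (@YM 2 4) => //; [apply: YE2|apply: YE4].
- apply: Ydiv l2 _; rewrite dq_E6; apply: YB; last first.
    by rewrite expr2; apply: (@YM 4 4) => //; apply: YE4.
  by apply: (@YM 2 6) => //; [apply: YE2|apply: YE6].
- by rewrite (derD (@dq_der _)); apply: YD.
- rewrite (derM (@dq_der _)); apply: YD.
    by apply: YM IH Hg; lia.
  by apply: YM Hf IH'; lia.
Qed.

Lemma vv_odd i : odd i -> vv i = 0. Proof. by rewrite vvE => ->. Qed.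
(** The factor 2k + 3 is kept apart from the unit u because it equals l in the top weight; the
    statement then says that l Phi_(l-2) lies in the ring. *)
Lemma Yvv_dvd k : (k.*2 + 3 <= l)%N ->
  exists u, ~~ (l %| u)%N /\ Y (k.*2 + 2) (vv k.*2 *+ ((k.*2 + 3) * u)).
Proof.
have [kap W] := weierstrass_moments.
elim/ltn_ind: k => k IH kl.
have Yv i : (i < k.*2)%N -> Y (i + 2) (vv i).
  move=> ik; case oi: (odd i); first by rewrite vv_odd //; exact: Y0.
  have iE : i = i./2.*2 by rewrite -[LHS]odd_double_half oi.
  have [|/ltac:(lia)|u [Hu H]] := IH i./2; first by lia.
  by rewrite iE; apply: Ydiv H; apply: lM Hu; apply: l_small; lia.
have YQ m : (m < k.*2)%N -> Y (m + 4) ((\sum_(i < m.+1) (vv i * vv (m - i)) *+ 'C(m, i)) *+ 6 + E2S * vv m).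
  move=> mk; apply: YD.
    apply: Yn; apply: Ysum => i _; apply: Yn; have im := ltn_ord i.
    by apply: (@YM (i + 2) (m - i + 2)); [lia|apply: Yv; lia|apply: Yv; lia].
  by apply: (@YM 2 (m + 2)); [lia|apply: YE2|apply: Yv].
have TE m : TT kap m.+1 = (\sum_(i < m.+2) (vv i * vv (m.+1 - i)) *+ 'C(m.+1, i)) *+ 6 + E2S * vv m.+1 - vv m.+3.
  by rewrite /TT subr0 -addrA [- _ + _]addrC addrA.
case: k IH kl Yv YQ => [|[|[|k]]] IH kl Yv YQ.
(* In the three base cases (2k + 3) u is 12, 120 or 252, half of 24, 240 or 504, because [vv] is
   twice Phi. *)
- exists 4; split; first exact: (lM l2 l2).
  rewrite (_ : _ *+ _ = 1 - E2S); first by apply: YB; [exact: Y1|apply: YE2].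
  by rewrite vvE -[((0.*2 + 3) * 4)%N]/12%N /= /E2S; move: (phiS 1) => p; ring.
- exists (4 * 6)%N; split; first by apply: lM (lM l2 l3); exact: (lM l2 l2).
  rewrite (_ : _ *+ _ = E4S - 1); first by apply: YB; [apply: YE4|exact: Y1].
  by rewrite vvE -[((1.*2 + 3) * (4 * 6))%N]/120%N /= /E4S; move: (phiS 3) => p; ring.
- exists (4 * 9)%N; split; first by apply: lM (lM l3 l3); exact: (lM l2 l2).
  rewrite (_ : _ *+ _ = 1 - E6S); first by apply: YB; [exact: Y1|apply: YE6].
  by rewrite vvE -[((2.*2 + 3) * (4 * 9))%N]/252%N /= /E6S; move: (phiS 5) => p; ring.
exists k.+1; split; first by apply: l_small => //; lia.
have := W k.+3 isT; rewrite big_ltn // big_nat_recr //= subnn.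
have TT0 : TT kap 0 = - (vv 2 *+ 6).
  by have := W 1%N isT; rewrite big_nat1 /= binn mulr1n addrC => /eqP; rewrite addr_eq0 => /eqP.
rewrite TT0 binn mulr1n (_ : k.+3.*2 - 1.*2 = k.*2.+3.+1)%N; last lia.
rewrite TE (_ : k.*2.+3.+3 = k.+3.*2); last lia.
set A := _ *+ 6 + E2S * _; set B := \sum_(_ <= i < _) _; set b := 'C(_, _) => E.
(* With a = 2(k + 3), the moment [vv a] occurs with coefficient C(a,2) in the term i = 1 and with 6
   outside the sum; the difference C(a,2) - 6 is (a - 4)(a + 3)/2. *)
have bE : (b = (k.+3.*2 + 3) * k.+1 + 6)%N.
  by rewrite /b -[1.*2]/2%N bin2_even; nia.
have -> : vv k.+3.*2 *+ ((k.+3.*2 + 3) * k.+1) = A *+ b + B - vv 2 *+ 6.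
  apply: (@eq_lin _ _ 0 (vv k.+3.*2 *+ 6 + ((A - vv k.+3.*2) *+ b + (B - vv 2 *+ 6)))) => //.
  rewrite bE; clear E bE; move: A B (vv _) (vv _) (_ * _)%N => A B c d n; ring.
have Y2 : Y (k.+3.*2 + 2) (vv 2 *+ 6) by apply: Yn; apply: Yw (Yv 2%N _) _; lia.
apply: YB Y2; apply: YD.
  by apply: Yn; apply: Yw (YQ _ _) _; lia.
rewrite /B big_nat_cond; apply: Ysum => i /andP[/andP[i2 ik] _]; apply: Yn.
have -> : (k.+3.*2 - i.*2 = (k.+3.*2 - i.*2).-1.+1)%N by lia.
rewrite TE; apply: YB.
  by apply: Yw (YQ _ _) _; lia.
by apply: Yw (Yv _ _) _; lia.
Qed.

Lemma Yvv i : (i + 3 < l)%N -> Y (i + 2) (vv i).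
Proof.
move=> il; case oi: (odd i); first by rewrite vv_odd //; exact: Y0.
have iE : i = i./2.*2 by rewrite -[LHS]odd_double_half oi.
have [|u [Hu H]] := @Yvv_dvd i./2; first by lia.
by rewrite iE; apply: Ydiv H; apply: lM Hu; apply: l_small; lia.
Qed.

(** Membership in P times the ring, tested after multiplication by 1/P. *)
Definition PY k (h : S1) := Y k (Q1 * h).
Lemma PYw k k' h : PY k h -> (k <= k')%N -> PY k' h. Proof. exact: Yw. Qed.
Lemma PYD k f g : PY k f -> PY k g -> PY k (f + g).
Proof. by move=> H H'; rewrite /PY mulrDr; apply: YD. Qed.
Lemma PYB k f g : PY k f -> PY k g -> PY k (f - g).
Proof. by move=> H H'; rewrite /PY mulrBr; apply: YB. Qed.
Lemma PYn k f n : PY k f -> PY k (f *+ n).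
Proof. by move=> H; rewrite /PY mulrnAr; apply: Yn. Qed.
Lemma PYZ k c f : lint c -> PY k f -> PY k (cst c * f).
Proof. by move=> H Hf; rewrite /PY mulrCA; apply: YZ. Qed.
Lemma PYsum k I (r : seq I) (P : pred I) (F : I -> S1) :
  (forall i, P i -> PY k (F i)) -> PY k (\sum_(i <- r | P i) F i).
Proof. by move=> H; rewrite /PY mulr_sumr; apply: Ysum. Qed.
Lemma PYdiv k f n : ~~ (l %| n)%N -> PY k (f *+ n) -> PY k f.
Proof. by rewrite /PY mulrnAr; exact: Ydiv. Qed.
Lemma PYM a b k f g : (a + b <= k)%N -> PY a f -> Y b g -> PY k (f * g).
Proof. by move=> H Hf Hg; rewrite /PY mulrA; apply: YM Hf Hg. Qed.
Lemma PYP1 k f : Y k f -> PY k (P1 * f).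
Proof. by rewrite /PY mulrA Q1_P1 mul1r. Qed.
Lemma Yphi1 : Y 2 (phiS 1).
Proof. by apply: Ydiv l2 _; have := @Yvv 0; rewrite vvE /=; apply; lia. Qed.
Lemma PYdq k f : PY k f -> PY k.+2 (dq f).
Proof.
move=> H; rewrite /PY; have -> : Q1 * dq f = dq (Q1 * f) + phiS 1 * (Q1 * f).
  by rewrite (derM (@dq_der _) Q1) dq_Q1; move: Q1 (phiS 1) f (dq f) {H} => a b c d; ring.
apply: YD; first exact: Ydq.
by apply: YM Yphi1 H; lia.
Qed.

(** The equation dz G = r G V makes the moment of order 2k a convolution of lower moments with those
    of V. Only the term with [mom 0 G] = P contains Phi_(2k-1), the one divisor sum that is not
    known to be l-integral when 2k = l - 1. *)
Lemma PYmom (G : SP) r : dz G = G * (Vser *+ r) -> mom 0 G = P1 -> pal G ->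
  forall k, (0 < k)%N -> (k.*2 < l)%N ->
  PY k.*2 (mom k.*2 G - P1 * phiS (k.*2.-1) *+ (2 * r)).
Proof.
move=> dG G0 pG; elim/ltn_ind => -[//|k] IH _ kl.
rewrite doubleS -mom_dz dG mom_M.
have -> : P1 * phiS k.*2.+2.-1 *+ (2 * r) = (mom 0 G * mom (k.*2.+1 - 0) (Vser *+ r)) *+ 'C(k.*2.+1, 0).
  by rewrite G0 mom_Mn mom_V subn0 /= odd_double /= bin0 mulr1n -mulrnAr mulrnA.
rewrite big_ord_recl [_ + \sum_(_ < _) _]addrC addrK; apply: PYsum => i _; apply: PYn.
rewrite !lift0; case oi: (odd i.+1).
  by rewrite (mom_pal pG oi) mul0r /PY mulr0; exact: Y0.
have ik := ltn_ord i.
have [j jE j0] : exists2 j, i.+1 = j.*2 & (0 < j)%N.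
  by exists i.+1./2; have := odd_double_half i.+1; rewrite oi; lia.
rewrite jE mom_Mn; have -> : (k.*2.+1 - j.*2 = (k - j).*2.+1)%N by lia.
rewrite mulrnAr; apply: PYn; rewrite -(mom_V1 (k - j).*2) -/(vv _).
apply: (@PYM j.*2 ((k - j).*2 + 2)); [lia| |by apply: Yvv; lia].
have H := IH j ltac:(lia) j0 ltac:(lia).
rewrite -[mom _ _](subrK (P1 * phiS j.*2.-1 *+ (2 * r))); apply: PYD H _; apply: PYn.
apply: PYP1; apply: Ydiv l2 _; have := @Yvv j.-1.*2 ltac:(lia).
rewrite vvE odd_double; have -> : j.-1.*2.+1 = j.*2.-1 by lia.
by move=> H; apply: Yw H _; lia.
Qed.

Lemma Plist_size k : size (Plist k) = k.+1.
Proof. by elim: k => //= k IH; rewrite size_rcons IH. Qed.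
Lemma Plist_nth j k : (j <= k)%N -> nth 0 (Plist k) j = Ppoly j.
Proof.
elim: k => [|k IH]; first by case: j.
rewrite leq_eqVlt => /orP[/eqP->|jk] //.
by rewrite /= nth_rcons Plist_size jk IH.
Qed.

Definition pd (p : {poly rat}) (f : S1) : S1 := Ser (poly_delta p f).
Lemma pdE p f n : pd p f n = p.[n%:R] * f n.
Proof.
rewrite /= /poly_delta horner_coef mulr_suml; apply: eq_bigr => i _.
have -> : iter i delta_q f n = n%:R ^+ i * f n.
  by elim: (nat_of_ord i) => [|j IH]; rewrite /= ?mul1r // /delta_q IH exprS mulrA.
by rewrite mulrA.
Qed.

Lemma Ppoly1 : Ppoly 1 = 1. Proof. by []. Qed.
Lemma Ppoly_rec k : (1 < k)%N ->
  ((2 * k - 1) * (k - 1))%:R *: Ppoly k =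
  - \sum_(1 <= i < k) (ra k i *: 'X + (rb k i)%:P) * Ppoly (k - i).
Proof.
have E n : Ppoly n.+1 = Pnext n.+1 (Plist n) by rewrite /Ppoly /= nth_rcons Plist_size ltnn eqxx.
case: k => // -[//|k] _; have F : (k.+2 <= 1)%N = false by []; rewrite E {1}/Pnext F.
rewrite scalerA mulrN mulfV; last by rewrite pnatr_eq0; lia.
rewrite scaleN1r; congr (- _); rewrite !big_nat; apply: eq_bigr => i /andP[i1 ik].
by rewrite Plist_nth //; lia.
Qed.

Definition DD k : S1 := RR k.*2 - pd (Ppoly k) (RR 2).
Lemma DD1 : DD 1 = 0.
Proof. by apply: serP => n; rewrite serB pdE Ppoly1 hornerE mul1r subrr. Qed.

Lemma DD_rec k : (1 < k)%N ->
  DD k *+ ((2 * k - 1) * (k - 1)) =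
  \sum_(s < k) cst 'C(2 * k, 2 * s)%:R * HH (k.*2 - s.*2) - cst (ra k k) * (P1 * phiS 1)
  - \sum_(1 <= i < k) (cst (ra k i) * dq (DD (k - i)) + cst (rb k i) * DD (k - i)).
Proof.
move=> k1; have := rank_rec k; rewrite !big_ord_recr /= subnn.
have -> : HH 0 = P1 by exact: mom0_Hgf.
have -> : RR 0 = P1 by exact: mom0_Rgf.
have -> : 'C(2 * k, 2 * k) = 1%N by rewrite binn.
have -> : rb k k = 1 by rewrite /rb binn !bin_small ?mulr0 ?mul0r ?subrr ?add0r //; lia.
rewrite cst1 !mul1r dq_P1 addrA => /addIr E.
rewrite -[X in X - _](addrK (cst (ra k k) * (P1 * phiS 1))) E.
have -> : forall a b : S1, a + b - b = a by move=> a b; rewrite addrK.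
case: k k1 E => // k k1 E {E}.
rewrite big_ord_recl /=.
have -> : ra k.+1 0 = 0 by rewrite /ra muln0 expn0 subrr !mulr0.
(* The value C(2k,2) - 2k + 1 = (2k-1)(k-1), written with k + 1 for k, is the denominator in the
   definition of P_k. *)
have -> : rb k.+1 0 = ((2 * k.+1 - 1) * (k.+1 - 1))%:R.
  rewrite /rb muln0 bin0 bin1 expn0 mul1r add0n expn1 mul2n bin2_even.
  rewrite (_ : k.+1 * k.+1.*2.-1 = (k.+1.*2 - 1) * (k.+1 - 1) + (k.+1.*2 - 1))%N; last nia.
  by rewrite natrD (@natrB _ k.+1.*2 1) //; ring.
rewrite cst0 mul0r add0r subn0 cst_natM.
have -> : \sum_(i < k) (cst (ra k.+1 (bump 0 i)) * dq (RR (k.+1.*2 - (bump 0 i).*2)) +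
    cst (rb k.+1 (bump 0 i)) * RR (k.+1.*2 - (bump 0 i).*2)) =
  \sum_(1 <= i < k.+1) (cst (ra k.+1 i) * dq (RR (k.+1 - i).*2) + cst (rb k.+1 i) * RR (k.+1 - i).*2).
  rewrite big_add1 big_mkord; apply: eq_bigr => i _.
  by rewrite -[bump 0 i]/(i.+1) -doubleB.
set SR := \sum_(1 <= i < k.+1) (_ + _); set SD := \sum_(1 <= i < k.+1) (_ + _).
pose SP := \sum_(1 <= i < k.+1) (cst (ra k.+1 i) * dq (pd (Ppoly (k.+1 - i)) (RR 2)) +
   cst (rb k.+1 i) * pd (Ppoly (k.+1 - i)) (RR 2)).
have -> : SR = SD + SP.
  rewrite /SR /SD /SP -big_split /=; apply: eq_bigr => i _.
  rewrite /DD (derB (@dq_der _)); move: (RR (k.+1 - i).*2) (pd _ _) (cst _) (cst _) => c d e f.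
  by move: (dq c) (dq d) => a b; ring.
have -> : DD k.+1 *+ ((2 * k.+1 - 1) * (k.+1 - 1)) = RR k.+1.*2 *+ ((2 * k.+1 - 1) * (k.+1 - 1)) + SP.
  rewrite /DD mulrnBl; congr (_ + _); apply: serP => n.
  rewrite serN serMn pdE -[_ *+ (_ * _)]mulr_natl mulrA -(hornerZ _ (Ppoly k.+1)) (Ppoly_rec k1) hornerN horner_sum.
  rewrite mulNr opprK mulr_suml /SP ser_sum; apply: eq_bigr => i _.
  rewrite serD !cstM dqE pdE hornerM hornerD hornerZ hornerX hornerC -[(_ * _) *+ n]mulr_natl.
  by move: (n%:R : rat) (ra _ _) (rb _ _) (Ppoly _).[_] (RR 2 n) => a b c d e; ring.
by rewrite addrK [SD + SP]addrC addrA addrK.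
Qed.

Lemma lint_ra k i : lint (ra k i).
Proof. by apply: lintM (lint_nat 6) _; apply: lintM (lint_nat _) _; apply: lintB (lint_nat _) lint1. Qed.
Lemma lint_rb k i : lint (rb k i).
Proof.
apply: lintD (lint_nat _); apply: lintB; last by apply: lintM; exact: lint_nat.
by apply: lintM (lint_nat _) _; apply: lintB (lint_nat _) lint1.
Qed.

Lemma PYcrank k : (0 < k)%N -> (k.*2 < l)%N ->
  PY k.*2 (mom k.*2 Cgf - P1 * phiS (k.*2.-1) *+ 2).
Proof.
by apply: (@PYmom _ 1) => //; [rewrite mulr1n; exact: dz_Cgf|exact: mom0_Cgf|exact: pal_Cgf].
Qed.
Lemma PYH k : (0 < k)%N -> (k.*2 < l)%N -> PY k.*2 (HH k.*2 - P1 * phiS (k.*2.-1) *+ 6).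
Proof. by apply: (@PYmom _ 3) => //; [exact: dz_Hgf|exact: mom0_Hgf|exact: pal_Hgf]. Qed.
Lemma Yphi k : (0 < k)%N -> (k.*2.+1 < l)%N -> Y k.*2 (phiS k.*2.-1).
Proof.
move=> k0 kl; apply: Ydiv l2 _; have := @Yvv k.-1.*2 ltac:(lia).
rewrite vvE odd_double; have -> : k.-1.*2.+1 = k.*2.-1 by lia.
by move=> H; apply: Yw H _; lia.
Qed.
Lemma PYcrank_lt k : (0 < k)%N -> (k.*2.+1 < l)%N -> PY k.*2 (mom k.*2 Cgf).
Proof.
move=> k0 kl; rewrite -[mom _ _](subrK (P1 * phiS k.*2.-1 *+ 2)).
by apply: PYD; [apply: PYcrank => //; lia|apply: PYn; apply: PYP1; exact: Yphi].
Qed.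
Lemma PYH_lt k : (k.*2.+1 < l)%N -> PY k.*2 (HH k.*2).
Proof.
case: k => [|k] kl; first by rewrite (mom0_Hgf : HH 0 = P1) /PY Q1_P1; exact: Y1.
rewrite -[HH _](subrK (P1 * phiS k.+1.*2.-1 *+ 6)).
by apply: PYD; [apply: PYH => //; lia|apply: PYn; apply: PYP1; apply: Yphi => //].
Qed.

(** The term s = 0 contributes H_(2k), hence 6 P Phi_(2k-1). All other terms have lower order, and
    lower differences are l-integral because their denominators (2i-1)(i-1) are units. *)
Lemma PYDD_N k : (1 < k)%N -> (k.*2 < l)%N ->
  PY k.*2 (DD k *+ ((2 * k - 1) * (k - 1)) - P1 * phiS (k.*2.-1) *+ 6).
Proof.
elim/ltn_ind: k => k IH k1 kl.
have DDlt i : (0 < i)%N -> (i < k)%N -> PY i.*2 (DD i).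
  move=> i0 ik; have [->|i1] := eqVneq i 1%N; first by rewrite DD1 /PY mulr0; exact: Y0.
  have {}i1 : (1 < i)%N by lia.
  apply: (@PYdiv _ _ ((2 * i - 1) * (i - 1))); first by apply: lM; apply: l_small; lia.
  rewrite -[_ *+ _](subrK (P1 * phiS i.*2.-1 *+ 6)); apply: PYD; first by apply: IH => //; lia.
  by apply: PYn; apply: PYP1; apply: Yphi => //; lia.
rewrite DD_rec //; case: k k1 kl DDlt {IH} => // k k1 kl DDlt.
rewrite big_ord_recl /= muln0 bin0 cst1 mul1r subn0.
set T1 := \sum_(i < k) _; set T2 := \sum_(_ <= _ < _) _.
have -> : forall a b c d e : S1, a + b - c - d - e = (a - e) + (b - c - d).
  by move=> a b c d e; ring.
apply: PYD; first exact: PYH.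
apply: PYB; first apply: PYB.
- apply: PYsum => i _; apply: PYZ (lint_nat _) _; rewrite -doubleB.
  by apply: (PYw (PYH_lt _)); rewrite -[bump 0 i]/(i.+1); lia.
- by apply: PYZ (lint_ra _ _) _; apply: PYP1; apply: Yw Yphi1 _; lia.
- rewrite /T2 big_nat_cond; apply: PYsum => i /andP[/andP[i1 ik] _].
  have H := DDlt (k.+1 - i)%N ltac:(lia) ltac:(lia).
  apply: PYD; first by apply: PYZ (lint_ra _ _) _; apply: PYw (PYdq H) _; lia.
  by apply: PYZ (lint_rb _ _) _; apply: PYw H _; lia.
Qed.

Lemma PYDD k : (1 < k)%N -> (k.*2.+1 < l)%N -> PY k.*2 (DD k).
Proof.
move=> k1 kl; apply: (@PYdiv _ _ ((2 * k - 1) * (k - 1))); first by apply: lM; apply: l_small; lia.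
rewrite -[_ *+ _](subrK (P1 * phiS k.*2.-1 *+ 6)); apply: PYD; first by apply: PYDD_N => //; lia.
by apply: PYn; apply: PYP1; apply: Yphi => //; lia.
Qed.

Lemma PYDD_top k : (1 < k)%N -> l = k.*2.+1 -> PY k.*2 (DD k - P1 * phiS k.*2.-1 *+ 2).
Proof.
move=> k1 lk; set N := ((2 * k - 1) * (k - 1))%N.
apply: (@PYdiv _ _ N); first by apply: lM; apply: l_small; lia.
have -> : (DD k - P1 * phiS k.*2.-1 *+ 2) *+ N =
   (DD k *+ N - P1 * phiS k.*2.-1 *+ 6) - (P1 * (phiS k.*2.-1 *+ l)) *+ (l - 5).
  have E : (2 * N = l * (l - 5) + 6)%N by rewrite /N lk; nia.
  rewrite mulrnBl -!mulrnA E mulrnDr !mulrnAr -mulrnA opprD addrA addrAC; congr (_ - _).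
apply: PYB; first by apply: PYDD_N => //; lia.
apply: PYn; apply: PYP1; apply: Ydiv l2 _.
have [|u [Hu H]] := @Yvv_dvd k.-1; first by lia.
apply: Ydiv Hu _; rewrite -!mulrnA mulnA [(l * 2)%N]mulnC -mulnA mulrnA.
have -> : phiS k.*2.-1 *+ 2 = vv k.-1.*2.
  by rewrite vvE odd_double; congr (phiS _ *+ 2); lia.
by move: H; have [-> ->] : (k.-1.*2 + 2 = k.*2 /\ k.-1.*2 + 3 = l)%N by lia.
Qed.
End LocalRing.

(** * Modularity of E4 and E6 *)

Definition zR (z : int) : R := IZR (int2Z z).
Lemma int2ZE z : int2Z z = ssrZ.Z_of_int z.
Proof. by case: z => n //=; lia. Qed.
Lemma zRD m n : zR (m + n) = Rplus (zR m) (zR n).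
Proof. by rewrite /zR -plus_IZR; congr IZR; rewrite !int2ZE; lia. Qed.
Lemma zRM m n : zR (m * n) = Rmult (zR m) (zR n).
Proof. by rewrite /zR -mult_IZR; congr IZR; rewrite !int2ZE; lia. Qed.
Lemma zR_eq0 m : m != 0 -> zR m <> R0.
Proof. by move=> H /eq_IZR_R0 E; case/eqP: H; move: E; rewrite int2ZE; lia. Qed.
Lemma zR_nat n : zR n%:Z = INR n.
Proof. by rewrite /zR INR_IZR_INZ. Qed.

(** Evaluation from an arbitrary fraction, so that sums and products need not be reduced to lowest
    terms. *)
Lemma ratR_eq (r : rat) (m n : int) : n != 0 -> r * n%:~R = m%:~R -> ratR r = Rdiv (zR m) (zR n).
Proof.
move=> n0 E; rewrite /ratR; apply: Analysis.Rdiv_cross; [exact: zR_eq0 (denq_neq0 r)|exact: zR_eq0|].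
rewrite -!/(zR _) -!zRM; congr zR; apply: (@intr_inj rat); rewrite !rmorphM /= -E numqE; ring.
Qed.
Lemma ratR_int (z : int) : ratR z%:~R = zR z.
Proof. by rewrite (@ratR_eq _ z 1) ?mulr1 //; exact: Analysis.Rdiv_one. Qed.
Lemma ratR_nat n : ratR n%:R = INR n.
Proof. by rewrite -zR_nat -ratR_int. Qed.
Lemma ratRD x y : ratR (x + y) = Rplus (ratR x) (ratR y).
Proof.
rewrite (@ratR_eq _ (numq x * denq y + numq y * denq x) (denq x * denq y)).
- by rewrite zRD !zRM; apply: Analysis.Rdiv_add; apply: zR_eq0; exact: denq_neq0.
- by rewrite mulf_neq0 ?denq_neq0.
- by rewrite rmorphD !rmorphM /= !numqE; ring.
Qed.
Lemma ratRN x : ratR (- x) = Ropp (ratR x).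
Proof. by apply: Rplus_opp_r_uniq; rewrite -ratRD subrr -[0]/(0%:R) ratR_nat. Qed.
Lemma ratRM x y : ratR (x * y) = Rmult (ratR x) (ratR y).
Proof.
rewrite (@ratR_eq _ (numq x * numq y) (denq x * denq y)).
- by rewrite !zRM; apply: Analysis.Rdiv_mul; apply: zR_eq0; exact: denq_neq0.
- by rewrite mulf_neq0 ?denq_neq0.
- by rewrite !rmorphM /= !numqE; ring.
Qed.
Lemma ratR_sum n (F : nat -> rat) : ratR (\sum_(i < n) F i) = Analysis.rsum n (fun i => ratR (F i)).
Proof.
elim: n => [|n IH]; first by rewrite big_ord0 -[0]/(0%:R) ratR_nat.
by rewrite big_ord_recr /= ratRD IH.
Qed.

Definition rc (a : qser) : nat -> R := fun n => ratR (a n).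
Lemma rc_qmul a b : rc (qmul a b) = Analysis.conv (rc a) (rc b).
Proof.
apply: funext => n; rewrite /rc /qmul (ratR_sum _ (fun i => a i * b (n - i)%N)) /Analysis.conv.
by congr (Analysis.rsum _ _); apply: funext => i; rewrite ratRM.
Qed.

Lemma qsum_Cv a z w : qsum_at a z w <-> Analysis.Cv (Analysis.qpart (rc a) z) w.
Proof. exact: (Analysis.qs_Cv (rc a) z w). Qed.
Lemma cpowE z b : cpow z b = Coquelicot.Complex.Cpow z b.
Proof. by elim: b => // b IH; rewrite /cpow iterS -/(cpow z b) IH. Qed.
Lemma cmoinvE z : Rlt R0 z.2 -> cmoinv z = Coquelicot.Complex.Copp (Coquelicot.Complex.Cinv z).
Proof. by case: z => x y; exact: Analysis.moinvE. Qed.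

Lemma is_modularE b a : is_modular b a <-> Analysis.modular b (rc a).
Proof.
split=> -[H1 H2]; split=> [z y0|z w w' y0 A B].
- by have [w /qsum_Cv Hw] := H1 z y0; exists w.
- rewrite -cpowE; apply: (H2 z w w' y0); first exact/qsum_Cv.
  by apply/qsum_Cv; rewrite cmoinvE.
- by have [w Hw] := H1 z y0; exists w; apply/qsum_Cv.
- rewrite cpowE; apply: (H2 z w w' y0); first exact/qsum_Cv.
  by apply/qsum_Cv; rewrite -cmoinvE.
Qed.

Lemma modM a b f g : is_modular a f -> is_modular b g -> is_modular (a + b) (qmul f g).
Proof. by rewrite !is_modularE rc_qmul; exact: Analysis.modular_mul. Qed.
Lemma mod_cst c : is_modular 0 (coef (cst c)).
Proof.
apply/is_modularE; apply: (@Analysis.modular_const (ratR c)) => // n.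
by rewrite /rc /= -[0]/(0%:R) ratR_nat.
Qed.

Lemma modnE m d : Nat.modulo m d.+1 = (m %% d.+1)%N.
Proof.
apply/esym/(Nat.mod_unique _ _ (m %/ d.+1)); first by apply/ssrnat.ltP; rewrite ltn_pmod.
by rewrite {1}(divn_eq m d.+1) mulnC.
Qed.
Lemma divnE m d : Nat.div m d.+1 = (m %/ d.+1)%N.
Proof.
apply/esym/(Nat.div_unique _ _ _ (m %% d.+1)); first by apply/ssrnat.ltP; rewrite ltn_pmod.
by rewrite {1}(divn_eq m d.+1) mulnC.
Qed.
Lemma INR_pow m j : INR (m ^ j)%N = pow (INR m) j.
Proof. by elim: j => [|j IH]; rewrite ?expn0 // expnS mult_INR IH. Qed.
Lemma sg_sigma j n : Analysis.sg j n.+1 = INR (Defs.sigma j n.+1).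
Proof.
rewrite -ratR_nat /Defs.sigma natr_sum.
rewrite -(@sdivE _ (fun d _ => (expn d j)%:R : rat) n.+1) // sdivC /sdiv big_mkcond big_add1 big_mkord.
rewrite (ratR_sum _ (fun i => if (i.+1 %| n.+1)%N then (expn (n.+1 %/ i.+1) j)%:R else 0)) /Analysis.sg.
congr (Analysis.rsum _ _); apply: funext => i; rewrite modnE divnE /dvdn.
have -> : Nat.eqb (n.+1 %% i.+1) 0 = (n.+1 %% i.+1 == 0)%N by apply/idP/eqP => [/PeanoNat.Nat.eqb_eq|->].
case: ifP => _; first by rewrite ratR_nat INR_pow.
exact: esym (ratR_nat 0).
Qed.

Lemma mod4 : is_modular 4 (coef E4S).
Proof.
apply/is_modularE; apply: (@Analysis.modular_eis 4 (IZR 240)); first exact: Analysis.eis4.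
  by rewrite /rc /E4S serD serMn ser1 /= mul0rn addr0 (ratR_nat 1).
move=> n; rewrite /rc /E4S serD serMn ser1 /= add0r -mulr_natl ratRM sg_sigma ratR_nat.
by congr Rmult; rewrite ?ratR_nat // INR_IZR_INZ.
Qed.
Lemma mod6 : is_modular 6 (coef E6S).
Proof.
apply/is_modularE; apply: (@Analysis.modular_eis 6 (IZR (-504))); first exact: Analysis.eis6.
  by rewrite /rc /E6S serB serMn ser1 /= mul0rn subr0 (ratR_nat 1).
move=> n; rewrite /rc /E6S serB serMn ser1 /= sub0r -mulr_natl -mulNr ratRM sg_sigma ratRN. rewrite (ratR_nat 504). rewrite [Phi _ _]/((Defs.sigma 5 n.+1)%:R) ratR_nat.
by congr (Rmult _ _); rewrite INR_IZR_INZ -opp_IZR.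
Qed.

(** * Integrality and the passage to quasimodular forms *)

Definition intser (f : S1) := forall n, exists z : int, f n = z%:~R.
Lemma intserD f g : intser f -> intser g -> intser (f + g).
Proof. by move=> H H' n; have [z E] := H n; have [z' E'] := H' n; exists (z + z'); rewrite serD E E' rmorphD. Qed.
Lemma intser_nat k : intser k%:R.
Proof. by move=> n; exists ((n == 0%N)%:R *+ k); rewrite serMn ser1 rmorphMn rmorph_nat. Qed.
Lemma intserN f : intser f -> intser (- f).
Proof. by move=> H n; have [z E] := H n; exists (- z); rewrite serN E rmorphN. Qed.
Lemma intserM f g : intser f -> intser g -> intser (f * g).
Proof.
move=> H H' n; rewrite serM; elim/big_rec: _ => [|i x _ [z ->]]; first by exists 0.
by have [u ->] := H i; have [v ->] := H' (n - i)%N; exists (u * v + z); rewrite rmorphD rmorphM.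
Qed.
Lemma intserX f k : intser f -> intser (f ^+ k).
Proof.
by move=> H; elim: k => [|k IH]; [exact: (intser_nat 1)|rewrite exprS; apply: intserM].
Qed.
Lemma intser_phi j : intser (phiS j).
Proof. by case=> [|n]; [exists 0|exists (sigma j n.+1)%:Z]. Qed.
Lemma intser_mulrn f k : intser f -> intser (f *+ k).
Proof. by move=> H; rewrite -mulr_natr; apply: intserM (intser_nat k). Qed.
Lemma intser_E4 : intser E4S.
Proof. by apply: intserD (intser_nat 1) _; apply: intser_mulrn; exact: intser_phi. Qed.
Lemma intser_E6 : intser E6S.
Proof. by apply: intserD (intser_nat 1) _; apply: intserN; apply: intser_mulrn; exact: intser_phi. Qed.

Lemma denq_frac (n : int) (d : nat) : (0 < d)%N -> (denq (n%:~R / d%:R) %| d%:Z)%Z.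
Proof.
move=> d0; have -> : (d%:R : rat) = (d%:Z)%:~R by [].
by case: divqP; [case: (d) d0|move=> k x _; rewrite dvdz_mull].
Qed.

(** All denominators of c f divide one denominator of c that is prime to l; this gives both clauses
    of [l_integral]. *)
Lemma l_integral_lint l c f : prime l -> lint l c -> intser f -> l_integral l (coef (cst c * f)).
Proof.
move=> pl [n [d [ld ->]]] H; have d0 : (0 < d)%N by case: d ld => //; rewrite dvdn0.
have E m : (denq ((cst (n%:~R / d%:R) * f) m) %| d%:Z)%Z.
  by rewrite cstM; have [z ->] := H m; rewrite mulrAC -rmorphM; exact: denq_frac.
split=> [m|]; last by exists d.
by apply: contra ld => /dvdz_trans /(_ (E m)).
Qed.

Lemma qpowE f a : qpow (coef f) a = coef ((f : S1) ^+ a).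
Proof. by elim: a => // a IH; rewrite exprS /qpow iterS -/(qpow _ _) IH. Qed.
Lemma mod_pow a f : is_modular a (coef f) -> forall b, is_modular (b * a) (coef ((f : S1) ^+ b)).
Proof.
move=> H; elim=> [|b IH]; first by rewrite expr0 -cst1; exact: mod_cst.
by rewrite exprS mulSn; apply: modM.
Qed.

Section NormalForm.
Variable l : nat.
Hypothesis hl : prime l.
Hypothesis hl3 : (3 < l)%N.

Definition monE (t : rat * (nat * nat * nat)) : S1 :=
  cst t.1 * (E2S ^+ t.2.1.1 * (E4S ^+ t.2.1.2 * E6S ^+ t.2.2)).
Definition wgt (t : rat * (nat * nat * nat)) := (2 * t.2.1.1 + (t.2.1.2 * 4 + t.2.2 * 6))%N.
(** [Xl] asks for a list of homogeneous forms, and each monomial is a quasimodular form of weight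
    [wgt]; a list of monomials therefore provides the witness. *)
Definition NF k (f : S1) := exists s : seq (rat * (nat * nat * nat)),
  (forall t, List.In t s -> lint l t.1 /\ (wgt t <= k)%N) /\ f = \sum_(t <- s) monE t.

Lemma NFD k f g : NF k f -> NF k g -> NF k (f + g).
Proof.
move=> [s [H ->]] [s' [H' ->]]; exists (s ++ s'); split; last by rewrite big_cat.
by move=> t ts; have [] := List.in_app_or _ _ _ ts; [exact: H|exact: H'].
Qed.
Lemma NF_mono k t : lint l t.1 -> (wgt t <= k)%N -> NF k (monE t).
Proof.
by move=> H H'; exists [:: t]; split; [move=> u [<-|[]]|rewrite big_seq1].
Qed.
Lemma NF0 k : NF k 0. Proof. by exists [::]; split; [move=> ? []|rewrite big_nil]. Qed.
Lemma monEM t u : monE t * monE u =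
  monE (t.1 * u.1, (t.2.1.1 + u.2.1.1, t.2.1.2 + u.2.1.2, t.2.2 + u.2.2)%N).
Proof.
case: t u => c [[a1 a2] a3] [d [[b1 b2] b3]].
rewrite /monE ![fst _]/= ![snd _]/= cst_mul; move: E2S E4S E6S (cst _) (cst _) => x y z c' d'.
by rewrite !exprD; move: (x ^+ _) (x ^+ _) (y ^+ _) (y ^+ _) (z ^+ _) (z ^+ _) => x1 x2 x3 x4 x5 x6; ring.
Qed.
Lemma NFM a b k f g : (a + b <= k)%N -> NF a f -> NF b g -> NF k (f * g).
Proof.
move=> ab [s [H ->]] [s' [H' ->]]; elim: s H => [|t s IH] H.
  by rewrite big_nil mul0r; exact: NF0.
rewrite big_cons mulrDl; apply: NFD; last by apply: IH => u us; apply: H; right.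
have [lt wt] := H t (or_introl erefl); elim: s' H' {IH} => [|u s' IH] H'.
  by rewrite big_nil mulr0; exact: NF0.
rewrite big_cons mulrDr; apply: NFD; last by apply: IH => v vs; apply: H'; right.
have [lu wu] := H' u (or_introl erefl).
rewrite monEM; apply: NF_mono; first exact: lintM.
by move: wt wu; rewrite /wgt /=; lia.
Qed.

Lemma Y_NF k f : Y l k f -> NF k f.
Proof.
elim=> {k f} [k c H|k H|k H|k H|k f g _ IH _ IH'|a b k f g H _ IH _ IH'].
- have -> : cst c = monE (c, (0, 0, 0)%N) by rewrite /monE ![fst _]/= ![snd _]/=; move: E2S E4S E6S (cst _) => x y z c'; rewrite !(expr0, mulr1).
  by apply: NF_mono.
- have -> : E2S = monE (1, (1, 0, 0)%N) by rewrite /monE ![fst _]/= ![snd _]/= cst1; move: E2S E4S E6S => x y z; rewrite !(expr0, expr1, mulr1, mul1r).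
  by apply: NF_mono; [exact: lint1|].
- have -> : E4S = monE (1, (0, 1, 0)%N) by rewrite /monE ![fst _]/= ![snd _]/= cst1; move: E2S E4S E6S => x y z; rewrite !(expr0, expr1, mulr1, mul1r).
  by apply: NF_mono; [exact: lint1|].
- have -> : E6S = monE (1, (0, 0, 1)%N) by rewrite /monE ![fst _]/= ![snd _]/= cst1; move: E2S E4S E6S => x y z; rewrite !(expr0, expr1, mulr1, mul1r).
  by apply: NF_mono; [exact: lint1|].
- exact: NFD.
- exact: NFM IH IH'.
Qed.

Lemma E2SE : E2 = coef E2S.
Proof.
by apply: funext => n; rewrite /E2S serB serMn ser1 -[phiS 1 n *+ 24]mulr_natl.
Qed.

Lemma quasimod_mono t : lint l t.1 -> quasimod_l l (wgt t) (coef (monE t)).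
Proof.
case: t => c [[a b] e] H; exists [:: (a, (b * 4 + e * 6)%N, coef (cst c * (E4S ^+ b * E6S ^+ e)))].
split=> [u [<-|[]]|]; last first.
  rewrite big_cons big_nil -[RHS]/(qadd (qmul (qpow E2 a) (coef (cst c * (E4S ^+ b * E6S ^+ e)))) qzero).
  rewrite E2SE qpowE -[monE _]/(cst c * (E2S ^+ a * (E4S ^+ b * E6S ^+ e))) mulrCA.
  by apply: funext => n; exact: (esym (addr0 _)).
split=> //; split; last first.
  by apply: l_integral_lint => //; apply: intserM; apply: intserX; [exact: intser_E4|exact: intser_E6].
by apply: (modM (mod_cst c)); apply: modM; apply: mod_pow; [exact: mod4|exact: mod6].
Qed.

Lemma NF_Xl k f : NF k f -> Xl l k (coef f).
Proof.
move=> [s [H ->]]; exists [seq (wgt t, coef (monE t)) | t <- s]; split.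
  move=> u /List.in_map_iff [t [<- ts]]; have [lt wt] := H t ts.
  by split=> //; exact: quasimod_mono.
elim: s {H} => [|t s IH]; first by rewrite !big_nil.
by rewrite /= !big_cons -IH.
Qed.
Lemma Y_Xl k f : Y l k f -> Xl l k (coef f). Proof. by move/Y_NF/NF_Xl. Qed.
Lemma PY_PXl k h : PY l k h -> PXl l k (coef h).
Proof.
move=> H; exists (coef (Q1 * h)); split; first exact: Y_Xl.
by rewrite -[qmul _ _]/(coef (P1 * (Q1 * h))) mulrA [P1 * _]mulrC Q1_P1 mul1r.
Qed.

(** The moment series of the statement start at n = 1, so the constant terms have to vanish. *)
Lemma mom_pos_0 j (f : SP) : (0 < j)%N -> (size (f 0%N) <= 1)%N -> mom j f 0%N = 0.
Proof.
move=> j0 s; rewrite (momE j s) big_ord1 subrr expr0n gtn_eqF // mul0r //.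
Qed.
Lemma CserE k : (0 < k)%N -> Cser k = coef (mom k Cgf).
Proof.
move=> k0; apply: funext => -[|n]; last by rewrite /Cser /= Mmom_mom.
by rewrite mom_pos_0 //; have [] := pal_Cgf 0.
Qed.
Lemma RserE k : (0 < k)%N -> Rser k = coef (RR k).
Proof.
move=> k0; apply: funext => -[|n]; last by rewrite /Rser /= Nmom_mom.
by rewrite /RR mom_pos_0 //; have [] := pal_Rgf 0.
Qed.
Lemma DDE k : (0 < k)%N -> qsub (Rser k.*2) (poly_delta (Ppoly k) (Rser 2)) = coef (DD k).
Proof. by move=> k0; rewrite !RserE ?double_gt0. Qed.
Lemma qscale2 f : qscale 2 (coef f) = coef (f *+ 2).
Proof. by apply: funext => n; rewrite /qscale serMn mulr_natl. Qed.
Lemma PY_top k h g : PY l k (h - P1 * g *+ 2) ->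
  exists GC, Xl l k GC /\ coef h = qadd (qscale 2 (qmul Pq (coef g))) (qmul Pq GC).
Proof.
move=> H; exists (coef (Q1 * (h - P1 * g *+ 2))); split; first exact: Y_Xl.
rewrite -[qmul Pq (coef g)]/(coef (P1 * g)) qscale2.
rewrite -[qmul Pq _]/(coef (P1 * (Q1 * (h - P1 * g *+ 2)))) mulrA [P1 * Q1]mulrC Q1_P1 mul1r.
by rewrite -[qadd _ _]/(coef (P1 * g *+ 2 + (h - P1 * g *+ 2))) addrC subrK.
Qed.
End NormalForm.

Theorem theorem7p6 (l : nat) (hl : prime l) (hl3 : (3 < l)%N) :
  (* (1) *)
  ((forall k : nat, (1 <= k)%N -> (k <= (l - 3) %/ 2)%N -> PXl l (2 * k) (Cser (2 * k)))
   /\ (exists GC : qser, Xl l (l - 1) GC /\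
         Cser (l - 1) = qadd (qscale 2 (qmul Pq (Phi (l - 2)))) (qmul Pq GC)))
  /\
  (* (2) *)
  ((forall k : nat, (2 <= k)%N -> (k <= (l - 3) %/ 2)%N ->
      PXl l (2 * k) (qsub (Rser (2 * k)) (poly_delta (Ppoly k) (Rser 2))))
   /\ (exists GR : qser, Xl l (l - 1) GR /\
         qsub (Rser (l - 1)) (poly_delta (Ppoly ((l - 1) %/ 2)) (Rser 2))
         = qadd (qscale 2 (qmul Pq (Phi (l - 2)))) (qmul Pq GR))).
Proof.
have ol : odd l by case: (even_prime hl) => // E; rewrite E in hl3.
have [h lE] : exists h, l = h.*2.+1 by exists l./2; rewrite -[LHS]odd_double_half ol.
have h1 : (1 < h)%N by lia.
have -> : (l - 1 = h.*2)%N by lia.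
have -> : (l - 2 = h.*2.-1)%N by lia.
have -> : (h.*2 %/ 2 = h)%N by lia.
have h0 : (0 < h)%N by lia.
split; (split=> [k k0 kl|]).
- by rewrite mul2n CserE ?double_gt0 //; apply: PY_PXl => //; apply: PYcrank_lt => //; lia.
- by rewrite CserE ?double_gt0 //; apply: (@PY_top l hl hl3 _ _ (phiS h.*2.-1)); apply: PYcrank => //; lia.
- by rewrite mul2n DDE; [apply: PY_PXl => //; apply: PYDD => //; lia|lia].
- by rewrite DDE //; apply: (@PY_top l hl hl3 _ _ (phiS h.*2.-1)); apply: PYDD_top.
Qed.
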